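(* Let $d\in\{1,2,3\}$, $T\in(0,\infty)$, $\gamma\in(\tfrac d2,4]$, and let $\mathcal D\subset\mathbb R^d$ be a bounded convex domain with Lipschitz boundary. Let $W$ be a (possibly cylindrical) $\dot H$-valued $Q$-Wiener process whose covariance operator $Q\in\mathcal L(\dot H)$ satisfies $\|A^{\frac{\gamma-2}{2}}Q^{\frac12}\|_{\mathcal L_2}<\infty$. Then for every $p\ge1$ there is a sufficiently large $p_0\in\mathbb N$ such that, for every $\mathcal F_0$-measurable $X_0:\Omega\to\dot H$ with $\mathbb E[|X_0|_\gamma^{p_0}]<\infty$, the tamed exponential Euler / spectral Galerkin approximations $X^{M,N}_{t_i}$ satisfy $$\sup_{M,N\in\mathbb N^+}\ \sup_{i\in\{0,1,\dots,M\}}\mathbb E\big[\|X^{M,N}_{t_i}\|_{L^6}^p\big]<\infty.$$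
   Context: Spaces and operators. $H=L^2(\mathcal D,\mathbb R)$ with inner product $\langle\cdot,\cdot\rangle$ and norm $\|\cdot\|$; $L^6=L^6(\mathcal D,\mathbb R)$; $\dot H=\{v\in H:\int_{\mathcal D}v\,\mathrm dx=0\}$; $P:H\to\dot H$, $Pv=v-|\mathcal D|^{-1}\int_{\mathcal D}v\,\mathrm dx$. $-A$ is the Neumann Laplacian: $Au=-\Delta u$ for $u\in\mathrm{dom}(A)=\{v\in H^2(\mathcal D)\cap\dot H:\partial v/\partial n=0\text{ on }\partial\mathcal D\}$, extended by $Av=APv$. $A$ has an orthonormal eigenbasis $\{e_j\}_{j\ge0}$ of $H$ with eigenvalues $0=\lambda_0<\lambda_1\le\lambda_2\le\cdots\to\infty$, $e_0=|\mathcal D|^{-1/2}$, and $\{e_j\}_{j\ge1}$ is an orthonormal basis of $\dot H$. For $\alpha\in\mathbb R$, $A^\alpha v=\sum_{j\ge1}\lambda_j^\alpha\langle v,e_j\rangle e_j$, $\dot H^\alpha=\mathrm{dom}(A^{\alpha/2})$ with norm $|v|_\alpha=\|A^{\alpha/2}v\|$. $E(t)=e^{-tA^2}$, $t\ge0$, i.e. $E(t)v=\sum_{j\ge0}e^{-t\lambda_j^2}\langle v,e_j\rangle e_j$. $\|\cdot\|_{\mathcal L_2}$ is the Hilbert–Schmidt norm. Nonlinearity. $F:L^6(\mathcal D)\to H$, $F(v)(x)=v(x)^3-v(x)$. Noise. $W$ is defined on a filtered probability space $(\Omega,\mathcal F,\mathbb P,\{\mathcal F_t\}_{t\ge0})$.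 Numerical scheme. $H_N=\mathrm{span}\{e_1,\dots,e_N\}$, $P_Nx=\sum_{i=1}^N\langle x,e_i\rangle e_i$. For $M\in\mathbb N^+$, $\tau=T/M$, $t_m=m\tau$. Set $X^{M,N}_{t_0}=P_NX_0$ and for $m=0,\dots,M-1$ $$X^{M,N}_{t_{m+1}}=E(\tau)X^{M,N}_{t_m}-\frac{A^{-1}(I-E(\tau))P_NF(X^{M,N}_{t_m})}{1+\tau\|P_NF(X^{M,N}_{t_m})\|}+E(\tau)P_N\big(W(t_{m+1})-W(t_m)\big).$$ *)

(* Defs.v *)
From HB Require Import structures.
From mathcomp Require Import all_boot all_order all_algebra.
From mathcomp Require Import all_classical all_reals all_analysis.
From mathcomp Require Import measurable_realfun.

Set Implicit Arguments.
Unset Strict Implicit.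
Unset Printing Implicit Defensive.
Import Order.TTheory GRing.Theory Num.Theory.
Import numFieldNormedType.Exports.
Local Open Scope classical_set_scope.
Local Open Scope ring_scope.

Definition borel_rV_display : measure_display.
Proof. exact: default_measure_display. Qed.

Section borel_rV.
Context {R : realType} (m n : nat).
Local Notation M := 'M[R]_(m, n).

Let borel0 : <<s @open M >> set0. Proof. exact: sigma_algebra0. Qed.

Let borelC (A : set M) : <<s @open M >> A -> <<s @open M >> (~` A).
Proof. exact: sigma_algebraC. Qed.

Let borel_bigcup (F : (set M)^nat) : (forall i, <<s @open M >> (F i)) ->
  <<s @open M >> (\bigcup_i F i).
Proof. exact: sigma_algebra_bigcup. Qed.

HB.instance Definition _ := @isMeasurable.Build borel_rV_display M
  <<s @open M >> borel0 borelC borel_bigcup.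

Lemma open_measurable_mx (A : set M) : open A -> measurable A.
Proof. exact: sub_sigma_algebra. Qed.
End borel_rV.

Section snoc.
Context {R : realType} (n : nat).

Definition snoc (z : 'rV[R]_n * R) : 'rV[R]_n.+1 :=
  \row_j (if unlift ord_max j is Some k then z.1 0 k else z.2).

Lemma snoc_lift z j : snoc z 0 (lift ord_max j) = z.1 0 j.
Proof. by rewrite mxE liftK. Qed.

Lemma snoc_max z : snoc z 0 ord_max = z.2.
Proof. by rewrite mxE unlift_none. Qed.

Lemma snoc_measurable : measurable_fun setT snoc.
Proof.
apply: (@measurability _ _ _ _ _ _ (@open 'rV[R]_n.+1)) => // _ [U oU <-].
rewrite setTI.
pose c (qk : 'rV[rat]_n.+1 * nat) : 'rV[R]_n.+1 := map_mx ratr qk.1.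
pose B qk : set 'rV[R]_n.+1 := ball (c qk) (qk.2.+1%:R^-1 : R).
have -> : snoc @^-1` U =
    \bigcup_(qk in [set qk | B qk `<=` U]) (snoc @^-1` (B qk)).
  apply/seteqP; split => [z Uz|z [qk BU]]; last exact: BU.
  have /nbhs_ballP[e /= e0 eU] := oU _ Uz.
  have [k ke] : exists k : nat, k.+1%:R^-1 < e / 2.
    have := near_infty_natSinv_lt (PosNum (divr_gt0 e0 (ltr0Sn R 1))).
    by move=> /filter_ex.
  have k0 : 0 < (k.+1%:R^-1 : R) by [].
  have q j : exists q : rat, `|snoc z 0 j - ratr q| < k.+1%:R^-1.
    have := @dense_rat R (ball (snoc z 0 j) k.+1%:R^-1).
    case.
    - by exists (snoc z 0 j); exact: ballxx.
    - exact: ball_open.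
    - by move=> x [hx [r _ rE]]; exists r; rewrite rE.
  have {q}[q hq] := choice q.
  exists (\row_j q j, k) => /=.
    move=> y [_ yB]; apply: eU; split => // i j.
    have := yB i j; rewrite ord1 /c /= 2!mxE => yj.
    rewrite [e]splitr; apply: (@ball_triangle R R (ratr (q j))).
      exact: (lt_trans (hq j)).
    exact: (lt_trans yj).
  split => // i j; rewrite /c /= [in X in ball X]mxE mxE ord1 /ball /=.
  by rewrite distrC; exact: hq.
rewrite bigcup_mkcond; apply: countable_bigcupT_measurable => [|qk].
  exact: countableP.
case: ifP => // _.
have k0 : 0 < (qk.2.+1%:R^-1 : R) by [].
rewrite (_ : _ @^-1` _ =
    ball (\row_j c qk 0 (lift ord_max j) : 'rV[R]_n) (qk.2.+1%:R^-1 : R)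
    `*` ball (c qk 0 ord_max) (qk.2.+1%:R^-1 : R)).
  apply: measurableX; last exact: measurable_ball.
  by apply: open_measurable_mx; exact: ball_open.
apply/seteqP; split => -[v x] /=.
  move=> [_ h]; split.
    split => // i j; have := h 0 (lift ord_max j).
    by rewrite snoc_lift ord1 [in X in _ -> X]mxE.
  by have := h 0 ord_max; rewrite snoc_max.
move=> [[_ h] hx]; split => // i j; rewrite ord1.
case: (unliftP ord_max j) => [k|] ->; last by rewrite snoc_max.
by have := h 0 k; rewrite mxE snoc_lift.
Qed.

HB.instance Definition _ :=
  isMeasurableFun.Build _ _ _ _ snoc snoc_measurable.

Definition snoc_measure (mu : {measure set 'rV[R]_n -> \bar R}) :
  set 'rV[R]_n.+1 -> \bar R := pushforward (mu \x lebesgue_measure)%E snoc.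

Section snoc_measure.
Variable mu : {measure set 'rV[R]_n -> \bar R}.

Let nu : {measure set _ -> \bar R} :=
  measure_function_pushforward__canonical__measure_function_Measure
    (mu \x lebesgue_measure)%E snoc_measurable.

HB.instance Definition _ := isMeasure.Build _ _ _ (snoc_measure mu)
  (measure0 nu) (measure_ge0 nu) (@measure_semi_sigma_additive _ _ _ nu).
End snoc_measure.
End snoc.

Fixpoint lebesgue_rV {R : realType} (n : nat) :
    {measure set 'rV[R]_n -> \bar R} :=
  match n with
  | 0%N => dirac (0 : 'rV[R]_0)
  | m.+1 => snoc_measure (lebesgue_rV m)
  end.

Definition dotmul {R : realType} {d : nat} (x y : 'rV[R]_d) : R := (x *m y^T) 0 0.

(* Near each boundary point, D lies strictly above the graph of a Lipschitz
   function over the hyperplane orthogonal to a unit vector nu; y - (y.nu) nu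
   is the projection of y onto that hyperplane. *)
Definition lipschitz_boundary {R : realType} {d : nat} (D : set 'rV[R]_d) :=
  forall x, (closure D `\` D°) x ->
    exists U : set 'rV[R]_d, exists nu : 'rV[R]_d,
    exists g : 'rV[R]_d -> R, exists k : R,
    [/\ open_nbhs x U, dotmul nu nu = 1,
        forall y z, `|g y - g z| <= k * `|y - z| &
        forall y, U y ->
          (D y <-> g (y - dotmul y nu *: nu) < dotmul y nu)].

(* Connectedness follows from convexity. *)
Record convex_lipschitz_domain (R : realType) (d : nat) := ConvexLipschitzDomain {
  dom_set :> set 'rV[R]_d ;
  dom_open : open dom_set ;
  dom_nonempty : dom_set !=set0 ;
  dom_bounded : bounded_set dom_set ;
  dom_convex : convex_set (dom_set : set (convex_lmodType 'rV[R]_d)) ;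
  dom_lipschitz : lipschitz_boundary dom_set }.

Section domain.
Context {R : realType} {d : nat} (D : convex_lipschitz_domain R d).
Implicit Types (u v w f : 'rV[R]_d -> R).

Definition leb : {measure set 'rV[R]_d -> \bar R} :=
  mrestr (lebesgue_rV d) (open_measurable_mx (@dom_open R d D)).

(* Elements of H are represented by square-integrable functions; two of them
   represent the same element when they agree almost everywhere on D. *)
Definition L2 : set ('rV[R]_d -> R) := [set v | v \in Lfun leb 2%:E].

Definition inner u v : R := \int[leb]_x (u x * v x).

Definition norm2 v : R := fine ('N[leb]_2%:E[EFin \o v])%E.

Definition eq_ae u v := {ae leb, forall x, u x = v x}.

Definition vol : R := fine (leb setT).

Definition mean v : R := vol^-1 * \int[leb]_x v x.

Definition Hdot : set ('rV[R]_d -> R) :=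
  [set v | L2 v /\ \int[leb]_x v x = 0].

Definition proj0 v : 'rV[R]_d -> R := fun x => v x - mean v.

Definition partial (i : 'I_d) (f : 'rV[R]_d -> R) : 'rV[R]_d -> R :=
  fun x => 'D_(delta_mx 0 i) f x.

Definition smooth (f : 'rV[R]_d -> R) := forall s : seq 'I_d,
  continuous (foldr partial f s) /\
  forall i x, derivable (foldr partial f s) x (delta_mx 0 i).

Definition test_function (phi : 'rV[R]_d -> R) :=
  [/\ smooth phi, compact (closure [set x | phi x != 0]) &
      closure [set x | phi x != 0] `<=` D].

Definition weak_partial (i : 'I_d) u w := forall phi, test_function phi ->
  \int[leb]_x (u x * partial i phi x) = - \int[leb]_x (w x * phi x).

Definition H1_gradient u (g : 'I_d -> 'rV[R]_d -> R) :=
  L2 u /\ forall i, L2 (g i) /\ weak_partial i u (g i).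

Definition H2_derivatives u (g : 'I_d -> 'rV[R]_d -> R)
    (h : 'I_d -> 'I_d -> 'rV[R]_d -> R) :=
  H1_gradient u g /\ forall i, H1_gradient (g i) (h i).

(* The normal derivative of an H^2 function with gradient g and Laplacian l,
   as the functional on H^1 (phi with gradient q) given by Green's formula:
   the boundary integral of phi * du/dn. *)
Definition normal_derivative (g : 'I_d -> 'rV[R]_d -> R) (l phi : 'rV[R]_d -> R)
    (q : 'I_d -> 'rV[R]_d -> R) : R :=
  \int[leb]_x (\sum_(i < d) g i x * q i x) + \int[leb]_x (l x * phi x).

(* v \in dom(A) and A v = f, on mean-zero functions *)
Definition neumann_graph0 v f := Hdot v /\
  exists g h, let lap x := \sum_(i < d) h i i x in
  [/\ H2_derivatives v g h,
      forall phi q, H1_gradient phi q -> normal_derivative g lap phi q = 0 &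
      eq_ae f (fun x => - lap x)].

(* extension of A by A v = A P v *)
Definition neumann_graph v f := L2 v /\ neumann_graph0 (proj0 v) f.

Definition L2_cvg (u_ : nat -> 'rV[R]_d -> R) u :=
  norm2 (u_ n - u) @[n --> \oo] --> 0.

Record neumann_eigenbasis (e : nat -> 'rV[R]_d -> R) (lam : nat -> R) : Prop := {
  eig_L2 : forall j, L2 (e j) ;
  eig_orthonormal : forall i j, inner (e i) (e j) = (i == j)%:R ;
  eig_complete : forall v, L2 v ->
    L2_cvg (fun n => \sum_(j < n) inner v (e j) \*: e j) v ;
  eig_A : forall j, neumann_graph (e j) (lam j \*: e j) ;
  eig_e0 : eq_ae (e 0%N) (cst (vol `^ (- 2^-1))) ;
  eig_lam0 : lam 0%N = 0 ;
  eig_lam1 : 0 < lam 1%N ;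
  eig_nondecreasing : nondecreasing_seq lam ;
  eig_cvgy : lam @ \oo --> +oo }.

Record Hdot_operator (B : ('rV[R]_d -> R) -> 'rV[R]_d -> R) : Prop := {
  op_Hdot : forall u, Hdot u -> Hdot (B u) ;
  op_linear : forall (a : R) u v, Hdot u -> Hdot v ->
    eq_ae (B (a \*: u + v)) (a \*: B u + B v) ;
  op_bounded : exists C : R, forall u, Hdot u -> norm2 (B u) <= C * norm2 u }.

Record covariance_operator (Q : ('rV[R]_d -> R) -> 'rV[R]_d -> R) : Prop := {
  cov_op : Hdot_operator Q ;
  cov_sym : forall u v, Hdot u -> Hdot v -> inner (Q u) v = inner u (Q v) ;
  cov_ge0 : forall u, Hdot u -> 0 <= inner (Q u) u }.

Definition sqrt_operator (S Q : ('rV[R]_d -> R) -> 'rV[R]_d -> R) :=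
  covariance_operator S /\ forall u, Hdot u -> eq_ae (S (S u)) (Q u).

Definition Hdot_open (U : set ('rV[R]_d -> R)) := forall u, Hdot u -> U u ->
  exists2 r : R, 0 < r & forall v, Hdot v -> norm2 (v - u) < r -> U v.

Definition nonlinearity v : 'rV[R]_d -> R := fun x => v x ^+ 3 - v x.

Section spectral.
Variables (e : nat -> 'rV[R]_d -> R) (lam : nat -> R).

Definition is_expansion (c : nat -> R) u :=
  L2 u /\ L2_cvg (fun n => \sum_(j < n) c j \*: e j) u.

(* A representative of the sum of the series c_j e_j in H; the junk value 0
   is used when the series diverges. *)
Definition expansion (c : nat -> R) : 'rV[R]_d -> R :=
  xget (cst 0) (is_expansion c).

Definition A_pow_coef (alpha : R) v (j : nat) : R :=
  if j is 0%N then 0 else lam j `^ alpha * inner v (e j).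

Definition A_pow_dom (alpha : R) v := exists u, is_expansion (A_pow_coef alpha v) u.

Definition A_pow (alpha : R) v := expansion (A_pow_coef alpha v).

(* |v|_alpha, equal to +oo outside dom(A^(alpha/2)) *)
Definition Hdot_norm (alpha : R) v : \bar R :=
  if `[< A_pow_dom (alpha / 2) v >] then 'N[leb]_2%:E[EFin \o A_pow (alpha / 2) v]%E
  else +oo%E.

(* Hilbert-Schmidt norm of A^(alpha/2) B on the mean-zero subspace, whose
   orthonormal basis is e_1, e_2, ... *)
Definition HS_norm (alpha : R) (B : ('rV[R]_d -> R) -> 'rV[R]_d -> R) : \bar R :=
  ((\sum_(1 <= k <oo) (Hdot_norm alpha (B (e k))) ^+ 2) `^ (2^-1))%E.

Definition semigroup (t : R) v :=
  expansion (fun j => expR (- t * lam j ^+ 2) * inner v (e j)).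

Definition galerkin (N : nat) v := \sum_(1 <= i < N.+1) inner v (e i) \*: e i.

End spectral.
End domain.

Section noise.
Context {R : realType} {d : nat} (D : convex_lipschitz_domain R d).
Context {dO : measure_display} {Omega : measurableType dO} (P : probability Omega R).

Record filtration (Ft : R -> set (set Omega)) : Prop := {
  filt_sigma : forall t, 0 <= t -> sigma_algebra setT (Ft t) ;
  filt_measurable : forall t, 0 <= t -> Ft t `<=` measurable ;
  filt_mono : forall s t, 0 <= s -> s <= t -> Ft s `<=` Ft t }.

(* The library's normal_prob is not a Dirac mass when the deviation is 0. *)
Definition centered_gaussian (X : Omega -> R) (var : R) :=
  if var == 0 then {ae P, forall w, X w = 0}
  else forall B, measurable B -> P (X @^-1` B) = normal_prob 0 (Num.sqrt var) B.

Definition independent_of (X : Omega -> R) (G : set (set Omega)) :=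
  forall (B : set R) (C : set Omega), measurable B -> G C ->
    P (X @^-1` B `&` C) = (P (X @^-1` B) * P C)%E.

(* A possibly cylindrical Q-Wiener process, given through its pairings
   W t h = <W(t), h> with the elements h of the mean-zero subspace. *)
Record Q_wiener (Ft : R -> set (set Omega))
    (Q : ('rV[R]_d -> R) -> 'rV[R]_d -> R)
    (W : R -> ('rV[R]_d -> R) -> Omega -> R) : Prop := {
  wiener_linear : forall t (a : R) h k, 0 <= t -> Hdot D h -> Hdot D k ->
    {ae P, forall w, W t (a \*: h + k) w = a * W t h w + W t k w} ;
  wiener_0 : forall h, Hdot D h -> {ae P, forall w, W 0 h w = 0} ;
  wiener_adapted : forall t h (B : set R), 0 <= t -> Hdot D h -> measurable B ->
    Ft t (W t h @^-1` B) ;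
  wiener_continuous : forall h, Hdot D h ->
    {ae P, forall w, {within `[0, +oo[, continuous (fun t : R => W t h w)}} ;
  wiener_independent : forall s t h, 0 <= s -> s <= t -> Hdot D h ->
    independent_of (fun w => W t h w - W s h w) (Ft s) ;
  wiener_gaussian : forall s t h, 0 <= s -> s <= t -> Hdot D h ->
    centered_gaussian (fun w => W t h w - W s h w) ((t - s) * inner D (Q h) h) }.

Definition Hdot_measurable (G : set (set Omega))
    (X : Omega -> 'rV[R]_d -> R) :=
  (forall w, Hdot D (X w)) /\ forall U, Hdot_open D U -> G (X @^-1` U).

Section scheme.
Variables (e : nat -> 'rV[R]_d -> R) (lam : nat -> R).
Variables (W : R -> ('rV[R]_d -> R) -> Omega -> R) (X0 : Omega -> 'rV[R]_d -> R).
Variables (T : R) (M N : nat).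

Let tau : R := T / M%:R.

Definition noise_increment (m : nat) (w : Omega) : 'rV[R]_d -> R :=
  \sum_(1 <= i < N.+1)
    (W (m.+1%:R * tau) (e i) w - W (m%:R * tau) (e i) w) \*: e i.

Fixpoint scheme (m : nat) (w : Omega) : 'rV[R]_d -> R :=
  match m with
  | 0%N => galerkin D e N (X0 w)
  | k.+1 =>
      let X := scheme k w in
      let PF := galerkin D e N (nonlinearity X) in
      semigroup D e lam tau X
      - (1 + tau * norm2 D PF)^-1 \*: A_pow D e lam (- 1) (PF - semigroup D e lam tau PF)
      + semigroup D e lam tau (noise_increment k w)
  end.
End scheme.
End noise.

(* Main.v *)
Require Import Defs.
From HB Require Import structures.
From mathcomp Require Import all_boot all_order all_algebra finmap.
From mathcomp Require Import all_classical all_reals all_analysis.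
From mathcomp Require Import measurable_realfun ring lra.

(* Write X = Y + O, with O the discrete stochastic convolution of the initial
   value and the noise.  Everything about Y is pathwise: the L^6 norm of every
   Y_k is at most C A^r, where A = 1 + sum_k tau (1 + |O_k|_gamma^2)^q.  The
   comparator is the implicit Euler iterate driven by the same O (it exists as
   a minimiser); its H^{-1}, L^2 and H^1 energies are bounded by powers of A,
   and its distance to Y is small if tau is small against A.  Otherwise 1/tau is at
   most a power of A, and the taming alone gives a crude bound on Y.  Then A^r
   is integrated: O_k is a subgaussian martingale transform of the noise plus
   a contraction of X_0.
   The analytic input on D (Nash, Sobolev and sup bounds for eigenfunction sums)
   comes from convexity alone, through averages over the contractions
   x |-> (1-s) x + s y of D and De Giorgi truncation. *)

Set Implicit Arguments.
Unset Strict Implicit.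
Unset Printing Implicit Defensive.
Import Order.TTheory GRing.Theory Num.Theory.
Import numFieldNormedType.Exports.
Local Open Scope classical_set_scope.
Local Open Scope ring_scope.

(** The tamed explicit step has no discrete energy law of its own; the implicit Euler step is a
    minimising movement in the H^-1 metric and inherits the energy estimates of the Cahn-Hilliard
    flow for every step size. The two paths can be compared because F' >= -1 makes the implicit step
    stable in H^-1 up to a factor exp(2 tau). Both gain a bound in H^(3/2) from the same linear
    smoothing, and interpolation lifts closeness in H^-1 to H^1, hence to L^6. The squared defect of
    one step in H^-3 is of order tau^(9/4); dividing by tau and summing over at most T/tau steps
    leaves tau^(1/4), against which powers of A compete. The noise lies in H^gamma with gamma > d/2
    only. Its supremum is controlled in every dimension, but in d = 1 it may have no gradient, so
    the H^1 energy is replaced there by smoothing from the L^2 energy into H^(5/8). In d = 3 its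
    gradient is not bounded and acts as a multiplier from H^1 to L^2. Constants must not depend on
    N, so spectral projections are only used where orthogonality bounds them: in L^2 and for the
    Dirichlet form. *)

Local Notation mfun := (measurable_fun setT).
Local Notation mEFinP := measurable_EFinP.
Local Notation le_via y := (@le_trans _ _ y).

(** * Borel measurability on row vectors and coordinate boxes *)

Section rV_measurability.
Context {R : realType}.

Lemma continuous_measurable_rV n (f : 'rV[R]_n -> R) :
  continuous f -> mfun f.
Proof.
move=> cf; apply: (measurability _ (RGenOInfty.measurableE R)) => //.
move=> _ [_ [x ->] <-]; rewrite setTI.
by apply: open_measurable_mx; apply: open_comp => //; move=> y _; exact: cf.
Qed.

Lemma coord_measurable n (j : 'I_n) : mfun (fun x : 'rV[R]_n => x 0 j).
Proof. by apply: continuous_measurable_rV => x; exact: coord_continuous. Qed.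

(** The sigma-algebra is generated by open sets rather than by coordinates. Writing the map as
    [snoc] of its first coordinates and its last one lets the measurability of [snoc] carry an
    induction on the dimension. *)
Lemma measurable_rV d (T : measurableType d) n (f : T -> 'rV[R]_n) :
  (forall j, mfun (fun t => f t 0 j)) -> mfun f.
Proof.
elim: n f => [|n IH] f mf.
  have -> : f = cst 0 by apply/funext => t; apply/matrixP => i [].
  exact: measurable_cst.
have -> : f = @snoc R n \o (fun t => ((\row_j f t 0 (lift ord_max j) : 'rV[R]_n), f t 0 ord_max)).
  apply/funext => t; apply/rowP => j /=.
  case: (unliftP ord_max j) => [k|] ->; last by rewrite snoc_max.
  by rewrite snoc_lift mxE.
apply: measurableT_comp; first exact: snoc_measurable.
apply/measurable_fun_pairP; split => /=; last exact: mf.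
apply: IH => j; rewrite (_ : (fun t => _) = (fun t => f t 0 (lift ord_max j))) //.
by apply/funext => t; rewrite /= mxE.
Qed.

Lemma measurable_affine n (a : R) (b : 'rV[R]_n) :
  mfun (fun x : 'rV[R]_n => a *: x + b).
Proof.
apply: measurable_rV => j; under eq_fun do rewrite !mxE.
by apply: measurable_funD => //; apply: measurable_funM => //; exact: coord_measurable.
Qed.

Definition box n (r : R) : set 'rV[R]_n := [set x | forall j, `|x 0 j| < r].
Arguments box : clear implicits.

Lemma measurable_box n r : measurable (box n r).
Proof.
rewrite (_ : box n r = \bigcap_(j in [set: 'I_n]) ((fun x : 'rV[R]_n => `|x 0 j|) @^-1` `]-oo, r[)).
  apply: fin_bigcap_measurable => // j _; rewrite -[X in measurable X]setTI.
  have : mfun (fun x : 'rV[R]_n => `|x 0 j|).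
    by apply: measurableT_comp => //; exact: coord_measurable.
  by apply.
apply/seteqP; split => x /= h j; first by move=> _; rewrite /= in_itv/=; exact: h.
by have := h j I; rewrite /= in_itv.
Qed.

Lemma snoc_box n r : @snoc R n @^-1` box n.+1 r = box n r `*` [set t | `|t| < r].
Proof.
apply/seteqP; split => -[x t] /=.
  move=> h; split; last by have := h ord_max; rewrite snoc_max.
  by move=> j /=; have := h (lift ord_max j); rewrite snoc_lift.
move=> [hx ht] j; case: (unliftP ord_max j) => [k|] ->; last by rewrite snoc_max.
by rewrite snoc_lift; exact: hx.
Qed.
End rV_measurability.

Arguments box {R} n r.

(** * Lebesgue measure on row vectors: boxes, Tonelli and affine changes of variable *)

Section lebesgue_rV_theory.
Context {R : realType}.
Local Notation mu := (@lebesgue_measure R).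

Lemma measurable_absball (r : R) : measurable [set t : R | `|t| < r].
Proof.
rewrite (_ : [set t | _] = ball (0 : R) r); first exact: measurable_ball.
by apply/seteqP; split => t; rewrite /ball /= sub0r normrN.
Qed.

Lemma lebesgue_rV_boxS n (r : R) :
  lebesgue_rV n.+1 (box n.+1 r) = (lebesgue_rV n (box n r) * mu [set t : R | (`|t| < r)%R])%E.
Proof.
rewrite /= /snoc_measure /pushforward snoc_box.
apply: product_measure1E; first exact: measurable_box.
exact: measurable_absball.
Qed.

Lemma lebesgue_rV_box_lty n (r : R) : (lebesgue_rV n (box n r) < +oo)%E.
Proof.
elim: n => [|n IH].
  by rewrite /= diracE; case: (_ \in _); rewrite ltry.
rewrite lebesgue_rV_boxS lte_mul_pinfty//.
  by rewrite ge0_fin_numE.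
case: (ltP 0 r) => [r0|r0].
  rewrite (_ : [set t | _] = ball (0 : R) r).
    by rewrite lebesgue_measure_ball ?ltry// ltW.
  by apply/seteqP; split => t; rewrite /ball /= sub0r normrN.
rewrite (_ : [set t | _] = set0) ?measure0//.
by apply/seteqP; split => t //=; rewrite ltNge (le_trans r0).
Qed.

Lemma bigcup_box n : \bigcup_k box n (k%:R : R) = setT.
Proof.
apply/seteqP; split => // x _.
exists (Num.bound (\sum_j `|x 0 j|)) => // j.
apply: (le_lt_trans _ (archi_boundP _)); last by apply: sumr_ge0.
by rewrite (bigD1 j)//= lerDl; apply: sumr_ge0.
Qed.

Lemma lebesgue_rV_sigma_finite n : sigma_finite setT (@lebesgue_rV R n).
Proof.
exists (fun k => box n (k%:R : R)); first by rewrite bigcup_box.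
by move=> k; split; [exact: measurable_box|exact: lebesgue_rV_box_lty].
Qed.

(** An alias of [lebesgue_rV n] under which the sigma-finite structure required by Tonelli is
    registered. *)
Definition lebS n : set 'rV[R]_n -> \bar R := lebesgue_rV n.
Arguments lebS : clear implicits.

HB.instance Definition _ n := isMeasure.Build _ _ _ (lebS n)
  (measure0 (lebesgue_rV n)) (measure_ge0 (lebesgue_rV n))
  (@measure_semi_sigma_additive _ _ _ (lebesgue_rV n)).

HB.instance Definition _ n := Measure_isSigmaFinite.Build _ _ _ (lebS n)
  (@lebesgue_rV_sigma_finite n).

Lemma ge0_integral_rVS n (f : 'rV[R]_n.+1 -> \bar R) :
  mfun f -> (forall x, 0 <= f x)%E ->
  (\int[lebesgue_rV n.+1]_x f x = \int[lebesgue_rV n]_x \int[mu]_t f (snoc (x, t)))%E.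
Proof.
move=> mf f0.
transitivity (\int[(lebS n \x mu)%E]_z (f \o @snoc R n) z)%E.
  rewrite [LHS](_ : _ = \int[pushforward (lebS n \x mu)%E (@snoc R n)]_x f x)%E.
    rewrite ge0_integral_pushforward//=; exact: snoc_measurable.
  reflexivity.
have mfs : mfun (f \o @snoc R n).
  by apply: measurableT_comp => //; exact: snoc_measurable.
exact: (@fubini_tonelli1 _ _ _ _ _ (lebS n) mu (f \o @snoc R n) mfs (fun z => f0 _)).
Qed.

Lemma measurable_snocr n (x : 'rV[R]_n) : mfun (fun t => snoc (x, t)).
Proof. by apply: measurableT_comp; [exact: snoc_measurable|exact: measurable_pair1]. Qed.

Lemma ge0_integral_affine1 (f : R -> \bar R) (a b : R) : 0 < a ->
  mfun f -> (forall x, 0 <= f x)%E ->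
  (\int[mu]_t f (a * t + b)%R = a^-1%:E * \int[mu]_t f t)%E.
Proof.
move=> a0 mf f0.
have mphi : mfun (fun t : measurableTypeR R => a * t + b : measurableTypeR R).
  by apply: measurable_funD => //; exact: measurable_funM.
pose pf : {measure set (measurableTypeR R) -> \bar R} :=
  measure_function_pushforward__canonical__measure_function_Measure mu mphi.
(* The image of Lebesgue measure under t |-> a t + b, multiplied by [a], agrees with Lebesgue
   measure on half-open intervals, hence on all Borel sets. *)
pose m1 := mscale (NngNum (ltW a0)) pf.
have E A : measurable A -> mu A = m1 A.
  apply: lebesgue_measure_unique => //= _ [[u v]] _ <-.
  rewrite /m1 /mscale /= /pushforward.
  rewrite (_ : _ @^-1` _ = `](u - b) / a, (v - b) / a]%classic); last first.
    apply/seteqP; split => t /=; rewrite !in_itv /= ltr_pdivrMr// ler_pdivlMr// mulrC; lra.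
  rewrite !lebesgue_measure_itv /= !lte_fin ltr_pM2r ?invr_gt0// ltrD2r.
  case: ifP => _; last by rewrite mule0.
  by rewrite -EFinM; congr (_%:E); field; rewrite gt_eqF.
have -> : (\int[mu]_t f t = \int[m1]_t f t)%E by apply: eq_measure_integral => A mA _; exact: E.
rewrite ge0_integral_mscale// ge0_integral_pushforward//.
by rewrite muleA -EFinM mulVf ?gt_eqF// mul1e.
Qed.

Lemma snoc_affine n (a : R) (b z : 'rV[R]_n) (s t : R) :
  a *: snoc (z, t) + snoc (b, s) = snoc (a *: z + b, a * t + s).
Proof.
apply/rowP => j; rewrite !mxE; case: (unlift _ _) => [k|] //=.
by rewrite !mxE.
Qed.

Lemma snocK n (x : 'rV[R]_n.+1) :
  snoc ((\row_j x 0 (lift ord_max j) : 'rV[R]_n), x 0 ord_max) = x.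
Proof.
apply/rowP => j; case: (unliftP ord_max j) => [k|] ->; last by rewrite snoc_max.
by rewrite snoc_lift mxE.
Qed.

Lemma ge0_integral_affine n (f : 'rV[R]_n -> \bar R) (a : R) (b : 'rV[R]_n) : 0 < a ->
  mfun f -> (forall x, 0 <= f x)%E ->
  (\int[lebesgue_rV n]_x f (a *: x + b)%R = (a^-1 ^+ n)%:E * \int[lebesgue_rV n]_x f x)%E.
Proof.
move=> a0; elim: n f b => [|n IH] f b mf f0.
  rewrite expr0 mul1e; apply: eq_integral => x _; congr f.
  by apply/matrixP => i [].
rewrite ge0_integral_rVS//; last first.
  by apply: measurableT_comp => //; exact: measurable_affine.
rewrite ge0_integral_rVS//.
rewrite -{1}(snocK b); set s := b 0 ord_max; set b' := \row_j _.
under eq_integral => x _.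
  under eq_integral do rewrite snoc_affine.
  rewrite (@ge0_integral_affine1 (fun t => f (snoc (a *: x + b', t))) a s)//; last first.
    by apply: measurableT_comp => //; exact: measurable_snocr.
  over.
have mF : mfun (fun x => \int[mu]_t f (snoc (x, t)))%E.
  have mfs : mfun (f \o @snoc R n).
    by apply: measurableT_comp => //; exact: snoc_measurable.
  exact: (@measurable_fun_fubini_tonelli_F _ _ _ _ _ mu (f \o @snoc R n) mfs (fun z => f0 _)).
have F0 x : (0 <= \int[mu]_t f (snoc (x, t)))%E by exact: integral_ge0.
rewrite ge0_integralZl//; last 2 first.
- apply: (measurableT_comp mF); exact: measurable_affine.
- by rewrite lee_fin invr_ge0 ltW.
by rewrite (IH (fun x => \int[mu]_t f (snoc (x, t)))%E)// muleA -EFinM exprS.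
Qed.

Lemma ge0_integral_translate n (f : 'rV[R]_n -> \bar R) (b : 'rV[R]_n) :
  mfun f -> (forall x, 0 <= f x)%E ->
  (\int[lebesgue_rV n]_x f (x + b)%R = \int[lebesgue_rV n]_x f x)%E.
Proof.
move=> mf f0; rewrite -[RHS]mul1e -[X in (X%:E * _)%E](expr1n _ n) -[X in (X ^+ n)%:E]invr1.
rewrite -(@ge0_integral_affine n f 1 b)//.
by under [RHS]eq_integral do rewrite scale1r.
Qed.
End lebesgue_rV_theory.

Arguments lebS {R} n.

(** * One-variable bump functions and their derivatives *)

Section cbump.
Context {R : realType}.
Implicit Types (P : {poly R}) (k : nat) (x : R).

(** The standard bump exp(-1/(1 - x^2)) with a polynomial factor and a pole of order [k] in 1 - x^2.
    The two extra parameters close the family under differentiation, which replaces (P, k) by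
    ([dbump P k], k + 2); smoothness then follows by induction on the list of derivatives. *)
Definition cbump P k x : R :=
  if `|x| < 1 then P.[x] * ((1 - x ^+ 2) ^- k * expR (- (1 - x ^+ 2)^-1)) else 0.

Definition dbump P k : {poly R} :=
  P^`() * (1 - 'X ^+ 2) ^+ 2 + (k%:R *+ 2) *: ('X * P * (1 - 'X ^+ 2)) - 2%:R *: ('X * P).

Lemma onem_sqr_gt0 x : `|x| < 1 -> 0 < 1 - x ^+ 2.
Proof. by rewrite ltr_norml => /andP[? ?]; nra. Qed.

Lemma poly_bound P : exists C : R, forall x, `|x| <= 1 -> `|P.[x]| <= C.
Proof.
exists (\sum_(i < size P) `|P`_i|) => x x1; rewrite horner_coef.
apply: (le_trans (ler_norm_sum _ _ _)); apply: ler_sum => i _.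
by rewrite normrM normrX ler_piMr// exprn_ile1.
Qed.

(** The exponential series gives exp(1/w) >= w^-(k+2) / (k+2)! with w = 1 - x^2. This beats the pole
    of order [k] and leaves a factor w^2, the second-order zero that makes the derivative vanish at
    |x| = 1. *)
Lemma bump_bound P k : exists C : R, 0 <= C /\
  forall x, `|cbump P k x| <= C * (1 - x ^+ 2) ^+ 2.
Proof.
have [C hC] := poly_bound P.
have C0 : 0 <= C by apply: le_trans (hC 0 _); rewrite ?normr0.
exists (C * k.+2`!%:R); split => [|x]; first by rewrite mulr_ge0.
rewrite /cbump; case: ifPn => [x1|_]; last first.
  by rewrite normr0; apply: mulr_ge0; [exact: mulr_ge0|exact: sqr_ge0].
have w0 := onem_sqr_gt0 x1; set w := 1 - x ^+ 2 in w0 *.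
rewrite normrM -mulrA ler_pM//; first exact: hC (ltW x1).
rewrite ger0_norm; last first.
  by rewrite mulr_ge0 ?expR_ge0// invr_ge0 exprn_ge0// ltW.
have h : w ^- k.+2 / k.+2`!%:R <= expR w^-1.
  have := @expR_ge1Dxn R w^-1 k.+1; rewrite invr_ge0 ltW// => /(_ isT).
  by apply: le_trans; rewrite exprVn lerDr.
have wk : 0 < w ^+ k by rewrite exprn_gt0.
have wk2 : 0 < w ^+ k.+2 by rewrite exprn_gt0.
have fk : 0 < k.+2`!%:R :> R by rewrite ltr0n fact_gt0.
have hE : (expR w^-1)^-1 <= k.+2`!%:R * w ^+ k.+2.
  rewrite -[leRHS]invrK lef_pV2 ?posrE ?invr_gt0 ?expR_gt0 ?(mulr_gt0 fk wk2)//.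
  by rewrite invfM mulrC.
have wkV : 0 <= w ^- k by rewrite invr_ge0 ltW.
rewrite expRN (le_trans (ler_wpM2l wkV hE))//.
by rewrite mulrCA ler_pM2l// -(addn2 k) exprD mulKf// gt_eqF.
Qed.

Lemma is_derive_bump P k x : is_derive x (1 : R) (cbump P k) (cbump (dbump P k) k.+2 x).
Proof.
have [x1|x1|x1] := ltgtP `|x| 1.
- have w0 := onem_sqr_gt0 x1.
  apply: (@near_eq_is_derive _ _ _
     (fun x => P.[x] * ((1 - x ^+ 2) ^- k * expR (- (1 - x ^+ 2)^-1)))).
  + near=> y; rewrite /cbump ifT//; near: y.
    exact: (cvgr_norm_lt x cvg_id).
  + have hw : is_derive x (1 : R) (fun y : R => 1 - y ^+ 2) (- (2 * x)).
      apply: is_derive_eq; rewrite /GRing.scale /=; ring.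
    have hV : is_derive x (1 : R) (fun y : R => (1 - y ^+ 2)^-1)
        (- (1 - x ^+ 2) ^- 2 *: - (2 * x)).
      by apply: is_deriveV => //; rewrite gt_eqF.
    have hVk : is_derive x (1 : R) (fun y : R => (1 - y ^+ 2) ^- k)
        ((k%:R * (1 - x ^+ 2)^-1 ^+ k.-1) *: (- (1 - x ^+ 2) ^- 2 *: - (2 * x))).
      rewrite (_ : (fun y => _) = (fun y : R => (1 - y ^+ 2)^-1) ^+ k); last first.
        by apply/funext => y; rewrite fctE exprVn.
      exact: is_deriveX.
    have hE : is_derive x (1 : R) (fun y : R => expR (- (1 - y ^+ 2)^-1))
        ((- (- (1 - x ^+ 2) ^- 2 *: - (2 * x))) * expR (- (1 - x ^+ 2)^-1)).
      have := @is_derive1_comp R expR (fun y => - (1 - y ^+ 2)^-1) x _ _ (is_derive_expR _) (is_deriveN hV).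
      by rewrite /comp mulrC.
    have hP := is_derive_poly P x.
    apply: (is_derive_eq (is_deriveM hP (is_deriveM hVk hE))).
    rewrite /cbump ifT// /dbump /GRing.scale /= !hornerE /=.
    set w := 1 - x ^+ 2 in w0 *; set ex := expR _.
    have kE : k%:R * w^-1 ^+ k.-1 = k%:R * (w ^- k * w).
      case: (k) => [|l]; first by rewrite !mul0r.
      by rewrite /= exprVn exprSr invfM divfK ?gt_eqF.
    rewrite (_ : (_ * _) x = w ^- k * ex)// -(mulrA ex) kE.
    have -> : w ^+ k.+2 = w ^+ k * w ^+ 2 by rewrite -exprD addn2.
    have : w ^+ k != 0 by rewrite gt_eqF// exprn_gt0.
    have : w != 0 by rewrite gt_eqF.
    by move: (w ^+ k) => a w1 a1; field; rewrite w1 a1.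
- apply: (@near_eq_is_derive _ _ _ (cst (0 : R))).
  + near=> y; rewrite /cbump ifF//; apply/negbTE; rewrite -leNgt ltW//; near: y.
    exact: (cvgr_norm_gt x cvg_id).
  + by rewrite /cbump ifF ?ltNge ?(ltW x1)//; exact: is_derive_cst.
(* At |x| = 1 the factor 1 - z^2 = -(z - x)(2 x + (z - x)) is at most 3 |z - x| once |z - x| <= 1,
   so the difference quotient is O(|z - x|) and the derivative is 0. *)
- have x2 : x ^+ 2 = 1 by rewrite -real_normK ?num_real// x1 expr1n.
  have bx Q j : cbump Q j x = 0 by rewrite /cbump x1 ltxx.
  have [C [C0 hC]] := bump_bound P k.
  rewrite bx; apply/is_derive1_caratheodory.
  exists (fun z => cbump P k z / (z - x)); split.
  + move=> z; rewrite bx subr0; have [->|zx] := eqVneq z x; first by rewrite bx !mul0r.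
    by rewrite divfK// subr_eq0.
  + rewrite /prop_for /continuous_at bx mul0r; apply/cvgrPdist_le => e e0.
    have C90 : 0 < 9 * C + 1 by lra.
    near=> z; rewrite sub0r normrN normrM normfV.
    have zx1 : `|z - x| <= 1.
      by rewrite distrC ltW//; near: z; exact: (@nbhsx_ballx _ _ x 1).
    have zxe : `|z - x| <= e / (9 * C + 1).
      rewrite distrC ltW//; near: z.
      by apply: (@nbhsx_ballx _ _ x (e / (9 * C + 1))); exact: divr_gt0.
    have [->|zx] := eqVneq z x; first by rewrite bx normr0 mul0r ltW.
    have zx0 : 0 < `|z - x| by rewrite normr_gt0 subr_eq0.
    rewrite ler_pdivrMr//; apply: (le_trans (hC z)).
    have h1 : (1 - z ^+ 2) ^+ 2 <= 9 * `|z - x| ^+ 2.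
      have -> : 1 - z ^+ 2 = - ((z - x) * (2 * x + (z - x))) by rewrite -[X in X - _ = _]x2; ring.
      rewrite sqrrN exprMn real_normK ?num_real// mulrC ler_wpM2r ?sqr_ge0//.
      move: zx1; rewrite ler_norml => /andP[? ?].
      have : -1 <= x <= 1 by rewrite -ler_norml x1.
      move=> /andP[? ?]; nra.
    apply: (le_trans (ler_wpM2l C0 h1)).
    rewrite expr2 mulrA mulrA; apply: ler_wpM2r; first exact: ltW.
    move: zxe; rewrite ler_pdivlMr//; nra.
  + by rewrite bx mul0r.
Unshelve. all: by end_near.
Qed.
End cbump.

(** * Test functions that are products of bumps *)

Section product_bump.
Context {R : realType} {n : nat}.
Implicit Types (q : {poly R} * nat) (Q : 'I_n -> {poly R} * nat) (y z v : 'rV[R]_n).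

Lemma is_derive_line (V : normedModType R) (F : V -> R) (x v : V) (G : R -> R) (a dG : R) :
  (forall h : R, F (h *: v + x) = G (h + a)) -> is_derive a (1 : R) G dG ->
  is_derive x v F dG.
Proof.
move=> FG [dG1 <-].
have E : (fun h : R => h^-1 *: (F (h *: v + x) - F x)) =
         (fun h : R => h^-1 *: (G (h *: 1 + a) - G a)).
  apply/funext => h; rewrite FG; congr (_ *: (G (_ + _) - _)).
    by rewrite /GRing.scale /= mulr1.
  by have := FG 0; rewrite scale0r !add0r.
by apply: DeriveDef; rewrite /derivable /derive E.
Qed.

Lemma is_derive_prod (I : eqType) (s : seq I) (f : I -> R -> R) (df : I -> R) (a : R) :
  uniq s -> (forall i, is_derive a (1 : R) (f i) (df i)) ->
  is_derive a (1 : R) (fun r => \prod_(j <- s) f j r)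
    (\sum_(i <- s) \prod_(j <- s) (if j == i then df j else f j a)).
Proof.
move=> us hf; elim: s us => [_|i s IH /= /andP[si us]].
  rewrite big_nil (_ : (fun r => _) = cst 1); first exact: is_derive_cst.
  by apply/funext => r; rewrite big_nil.
rewrite (_ : (fun r => _) = f i * (fun r => \prod_(j <- s) f j r)); last first.
  by apply/funext => r; rewrite big_cons.
apply: (is_derive_eq (is_deriveM (hf i) (IH us))).
rewrite /GRing.scale /= [RHS]big_cons big_cons eqxx addrC; congr (_ + _).
  rewrite mulrC; congr (_ * _); apply: eq_big_seq => j js.
  by case: eqP js si => // -> ->.
rewrite mulr_sumr; apply: eq_big_seq => j js.
by rewrite big_cons; case: eqP js si => // -> ->.
Qed.

Definition dpk q : {poly R} * nat := (dbump q.1 q.2, q.2.+2).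

Definition upd Q (i : 'I_n) : 'I_n -> {poly R} * nat := fun j => if j == i then dpk (Q j) else Q j.

(** A product over the coordinates rather than a radial bump: a partial derivative only changes the
    i-th parameter pair ([upd]), and the support is a cube, matching the cubes that measure margins
    to the boundary. The factor [c] absorbs the 1/e of each derivative. *)
Definition ptest (c e : R) Q z y : R :=
  c * \prod_j cbump (Q j).1 (Q j).2 (e^-1 * (y 0 j - z 0 j)).

Lemma is_derive_ptest c e Q z y i :
  is_derive y (delta_mx 0 i : 'rV[R]_n) (ptest c e Q z) (ptest (c / e) e (upd Q i) z y).
Proof.
pose G t := (c * \prod_(j | j != i) cbump (Q j).1 (Q j).2 (e^-1 * (y 0 j - z 0 j))) *
  cbump (Q i).1 (Q i).2 (e^-1 * (t - z 0 i)).
apply: (@is_derive_line _ _ _ _ G (y 0 i)) => [h|].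
  rewrite /ptest (bigD1 i)//= /G !mxE !eqxx mulr1 mulrCA mulrC; congr (_ * _ * _).
  by apply: eq_bigr => j ji; rewrite !mxE eqxx (negbTE ji) mulr0 add0r.
have h1 : is_derive (y 0 i) (1 : R) (fun t : R => e^-1 * (t - z 0 i)) e^-1.
  by apply: is_derive_eq; rewrite /GRing.scale /=; ring.
have h2 := @is_derive1_comp R (cbump (Q i).1 (Q i).2) (fun t => e^-1 * (t - z 0 i)) (y 0 i) _ _
  (is_derive_bump _ _ _) h1.
have h3 := is_deriveZ (c * \prod_(j | j != i) cbump (Q j).1 (Q j).2 (e^-1 * (y 0 j - z 0 j))) h2.
apply: (is_derive_eq h3); rewrite /ptest [in RHS](bigD1 i)//= /upd eqxx /GRing.scale /=.
rewrite [in RHS](eq_bigr (fun j => cbump (Q j).1 (Q j).2 (e^-1 * (y 0 j - z 0 j)))); first by ring.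
by move=> j /negbTE ->.
Qed.

Lemma continuous_bump (P : {poly R}) k : continuous (cbump P k).
Proof.
move=> x; have [dx _] := is_derive_bump P k x.
have dfx := (derivable1_diffP _ _).1 dx.
have cfx := differentiable_continuous dfx.
exact: cfx.
Qed.

Lemma continuous_prod (I : Type) (s : seq I) (T : topologicalType) (f : I -> T -> R) :
  (forall i, continuous (f i)) -> continuous (fun t => \prod_(i <- s) f i t).
Proof.
move=> cf; elim: s => [|i s IH].
  rewrite (_ : (fun t => _) = cst 1); first exact: cst_continuous.
  by apply/funext => x; rewrite big_nil.
rewrite (_ : (fun t => _) = (fun t => f i t * \prod_(j <- s) f j t)); last first.
  by apply/funext => x; rewrite big_cons.
by move=> t; exact: (cvgM (cf i t) (IH t)).
Qed.

Lemma continuous_mulC (T : topologicalType) (f : T -> R) (a : R) :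
  continuous f -> continuous (fun t => a * f t).
Proof. by move=> cf t; exact: (cvgM (cvg_cst a) (cf t)). Qed.

Lemma continuous_subC (T : topologicalType) (f : T -> R) (a : R) :
  continuous f -> continuous (fun t => f t - a).
Proof. by move=> cf t; exact: (cvgB (cf t) (cvg_cst a)). Qed.

Lemma continuous_ptest c e Q z : continuous (ptest c e Q z).
Proof.
apply: continuous_mulC.
apply: (@continuous_prod _ _ _ (fun j y => cbump (Q j).1 (Q j).2 (e^-1 * (y 0 j - z 0 j)))) => j.
have h : continuous (fun y : 'rV[R]_n => e^-1 * (y 0 j - z 0 j)).
  by apply: continuous_mulC; apply: continuous_subC => y; exact: coord_continuous.
by move=> w; apply: (continuous_comp (h w)); exact: continuous_bump.
Qed.

Lemma partial_ptest c e Q z i : partial i (ptest c e Q z) = ptest (c / e) e (upd Q i) z.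
Proof. by apply/funext => y; have [_ ] := is_derive_ptest c e Q z y i. Qed.

Lemma smooth_ptest c e Q z : smooth (ptest c e Q z).
Proof.
move=> s; have [c' [Q' ->]] : exists c' Q', foldr partial (ptest c e Q z) s = ptest c' e Q' z.
  elim: s => [|i s [c' [Q' IH]]]; first by exists c, Q.
  by exists (c' / e), (upd Q' i); rewrite /= IH partial_ptest.
split; first exact: continuous_ptest.
by move=> i x; have [] := is_derive_ptest c' e Q' z x i.
Qed.

Lemma ptest_eq0 c e Q z y j : 0 < e -> e <= `|y 0 j - z 0 j| -> ptest c e Q z y = 0.
Proof.
move=> e0 h; rewrite /ptest (bigD1 j)//= {1}/cbump ifF ?mul0r ?mulr0//.
by apply/negbTE; rewrite -leNgt normrM gtr0_norm ?invr_gt0// ler_pdivlMl// mulr1.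
Qed.

Definition cbox z (r : R) : set 'rV[R]_n := [set y | forall j, `|y 0 j - z 0 j| <= r].

Lemma compact_cbox z r : compact (cbox z r).
Proof.
rewrite (_ : cbox z r = [set y : 'rV[R]_n | forall j, `[z 0 j - r, z 0 j + r]%classic (y 0 j)]).
  by apply: (@rV_compact R n (fun j => `[z 0 j - r, z 0 j + r]%classic)) => j; exact: segment_compact.
by apply/seteqP; split => y /= h j; have := h j; rewrite /= in_itv /= ler_distl.
Qed.

Lemma closed_cbox z r : closed (cbox z r).
Proof.
rewrite (_ : cbox z r = \bigcap_(j in [set: 'I_n]) ((fun y : 'rV[R]_n => y 0 j) @^-1` `[z 0 j - r, z 0 j + r]%classic)).
  apply: closed_bigI => j _; apply: closed_comp; last exact: interval_closed.
  by move=> y _; exact: coord_continuous.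
by apply/seteqP; split => y /= h j; have := h j; rewrite /= in_itv /= ler_distl// => ->.
Qed.

Lemma supp_ptest c e Q z : 0 < e ->
  closure [set y | ptest c e Q z y != 0] `<=` cbox z e.
Proof.
move=> e0; rewrite [X in _ `<=` X](closure_id (cbox z e)).1; last exact: closed_cbox.
apply: closureS => y /= py0 j; rewrite leNgt; apply/negP => h.
by move: py0; rewrite (@ptest_eq0 _ _ _ _ _ j)// ?eqxx// ltW.
Qed.

Lemma test_function_ptest (d := n) (D : convex_lipschitz_domain R d) c e Q z : 0 < e ->
  cbox z e `<=` D -> test_function D (ptest c e Q z).
Proof.
move=> e0 zD; split; first exact: smooth_ptest.
- apply: (@subclosed_compact _ _ (cbox z e)); first exact: closed_closure.
    exact: compact_cbox.
  exact: supp_ptest.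
- by apply: subset_trans zD; exact: supp_ptest.
Qed.

Lemma bump_bounded (P : {poly R}) k : exists C : R, 0 <= C /\ forall x, `|cbump P k x| <= C.
Proof.
have [C [C0 hC]] := bump_bound P k.
exists C; split => // x; have [x1|x1] := ltP `|x| 1.
  apply: (le_trans (hC x)); apply: ler_piMr => //.
  by apply: exprn_ile1; [rewrite ltW// onem_sqr_gt0|rewrite gerBl sqr_ge0].
by rewrite /cbump ltNge x1 normr0.
Qed.

Lemma ptest_bounded c e Q : exists C : R, 0 <= C /\ forall z y, `|ptest c e Q z y| <= C.
Proof.
have /choice[C hC] : forall j, exists C : R, 0 <= C /\ forall x, `|cbump (Q j).1 (Q j).2 x| <= C.
  by move=> j; exact: bump_bounded.
exists (`|c| * \prod_j C j); split.
  by apply: mulr_ge0 => //; apply: prodr_ge0 => j _; exact: (hC j).1.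
move=> z y; rewrite normrM ler_wpM2l// normr_prod; apply: ler_prod => j _.
by rewrite normr_ge0 /=; exact: (hC j).2.
Qed.

(** The centre of the test function moves here, not its argument, whence the minus sign. A
    mollification at a moving point is thus differentiated by putting the derivative on the
    kernel. *)
Lemma is_derive_ptest_line c e Q x v y (r : R) :
  is_derive r (1 : R) (fun r => ptest c e Q (x + r *: v) y)
    (- \sum_i v 0 i * ptest (c / e) e (upd Q i) (x + r *: v) y).
Proof.
pose f (j : 'I_n) (t : R) := cbump (Q j).1 (Q j).2 (e^-1 * (y 0 j - (x 0 j + t * v 0 j))).
pose df (j : 'I_n) := cbump (dpk (Q j)).1 (dpk (Q j)).2 (e^-1 * (y 0 j - (x 0 j + r * v 0 j))) * (- (e^-1 * v 0 j)).
have hf j : is_derive r (1 : R) (f j) (df j).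
  have h1 : is_derive r (1 : R) (fun t : R => e^-1 * (y 0 j - (x 0 j + t * v 0 j))) (- (e^-1 * v 0 j)).
    by apply: is_derive_eq; rewrite /GRing.scale /=; ring.
  exact: (@is_derive1_comp R (cbump (Q j).1 (Q j).2) (fun t => e^-1 * (y 0 j - (x 0 j + t * v 0 j))) r
    _ _ (is_derive_bump _ _ _) h1).
have hp := @is_derive_prod _ (index_enum 'I_n) f df r (index_enum_uniq _) hf.
rewrite (_ : (fun r => _) = c *: (fun r => \prod_j f j r)); last first.
  apply/funext => t; rewrite /ptest; congr (_ * _); apply: eq_bigr => j _.
  by rewrite /f !mxE.
apply: (is_derive_eq (is_deriveZ c hp)).
rewrite /GRing.scale /= mulr_sumr -sumrN; apply: eq_bigr => i _.
rewrite (bigD1 i)//= eqxx /ptest [in RHS](bigD1 i)//= /upd eqxx !mxE.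
rewrite [in RHS](eq_bigr (fun j => f j r)); last by move=> j /negbTE ->; rewrite /f !mxE.
rewrite [in LHS](eq_bigr (fun j => f j r)); last by move=> j /negbTE ->.
by rewrite /df; ring.
Qed.
End product_bump.

(** * Continuity of translations in L^1 *)

Section translation.
Context {R : realType} {n : nat}.
Local Notation V := 'rV[R]_n.
Local Notation mu := (@lebS R n).
Implicit Types (f g h : V -> R) (z : V) (U A : set V).

Definition cube z (r : R) : set V := [set y | forall j, `|y 0 j - z 0 j| < r].

Definition N1 f : \bar R := (\int[mu]_x `|f x|%:E)%E.

Lemma measurable_translate z : mfun (fun x : V => x + z).
Proof.
rewrite (_ : (fun x => _) = (fun x : V => 1 *: x + z)); first exact: measurable_affine.
by apply/funext => x; rewrite scale1r.
Qed.

Lemma mfun_translate f z : mfun f -> mfun (fun x : V => f (x + z)).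
Proof. by move=> mf; apply: (measurableT_comp mf); exact: measurable_translate. Qed.

Lemma mfun_norm f : mfun f -> mfun (fun x => `|f x|%:E).
Proof. by move=> mf; apply/mEFinP; exact: measurableT_comp. Qed.

Lemma N1_translate f z : mfun f -> N1 (fun x => f (x + z)) = N1 f.
Proof.
move=> mf; rewrite /N1 -(@ge0_integral_translate R n (fun x => `|f x|%:E) z)//.
exact: mfun_norm.
Qed.

Lemma N1D f g : mfun f -> mfun g ->
  (N1 (fun x => f x + g x)%R <= N1 f + N1 g)%E.
Proof.
move=> mf mg; rewrite /N1 -ge0_integralD//; [|exact: mfun_norm..].
apply: ge0_le_integral => //.
- by apply: mfun_norm; exact: measurable_funD.
- by apply: emeasurable_funD; exact: mfun_norm.
- by move=> x _; rewrite -EFinD lee_fin ler_normD.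
Qed.

Lemma N1_le f g : mfun f -> mfun g ->
  (forall x, `|f x| <= `|g x|) -> (N1 f <= N1 g)%E.
Proof.
move=> mf mg fg; apply: ge0_le_integral => //; [exact: mfun_norm..|].
by move=> x _; rewrite lee_fin.
Qed.

Lemma N1_indic A : measurable A -> N1 (\1_A) = mu A.
Proof.
move=> mA; rewrite /N1; under eq_integral do rewrite ger0_norm//.
by rewrite integral_indic// setIT.
Qed.

(** L^1-continuity of translations at 0, as a predicate that can be carried through sums, multiples
    and L^1-limits up to [Tc_integrable]. *)
Definition Tc g := mfun g /\
  forall e : R, 0 < e -> exists2 del : R, 0 < del &
    forall z, cube 0 del z -> (N1 (fun x => (g (x + z) - g x)%R) <= e%:E)%E.

Lemma mfun_diff g z : mfun g -> mfun (fun x : V => g (x + z) - g x).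
Proof. by move=> mg; apply: measurable_funB => //; exact: mfun_translate. Qed.

Lemma Tc_approx g : mfun g ->
  (forall e : R, 0 < e -> exists2 h, Tc h & (N1 (fun x => (g x - h x)%R) <= e%:E)%E) -> Tc g.
Proof.
move=> mg H; split => // e e0.
have e3 : 0 < e / 3 by lra.
have [h [mh Th] gh] := H _ e3; have [del del0 hd] := Th _ e3.
exists del => // z zdel.
have mgh : mfun (fun x => g x - h x) by exact: measurable_funB.
pose a x := g (x + z) - h (x + z); pose b x := h (x + z) - h x; pose c x := - (g x - h x).
have ma : mfun a by exact: (mfun_translate z mgh).
have mb : mfun b by exact: mfun_diff.
have mc : mfun c by exact: measurableT_comp.
have -> : (fun x => g (x + z) - g x) = (fun x => (a x + b x) + c x).
  by apply/funext => x; rewrite /a /b /c; ring.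
apply: (le_trans (N1D (measurable_funD ma mb) mc)).
have Na : (N1 a <= (e / 3)%:E)%E by rewrite (N1_translate z mgh).
have Nc : (N1 c <= (e / 3)%:E)%E.
  by rewrite (_ : N1 c = N1 (fun x => g x - h x))//; apply: eq_integral => x _; rewrite normrN.
have Nb := hd z zdel.
apply: (le_trans (leeD (N1D ma mb) (lexx _))).
apply: (le_trans (leeD (leeD Na Nb) Nc)).
by rewrite -!EFinD lee_fin; lra.
Qed.

Lemma Tc_add f g : Tc f -> Tc g -> Tc (fun x => f x + g x).
Proof.
move=> [mf Tf] [mg Tg]; split; first exact: measurable_funD.
move=> e e0; have e2 : 0 < e / 2 by lra.
have [d1 d10 h1] := Tf _ e2; have [d2 d20 h2] := Tg _ e2.
exists (Num.min d1 d2) => [|z zd]; first by rewrite lt_min d10.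
have z1 : cube 0 d1 z by move=> j; have := zd j; rewrite lt_min => /andP[].
have z2 : cube 0 d2 z by move=> j; have := zd j; rewrite lt_min => /andP[].
rewrite (_ : (fun x => _) = (fun x => (f (x + z) - f x) + (g (x + z) - g x))); last first.
  by apply/funext => x; ring.
apply: (le_trans (N1D (mfun_diff z mf) (mfun_diff z mg))).
by apply: (le_trans (leeD (h1 _ z1) (h2 _ z2))); rewrite -EFinD lee_fin; lra.
Qed.

Lemma N1Z f (c : R) : mfun f -> N1 (fun x => c * f x) = (`|c|%:E * N1 f)%E.
Proof.
move=> mf; rewrite /N1 -ge0_integralZl//; last exact: mfun_norm.
by apply: eq_integral => x _; rewrite normrM EFinM.
Qed.

Lemma Tc_scale f (c : R) : Tc f -> Tc (fun x => c * f x).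
Proof.
move=> [mf Tf]; split; first exact: measurable_funM.
move=> e e0; have ec : 0 < e / (`|c| + 1) by apply: divr_gt0 => //; rewrite ltr_wpDl.
have [d1 d10 h1] := Tf _ ec; exists d1 => // z zd.
rewrite (_ : (fun x => _) = (fun x => c * (f (x + z) - f x))); last first.
  by apply/funext => x; ring.
rewrite N1Z; last exact: mfun_diff.
apply: (le_trans (lee_wpmul2l _ (h1 _ zd))); first by rewrite lee_fin.
rewrite -EFinM lee_fin mulrCA ler_piMr ?(ltW e0)// ler_pdivrMr ?ltr_wpDl// mul1r.
by rewrite lerDl.
Qed.

Lemma open_cube z r : open (cube z r).
Proof.
rewrite openE => y yz; rewrite /interior.
exists (fun _ j => [set t : R | `|t - z 0 j| < r]); last by move=> x /= h j; exact: h.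
move=> i j /=; rewrite ord1.
have : open [set t : R | `|t - z 0 j| < r].
  rewrite (_ : [set t | _] = ball (z 0 j) r); first exact: ball_open.
  by apply/seteqP; split => t; rewrite /ball /= distrC.
by rewrite openE => /(_ (y 0 j)); apply; exact: yz.
Qed.

Lemma cubeC y z r : cube z r y -> cube y r z.
Proof. by move=> h j; rewrite distrC; exact: h. Qed.

Lemma cubexx z r : 0 < r -> cube z r z.
Proof. by move=> r0 j; rewrite subrr normr0. Qed.

Lemma open_cubeP U x : open U -> U x -> exists2 r : R, 0 < r & cube x r `<=` U.
Proof.
rewrite openE => /(_ x) /[apply]; rewrite /interior => /nbhs_ballP[r /= r0 rU].
exists r => // y yx; apply: rU; split => // i j; rewrite ord1 /ball /= distrC; exact: yx.
Qed.

Definition inner_cubes U (r : R) : set V := [set x | cube x r `<=` U].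

Lemma measurable_inner_cubes U r : measurable (inner_cubes U r).
Proof.
rewrite -[inner_cubes U r]setCK; apply: measurableC; apply: open_measurable_mx.
rewrite (_ : ~` _ = \bigcup_(y in ~` U) cube y r).
  by apply: bigcup_open => y _; exact: open_cube.
apply/seteqP; split => x /=.
  move=> /existsNP[y /not_implyP[yx nUy]]; exists y => //; exact: cubeC.
by move=> [y nUy yx] h; apply: nUy; apply: h; exact: cubeC.
Qed.

Lemma inner_cubes_sub U r : 0 < r -> inner_cubes U r `<=` U.
Proof. by move=> r0 x; apply; exact: cubexx. Qed.

(** The points of [U] without margin 1/(k + 1) decrease to the empty set because [U] is open; finite
    measure makes their measures tend to 0. *)
Lemma inner_cubes_cvg U e : open U -> (mu U < +oo)%E -> 0 < e ->
  exists k : nat, (mu (U `\` inner_cubes U k.+1%:R^-1) <= e%:E)%E.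
Proof.
move=> oU Uoo e0; pose B k := U `\` inner_cubes U k.+1%:R^-1.
have mU := open_measurable_mx oU.
have mB k : measurable (B k) by apply: measurableD => //; exact: measurable_inner_cubes.
have cB : \bigcap_k B k = set0.
  apply/seteqP; split => // x h; have [Ux _] := h 0%N I.
  have [r r0 rU] := open_cubeP oU Ux.
  have [k kr] : exists k : nat, k.+1%:R^-1 < r.
    by have /filter_ex := near_infty_natSinv_lt (PosNum r0).
  by have [_ []] := h k I => y yx; apply: rU => j; apply: lt_trans kr; exact: yx.
have : mu \o B @ \oo --> mu (\bigcap_k B k).
  apply: nonincreasing_cvg_mu => //.
  - by apply: le_lt_trans Uoo; apply: le_measure; rewrite ?inE//; exact: subDsetl.
  - exact: bigcap_measurableType.
  - move=> i j ij; apply/subsetPset => x [Ux h]; split => //; apply: contra_not h => h y yx.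
    apply: h => k; apply: (lt_le_trans (yx k)).
    by rewrite lef_pV2 ?posrE ?ltr0n// ler_nat ltnS.
rewrite cB measure0 => /fine_cvgP[fB /cvgrPdist_le /(_ _ e0)] hB.
have [k [fk hk]] : exists k, mu (B k) \is a fin_num /\ `|0 - fine (mu (B k))| <= e.
  have [k [h1 h2]] := @filter_ex _ _ _ _ (filterI fB hB); by exists k.
exists k; rewrite -(fineK fk) lee_fin; move: hk; rewrite sub0r normrN.
by apply: le_trans; exact: ler_norm.
Qed.

(** If the indicator of [U] differs at x and x + z while z is smaller than the margin, then one of
    the two points lies in [U] but outside [inner_cubes], a set of small measure. *)
Lemma Tc_open U : open U -> (mu U < +oo)%E -> Tc (\1_U).
Proof.
move=> oU Uoo; have mU := open_measurable_mx oU.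
split => // e e0; have e2 : 0 < e / 2 by lra.
have [k hk] := inner_cubes_cvg oU Uoo e2.
exists k.+1%:R^-1 => // z zk; set B := U `\` _ in hk.
have mB : measurable B by apply: measurableD => //; exact: measurable_inner_cubes.
have mIB : mfun (\1_B : V -> R) by exact: measurable_indic.
have mIU : mfun (\1_U : V -> R) by exact: measurable_indic.
apply: (le_via (N1 (fun x => \1_B x + \1_B (x + z)))).
  apply: N1_le; [exact: mfun_diff|by apply: measurable_funD => //; exact: mfun_translate|].
  move=> x; rewrite !indicE; have [|] := boolP (x + z \in U); have [|] := boolP (x \in U).
  - by move=> _ _; rewrite subrr normr0.
  - rewrite notin_setE => xU; rewrite inE => xzU.
    rewrite (_ : x + z \in B); last first.
      rewrite inE; split => // h; apply: xU; apply: h => j; have := zk j.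
      by rewrite !mxE subr0 opprD addNKr normrN.
    by rewrite subr0 normr1 ger0_norm// lerDr.
  - rewrite inE => xU; rewrite notin_setE => xzU.
    rewrite (_ : x \in B); last first.
      rewrite inE; split => // h; apply: xzU; apply: h => j; have := zk j.
      by rewrite !mxE subr0 [x 0 j + _]addrC addrK.
    by rewrite sub0r normrN normr1 ger0_norm// lerDl.
  - by move=> _ _; rewrite subrr normr0.
apply: (le_trans (N1D mIB (mfun_translate z mIB))).
rewrite (N1_translate z mIB) N1_indic//.
by apply: (le_trans (leeD hk hk)); rewrite -EFinD lee_fin; lra.
Qed.

Lemma open_box r : open (box n r : set V).
Proof.
rewrite (_ : box n r = cube 0 r); first exact: open_cube.
by apply/seteqP; split => x h j; have := h j; rewrite mxE subr0.
Qed.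

Lemma Tc_ext f g : f =1 g -> Tc f -> Tc g.
Proof. by move=> /funext ->. Qed.

(** Dynkin induction from the open sets. The intersection with a box keeps every measure finite,
    which the passage to countable disjoint unions needs. *)
Lemma Tc_box (k : nat) A : measurable A -> Tc (\1_(A `&` box n k%:R)).
Proof.
move=> mA; set B := box n k%:R.
have mB : measurable B by exact: measurable_box.
have Boo : (mu B < +oo)%E by exact: lebesgue_rV_box_lty.
have TB : Tc (\1_B) by apply: Tc_open => //; exact: open_box.
have fin A' : measurable A' -> (mu (A' `&` B) < +oo)%E.
  by move=> mA'; apply: le_lt_trans Boo; apply: le_measure; rewrite ?inE//; exact: measurableI.
move: A mA; apply: (dynkin_induction (G := @open V)) => //.
- by move=> X Y; exact: openI.
- by rewrite setTI.
- move=> U oU; apply: Tc_open; first by apply: openI => //; exact: open_box.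
  by apply: fin; exact: open_measurable_mx.
- move=> S mS TS; apply: (@Tc_ext (fun x => \1_B x + (-1) * \1_(S `&` B) x)).
    move=> x; rewrite !indicE !in_setI in_setC; case: (x \in S); case: (x \in B) => /=; lra.
  by apply: Tc_add => //; exact: Tc_scale.
- move=> F mF tF TF.
  have Tn m : Tc (\1_(\big[setU/set0]_(i < m) F i `&` B)).
    elim: m => [|m IH].
      apply: (@Tc_ext (fun x => 0 * \1_B x)); last exact: Tc_scale.
      by move=> x; rewrite big_ord0 set0I indic0 mul0r.
    apply: (@Tc_ext (fun x => \1_(\big[setU/set0]_(i < m) F i `&` B) x + \1_(F m `&` B) x)); last exact: Tc_add.
    move=> x; rewrite big_ord_recr/= !indicE !in_setI in_setU.
    have : ~ ((x \in \big[setU/set0]_(i < m) F i) && (x \in F m)).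
      move=> /andP[]; rewrite !inE -bigcup_mkord => -[i /= im Fi] Fm.
      have im' := tF i m I I (ex_intro _ x (conj Fi Fm)).
      by move: im; rewrite im' ltnn.
    by case: (_ \in \big[setU/set0]_(i < m) F i); case: (x \in F m); case: (x \in B) => //= _; lra.
  have mU : measurable (\bigcup_k F k) by exact: bigcupT_measurable.
  have mUB : measurable (\bigcup_k F k `&` B) by exact: measurableI.
  apply: Tc_approx; first exact: measurable_indic.
  move=> e e0; pose C m := (\bigcup_k F k `&` B) `\` \big[setU/set0]_(i < m) F i.
  have mC m : measurable (C m).
    by apply: measurableD => //; apply: bigsetU_measurable => i _.
  have : mu \o C @ \oo --> mu (\bigcap_k C k).
    apply: nonincreasing_cvg_mu => //.
    - apply: le_lt_trans (fin _ mU); apply: le_measure; rewrite ?inE//; exact: subDsetl.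
    - exact: bigcap_measurableType.
    - move=> i j ij; apply/subsetPset; apply: setDS; rewrite -!bigcup_mkord.
      by move=> x [l /= li Fl]; exists l => //=; exact: leq_trans ij.
  rewrite (_ : \bigcap_k C k = set0); last first.
    apply/seteqP; split => // x h; have [[[l _ Fl] _] _] := h 0%N I.
    by have [_] := h l.+1 I; rewrite -bigcup_mkord; apply; exists l => /=.
  rewrite measure0 => /fine_cvgP[fB /cvgrPdist_le /(_ _ e0)] hB.
  have [m [fk hk]] : exists m, mu (C m) \is a fin_num /\ `|0 - fine (mu (C m))| <= e.
    by have [m [h1 h2]] := @filter_ex _ _ _ _ (filterI fB hB); exists m.
  exists (\1_(\big[setU/set0]_(i < m) F i `&` B)) => //.
  rewrite (_ : (fun x => _) = (\1_(C m) : V -> R)); last first.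
    apply/funext => x; rewrite !indicE in_setD !in_setI.
    have [xm|] := boolP (x \in \big[setU/set0]_(i < m) F i).
      rewrite (_ : (x \in \bigcup_k0 F k0) = true) /=.
        by case: (x \in B) => /=; rewrite ?subrr.
      by move: xm => /set_mem; rewrite -bigcup_mkord => -[i _ Fi]; apply/mem_set; exists i.
    by move=> _; rewrite andbT /= subr0.
  rewrite N1_indic// -(fineK fk) lee_fin; move: hk; rewrite sub0r normrN.
  by apply: le_trans; exact: ler_norm.
Qed.

Lemma Tc0 : Tc (fun=> 0).
Proof.
split => // e e0; exists 1 => // z _.
rewrite (_ : N1 _ = 0%E) ?lee_fin ?(ltW e0)//; apply: integral0_eq => x _.
by rewrite subrr normr0.
Qed.

Lemma Tc_sum (I : Type) (s : seq I) (F : I -> V -> R) :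
  (forall i, Tc (F i)) -> Tc (fun x => \sum_(i <- s) F i x).
Proof.
move=> TF; elim: s => [|i s IH].
  by apply: (Tc_ext _ Tc0) => x; rewrite big_nil.
by apply: (Tc_ext _ (Tc_add (TF i) IH)) => x; rewrite big_cons.
Qed.

Lemma cvge0_le (u : nat -> \bar R) (e : R) : u @ \oo --> 0%E -> 0 < e ->
  exists m, (u m <= e%:E)%E.
Proof.
move=> /fine_cvgP[fB /cvgrPdist_le H] e0; have hB := H _ e0.
have [m [fk hk]] := @filter_ex _ _ _ _ (filterI fB hB).
exists m; rewrite -(fineK fk) lee_fin; move: hk; rewrite sub0r normrN.
by apply: le_trans; exact: ler_norm.
Qed.

Import HBSimple.

(** Cut off by a box (dominated convergence), then approximated by simple functions in L^1; each of
    these is a finite combination of indicators covered by [Tc_box]. *)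
Lemma Tc_integrable g : mu.-integrable setT (EFin \o g) -> Tc g.
Proof.
move=> ig; have mg : mfun g by apply/mEFinP; exact: measurable_int ig.
pose B k : set V := box n k%:R.
have mB k : measurable (B k) by exact: measurable_box.
have tail e : 0 < e -> exists k, (N1 (fun x => (g x - g x * \1_(B k) x)%R) <= e%:E)%E.
  apply: cvge0_le.
  pose f_ (k : nat) (x : V) : \bar R := `|g x - g x * \1_(B k) x|%:E.
  have := @dominated_cvg _ _ R mu setT measurableT f_ (cst 0%E) (fun x => `|g x|%:E).
  rewrite integral_cst// mul0e; apply.
  - move=> k; apply: mfun_norm; apply: measurable_funB => //.
    by apply: measurable_funM => //; exact: measurable_indic.
  - move=> x _; have [l _ xl] : (\bigcup_k (box n k%:R : set V)) x by rewrite bigcup_box.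
    apply: cvg_near_cst; near=> k.
    have xk : x \in B k.
      apply/mem_set => j; apply: (lt_le_trans (xl j)); rewrite ler_nat.
      by near: k; exact: nbhs_infty_ge.
    by rewrite /f_ indicE xk mulr1 subrr normr0.
  - by move=> x _.
  - have := integrable_abse ig; by apply: eq_integrable.
  - move=> k x _; rewrite gee0_abs ?lee_fin// indicE; case: (_ \in _).
      by rewrite mulr1 subrr normr0.
    by rewrite mulr0 subr0.
apply: Tc_approx => // e e0; have e2 : 0 < e / 2 by lra.
have [k hk] := tail _ e2.
have [g_ [ig_ _ cg_]] := approximation_sfun_integrable (mB k)
  (integrableS measurableT (mB k) (@subsetT _ _) ig).
have [m hm] := cvge0_le cg_ e2.
exists (fun x => g_ m x * \1_(B k) x).
  set t := (fset_set (g_ m @` setT)).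
  apply: (@Tc_ext (fun x => \sum_(i < #|`t|) t`_i * \1_((g_ m @^-1` [set t`_i]) `&` B k) x)).
    move=> x; rewrite [in RHS]fimfunEord mulr_suml; apply: eq_bigr => i _.
    by rewrite indicI -mulrA.
  by apply: Tc_sum => i; apply: Tc_scale; apply: Tc_box.
have m1 : mfun (fun x => g x * \1_(B k) x).
  by apply: measurable_funM => //; exact: measurable_indic.
have m2 : mfun (fun x => g_ m x * \1_(B k) x).
  by apply: measurable_funM => //; exact: measurable_indic.
rewrite (_ : (fun x => _) = (fun x => (g x - g x * \1_(B k) x) + (g x * \1_(B k) x - g_ m x * \1_(B k) x))); last first.
  by apply/funext => x; ring.
apply: (le_trans (N1D (measurable_funB mg m1) (measurable_funB m1 m2))).
apply: (le_via ((e / 2)%:E + (e / 2)%:E)%E); last by rewrite -EFinD lee_fin; lra.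
apply: leeD => //; apply: le_trans hm; rewrite [leRHS]integral_mkcond /N1 le_eqVlt; apply/orP; left; apply/eqP.
apply: eq_integral => x _ /=; rewrite patchE !indicE; case: (x \in B k).
  by rewrite !mulr1.
by rewrite !mulr0 subrr normr0.
Unshelve. all: by end_near.
Qed.
End translation.

(** * Mollification: convergence in L^1 and contraction in L^2 *)

Section mollifier.
Context {R : realType} {n : nat}.
Local Notation V := 'rV[R]_n.
Local Notation mu := (@lebS R n).
Implicit Types (f g h : V -> R) (x y z : V) (e : R).

Definition Q1 : 'I_n -> {poly R} * nat := fun=> (1, 0%N).

Lemma cbump1_even (t : R) : cbump 1 0 (- t) = cbump 1 0 t.
Proof. by rewrite /cbump normrN sqrrN !hornerC. Qed.

Lemma cbump1_ge0 (t : R) : 0 <= cbump 1 0 t.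
Proof. by rewrite /cbump; case: ifP => // _; rewrite hornerC expr0 invr1 !mul1r expR_ge0. Qed.

Lemma cbump1_le1 (t : R) : cbump 1 0 t <= 1.
Proof.
rewrite /cbump; case: ifP => // t1; rewrite hornerC expr0 invr1 !mul1r -[leRHS]expR0 ler_expR.
by rewrite oppr_le0 invr_ge0 ltW// onem_sqr_gt0.
Qed.

Lemma ptest_sym c e x y : ptest c e Q1 x y = ptest c e Q1 y x.
Proof.
rewrite /ptest; congr (_ * _); apply: eq_bigr => j _ /=.
by rewrite -cbump1_even -mulrN opprB.
Qed.

Lemma ptest_ge0 c e x y : 0 <= c -> 0 <= ptest c e Q1 x y.
Proof. by move=> c0; apply: mulr_ge0 => //; apply: prodr_ge0 => j _; exact: cbump1_ge0. Qed.

Lemma measurable_prodR d (T : measurableType d) (I : Type) (s : seq I) (F : I -> T -> R) :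
  (forall i, mfun (F i)) -> mfun (fun t => \prod_(i <- s) F i t).
Proof.
move=> mF; elim: s => [|i s IH].
  by under eq_fun do rewrite big_nil; exact: measurable_cst.
by under eq_fun do rewrite big_cons; exact: measurable_funM.
Qed.

Lemma measurable_ptest d (T : measurableType d) c e Q (z y : T -> V) :
  mfun z -> mfun y ->
  mfun (fun t => ptest c e Q (z t) (y t)).
Proof.
move=> mz my; apply: measurable_funM => //; apply: measurable_prodR => j.
apply: (measurableT_comp (f := cbump (Q j).1 (Q j).2)).
  by apply: continuous_measurable_fun; exact: continuous_bump.
apply: measurable_funM => //; apply: measurable_funB.
  exact: (measurableT_comp (@coord_measurable R n j)).
exact: (measurableT_comp (@coord_measurable R n j)).
Qed.

Definition bmass : \bar R := (\int[mu]_y (ptest 1 1 Q1 0 y)%:E)%E.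

Lemma measurable_ptest1 c e x : mfun (fun y => (ptest c e Q1 x y)%:E).
Proof. by apply/mEFinP; exact: measurable_ptest. Qed.

Lemma bmass_fin : (0 < bmass < +oo)%E.
Proof.
have mb r : measurable (box n r : set V) by exact: measurable_box.
apply/andP; split.
  pose b := cbump 1 0 (2^-1 : R).
  have b0 : 0 < b.
    rewrite /b /cbump ifT; first by rewrite hornerC expr0 invr1 !mul1r expR_gt0.
    by rewrite ger0_norm ?invr_ge0//; lra.
  apply: (@lt_le_trans _ _ (\int[mu]_y (b ^+ n * \1_(box n 2^-1) y)%:E)%E).
    under eq_integral do rewrite EFinM.
    rewrite ge0_integralZl//; last 2 first.
    - by apply/mEFinP; exact: measurable_indic.
    - by rewrite lee_fin exprn_ge0// ltW.
    rewrite integral_indic// setIT mule_gt0//; first by rewrite lte_fin exprn_gt0.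
    suff h : lebesgue_rV n (box n (2^-1 : R)) = 1%E.
      by change (0 < lebesgue_rV n (box n (2^-1 : R)))%E; rewrite h lte01.
    elim: (n) => [|m IH].
      by rewrite /= diracE mem_set// => -[].
    rewrite lebesgue_rV_boxS IH mul1e (_ : [set t | _] = ball (0 : R) 2^-1); last first.
      by apply/seteqP; split => t; rewrite /ball /= sub0r normrN.
    rewrite lebesgue_measure_ball ?invr_ge0//; congr (_%:E); rewrite mulr2n; lra.
  apply: ge0_le_integral => //.
  - by move=> x _; rewrite lee_fin mulr_ge0// exprn_ge0// ltW.
  - apply/mEFinP; apply: measurable_funM => //; exact: measurable_indic.
  - exact: measurable_ptest1.
  - move=> x _; rewrite lee_fin indicE; have [|_] := boolP (x \in box n 2^-1); last first.
      by rewrite mulr0 ptest_ge0.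
    move=> /set_mem hx; rewrite mulr1 /ptest mul1r -[X in _ ^+ X](card_ord n) -prodr_const.
    apply: ler_prod => j _; rewrite (ltW b0) /= mxE subr0 invr1 mul1r.
    have xj := hx j; rewrite /b /cbump !ifT; last 2 first.
    + by apply: (lt_trans xj); lra.
    + by rewrite ger0_norm ?invr_ge0//; lra.
    rewrite !hornerC !expr0 invr1 !mul1r ler_expR lerN2 lef_pV2 ?posrE; last 2 first.
    + by apply: onem_sqr_gt0; apply: (lt_trans xj); lra.
    + by lra.
    move: xj; rewrite ltr_norml => /andP[? ?]; nra.
apply: (@le_lt_trans _ _ (\int[mu]_y (\1_(box n 1) y)%:E)%E).
  apply: ge0_le_integral => //.
  - by move=> x _; rewrite lee_fin ptest_ge0.
  - exact: measurable_ptest1.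
  - by apply/mEFinP; exact: measurable_indic.
  - move=> x _; rewrite lee_fin indicE; have [_|] := boolP (x \in box n 1).
      rewrite /ptest mul1r; apply: prodr_ile1 => j _.
      by rewrite cbump1_ge0 cbump1_le1.
    rewrite notin_setE => /existsNP[j /negP]; rewrite -leNgt => xj.
    by rewrite (@ptest_eq0 _ _ _ _ _ _ _ j)// mxE subr0.
by rewrite integral_indic// setIT; exact: lebesgue_rV_box_lty.
Qed.

Lemma bmass_gt0 : 0 < fine bmass.
Proof. by apply: fine_gt0; exact: bmass_fin. Qed.

Lemma bmassE : bmass = (fine bmass)%:E.
Proof. by rewrite fineK// gt0_fin_numE; have /andP[] := bmass_fin. Qed.

Definition kern e x y := ptest ((fine bmass)^-1 * e^-1 ^+ n) e Q1 x y.

Lemma kern_ge0 e x y : 0 < e -> 0 <= kern e x y.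
Proof.
by move=> e0; apply: ptest_ge0; rewrite mulr_ge0 ?invr_ge0 ?exprn_ge0 ?invr_ge0 ?(ltW e0) ?(ltW bmass_gt0).
Qed.

Lemma kern_sym e x y : kern e x y = kern e y x.
Proof. exact: ptest_sym. Qed.

Lemma kern_shift e x z : kern e x (x + z) = kern e 0 z.
Proof.
by rewrite /kern /ptest; congr (_ * _); apply: eq_bigr => j _; rewrite !mxE subr0 addrAC subrr add0r.
Qed.

Lemma kern_eq0 e x y : 0 < e -> ~ cube x e y -> kern e x y = 0.
Proof.
by move=> e0 /existsNP[j /negP]; rewrite -leNgt => xj; rewrite /kern (@ptest_eq0 _ _ _ _ _ _ _ j).
Qed.

Lemma measurable_kern d (T : measurableType d) e (x y : T -> V) :
  mfun x -> mfun y ->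
  mfun (fun t => kern e (x t) (y t)).
Proof. exact: measurable_ptest. Qed.

Lemma measurable_kernE d (T : measurableType d) e (x y : T -> V) :
  mfun x -> mfun y ->
  mfun (fun t => (kern e (x t) (y t))%:E).
Proof. by move=> *; apply/mEFinP; exact: measurable_kern. Qed.

Lemma integral_kern e x : 0 < e -> (\int[mu]_y (kern e x y)%:E = 1)%E.
Proof.
move=> e0; have eV : 0 < e^-1 by rewrite invr_gt0.
pose c := (fine bmass)^-1 * e^-1 ^+ n.
have E y : (kern e x y)%:E = (c%:E * (ptest 1 1 Q1 0 (e^-1 *: y + (- (e^-1 *: x))))%:E)%E.
  rewrite -EFinM /kern /ptest; congr (_%:E); rewrite -/c mul1r; congr (_ * _).
  by apply: eq_bigr => j _; rewrite !mxE subr0 invr1 mul1r mulrBr.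
under eq_integral do rewrite E.
rewrite ge0_integralZl//; last 3 first.
- apply: (measurableT_comp (measurable_ptest1 1 1 0)); exact: measurable_affine.
- by move=> y _; rewrite lee_fin ptest_ge0.
- by rewrite lee_fin mulr_ge0 ?invr_ge0 ?exprn_ge0 ?invr_ge0 ?(ltW e0) ?(ltW bmass_gt0).
rewrite [X in (_ * X)%E](@ge0_integral_affine R n (fun y => (ptest 1 1 Q1 0 y)%:E) e^-1)//; last 2 first.
- exact: measurable_ptest1.
- by move=> y; rewrite lee_fin ptest_ge0.
rewrite -/bmass bmassE -!EFinM invrK; congr (_%:E).
have n1 : fine bmass != 0 by rewrite gt_eqF// bmass_gt0.
have n2 : e ^+ n != 0 by rewrite gt_eqF// exprn_gt0.
by rewrite /c exprVn -mulrA mulKf// mulVf.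
Qed.

Lemma kern_bounded e : exists C : R, 0 <= C /\ forall x y, `|kern e x y| <= C.
Proof. exact: ptest_bounded. Qed.

Definition Mol e f x : R := \int[mu]_y (f y * kern e x y).

Section mol.
Variables (f : V -> R) (if1 : mu.-integrable setT (EFin \o f)).
Variables (e : R) (e0 : 0 < e).

Let mf : mfun f.
Proof. by apply/mEFinP; exact: measurable_int if1. Qed.

Lemma integrable_kern x : mu.-integrable setT (fun y => (kern e x y)%:E).
Proof.
apply/integrableP; split; first exact: measurable_kernE.
under eq_integral do rewrite /= ger0_norm ?kern_ge0//.
by rewrite integral_kern// ltry.
Qed.

Lemma integrable_mul_bounded (h k : V -> R) C : mu.-integrable setT (EFin \o h) ->
  mfun k -> (forall y, `|k y| <= C) ->
  mu.-integrable setT (fun y => (h y * k y)%:E).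
Proof.
move=> ih mk kC; have mh : mfun h by apply/mEFinP; exact: measurable_int ih.
apply: (@le_integrable _ _ _ _ setT _ _ (fun y => (C%:E * (EFin \o h) y)%E)) => //.
- by apply/mEFinP; exact: measurable_funM.
- move=> y _ /=; rewrite lee_fin !normrM mulrC; apply: ler_wpM2r => //.
  exact: le_trans (kC y) (ler_norm _).
- exact: integrableZl.
Qed.

Lemma integrable_fkern x : mu.-integrable setT (fun y => (f y * kern e x y)%:E).
Proof.
have [C [_ hC]] := kern_bounded e.
by apply: (integrable_mul_bounded if1 _ (hC x)); exact: measurable_kern.
Qed.

Let F2 (z : V * V) : \bar R := (f z.2 * kern e z.1 z.2)%:E.

Let mF2 : mfun F2.
Proof.
apply/mEFinP; apply: measurable_funM; first exact: (measurableT_comp mf).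
exact: measurable_kern.
Qed.

Lemma integrable_fkern2 : (mu \x mu)%E.-integrable setT F2.
Proof.
apply: (proj2 (@integrable21ltyP _ _ _ _ _ mu mu F2 mF2)).
rewrite (_ : (\int[mu]_y _)%E = N1 f); last first.
  apply: eq_integral => y _; rewrite /F2 /=.
  under eq_integral => x _ do rewrite normrM (ger0_norm (kern_ge0 x y e0)) kern_sym EFinM.
  rewrite ge0_integralZl//; last 2 first.
  - exact: measurable_kernE.
  - by move=> x _; rewrite lee_fin kern_ge0.
  by rewrite integral_kern// mule1.
by have /integrableP[_] := if1.
Qed.

Lemma MolE x : (Mol e f x)%:E = (\int[mu]_y (f y * kern e x y)%:E)%E.
Proof. by rewrite /Mol /Rintegral fineK//; apply: integrable_fin_num => //; exact: integrable_fkern. Qed.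

Lemma measurable_Mol : mfun (Mol e f).
Proof.
apply/mEFinP; rewrite (_ : EFin \o Mol e f = fun x => \int[mu]_y F2 (x, y))%E.
  exact: (measurable_fubini_F integrable_fkern2).
by apply/funext => x; rewrite /= MolE.
Qed.

Lemma Mol_sub x : (`|Mol e f x - f x|%:E <= \int[mu]_z (`|f (x + z) - f x| * kern e 0 z)%:E)%E.
Proof.
have i1 := integrable_fkern x; have i2 := integrable_kern x.
have -> : (`|Mol e f x - f x|%:E = `| \int[mu]_y ((f y - f x) * kern e x y)%:E |)%E.
  rewrite -abse_EFin EFinB MolE; congr (`| _ |)%E.
  rewrite -[(f x)%:E]mule1 -(integral_kern x e0) -integralZl//.
  rewrite -integralB//; last exact: integrableZl.
  by apply: eq_integral => y _; rewrite -EFinM -EFinB mulrBl.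
have mk : mfun (fun y => ((f y - f x) * kern e x y)%:E).
  by apply/mEFinP; apply: measurable_funM; [exact: measurable_funB|exact: measurable_kern].
apply: (le_trans (le_abse_integral _ _ mk)) => //.
rewrite -(@ge0_integral_translate R n (fun y => `|((f y - f x) * kern e x y)%:E|%E) x)//; last first.
  exact: measurableT_comp.
rewrite le_eqVlt; apply/orP; left; apply/eqP; apply: eq_integral => z _.
by rewrite /= [z + x]addrC kern_shift normrM (ger0_norm (kern_ge0 _ _ e0)).
Qed.

(** Minkowski's inequality through Tonelli: the L^1 distance is at most the average over [z] of the
    L^1 modulus of continuity, and the kernel vanishes unless [z] lies in the cube of half-side
    [e]. *)
Lemma Mol_cvg del c : e <= del -> 0 <= c ->
  (forall z, cube 0 del z -> (N1 (fun x => (f (x + z) - f x)%R) <= c%:E)%E) ->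
  (N1 (fun x => (Mol e f x - f x)%R) <= c%:E)%E.
Proof.
move=> ed c0 hc.
have mG : mfun (fun z : V * V => (`|f (z.1 + z.2) - f z.1| * kern e 0 z.2)%:E).
  apply/mEFinP; apply: measurable_funM; last exact: measurable_kern.
  apply: measurableT_comp => //; apply: measurable_funB; last exact: (measurableT_comp mf).
  apply: (measurableT_comp mf); apply: measurable_rV => j.
  under eq_fun do rewrite mxE; apply: measurable_funD.
    exact: (measurableT_comp (@coord_measurable R n j)).
  exact: (measurableT_comp (@coord_measurable R n j)).
have G0 (z : V * V) : (0 <= (`|f (z.1 + z.2) - f z.1| * kern e 0 z.2)%:E)%E.
  by rewrite lee_fin mulr_ge0// kern_ge0.
apply: (le_via (\int[mu]_x \int[mu]_z (`|f (x + z) - f x| * kern e 0 z)%:E)%E).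
  apply: ge0_le_integral => //.
  - by apply: mfun_norm; apply: measurable_funB => //; exact: measurable_Mol.
  - exact: (@measurable_fun_fubini_tonelli_F _ _ _ _ _ mu _ mG G0).
  - by move=> x _; exact: Mol_sub.
rewrite (@fubini_tonelli _ _ _ _ _ mu mu _ mG G0) /=.
apply: (le_via (\int[mu]_z (c%:E * (kern e 0 z)%:E))%E).
  apply: ge0_le_integral => //.
  - by move=> z _; apply: integral_ge0 => x _; exact: (G0 (x, z)).
  - exact: (@measurable_fun_fubini_tonelli_G _ _ _ _ _ mu _ mG G0).
  - by apply: emeasurable_funM => //; exact: measurable_kernE.
  - move=> z _; under eq_integral do rewrite EFinM.
    rewrite ge0_integralZr//; last 2 first.
    + by apply: mfun_norm; exact: mfun_diff.
    + by rewrite lee_fin kern_ge0.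
    have [ze|ze] := pselect (cube 0 e z).
      apply: lee_wpmul2r; first by rewrite lee_fin kern_ge0.
      by apply: hc => j; exact: lt_le_trans (ze j) ed.
    by rewrite (kern_eq0 e0 ze) !mule0.
rewrite ge0_integralZl//; last 2 first.
- exact: measurable_kernE.
- by move=> z _; rewrite lee_fin kern_ge0.
by rewrite integral_kern// mule1.
Qed.

Hypothesis if2 : mu.-integrable setT (fun y => (f y ^+ 2)%:E).

(** Jensen's inequality for the probability kernel: the integral of (f - t)^2 against it is
    nonnegative at t = [Mol e f x]. *)
Lemma Mol_sqr x : ((Mol e f x ^+ 2)%:E <= \int[mu]_y (f y ^+ 2 * kern e x y)%:E)%E.
Proof.
have i1 := integrable_fkern x; have i2 := integrable_kern x.
have [C [_ hC]] := kern_bounded e.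
have i3 : mu.-integrable setT (fun y => (f y ^+ 2 * kern e x y)%:E).
  by apply: (integrable_mul_bounded if2 _ (hC x)); exact: measurable_kern.
set t := Mol e f x.
have i4 : mu.-integrable setT (fun y => (2 * t)%:E * (f y * kern e x y)%:E)%E by exact: integrableZl.
have i5 : mu.-integrable setT (fun y => (t ^+ 2)%:E * (kern e x y)%:E)%E by exact: integrableZl.
have h : (0 <= \int[mu]_y ((f y ^+ 2 * kern e x y)%:E - (2 * t)%:E * (f y * kern e x y)%:E
    + (t ^+ 2)%:E * (kern e x y)%:E))%E.
  apply: integral_ge0 => y _; rewrite -!EFinM -EFinB -EFinD lee_fin.
  have -> : f y ^+ 2 * kern e x y - 2 * t * (f y * kern e x y) + t ^+ 2 * kern e x y =
    (f y - t) ^+ 2 * kern e x y by ring.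
  by rewrite mulr_ge0 ?sqr_ge0// kern_ge0.
move: h; rewrite integralD//; last exact: integrableB.
rewrite integralB// !integralZl// integral_kern// -MolE -/t mule1.
have f3 := integrable_fin_num measurableT i3.
rewrite -(fineK f3) -EFinM -EFinB -EFinD !lee_fin.
by move=> h; apply: le_trans (_ : t ^+ 2 <= _) _ => //; nra.
Qed.

Lemma Mol_sqr_le : (\int[mu]_x (Mol e f x ^+ 2)%:E <= \int[mu]_y (f y ^+ 2)%:E)%E.
Proof.
have mG : mfun (fun z : V * V => (f z.2 ^+ 2 * kern e z.1 z.2)%:E).
  apply/mEFinP; apply: measurable_funM; last exact: measurable_kern.
  by apply: measurable_funX; exact: (measurableT_comp mf).
have G0 (z : V * V) : (0 <= (f z.2 ^+ 2 * kern e z.1 z.2)%:E)%E.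
  by rewrite lee_fin mulr_ge0 ?sqr_ge0// kern_ge0.
apply: (le_via (\int[mu]_x \int[mu]_y (f y ^+ 2 * kern e x y)%:E)%E).
  apply: ge0_le_integral => //.
  - by move=> x _; rewrite lee_fin sqr_ge0.
  - by apply/mEFinP; apply: measurable_funX; exact: measurable_Mol.
  - exact: (@measurable_fun_fubini_tonelli_F _ _ _ _ _ mu _ mG G0).
  - by move=> x _; exact: Mol_sqr.
rewrite (@fubini_tonelli _ _ _ _ _ mu mu _ mG G0) /= le_eqVlt; apply/orP; left; apply/eqP.
apply: eq_integral => y _.
under eq_integral => x _ do rewrite kern_sym EFinM.
rewrite ge0_integralZl//; last 3 first.
- exact: measurable_kernE.
- by move=> z _; rewrite lee_fin kern_ge0.
- by rewrite lee_fin sqr_ge0.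
by rewrite integral_kern// mule1.
Qed.
End mol.
End mollifier.

(** * Calculus of integrals of real-valued functions *)

Section real_integral.
Context d (T : measurableType d) (R : realType) (nu : {measure set T -> \bar R}).
Implicit Types (f g : T -> R) (c : R).

Definition Ig f := nu.-integrable setT (EFin \o f).

Lemma Ig_meas f : Ig f -> mfun f.
Proof. by move=> fi; apply/mEFinP; exact: (measurable_int nu). Qed.

Lemma Ig_ext f g : f =1 g -> Ig f -> Ig g.
Proof. by move=> /funext ->. Qed.

Lemma IgP f : mfun f -> (\int[nu]_x `|f x|%:E < +oo)%E -> Ig f.
Proof. by move=> mf h; apply/integrableP; split => //; apply/mEFinP. Qed.

Lemma Ig_lty f : Ig f -> (\int[nu]_x `|f x|%:E < +oo)%E.
Proof. by move=> /integrableP[]. Qed.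

Lemma Ig_fin f : Ig f -> (\int[nu]_x (f x)%:E = (\int[nu]_x f x)%:E)%E.
Proof. by move=> fi; rewrite /Rintegral fineK//; exact: integrable_fin_num. Qed.

Lemma IgD f g : Ig f -> Ig g -> Ig (fun x => f x + g x).
Proof. by move=> fi gi; exact: (integrableD measurableT fi gi). Qed.

Lemma IgB f g : Ig f -> Ig g -> Ig (fun x => f x - g x).
Proof. by move=> fi gi; exact: (integrableB measurableT fi gi). Qed.

Lemma IgN f : Ig f -> Ig (fun x => - f x).
Proof. by move=> fi; exact: (integrableN fi). Qed.

Lemma IgZ c f : Ig f -> Ig (fun x => c * f x).
Proof. by move=> fi; exact: (integrableZl measurableT c fi). Qed.

Lemma Ig0 : Ig (fun=> 0).
Proof. by apply: IgP => //; under eq_integral do rewrite normr0; rewrite integral0. Qed.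

Lemma Ig_sum (I : Type) (s : seq I) (f : I -> T -> R) : (forall i, Ig (f i)) ->
  Ig (fun x => \sum_(i <- s) f i x).
Proof.
move=> fi; elim: s => [|i s ih].
  by apply: (Ig_ext _ Ig0) => x; rewrite big_nil.
by apply: (Ig_ext _ (IgD (fi i) ih)) => x; rewrite big_cons.
Qed.

Lemma Ig_abs f : Ig f -> Ig (fun x => `|f x|).
Proof. by move=> fi; exact: (integrable_abse fi). Qed.

Lemma Ig_le f g : mfun f -> Ig g -> (forall x, `|f x| <= g x) -> Ig f.
Proof.
move=> mf gi fg; apply: (le_integrable measurableT _ _ gi); first exact/mEFinP.
by move=> x _ /=; rewrite lee_fin (le_trans (fg x))// ler_norm.
Qed.

Lemma RI_ext f g : f =1 g -> \int[nu]_x f x = \int[nu]_x g x.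
Proof. by move=> fg; apply: eq_Rintegral => x _. Qed.

Lemma RI_D f g : Ig f -> Ig g -> \int[nu]_x (f x + g x) = \int[nu]_x f x + \int[nu]_x g x.
Proof. by move=> fi gi; exact: (RintegralD measurableT fi gi). Qed.

Lemma RI_B f g : Ig f -> Ig g -> \int[nu]_x (f x - g x) = \int[nu]_x f x - \int[nu]_x g x.
Proof. by move=> fi gi; exact: (RintegralB measurableT fi gi). Qed.

Lemma RI_Z c f : Ig f -> \int[nu]_x (c * f x) = c * \int[nu]_x f x.
Proof. by move=> fi; exact: (RintegralZl c measurableT fi). Qed.

Lemma RI_Zr c f : Ig f -> \int[nu]_x (f x * c) = (\int[nu]_x f x) * c.
Proof. by move=> fi; rewrite mulrC -RI_Z//; apply: RI_ext => x; rewrite mulrC. Qed.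

Lemma RI_N f : Ig f -> \int[nu]_x (- f x) = - \int[nu]_x f x.
Proof. by move=> fi; rewrite -mulN1r -RI_Z//; apply: RI_ext => x; rewrite mulN1r. Qed.

Lemma RI_0 : \int[nu]_x (0 : R) = 0.
Proof. by rewrite /Rintegral integral0. Qed.

Lemma RI_sum (I : Type) (s : seq I) (f : I -> T -> R) : (forall i, Ig (f i)) ->
  \int[nu]_x (\sum_(i <- s) f i x) = \sum_(i <- s) \int[nu]_x f i x.
Proof.
move=> fi; elim: s => [|i s ih].
  by rewrite big_nil -[RHS]RI_0; apply: RI_ext => x; rewrite big_nil.
rewrite big_cons -ih -RI_D//; last exact: Ig_sum.
by apply: RI_ext => x; rewrite big_cons.
Qed.

Lemma RI_ge0 f : (forall x, 0 <= f x) -> 0 <= \int[nu]_x f x.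
Proof. by move=> f0; rewrite fine_ge0// integral_ge0// => x _; rewrite lee_fin. Qed.

Lemma RI_le f g : Ig f -> Ig g -> (forall x, f x <= g x) -> \int[nu]_x f x <= \int[nu]_x g x.
Proof. by move=> fi gi fg; rewrite -subr_ge0 -RI_B// RI_ge0// => x; rewrite subr_ge0. Qed.

Lemma RI_norm f : Ig f -> `|\int[nu]_x f x| <= \int[nu]_x `|f x|.
Proof.
move=> fi; have fi' := Ig_abs fi; rewrite ler_norml; apply/andP; split.
  rewrite lerNl -RI_N//; apply: RI_le => //; first exact: IgN.
  by move=> x; rewrite -normrN ler_norm.
by apply: RI_le => // x; rewrite ler_norm.
Qed.

Lemma RI_norm_le f g : Ig f -> Ig g -> (forall x, `|f x| <= g x) ->
  `|\int[nu]_x f x| <= \int[nu]_x g x.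
Proof. by move=> fi gi h; apply: le_trans (RI_norm fi) _; apply: RI_le => //; exact: Ig_abs. Qed.

Lemma sqr_Ig_mul f g : mfun f -> mfun g ->
  Ig (fun x => f x ^+ 2) -> Ig (fun x => g x ^+ 2) -> Ig (fun x => f x * g x).
Proof.
move=> mf mg f2 g2; apply: Ig_le (IgD f2 g2) _; first exact: measurable_funM.
move=> x; rewrite normrM -(real_normK (num_real (f x))) -(real_normK (num_real (g x))).
set a := `|f x|; set b := `|g x|; have : 0 <= (a - b) ^+ 2 by exact: sqr_ge0.
have : 0 <= a * b by rewrite /a /b mulr_ge0.
by rewrite sqrrB -mulr_natr; nra.
Qed.

Lemma RI_CS f g : mfun f -> mfun g ->
  Ig (fun x => f x ^+ 2) -> Ig (fun x => g x ^+ 2) ->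
  (\int[nu]_x (f x * g x)) ^+ 2 <= \int[nu]_x (f x ^+ 2) * \int[nu]_x (g x ^+ 2).
Proof.
move=> mf mg f2 g2; have fg := sqr_Ig_mul mf mg f2 g2.
set A := \int[nu]_x (f x ^+ 2); set B := \int[nu]_x (g x ^+ 2); set C := \int[nu]_x _.
have A0 : 0 <= A by apply: RI_ge0 => x; exact: sqr_ge0.
have B0 : 0 <= B by apply: RI_ge0 => x; exact: sqr_ge0.
have H t : 0 <= A + 2 * t * C + t ^+ 2 * B.
  have -> : A + 2 * t * C + t ^+ 2 * B = \int[nu]_x ((f x + t * g x) ^+ 2).
    rewrite /A /B /C -RI_Z// -RI_Z// -RI_D//; last exact: IgZ.
    rewrite -RI_D; [|by apply: IgD => //; exact: IgZ|exact: IgZ].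
    by apply: RI_ext => x; ring.
  by apply: RI_ge0 => x; exact: sqr_ge0.
have [B00|Bn0] := eqVneq B 0.
  have [->|Cn0] := eqVneq C 0; first by rewrite expr0n/= mulr_ge0.
  (* With B = 0 the quadratic polynomial is affine in t; this t gives it the value -1. *)
  have := H (- (A + 1) / (2 * C)); rewrite B00 mulr0 addr0.
  rewrite (_ : A + _ = -1); last by field.
  by move=> ?; exfalso; lra.
have Bp : 0 < B by rewrite lt_neqAle eq_sym Bn0.
have := H (- C / B); rewrite (_ : A + _ + _ = (A * B - C ^+ 2) / B); last by field.
by rewrite pmulr_lge0 ?invr_gt0// subr_ge0.
Qed.
End real_integral.

Section dominated.
Context d (T : measurableType d) (R : realType) (nu : {measure set T -> \bar R}).

Lemma RI_dominated (fn : nat -> T -> R) (f g : T -> R) :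
  (forall n, mfun (fn n)) -> mfun f -> Ig nu g ->
  (forall x, fn n x @[n --> \oo] --> f x) -> (forall n x, `|fn n x| <= g x) ->
  Ig nu f /\ \int[nu]_x fn n x @[n --> \oo] --> \int[nu]_x f x.
Proof.
move=> mfn mf gi cvf bnd.
have h1 : {ae nu, forall x, setT x -> (fun n => (EFin \o fn n) x) @ \oo --> (EFin \o f) x}.
  by apply: aeW => x _; apply: cvg_EFin; [exact: nearW|exact: cvf].
have h2 : {ae nu, forall x n, setT x -> (`|(EFin \o fn n) x| <= (EFin \o g) x)%E}.
  by apply: aeW => x n _; rewrite /= lee_fin.
have [fi _ cvi] := @dominated_convergence _ T R nu setT measurableT
  (fun n => EFin \o fn n) (EFin \o f) (EFin \o g)
  (fun n => (mEFinP _ _).2 (mfn n)) ((mEFinP _ _).2 mf) h1 gi h2.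
split; first exact: fi.
by apply: fine_cvg; rewrite -(Ig_fin fi) in cvi *.
Qed.
End dominated.

Ltac pos := repeat match goal with
 | H : is_true ?g |- is_true ?g => exact H
 | H : is_true (0 < ?x) |- is_true (0 <= ?x) => exact: ltW H
 | |- is_true (0 < _ * _) => apply: mulr_gt0
 | |- is_true (0 < _ ^+ _) => apply: exprn_gt0
 | |- is_true (0 < _ ^-1) => rewrite invr_gt0
 | |- is_true (0 <= _ * _) => apply: mulr_ge0
 | |- is_true (0 <= _ + _) => apply: addr_ge0
 | |- is_true (0 <= _ ^+ 2) => apply: sqr_ge0
 | |- is_true (0 <= _ ^+ _) => apply: exprn_ge0
 | |- is_true (0 <= _ ^-1) => rewrite invr_ge0
 | H : is_true (0 < ?x) |- is_true (0 <= ?x) => exact: ltW H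
 | H : is_true ?g |- is_true ?g => exact H
 | H : is_true (0 < ?x) |- is_true (0 < ?x + _) => apply: ltr_wpDr
 | |- is_true (0 < _ + _) => apply: ltr_wpDl
 | |- is_true (0 <= _) => first [done | solve [apply: sumr_ge0 => ? _; pos]]
 | |- _ => done
 end.

(** * A truncation with Lipschitz derivative *)

Section smooth_step.
Context {R : realType}.
Implicit Types (t a b k dl : R).

Definition clamp01 t : R := Num.max 0 (Num.min t 1).

(** The cubic smoothstep. Its derivative is Lipschitz, so it has a global second-order Taylor
    remainder ([sstep_taylor]), the form in which [H1_chain] consumes it; a piecewise linear
    truncation fails this at its corners. *)
Definition sstep t : R := 3 * clamp01 t ^+ 2 - 2 * clamp01 t ^+ 3.

Definition dsstep t : R := 6 * clamp01 t * (1 - clamp01 t).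

Lemma clamp01P t : [\/ t <= 0 /\ clamp01 t = 0, 0 < t < 1 /\ clamp01 t = t | 1 <= t /\ clamp01 t = 1].
Proof.
have [t0|t0] := leP t 0.
  by apply: Or31; split => //; rewrite /clamp01 min_l ?(le_trans t0)// max_l.
have [t1|t1] := ltP t 1; first by apply: Or32; split => //; rewrite /clamp01 min_l ?(ltW t1)// max_r// ltW.
by apply: Or33; split => //; rewrite /clamp01 min_r// max_r.
Qed.

Lemma clamp01_itv t : 0 <= clamp01 t <= 1.
Proof. by case: (clamp01P t) => -[h ->]; rewrite ?lexx ?ler01// ltW ?(andP h).1//= ltW ?(andP h).2. Qed.

Lemma dsstep_bound t : 0 <= dsstep t <= 3 / 2.
Proof.
have /andP[h0 h1] := clamp01_itv t; rewrite /dsstep; move: (clamp01 t) h0 h1 => c h0 h1.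
by apply/andP; split; [rewrite !mulr_ge0// subr_ge0|have := sqr_ge0 (c - 1 / 2); nra].
Qed.

Lemma sstep_bound t : 0 <= sstep t <= 1.
Proof.
have /andP[h0 h1] := clamp01_itv t; rewrite /sstep; move: (clamp01 t) h0 h1 => c h0 h1.
have e1 : 3 * c ^+ 2 - 2 * c ^+ 3 = c ^+ 2 * (3 - 2 * c) by ring.
have e2 : 1 - (3 * c ^+ 2 - 2 * c ^+ 3) = (1 - c) ^+ 2 * (1 + 2 * c) by ring.
by apply/andP; split; [rewrite e1|rewrite -subr_ge0 e2]; rewrite mulr_ge0 ?sqr_ge0//; lra.
Qed.

Lemma sstep_le0 t : t <= 0 -> sstep t = 0.
Proof.
move=> t0; rewrite /sstep; case: (clamp01P t) => -[h ->]; first by rewrite !expr0n/= !mulr0 subr0.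
  by move: h => /andP[? _]; lra.
by lra.
Qed.

Lemma sstep_ge1 t : 1 <= t -> sstep t = 1.
Proof.
move=> t0; rewrite /sstep; case: (clamp01P t) => -[h ->]; [lra| |by rewrite !expr1n; ring].
by move: h => /andP[_ ?]; lra.
Qed.

Lemma dsstep_eq0 t : ~~ (0 < t < 1) -> dsstep t = 0.
Proof.
rewrite /dsstep; case: (clamp01P t) => -[h ->]; first by rewrite mulr0 mul0r.
  by rewrite h.
by rewrite subrr mulr0.
Qed.

(** An exact cubic identity in the clamped values plus the error of clamping. The latter carries the
    factor [dsstep a], which vanishes unless 0 < a < 1, and is then quadratic in b - a. *)
Lemma sstep_taylor a b : `|sstep b - sstep a - dsstep a * (b - a)| <= 9 * (b - a) ^+ 2.
Proof.
have E : sstep b - sstep a - dsstep a * (clamp01 b - clamp01 a) =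
  (clamp01 b - clamp01 a) ^+ 2 * (3 - 2 * clamp01 b - 4 * clamp01 a).
  by rewrite /sstep /dsstep; ring.
have -> : sstep b - sstep a - dsstep a * (b - a) =
  (clamp01 b - clamp01 a) ^+ 2 * (3 - 2 * clamp01 b - 4 * clamp01 a) -
  dsstep a * ((b - clamp01 b) - (a - clamp01 a)) by rewrite -E; ring.
apply: (le_trans (ler_normB _ _)); rewrite (_ : 9 * _ = 3 * (b - a) ^+ 2 + 6 * (b - a) ^+ 2); last by ring.
have /andP[cb0 cb1] := clamp01_itv b; have /andP[ca0 ca1] := clamp01_itv a.
apply: lerD.
  rewrite normrM (ger0_norm (sqr_ge0 _)) mulrC; apply: ler_pM => //; first by rewrite sqr_ge0.
    by rewrite ler_norml; apply/andP; split; lra.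
  rewrite -[leRHS](real_normK (num_real _)) -[leLHS](real_normK (num_real _)) lerXn2r ?nnegrE//.
  case: (lerP a b) => ba; rewrite ler_norml;
   case: (clamp01P a) => -[ha ->]; case: (clamp01P b) => -[hb ->];
   try (move: ha => /andP[? ?]); try (move: hb => /andP[? ?]); apply/andP; split; lra.
rewrite normrM /dsstep; case: (clamp01P a) => -[ha ->].
- by rewrite mulr0 mul0r normr0 mul0r mulr_ge0 ?sqr_ge0.
- rewrite subrr subr0; move: ha => /andP[a0 a1].
  rewrite ger0_norm; last by nra.
  case: (clamp01P b) => -[hb ->].
  + by rewrite subr0 ler0_norm//; nra.
  + by rewrite subrr normr0 mulr0 mulr_ge0 ?sqr_ge0.
  + rewrite ger0_norm ?subr_ge0//; have h1 : 0 <= (1 - a) * (b - 1) by rewrite mulr_ge0// subr_ge0// ltW.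
    have : a * ((1 - a) * (b - 1)) <= 1 * ((1 - a) * (b - 1)) by rewrite ler_wpM2r// ltW.
    have : 0 <= (1 - a) ^+ 2 + (b - 1) ^+ 2 by rewrite addr_ge0 ?sqr_ge0.
    by lra.
- by rewrite subrr mulr0 normr0 mul0r mulr_ge0 ?sqr_ge0.
Qed.

Lemma measurable_clamp01 : mfun (clamp01 : R -> R).
Proof.
apply: (@measurable_maxr _ _ _ _ (cst 0) (fun t => Num.min t 1)) => //.
exact: (@measurable_minr _ _ _ _ id (cst 1)).
Qed.

Lemma measurable_sstep : mfun (sstep : R -> R).
Proof.
by apply: measurable_funB; apply: measurable_funM => //; apply: measurable_funX; exact: measurable_clamp01.
Qed.

Lemma measurable_dsstep : mfun (dsstep : R -> R).
Proof.
apply: measurable_funM; first by apply: measurable_funM => //; exact: measurable_clamp01.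
by apply: measurable_funB => //; exact: measurable_clamp01.
Qed.

Definition trunc k dl t : R := dl * sstep ((t - k) / dl).

Definition dtrunc k dl t : R := dsstep ((t - k) / dl).

Lemma measurable_affine1 k dl : mfun (fun t => (t - k) / dl).
Proof. by apply: measurable_funM => //; apply: measurable_funB. Qed.

Lemma measurable_trunc k dl : mfun (trunc k dl).
Proof.
apply: measurable_funM => //.
exact: (measurableT_comp measurable_sstep (measurable_affine1 k dl)).
Qed.

Lemma measurable_dtrunc k dl : mfun (dtrunc k dl).
Proof. exact: (measurableT_comp measurable_dsstep (measurable_affine1 k dl)). Qed.

Lemma trunc_taylor k dl a b : 0 < dl ->
  `|trunc k dl b - trunc k dl a - dtrunc k dl a * (b - a)| <= 9 / dl * (b - a) ^+ 2.
Proof.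
move=> dl0; have := sstep_taylor ((a - k) / dl) ((b - k) / dl).
rewrite /trunc /dtrunc; set sa := sstep _; set sb := sstep _; set ds := dsstep _.
rewrite (_ : (b - k) / dl - (a - k) / dl = (b - a) / dl); last by ring.
move=> h; rewrite (_ : _ - _ - _ = dl * (sa - sb - ds * ((b - a) / dl))); last by field; rewrite gt_eqF.
rewrite normrM gtr0_norm// (_ : _ / dl * _ = dl * (9 * ((b - a) / dl) ^+ 2)); last by field; rewrite gt_eqF.
by rewrite ler_pM2l.
Qed.
End smooth_step.

(** * Inequalities for finite sums and powers *)

Lemma geometric_CS (R : realType) (r : R) (K : nat) (a : nat -> R) : 0 < r < 1 ->
  (\sum_(k < K) a k) ^+ 2 <= (1 - r)^-1 * \sum_(k < K) r ^- k * a k ^+ 2.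
Proof.
move=> /andP[r0 r1]; have r2 : 0 < 1 - r by lra.
elim: K a => [a|K ih a]; first by rewrite !big_ord0 expr0n mulr0.
have E1 : \sum_(k < K.+1) a k = a 0%N + \sum_(k < K) a k.+1 by rewrite big_ord_recl.
have E2 : \sum_(k < K.+1) r ^- k * a k ^+ 2 = a 0%N ^+ 2 + r^-1 * \sum_(k < K) r ^- k * a k.+1 ^+ 2.
  rewrite big_ord_recl expr0 invr1 mul1r mulr_sumr; congr (_ + _); apply: eq_bigr => k _.
  by rewrite mulrA -invfM -exprS.
rewrite E1 E2; have := ih (fun k => a k.+1).
set T := \sum_(k < K) a k.+1; set Z := \sum_(k < K) _ => h.
(* Convexity of the square with weights 1 - r and r; iterated, it is Cauchy-Schwarz against the
   weights r^k, uniformly in [K]. *)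
have h1 : (a 0%N + T) ^+ 2 <= (1 - r)^-1 * a 0%N ^+ 2 + r^-1 * T ^+ 2.
  rewrite -subr_ge0 (_ : _ - _ = (r * a 0%N - (1 - r) * T) ^+ 2 / (r * (1 - r))); last first.
    by field; rewrite !gt_eqF.
  by rewrite divr_ge0 ?sqr_ge0// mulr_ge0 ?ltW.
apply: (le_trans h1); rewrite [leRHS]mulrDr lerD2l [leRHS]mulrCA ler_wpM2l// invr_ge0 ltW//.
Qed.

Section real_continuity.
Context {R : realType} {T : topologicalType}.
Implicit Types f g : T -> R.

Lemma continuous_fadd f g : continuous f -> continuous g -> continuous (fun t => f t + g t).
Proof. by move=> hf hg t; exact: (cvgD (hf t) (hg t)). Qed.

Lemma continuous_fsub f g : continuous f -> continuous g -> continuous (fun t => f t - g t).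
Proof. by move=> hf hg t; exact: (cvgB (hf t) (hg t)). Qed.

Lemma continuous_fmul f g : continuous f -> continuous g -> continuous (fun t => f t * g t).
Proof. by move=> hf hg t; exact: (cvgM (hf t) (hg t)). Qed.

Lemma continuous_fsum (k : nat) (f : 'I_k -> T -> R) :
  (forall i, continuous (f i)) -> continuous (fun v => \sum_i f i v).
Proof.
move=> h; elim: k f h => [f h|k ih f h].
  rewrite (_ : (fun t => _) = cst 0); first exact: cst_continuous.
  by apply/funext => x; rewrite big_ord0.
rewrite (_ : (fun t => _) = (fun t => f ord0 t + \sum_(j < k) f (lift ord0 j) t)); last first.
  by apply/funext => x; rewrite big_ord_recl.
by apply: continuous_fadd => //; apply: ih => i; exact: h.
Qed.
End real_continuity.

(** The first-order condition at a minimum, from a quadratic upper bound for the increment alone. It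
    serves the existence of the implicit step. *)
Lemma stationary (R : realType) (al K : R) : 0 <= K ->
  (forall t : R, `|t| <= 1 -> 0 <= t * al + K * t ^+ 2) -> al = 0.
Proof.
move=> K0 h; apply/eqP; apply: contraT => a0.
set M := 1 + K + `|al|; have M0 : 0 < M by rewrite /M; have := normr_ge0 al; lra.
have aM : `|- al / M| <= 1.
  rewrite normrM normrN normfV (gtr0_norm M0) ler_pdivrMr// mul1r /M.
  by have := normr_ge0 al; lra.
have := h _ aM; rewrite (_ : _ + _ = - (al ^+ 2 / M) * (1 - K / M)); last by field; rewrite gt_eqF.
rewrite leNgt mulNr oppr_lt0 => /negP[]; apply: mulr_gt0.
  by rewrite divr_gt0// exprn_even_gt0.
by rewrite subr_gt0 ltr_pdivrMr// mul1r /M; have := normr_ge0 al; lra.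
Qed.

Lemma sum_CS (R : realType) n (a b : nat -> R) :
  (\sum_(i < n) a i * b i) ^+ 2 <= (\sum_(i < n) a i ^+ 2) * (\sum_(i < n) b i ^+ 2).
Proof.
elim: n => [|n ih]; first by rewrite !big_ord0 expr0n mulr0.
rewrite !big_ord_recr /=; move: ih.
have A0 : 0 <= \sum_(i < n) a i ^+ 2 by apply: sumr_ge0 => i _; exact: sqr_ge0.
have B0 : 0 <= \sum_(i < n) b i ^+ 2 by apply: sumr_ge0 => i _; exact: sqr_ge0.
move: A0 B0; set s := \sum_(i < n) a i * b i; set A := \sum_(i < n) a i ^+ 2; set B := \sum_(i < n) b i ^+ 2.
move: (a n) (b n) => x y A0 B0 h.
have Z0 : 0 <= A * y ^+ 2 + B * x ^+ 2 by pos.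
suff : 2 * s * x * y <= A * y ^+ 2 + B * x ^+ 2 by lra.
apply: (le_trans (ler_norm _)); rewrite -(ler_pXn2r (n:=2)) ?nnegrE// real_normK ?num_real//.
apply: (le_via (4 * (A * B) * (x * y) ^+ 2)).
  rewrite (_ : (2 * s * x * y) ^+ 2 = 4 * s ^+ 2 * (x * y) ^+ 2); last by ring.
  by rewrite ler_wpM2r ?sqr_ge0// ler_pM2l.
rewrite -subr_ge0 (_ : _ - _ = (A * y ^+ 2 - B * x ^+ 2) ^+ 2); last by ring.
exact: sqr_ge0.
Qed.

Lemma telescope_le (R : realType) n (u v w : nat -> R) :
  (forall k, (k < n)%N -> u k.+1 - u k + v k <= w k) ->
  u n - u 0%N + \sum_(k < n) v k <= \sum_(k < n) w k.
Proof.
elim: n => [|n ih] h; first by rewrite !big_ord0; lra.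
rewrite !big_ord_recr /=; have h1 := h n (ltnSn n).
have := ih (fun k kn => h k (ltnW kn)); lra.
Qed.

(** A right-endpoint Riemann sum of the decreasing function t^(-7/8), whose integral is 8 t^(1/8).
    In terms of the eighth roots u >= v of consecutive times the induction step is u^8 - v^8 <= 8
    u^7 (u - v), proved by expanding in e = u - v. *)
Lemma fractional_sum (R : realType) (tau : R) n : 0 < tau ->
  \sum_(j < n) tau * (tau * j.+1%:R) `^ (- (7 / 8)) <= 8 * (tau * n%:R) `^ (1 / 8).
Proof.
move=> t0; elim: n => [|n ih]; first by rewrite big_ord0 mulr_ge0// powR_ge0.
rewrite big_ord_recr /=; apply: (le_trans (lerD ih (lexx _))).
set u := (tau * n.+1%:R) `^ (1 / 8); set v := (tau * n%:R) `^ (1 / 8).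
have p8 k : 0 <= tau * k%:R by rewrite mulr_ge0// ltW.
have root k : ((tau * k%:R) `^ (1 / 8)) ^+ 8 = tau * k%:R.
  by rewrite -powR_mulrn ?powR_ge0// -powRrM (_ : 1 / 8 * 8%:R = 1) ?powRr1//; field.
have u0 : 0 < u by rewrite powR_gt0// mulr_gt0.
have v0 : 0 <= v by rewrite powR_ge0.
have uv : v <= u by apply: ge0_ler_powR; rewrite ?nnegrE// ler_pM2l// ler_nat.
have tE : tau = u ^+ 8 - v ^+ 8 by rewrite /u /v !root -mulrBr -natrB// subSnn mulr1.
have -> : (tau * n.+1%:R) `^ (- (7 / 8)) = (u ^+ 7)^-1.
  rewrite powRN; congr (_^-1); rewrite -powR_mulrn ?(ltW u0)// /u -powRrM; congr (_ `^ _).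
  by field.
rewrite -(ler_pM2r (exprn_gt0 7 u0)) mulrDl divfK ?expf_neq0 ?gt_eqF// tE.
have [e [e0 ->]] : exists e, 0 <= e /\ u = v + e by exists (u - v); rewrite subr_ge0 uv; split => //; ring.
rewrite -subr_ge0 (_ : _ - _ = 28 * (e ^+ 2 * v ^+ 6) + 112 * (e ^+ 3 * v ^+ 5) + 210 * (e ^+ 4 * v ^+ 4) +
  224 * (e ^+ 5 * v ^+ 3) + 140 * (e ^+ 6 * v ^+ 2) + 48 * (e ^+ 7 * v) + 7 * e ^+ 8); last by ring.
by pos.
Qed.

Lemma powR_le_add1 (R : realType) (t p : R) : 0 <= t -> 0 <= p <= 1 -> t `^ p <= 1 + t.
Proof.
move=> t0 /andP[p0 p1]; have [h|h] := lerP t 1.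
  apply: (@le_trans _ _ 1); last by lra.
  have : t `^ p <= 1 `^ p by apply: ge0_ler_powR; rewrite ?nnegrE.
  by rewrite powR1.
apply: (@le_trans _ _ t); last by lra.
by rewrite -[leRHS]powRr1 ?ler_powR// ltW.
Qed.

Section power_mean.
Context {R : realType}.

(** Symmetrisation: the double sum of w_i w_j (y_i^s - y_j^s)(y_i - y_j) has nonnegative terms and
    expands to twice the difference of the two sides. *)
Lemma chebyshev_sum n (w y : nat -> R) (s : nat) : (forall i, 0 <= w i) -> (forall i, 0 <= y i) ->
  (\sum_(i < n) w i * y i ^+ s) * (\sum_(i < n) w i * y i) <=
  (\sum_(i < n) w i) * \sum_(i < n) w i * y i ^+ s.+1.
Proof.
move=> w0 y0.
have h : 0 <= \sum_(i < n) \sum_(j < n) w i * w j * ((y i ^+ s - y j ^+ s) * (y i - y j)).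
  apply: sumr_ge0 => i _; apply: sumr_ge0 => j _.
  apply: mulr_ge0; first by apply: mulr_ge0.
  have [h|h] := lerP (y i) (y j).
    by apply: mulr_le0; rewrite subr_le0// lerXn2r ?nnegrE.
  by apply: mulr_ge0; rewrite subr_ge0 ?lerXn2r ?nnegrE// ltW.
have E : \sum_(i < n) \sum_(j < n) w i * w j * ((y i ^+ s - y j ^+ s) * (y i - y j)) =
   2 * ((\sum_(i < n) w i) * \sum_(i < n) w i * y i ^+ s.+1) -
   2 * ((\sum_(i < n) w i * y i ^+ s) * (\sum_(i < n) w i * y i)).
  transitivity (\sum_(i < n) (w i * y i ^+ s.+1 * (\sum_(j < n) w j) + w i * (\sum_(j < n) w j * y j ^+ s.+1)
     - w i * y i ^+ s * (\sum_(j < n) w j * y j) - w i * y i * (\sum_(j < n) w j * y j ^+ s))).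
    apply: eq_bigr => i _; rewrite !mulr_sumr -big_split -!sumrB /=; apply: eq_bigr => j _.
    by rewrite !exprS; ring.
  by rewrite !sumrB big_split /= -!mulr_suml; ring.
by rewrite E in h; lra.
Qed.

(** Jensen's inequality for the power s + 1 by induction, with one use of [chebyshev_sum] per
    factor. *)
Lemma power_mean n (w y : nat -> R) (s : nat) : (forall i, 0 <= w i) -> (forall i, 0 <= y i) ->
  (\sum_(i < n) w i * y i) ^+ s.+1 <= (\sum_(i < n) w i) ^+ s * \sum_(i < n) w i * y i ^+ s.+1.
Proof.
move=> w0 y0; have W0 : 0 <= \sum_(i < n) w i by apply: sumr_ge0.
have S0 k : 0 <= \sum_(i < n) w i * y i ^+ k.
  by apply: sumr_ge0 => i _; have := w0 i; have := y0 i => yi wi; pos.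
elim: s => [|s ih]; first by rewrite expr0 mul1r expr1.
rewrite exprSr; apply: (le_via ((\sum_(i < n) w i) ^+ s * (\sum_(i < n) w i * y i ^+ s.+1) * (\sum_(i < n) w i * y i))).
  by apply: ler_wpM2r => //; have := S0 1; rewrite (eq_bigr (fun i : 'I_n => w i * y i)).
rewrite -mulrA [in leRHS]exprSr -[leRHS]mulrA; apply: ler_wpM2l; first by pos.
exact: chebyshev_sum.
Qed.
Lemma exprD_le (a b : R) n : 0 <= a -> 0 <= b -> (a + b) ^+ n <= 2 ^+ n * (a ^+ n + b ^+ n).
Proof.
move=> a0 b0.
have am : 0 <= a ^+ n by exact: exprn_ge0.
have bm : 0 <= b ^+ n by exact: exprn_ge0.
have key (t : R) : 0 <= t -> a + b <= 2 * t -> t ^+ n <= a ^+ n + b ^+ n ->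
    (a + b) ^+ n <= 2 ^+ n * (a ^+ n + b ^+ n).
  move=> tt h2 h3; apply: (le_via ((2 * t) ^+ n)); first by rewrite lerXn2r ?nnegrE//; lra.
  by rewrite exprMn; apply: ler_wpM2l => //; exact: exprn_ge0.
by have [ab|ab] := lerP a b; [apply: (key b)|apply: (key a)] => //; lra.
Qed.
End power_mean.

(** * Comparison of integrals and integration against densities *)

Section integral_tools.
Context d (T : measurableType d) (R : realType) (mu : {measure set T -> \bar R}).

(** The integral of a nonnegative function is a supremum over simple functions below it, so
    monotonicity holds for arbitrary integrands. It serves those whose measurability in omega is not
    established: the L^6 norm of the scheme and [Hdot_norm] of the initial value. *)
Lemma le_integral0 (f g : T -> \bar R) : (forall x, 0 <= f x)%E -> (forall x, f x <= g x)%E ->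
  (\int[mu]_x f x <= \int[mu]_x g x)%E.
Proof.
move=> f0 fg; rewrite !ge0_integralTE//; last by move=> x; exact: le_trans (fg x).
by apply: le_ereal_sup => _ [h hf <-]; exists h => // x; exact: le_trans (hf x) (fg x).
Qed.

Lemma eq_integral_measure (m1 m2 : {measure set T -> \bar R}) (f : T -> \bar R) :
  (forall A, measurable A -> m1 A = m2 A) -> (\int[m1]_x f x = \int[m2]_x f x)%E.
Proof. by move=> h; apply: eq_measure_integral => A mA _; exact: h. Qed.

Import HBNNSimple.

Lemma integral_density (nu : {measure set T -> \bar R}) (g : T -> R) (f : T -> \bar R) :
  mfun g -> (forall x, 0 <= g x) ->
  (forall A, measurable A -> nu A = \int[mu]_(x in A) (g x)%:E)%E ->
  mfun f -> (forall x, 0 <= f x)%E ->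
  (\int[nu]_x f x = \int[mu]_x (f x * (g x)%:E))%E.
Proof.
move=> mg g0 nuE mf f0.
have mgE : mfun (EFin \o g) by exact/mEFinP.
have gE0 x : (0 <= (g x)%:E)%E by rewrite lee_fin.
have indic E : measurable E -> (\int[nu]_x (\1_E x)%:E = \int[mu]_x ((\1_E x)%:E * (g x)%:E))%E.
  move=> mE; rewrite integral_indic// setIT nuE// integral_mkcond.
  apply: eq_integral => x _; rewrite patchE indicE; case: ifP => _; first by rewrite mul1e.
  by rewrite mul0e.
have simple (h : {nnsfun T >-> R}) : (\int[nu]_x (h x)%:E = \int[mu]_x ((h x)%:E * (g x)%:E))%E.
  under [LHS]eq_integral do rewrite fimfunE -fsumEFin//.
  rewrite [LHS]ge0_integral_fsum//; last 2 first.
    - by move=> r; exact/mEFinP/measurableT_comp.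
    - by move=> n x _; rewrite EFinM nnfun_muleindic_ge0.
  under [RHS]eq_integral.
    move=> x xD; rewrite fimfunE -fsumEFin// ge0_mule_fsuml; last first.
      by move=> r; rewrite EFinM nnfun_muleindic_ge0.
    over.
  rewrite [RHS]ge0_integral_fsum//; last 2 first.
    - move=> r; apply: emeasurable_funM => //.
      by apply/mEFinP; apply: measurable_funM => //; exact: measurable_indic.
    - by move=> n x _; rewrite mule_ge0// EFinM nnfun_muleindic_ge0.
  apply: eq_fsbigr => r _.
  have [r0|r0] := ltP r 0.
    rewrite preimage_nnfun0// !integral0_eq// => x _; first by rewrite indic0 mulr0 mul0e.
    by rewrite indic0 mulr0.
  under eq_integral do rewrite EFinM.
  rewrite ge0_integralZl_EFin//; last exact/mEFinP/measurable_indic.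
  under [RHS]eq_integral do rewrite EFinM -muleA.
  rewrite ge0_integralZl_EFin//; last 2 first.
    - by move=> x _; rewrite mule_ge0// lee_fin.
    - by apply: emeasurable_funM => //; exact/mEFinP/measurable_indic.
  by rewrite indic.
pose f_ := nnsfun_approx measurableT mf.
transitivity (lim (\int[nu]_x (f_ n x)%:E @[n --> \oo])%E).
  rewrite -monotone_convergence//=.
  - by apply: eq_integral => x _; apply/esym/cvg_lim => //=; exact: cvg_nnsfun_approx.
  - by move=> n; exact/mEFinP/measurable_funTS.
  - by move=> n ? _; rewrite lee_fin.
  - by move=> ? _ ? ? mn; rewrite lee_fin; exact/lefP/nd_nnsfun_approx.
transitivity (lim (\int[mu]_x ((f_ n x)%:E * (g x)%:E) @[n --> \oo])%E).
  by apply: congr_lim; apply/funext => n /=; exact: simple.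
rewrite -monotone_convergence//=.
- apply: eq_integral => x _; apply/cvg_lim => //=.
  by apply: cvgeZr => //; exact: cvg_nnsfun_approx.
- by move=> n; apply: emeasurable_funM => //; exact/mEFinP/measurable_funTS.
- by move=> n x _; rewrite mule_ge0// lee_fin.
- move=> x _ i j ij; apply: lee_wpmul2r => //.
  by rewrite lee_fin; exact/lefP/nd_nnsfun_approx.
Qed.
End integral_tools.

(** * Subgaussian variables and their moments *)

Section subgaussian.
Context {R : realType} {d : measure_display} {Omega : measurableType d} (P : probability Omega R).
Implicit Types (X Y : Omega -> R).

(** The joint law of (X, Y) agrees with the product of the laws on rectangles, hence everywhere;
    Tonelli then factors the integral. *)
Lemma independent_integral X Y (G : set (set Omega)) (f g : R -> R) :
  mfun X -> mfun Y ->
  (forall B, measurable B -> G (X @^-1` B)) -> independent_of P Y G ->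
  mfun f -> mfun g -> (forall x, 0 <= f x) -> (forall x, 0 <= g x) ->
  (\int[P]_w (f (X w) * g (Y w))%:E = (\int[P]_w (f (X w))%:E) * \int[P]_w (g (Y w))%:E)%E.
Proof.
move=> mX mY GX iY mf mg f0 g0.
pose X' : {mfun Omega >-> R} := HB.pack X (isMeasurableFun.Build _ _ _ _ X mX).
pose Y' : {mfun Omega >-> R} := HB.pack Y (isMeasurableFun.Build _ _ _ _ Y mY).
have mXY : mfun (fun w => (X w, Y w)) by exact: measurable_fun_pair.
pose Z' : {mfun Omega >-> (R * R)%type} := HB.pack (fun w => (X w, Y w)) (isMeasurableFun.Build _ _ _ _ _ mXY).
pose m1 := distribution P X'; pose m2 := distribution P Y'; pose m3 := distribution P Z'.
have h := @product_measure_unique _ _ _ _ R m1 m2 m3.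
have {h}h : forall A, measurable A -> (m1 \x m2)%E A = m3 A.
  apply: h => A B mA mB.
  have := iY B (X @^-1` A) mB (GX A mA).
  by rewrite /m1 /m2 /m3 /distribution /pushforward /= muleC => <-; rewrite setIC.
have mfE : mfun (EFin \o f) by exact/mEFinP.
have mgE : mfun (EFin \o g) by exact/mEFinP.
have mfg : mfun (fun z : R * R => (f z.1 * g z.2)%:E).
  by apply/mEFinP; apply: measurable_funM; apply: measurableT_comp.
transitivity (\int[m3]_z (f z.1 * g z.2)%:E)%E.
  by rewrite ge0_integral_distribution// => z; rewrite lee_fin mulr_ge0.
transitivity (\int[(m1 \x m2)%E]_z (f z.1 * g z.2)%:E)%E.
  by apply: eq_integral_measure => A mA; exact/esym/h.
rewrite fubini_tonelli1//; last by move=> z; rewrite lee_fin mulr_ge0.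
rewrite /fubini_F /=.
transitivity (\int[m1]_x ((f x)%:E * \int[m2]_y (g y)%:E))%E.
  apply: eq_integral => x _.
  rewrite (_ : (fun y => (f x * g y)%:E) = (fun y => (f x)%:E * (g y)%:E)%E); last by apply/funext => y; rewrite EFinM.
  by rewrite ge0_integralZl_EFin// => y _; rewrite lee_fin.
rewrite ge0_integralZr//; last 2 first.
- by move=> x _; rewrite lee_fin.
- by apply: integral_ge0 => y _; rewrite lee_fin.
congr (_ * _)%E; rewrite ge0_integral_distribution// => y; rewrite lee_fin//.
Qed.

(** Only a bound on the moment generating function, with variance proxy [v]: it is stable under
    damping and under adding independent increments, and it includes the degenerate case of variance
    0. *)
Definition subgaussian X (v : R) := forall s : R, (\int[P]_w (expR (s * X w))%:E <= (expR (s ^+ 2 * v / 2))%:E)%E.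

Lemma gaussian_subgaussian Y v : mfun Y -> 0 <= v -> centered_gaussian P Y v -> subgaussian Y v.
Proof.
move=> mY v0; rewrite /centered_gaussian; case: eqP => [-> h s|/eqP vn0 h s].
  rewrite mulr0 mul0r expR0 (ae_eq_integral (cst 1%E))//.
  - by rewrite integral_cst// mul1e; exact: probability_le1.
  - by apply/mEFinP; apply: measurableT_comp => //; exact: measurable_funM.
  - by apply: filterS h => w h _ /=; rewrite h mulr0 expR0.
set sg := Num.sqrt v; have sg0 : sg != 0 by rewrite sqrtr_eq0 -ltNge lt_neqAle eq_sym vn0.
have sg2 : sg ^+ 2 = v by rewrite sqr_sqrtr.
pose Y' : {mfun Omega >-> measurableTypeR R} := HB.pack (Y : Omega -> measurableTypeR R) (isMeasurableFun.Build _ _ _ (measurableTypeR R) Y mY).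
have me : mfun (fun y : measurableTypeR R => (expR (s * y))%:E).
  by apply/mEFinP; apply: measurableT_comp => //; exact: measurable_funM.
have e0 (y : measurableTypeR R) : (0 <= (expR (s * y))%:E)%E by rewrite lee_fin expR_ge0.
rewrite -[leLHS](@ge0_integral_distribution _ _ _ _ _ P Y' _ me e0).
rewrite (@eq_integral_measure _ _ _ (distribution P Y') (normal_prob 0 sg)); last by move=> A mA; exact: h.
rewrite (@integral_density _ _ _ lebesgue_measure _ (normal_pdf 0 sg) _ _ _ _ me e0)//; last 2 first.
- exact: measurable_normal_pdf.
- by move=> y; exact: normal_pdf_ge0.
(* Completing the square: the exponential factor shifts the mean of the normal density from 0 to s
   v. *)
have E y : ((expR (s * y))%:E * (normal_pdf 0 sg y)%:E = (expR (s ^+ 2 * v / 2))%:E * (normal_pdf (s * v) sg y)%:E)%E.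
  rewrite -!EFinM !normal_pdfE// mulrCA [in RHS]mulrCA; congr ((_ * _)%:E).
  rewrite /normal_fun -!expRD; congr expR; rewrite sg2; field.
  by rewrite vn0.
under eq_integral do rewrite E.
rewrite ge0_integralZl_EFin// ?expR_ge0//; last 2 first.
- by move=> y _; rewrite lee_fin normal_pdf_ge0.
- by apply/mEFinP; apply: (@measurable_normal_pdf R (s * v) sg).
by rewrite integral_normal_pdf mule1.
Qed.

Lemma subgaussian_step X Y (G : set (set Omega)) (v u a : R) :
  mfun X -> mfun Y ->
  (forall B, measurable B -> G (X @^-1` B)) -> independent_of P Y G ->
  subgaussian X v -> subgaussian Y u -> subgaussian (fun w => a * (X w + Y w)) (a ^+ 2 * (v + u)).
Proof.
move=> mX mY GX iY hX hY s.
under eq_integral do rewrite (mulrA s a) mulrDr expRD.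
have me (b : R) : mfun (fun y : R => expR (b * y)).
  by apply: measurableT_comp => //; exact: measurable_funM.
rewrite (independent_integral mX mY GX iY (me (s * a)) (me (s * a))); last 2 first.
- by move=> x; exact: expR_ge0.
- by move=> x; exact: expR_ge0.
have -> : expR (s ^+ 2 * (a ^+ 2 * (v + u)) / 2) = expR ((s * a) ^+ 2 * v / 2) * expR ((s * a) ^+ 2 * u / 2).
  by rewrite -expRD; congr expR; field.
rewrite EFinM; apply: lee_pmul => //; apply: integral_ge0 => w _; rewrite lee_fin expR_ge0//.
Qed.

Lemma pow_le_expR (y : R) n : 0 <= y -> y ^+ n <= n%:R ^+ n * expR y.
Proof.
move=> y0; case: n => [|n].
  by rewrite !expr0 mul1r -expR0 ler_expR.
have -> : expR y = expR (y / n.+1%:R) ^+ n.+1.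
  by rewrite -expRM_natl; congr expR; rewrite mulrC divfK// pnatr_eq0.
rewrite -exprMn; apply: lerXn2r; rewrite ?nnegrE//.
rewrite -ler_pdivrMl; last by rewrite ltr0n.
apply: (le_via (1 + y / n.+1%:R)); last exact: expR_ge1Dx.
by rewrite mulrC lerDr.
Qed.

Definition moment_const n : R := (2 * n)%:R ^+ (2 * n) * (2 * expR (1 / 2)).

Lemma moment_const_ge0 n : 0 <= moment_const n.
Proof. by rewrite /moment_const; apply: mulr_ge0; [apply: exprn_ge0|apply: mulr_ge0 => //; exact: expR_ge0]. Qed.

(** The generating function is used at s = 1/sqrt v and at its opposite, where its bound is
    exp(1/2); an even power is dominated by the sum of the two exponentials. *)
Lemma subgaussian_moment X v n : mfun X -> 0 < v -> subgaussian X v ->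
  (\int[P]_w (X w ^+ (2 * n))%:E <= (moment_const n * v ^+ n)%:E)%E.
Proof.
move=> mX v0 hX; set s := (Num.sqrt v)^-1; have sv : s ^+ 2 = v^-1 by rewrite exprVn sqr_sqrtr ?ltW.
have s0 : 0 < s by rewrite invr_gt0 sqrtr_gt0.
set K : R := (2 * n)%:R ^+ (2 * n) * v ^+ n.
have K0 : 0 <= K by rewrite /K; apply: mulr_ge0; [exact: exprn_ge0|pos].
have pw (x : R) : x ^+ (2 * n) <= K * (expR (s * x) + expR (- s * x)).
  have h1 : (s * `|x|) ^+ (2 * n) <= (2 * n)%:R ^+ (2 * n) * expR (s * `|x|).
    by apply: pow_le_expR; apply: mulr_ge0 => //; exact: ltW.
  have h2 : expR (s * `|x|) <= expR (s * x) + expR (- s * x).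
    have := expR_ge0 (s * x); have := expR_ge0 (- s * x).
    have [x0|x0] := lerP 0 x; [rewrite ger0_norm//; lra|rewrite ltr0_norm// mulrN -mulNr; lra].
  have xE : x ^+ (2 * n) = v ^+ n * (s * `|x|) ^+ (2 * n).
    by rewrite exprMn !exprM real_normK ?num_real// sv mulrA -exprMn mulfV ?gt_eqF// expr1n mul1r.
  rewrite xE /K [_ * v ^+ n]mulrC -mulrA; apply: ler_wpM2l; first by pos.
  by apply: (le_trans h1); apply: ler_wpM2l => //; exact: exprn_ge0.
have me (b : R) : mfun (fun w => (expR (b * X w))%:E).
  by apply/mEFinP; apply: measurableT_comp => //; exact: measurable_funM.
apply: (le_via (\int[P]_w (K%:E * ((expR (s * X w))%:E + (expR (- s * X w))%:E)))%E).
  apply: le_integral0 => w; last by rewrite -EFinD -EFinM lee_fin pw.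
  by rewrite lee_fin exprM exprn_ge0// sqr_ge0.
rewrite ge0_integralZl_EFin//; last 2 first.
- by move=> w _; rewrite -EFinD lee_fin; apply: addr_ge0; exact: expR_ge0.
- exact: emeasurable_funD.
rewrite ge0_integralD//; try by move=> w _; rewrite lee_fin expR_ge0.
have -> : moment_const n * v ^+ n = K * (expR (1 / 2) + expR (1 / 2)) by rewrite /moment_const /K; ring.
rewrite (_ : (K * _)%:E = K%:E * ((expR (1 / 2))%:E + (expR (1 / 2))%:E))%E//.
apply: lee_wpmul2l; first by rewrite lee_fin.
have e b : b ^+ 2 = v^-1 -> expR (b ^+ 2 * v / 2) = expR (1 / 2) by move=> ->; rewrite mulVf ?gt_eqF.
by apply: leeD; [have := hX s; rewrite e|have := hX (- s); rewrite e// sqrrN].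
Qed.
End subgaussian.

Section domain_analysis.
Context {R : realType} {d : nat} (d_range : (1 <= d <= 3)%N) (D : convex_lipschitz_domain R d).
Local Notation V := 'rV[R]_d.
Local Notation m := (leb D).
Local Notation mu := (@lebS R d).
Local Notation mu_int f := (mu.-integrable setT (EFin \o f)).
Local Notation H1grad := (H1_gradient D).

(** * Integrals and square-integrable functions on the domain *)

Section domain_integrals.
Implicit Types (u v w f g : V -> R).

Lemma measurable_dom : measurable (D : set V).
Proof. by apply: open_measurable_mx; exact: dom_open. Qed.
Hint Resolve measurable_dom : core.

Lemma lebE (A : set V) : m A = mu (A `&` D).
Proof. by []. Qed.

(** Extension by zero: integrals against [leb D] become integrals over the whole space, where
    translations and affine maps can act. *)
Definition ext u : V -> R := fun x => u x * \1_(D : set V) x.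

Lemma measurable_ext u : mfun u -> mfun (ext u).
Proof. by move=> mu_; apply: measurable_funM => //; exact: measurable_indic. Qed.

Lemma ext_in u x : (D : set V) x -> ext u x = u x.
Proof. by move=> Dx; rewrite /ext indicE mem_set// mulr1. Qed.

Lemma ext_out u x : ~ (D : set V) x -> ext u x = 0.
Proof. by move=> Dx; rewrite /ext indicE memNset// mulr0. Qed.

Lemma ge0_integral_leb (f : V -> \bar R) : mfun f -> (forall x, 0 <= f x)%E ->
  (\int[m]_x f x = \int[mu]_(x in D) f x)%E.
Proof.
move=> mf f0; rewrite (@ge0_negligible_integral _ _ _ m setT (~` (D : set V)))//; last 2 first.
- exact: measurableC.
- by rewrite lebE setICl measure0.
rewrite setTD setCK; apply: eq_measure_integral => A mA AD.
by rewrite lebE setIidl.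
Qed.

Lemma integral_leb (f : V -> \bar R) : mfun f ->
  (\int[m]_x f x = \int[mu]_(x in D) f x)%E.
Proof.
move=> mf; rewrite integralE [in RHS]integralE; congr (_ - _)%E.
  by apply: ge0_integral_leb => //; exact: measurable_funepos.
by apply: ge0_integral_leb => //; exact: measurable_funeneg.
Qed.

Lemma integral_leb_ext u : mfun u ->
  (\int[m]_x (u x)%:E = \int[mu]_x (ext u x)%:E)%E.
Proof.
move=> mf; rewrite integral_leb; last exact/mEFinP.
rewrite integral_mkcond; apply: eq_integral => x _; rewrite patchE /ext indicE.
by case: ifPn => _; rewrite ?mulr1 ?mulr0.
Qed.

Lemma Rintegral_leb u : mfun u -> \int[m]_x u x = \int[mu]_x ext u x.
Proof. by move=> mu_; rewrite /Rintegral integral_leb_ext. Qed.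

Lemma integrable_leb u : mfun u ->
  m.-integrable setT (EFin \o u) <-> mu_int (ext u).
Proof.
move=> mu_; have E : (\int[m]_x `|(u x)%:E| = \int[mu]_x `|(ext u x)%:E|)%E.
  have := @integral_leb_ext (fun x => `|u x|) (measurableT_comp (@normr_measurable _ _) mu_).
  move=> /= ->; apply: eq_integral => x _ /=; rewrite /ext normrM; congr (_ * _)%:E.
  by rewrite [RHS]ger0_norm.
split=> /integrableP[_ h]; apply/integrableP; split.
- by apply/mEFinP; exact: measurable_ext.
- by move: h; rewrite /= E.
- exact/mEFinP.
- by move: h; rewrite /= E.
Qed.

Lemma dom_box : exists r : nat, (D : set V) `<=` box d r%:R.
Proof.
have [M [Mreal hM]] := @dom_bounded R d D.
have M1 : M < Num.max M 0 + 1 by rewrite (@le_lt_trans _ _ (Num.max M 0)) ?ltrDl// le_max lexx.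
exists (Num.bound (Num.max M 0 + 1)) => x Dx j.
apply: (@le_lt_trans _ _ (Num.max M 0 + 1)).
  apply: le_trans (hM _ M1 x Dx); rewrite [leRHS]/Num.norm /= mx_normrE.
  exact: (le_bigmax _ (fun i : 'I_1 * 'I_d => `|x i.1 i.2|) (0, j)).
by apply: archi_boundP; rewrite addr_ge0// le_max lexx orbT.
Qed.

Lemma lebD_lty : (m setT < +oo)%E.
Proof.
have [r Dr] := dom_box; rewrite lebE setTI.
apply: le_lt_trans (lebesgue_rV_box_lty d r%:R).
by apply: le_measure; rewrite ?inE//; exact: measurable_box.
Qed.

Lemma lebD_gt0 : (0 < m setT)%E.
Proof.
have [x Dx] := @dom_nonempty R d D.
have [r r0 rD] := open_cubeP (@dom_open R d D) Dx.
have mc : measurable (cube x r) by apply: open_measurable_mx; exact: open_cube.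
rewrite lebE setTI; apply: (@lt_le_trans _ _ (mu (cube x r))); last first.
  by apply: le_measure; rewrite ?inE.
rewrite -N1_indic// (_ : \1_(cube x r) = (fun y => \1_(cube 0 r) (y + (- x)))); last first.
  apply/funext => y; rewrite !indicE; congr (_%:R); congr nat_of_bool.
  by apply/idP/idP => /set_mem h; apply/mem_set => j; have := h j; rewrite !mxE subr0.
rewrite N1_translate; last by apply: measurable_indic; apply: open_measurable_mx; exact: open_cube.
rewrite N1_indic; last by apply: open_measurable_mx; exact: open_cube.
rewrite (_ : cube 0 r = box d r); last first.
  by apply/seteqP; split => y h j; have := h j; rewrite mxE subr0.
change (0 < lebesgue_rV d (box d r))%E; elim: (d) => [|k IH].
  by rewrite /= diracE mem_set ?lte01// => -[].
rewrite lebesgue_rV_boxS mule_gt0// (_ : [set t | _] = ball (0 : R) r); last first.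
  by apply/seteqP; split => t; rewrite /ball /= sub0r normrN.
by rewrite lebesgue_measure_ball ?(ltW r0)// lte_fin mulr2n addr_gt0.
Qed.

(** An alias of [leb D] under which its finiteness is registered. *)
Definition lebD : set V -> \bar R := m.
HB.instance Definition _ := isMeasure.Build _ _ _ lebD
  (measure0 m) (measure_ge0 m) (@measure_semi_sigma_additive _ _ _ m).
HB.instance Definition _ := Measure_isFinite.Build _ _ _ lebD (lty_fin_num_fun lebD_lty).

Lemma L2_measurable u : L2 D u -> mfun u.
Proof. by rewrite /L2 /= inE => /andP[]; rewrite inE. Qed.

Lemma L2_integrable_mul u v : L2 D u -> L2 D v -> m.-integrable setT (EFin \o (fun x => u x * v x)).
Proof. by move=> hu hv; exact: (Lfun1_integrable _ _).1 (Lfun2_mul_Lfun1 hu hv). Qed.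

Lemma L2_sqr u : L2 D u -> m.-integrable setT (EFin \o (fun x => u x ^+ 2)).
Proof. exact: Lfun2_integrable_sqr. Qed.

Lemma L2P u : mfun u -> m.-integrable setT (EFin \o (fun x => u x ^+ 2)) -> L2 D u.
Proof.
move=> mu_ iu; rewrite /L2 /= inE; apply/andP; split; rewrite inE//=.
rewrite /finite_norm unlock /= poweR_lty//.
have /integrableP[_] := iu; apply: le_lt_trans.
rewrite le_eqVlt; apply/orP; left; apply/eqP; apply: eq_integral => x _ /=.
by rewrite powR_mulrn// normrX.
Qed.

Lemma L2_cst c : L2 D (cst c).
Proof.
apply: L2P => //; apply: (@finite_measure_integrable_cst _ _ _ lebD setT (c ^+ 2) measurableT).
Qed.

Lemma L2_integrable u : L2 D u -> m.-integrable setT (EFin \o u).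
Proof.
move=> hu; have := L2_integrable_mul hu (L2_cst 1).
by apply: eq_integrable => // x _ /=; rewrite mulr1.
Qed.
End domain_integrals.

(** * Differences of H^1 functions along affine displacements *)

Section segment_identity.
Variables (u : V -> R) (g : 'I_d -> V -> R) (hug : H1grad u g).

Lemma L2_ext_integrable (w : V -> R) : L2 D w -> mu_int (ext w).
Proof. by move=> hw; apply/(integrable_leb (L2_measurable hw)); exact: L2_integrable. Qed.

Lemma L2_ext_sqr (w : V -> R) : L2 D w -> mu.-integrable setT (fun y => (ext w y ^+ 2)%:E).
Proof.
move=> hw; have mw := L2_measurable hw.
have := (integrable_leb (measurable_funX 2 mw)).1 (L2_sqr hw).
apply: eq_integrable => // x _ /=; rewrite /ext exprMn; congr (_ * _)%:E.
by rewrite indicE; case: (_ \in _); rewrite ?expr1n ?expr0n.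
Qed.

Let iu : mu_int (ext u).
Proof. by apply: L2_ext_integrable; have [] := hug. Qed.

Let ig j : mu_int (ext (g j)).
Proof. by apply: L2_ext_integrable; have [_ /(_ j)[]] := hug. Qed.

Let muu : mfun u.
Proof. by apply: (@L2_measurable); have [] := hug. Qed.

Let mg j : mfun (g j).
Proof. by apply: (@L2_measurable); have [_ /(_ j)[]] := hug. Qed.

Variables (psi : V -> R) (mpsi : mfun psi) (B : R).
Hypothesis psiB : forall x, `|psi x| <= B.
Variables (b : V) (a : R) (Vb : R) (e : R) (e0 : 0 < e).
(** One affine displacement covers both uses: [a] = 0 and [b] = h e_i give translations, [a] = s and
    [b] = s y give the contraction towards [y]. *)
Let v (x : V) : V := b - a *: x.
Hypothesis psiD : forall x, psi x != 0 -> (D : set V) x /\ forall j, `|v x 0 j| <= Vb.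
Hypothesis psie : forall x r, psi x != 0 -> 0 < r < 1 -> cbox (x + r *: v x) e `<=` D.

Lemma bounded_supp_integrable : mu_int psi.
Proof.
have E : ext psi = psi.
  apply/funext => x; have [Dx|nDx] := pselect ((D : set V) x); first by rewrite ext_in.
  rewrite ext_out//; apply/esym/eqP; apply: contra_notT nDx => px.
  by have [] := psiD px.
rewrite -E; apply/integrable_leb => //.
apply: (@le_integrable _ _ _ m setT measurableT _ (cst B%:E)).
- exact/mEFinP.
- move=> x _ /=; rewrite lee_fin; exact: le_trans (psiB x) (ler_norm _).
- exact: (@L2_integrable (cst B) (L2_cst B)).
Qed.
Let ipsi := bounded_supp_integrable.

Let mv (T := (V * V)%type) (r : R) : mfun (fun z : T => z.1 + r *: v z.1).
Proof.
apply: measurable_rV => j; under eq_fun do rewrite !mxE.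
have mc : mfun (fun z : T => z.1 0 j).
  exact: (measurableT_comp (@coord_measurable R d j)).
apply: measurable_funD => //; apply: measurable_funM => //; apply: measurable_funB => //.
exact: measurable_funM.
Qed.

Let mv1 (r : R) : mfun (fun x : V => x + r *: v x).
Proof.
rewrite (_ : (fun x => _) = (fun x : V => (1 - r * a) *: x + r *: b)); first exact: measurable_affine.
by apply/funext => x; apply/rowP => j; rewrite /v !mxE; ring.
Qed.

Let mvj j : mfun (fun x : V => v x 0 j).
Proof.
under eq_fun do rewrite !mxE; apply: measurable_funB => //; apply: measurable_funM => //.
exact: coord_measurable.
Qed.

Let kd i (x y : V) : R := ptest ((fine (@bmass R d))^-1 * e^-1 ^+ d / e) e (upd Q1 i) x y.

Let W i (x : V) : R := \int[mu]_y (ext u y * kd i x y).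

Lemma kd_bounded : exists C : R, 0 <= C /\ forall i x y, `|kd i x y| <= C.
Proof.
have /choice[C hC] : forall i, exists C : R, 0 <= C /\ forall x y, `|kd i x y| <= C.
  by move=> i; exact: ptest_bounded.
exists (\sum_i C i); split; first by apply: sumr_ge0 => i _; exact: (hC i).1.
move=> i x y; apply: (le_trans ((hC i).2 x y)); rewrite (bigD1 i)//= lerDl.
by apply: sumr_ge0 => j _; exact: (hC j).1.
Qed.

Lemma product_dominated (h : V * V -> R) C : mfun h -> 0 <= C ->
  (forall z, `|h z| <= C * (`|psi z.1| * `|ext u z.2|)) ->
  (mu \x mu)%E.-integrable setT (EFin \o h).
Proof.
move=> mh C0 hC.
have mG : mfun (fun z : V * V => (`|psi z.1| * `|ext u z.2|)%:E).
  apply/mEFinP; apply: measurable_funM; apply: measurableT_comp => //.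
    exact: (measurableT_comp mpsi).
  by apply: (measurableT_comp (measurable_ext muu)).
have iG : (mu \x mu)%E.-integrable setT (fun z : V * V => (`|psi z.1| * `|ext u z.2|)%:E).
  apply: (proj2 (@integrable12ltyP _ _ _ _ _ mu mu _ mG)).
  have mE := mfun_norm (measurable_ext muu); have mP := mfun_norm mpsi.
  rewrite (_ : (\int[mu]_x _)%E = (N1 psi * N1 (ext u))%E); last first.
    rewrite /N1 -ge0_integralZr//; last exact: integral_ge0.
    apply: eq_integral => x _ /=; rewrite -ge0_integralZl//.
    by apply: eq_integral => y _; rewrite ger0_norm ?mulr_ge0// EFinM.
  have /integrableP[_ /= h1] := ipsi; have /integrableP[_ /= h2] := iu.
  rewrite lte_mul_pinfty//; first exact: integral_ge0.
  by rewrite ge0_fin_numE//; exact: integral_ge0.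
apply: (@le_integrable _ _ _ (mu \x mu)%E setT measurableT _ (fun z => C%:E * (`|psi z.1| * `|ext u z.2|)%:E)%E).
- exact/mEFinP.
- by move=> z _; rewrite -EFinM /= lee_fin; exact: le_trans (hC z) (ler_norm _).
- exact: integrableZl.
Qed.

(** The kernel centred at [x] is an admissible test function once its cube lies in [D], so the weak
    derivative moves the derivative from the kernel to [g i]. *)
Lemma weak_kern i x : cbox x e `<=` D -> - W i x = Mol e (ext (g i)) x.
Proof.
move=> xD; have [_ /(_ i)[_ wi]] := hug.
have := wi (kern e x) (test_function_ptest _ _ e0 xD).
rewrite /kern partial_ptest -/(kern e x) => h.
have mk : mfun (kern e x) by exact: measurable_kern.
have mkd : mfun (kd i x) by exact: measurable_ptest.
rewrite Rintegral_leb in h; last exact: measurable_funM.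
rewrite Rintegral_leb in h; last exact: measurable_funM.
rewrite /W /Mol; transitivity (- (\int[mu]_y ext (fun y => u y * kd i x y) y)).
  by congr (- _); apply: eq_Rintegral => y _; rewrite /ext mulrAC.
rewrite /kd h opprK; apply: eq_Rintegral => y _; by rewrite /ext mulrAC.
Qed.

Let f (r : R) (z : V * V) : R := psi z.1 * ext u z.2 * kern e (z.1 + r *: v z.1) z.2.
Let df (r : R) (z : V * V) : R :=
  psi z.1 * ext u z.2 * - \sum_i v z.1 0 i * kd i (z.1 + r *: v z.1) z.2.

Let is_derive_f r z : is_derive r (1 : R) (f ^~ z) (df r z).
Proof.
exact: (is_deriveZ (psi z.1 * ext u z.2) (is_derive_ptest_line _ e Q1 z.1 (v z.1) z.2 r)).
Qed.

Let mf r : mfun (f r).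
Proof.
apply: measurable_funM; last by apply: measurable_kern.
by apply: measurable_funM; [exact: (measurableT_comp mpsi)|exact: (measurableT_comp (measurable_ext muu))].
Qed.

Let mdf r : mfun (df r).
Proof.
apply: measurable_funM.
  by apply: measurable_funM; [exact: (measurableT_comp mpsi)|exact: (measurableT_comp (measurable_ext muu))].
apply: measurableT_comp => //; apply: measurable_sum => i; apply: measurable_funM.
  exact: (measurableT_comp (mvj i)).
exact: measurable_ptest.
Qed.

Let f_bound : exists C : R, 0 <= C /\ forall r z, `|f r z| <= C * (`|psi z.1| * `|ext u z.2|).
Proof.
have [C [C0 hC]] := @kern_bounded R d e; exists C; split => // r z.
by rewrite /f normrM normrM mulrC ler_wpM2r ?mulr_ge0.
Qed.

Let df_bound : exists C : R, 0 <= C /\ forall r z, `|df r z| <= C * (`|psi z.1| * `|ext u z.2|).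
Proof.
have [C [C0 hC]] := kd_bounded; exists (\sum_(i < d) (`|Vb| * C)); split => [|r z].
  by apply: sumr_ge0 => i _; exact: mulr_ge0.
rewrite /df; have [->|pz] := eqVneq (psi z.1) 0.
  by rewrite !mul0r normr0 mul0r mulr0.
rewrite normrM normrM mulrC ler_wpM2r ?mulr_ge0// normrN.
apply: (le_trans (ler_norm_sum _ _ _)); apply: ler_sum => i _.
rewrite normrM ler_pM//; have [_ /(_ i)] := psiD pz.
by move=> h; exact: le_trans h (ler_norm _).
Qed.

Let Phi r := \int[(mu \x mu)%E]_z f r z.

Let slice r x : (\int[mu]_y (EFin \o f r) (x, y) = (psi x * Mol e (ext u) (x + r *: v x))%:E)%E.
Proof.
have ik := integrable_fkern iu e (x + r *: v x).
rewrite EFinM MolE// -(integralZl measurableT ik (psi x)).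
by apply: eq_integral => y _; rewrite -EFinM; congr EFin; exact/esym/mulrA.
Qed.

Let PhiE r : Phi r = \int[mu]_x (psi x * Mol e (ext u) (x + r *: v x)).
Proof.
have [C [C0 hC]] := f_bound; have i2 := product_dominated (mf r) C0 (hC r).
rewrite /Phi /Rintegral; congr fine.
rewrite -(@integral12_prod_meas1 _ _ _ _ _ mu mu _ i2).
by apply: eq_integral => x _; rewrite -slice.
Qed.

Let dPhiE r : \int[(mu \x mu)%E]_z df r z =
  \int[mu]_x (psi x * - \sum_i v x 0 i * W i (x + r *: v x)).
Proof.
have [C [C0 hC]] := df_bound; have i2 := product_dominated (mdf r) C0 (hC r).
have [Ck [_ hCk]] := kd_bounded.
rewrite /Rintegral; congr fine.
rewrite -(@integral12_prod_meas1 _ _ _ _ _ mu mu _ i2).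
apply: eq_integral => x _; rewrite /fubini_F /=.
have ii i : mu.-integrable setT (fun y => (ext u y * kd i (x + r *: v x) y)%:E).
  by apply: (integrable_mul_bounded iu _ (hCk i (x + r *: v x))); exact: measurable_ptest.
have ii2 i : mu.-integrable setT (fun y => (v x 0 i * (ext u y * kd i (x + r *: v x) y))%:E).
  by under eq_fun do rewrite EFinM; exact: integrableZl.
transitivity (\int[mu]_y ((- psi x)%:E * \sum_i (v x 0 i * (ext u y * kd i (x + r *: v x) y))%:E))%E.
  apply: eq_integral => y _; rewrite sumEFin -EFinM /df /=; congr (_%:E).
  rewrite mulNr mulrN -mulrA; congr (- (_ * _)); rewrite mulr_sumr.
  by apply: eq_bigr => i _; rewrite mulrCA.
rewrite integralZl//; last exact: integrable_sum.
rewrite integral_sum// mulrN -mulNr EFinM -sumEFin; congr (_ * _)%E; apply: eq_bigr => i _.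
rewrite EFinM; under eq_integral do rewrite EFinM.
by rewrite (integralZl measurableT (ii i)) /W /Rintegral fineK//; exact: integrable_fin_num.
Qed.

(** The mean value theorem is applied to r |-> the integral of psi(x) Mol u (x + r v(x)), after the
    integration in x, so a single [xi] serves all x. Differentiation takes place under one double
    integral, dominated by a multiple of |psi(x)| |u(y)|. *)
Lemma segment_identity : exists2 xi : R, 0 < xi < 1 &
  \int[mu]_x (psi x * (Mol e (ext u) (x + v x) - Mol e (ext u) x)) =
  \int[mu]_x (psi x * \sum_i v x 0 i * Mol e (ext (g i)) (x + xi *: v x)).
Proof.
have [C [C0 hC]] := f_bound; have [C' [C'0 hC']] := df_bound.
have iG : (mu \x mu)%E.-integrable setT (EFin \o (fun z : V * V => C' * (`|psi z.1| * `|ext u z.2|))).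
  apply: (@product_dominated _ C') => //.
    apply: measurable_funM => //; apply: measurable_funM; apply: measurableT_comp => //.
      exact: (measurableT_comp mpsi).
    by apply: (measurableT_comp (measurable_ext muu)).
  by move=> z; rewrite ger0_norm// mulr_ge0// mulr_ge0.
have d1E r z : partial1of2 f r z = df r z.
  by rewrite partial1of2E; have [_ ->] := is_derive_f r z.
have dPhi r : is_derive r (1 : R) Phi (\int[(mu \x mu)%E]_z df r z).
  have Ir : `]r - 1, r + 1[%classic r by rewrite /= in_itv /= ltrBlDr ltrDl ltr01.
  have intf x : `]r - 1, r + 1[%classic x -> (mu \x mu)%E.-integrable setT (EFin \o f x).
    by move=> _; exact: product_dominated (mf x) C0 (hC x).
  have derf x y : `]r - 1, r + 1[%classic x -> setT y -> derivable (f ^~ y) x 1.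
    by move=> _ _; have [] := is_derive_f x y.
  have Gub x y : `]r - 1, r + 1[%classic x -> setT y ->
      `|partial1of2 f x y| <= C' * (`|psi y.1| * `|ext u y.2|).
    by move=> _ _; rewrite d1E; exact: hC'.
  have G0 (y : V * V) : 0 <= C' * (`|psi y.1| * `|ext u y.2|) by rewrite !mulr_ge0.
  apply: DeriveDef.
    exact: (derivable_under_integral measurableT Ir intf derf G0 iG Gub).
  rewrite -derive1E (differentiation_under_integral measurableT Ir intf derf G0 iG Gub).
  by apply: eq_Rintegral => z _; exact: d1E.
have cPhi : {within `[0, 1], continuous Phi}.
  apply: continuous_subspaceT => r; have [dr _] := dPhi r.
  have dfr := (derivable1_diffP _ _).1 dr.
  have cfr := differentiable_continuous dfr.
  exact: cfr.
have [xi xi01 E] := @MVT _ Phi (fun r => \int[(mu \x mu)%E]_z df r z) 0 1 ltr01 (fun r _ => dPhi r) cPhi.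
move: xi01; rewrite in_itv /= => xi01; exists xi => //.
have iM r : mu.-integrable setT (fun x => (psi x * Mol e (ext u) (x + r *: v x))%:E).
  have i2 := product_dominated (mf r) C0 (hC r).
  have := @integrable_fubini_F _ _ _ _ _ mu mu _ i2.
  by apply: eq_integrable => // x _; rewrite -slice.
transitivity (Phi 1 - Phi 0).
  rewrite !PhiE -(RintegralB measurableT (iM 1) (iM 0)); apply: eq_Rintegral => x _.
  by rewrite scale1r scale0r addr0 mulrBr.
rewrite E subr0 mulr1 dPhiE; apply: eq_Rintegral => x _.
have [->|px] := eqVneq (psi x) 0; first by rewrite !mul0r.
congr (_ * _); rewrite -sumrN; apply: eq_bigr => i _.
by rewrite -mulrN weak_kern//; exact: psie.
Qed.
End segment_identity.

(** * Segments and thickened segments in the domain *)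

Section convexity.
Lemma dom_segment (x y : V) (r : R) : (D : set V) x -> (D : set V) y -> 0 < r < 1 ->
  (D : set V) (x + r *: (y - x)).
Proof.
move=> Dx Dy /andP[r0 r1].
have r01 : Itv.spec (@Itv.num_sem R) (Itv.Real `[0%Z, 1%Z]%O) (1 - r).
  by rewrite /Itv.num_sem /= num_real/= in_itv/= subr_ge0 (ltW r1)/= gerBl ltW.
have := @dom_convex _ _ D x y (Itv.mk r01).
rewrite !inE => /(_ Dx Dy) h.
have -> : x + r *: (y - x) = (1 - r) *: x + (1 - (1 - r)) *: y.
  by apply/rowP => j; rewrite !mxE; ring.
exact: h.
Qed.

(** Every point of the intermediate cube lies on a segment joining corresponding points of the two
    end cubes; this is how convexity of [D] enters the analysis. *)
Lemma cbox_segment (x v : V) (e r : R) : cbox x e `<=` D -> cbox (x + v) e `<=` D -> 0 < r < 1 ->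
  cbox (x + r *: v) e `<=` D.
Proof.
move=> h1 h2 r01 y hy; pose z := y - (x + r *: v).
have -> : y = (x + z) + r *: ((x + v + z) - (x + z)).
  by rewrite /z; apply/rowP => j; rewrite !mxE; ring.
apply: dom_segment => //; [apply: h1 => j|apply: h2 => j]; have := hy j; rewrite !mxE.
- by rewrite (_ : x 0 j + _ - _ = y 0 j - (x 0 j + r * v 0 j)) //; ring.
- by rewrite (_ : x 0 j + v 0 j + _ - _ = y 0 j - (x 0 j + r * v 0 j)) //; ring.
Qed.

Lemma cbox_le (x : V) (e r : R) : e <= r -> cbox x e `<=` cbox x r.
Proof. by move=> er y h j; exact: le_trans (h j) er. Qed.
End convexity.

(** * Bounds for weighted differences by the gradient *)

Section difference_bounds.
Implicit Types f k : V -> R.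

Lemma N1_lty f : mu_int f -> (N1 f < +oo)%E.
Proof. by move=> /integrableP[_]. Qed.

Lemma Rintegral_le_N1 f : mu_int f -> (`|\int[mu]_x f x|%:E <= N1 f)%E.
Proof.
move=> fi; rewrite /Rintegral -abse_EFin fineK; last exact: integrable_fin_num.
by apply: le_abse_integral => //; exact: (measurable_int mu).
Qed.

Lemma N1_affine f (a : R) (b : V) : 0 < a -> mfun f ->
  N1 (fun x : V => f (a *: x + b)) = ((a^-1 ^+ d)%:E * N1 f)%E.
Proof.
move=> a0 mf; exact: (@ge0_integral_affine R d (fun x => `|f x|%:E) a b a0 (mfun_norm mf)).
Qed.

Lemma integrable_affine f (a : R) (b : V) : 0 < a -> mu_int f ->
  mu_int ((fun x : V => f (a *: x + b))).
Proof.
move=> a0 fi; have mf : mfun f by apply/mEFinP; exact: (measurable_int mu).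
apply/integrableP; split.
  by apply/mEFinP; exact: (measurableT_comp mf (measurable_affine a b)).
rewrite (_ : (\int[mu]_x _)%E = N1 (fun x : V => f (a *: x + b)))//.
by rewrite N1_affine// lte_mul_pinfty ?lee_fin ?exprn_ge0 ?invr_ge0 ?ltW//; exact: N1_lty.
Qed.

Lemma N1_mul_bounded f k (B : R) : mu_int f -> mfun k -> 0 <= B ->
  (forall x, `|k x| <= B) -> (N1 (fun x => (k x * f x)%R) <= B%:E * N1 f)%E.
Proof.
move=> fi mk B0 kB; have mf : mfun f by apply/mEFinP; exact: (measurable_int mu).
rewrite -[B in leRHS]ger0_norm// -N1Z//; apply: N1_le => [||x]; try exact: measurable_funM.
by rewrite !normrM ler_wpM2r// (ger0_norm B0).
Qed.

Lemma Mol_cvg_int f (r : R) : mu_int f -> 0 < r ->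
  exists2 del : R, 0 < del & forall e : R, 0 < e <= del ->
  (N1 (fun x => (Mol e f x - f x)%R) <= r%:E)%E.
Proof.
move=> fi r0; have [_ /(_ _ r0)[del del0 h]] := Tc_integrable fi.
exists del => // e /andP[e0 ed]; exact: (Mol_cvg fi e0 ed (ltW r0) h).
Qed.

Lemma integrable_Mol f (e : R) : mu_int f -> 0 < e ->
  mu_int (Mol e f).
Proof.
move=> fi e0; have mf : mfun f by apply/mEFinP; exact: (measurable_int mu).
have mM := measurable_Mol fi e0.
have hz z : (N1 (fun x => (f (x + z) - f x)%R) <= (2 * fine (N1 f))%:E)%E.
  apply: (le_via (N1 (fun x => f (x + z)%R) + N1 (fun x => - f x)%R)%E).
    by apply: N1D; [exact: mfun_translate|exact: measurableT_comp].
  rewrite N1_translate// (_ : N1 (fun x => - f x) = N1 f); last first.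
    by apply: eq_integral => x _; rewrite normrN.
  by rewrite EFinM fineK ?mule_natl ?mule2n// ge0_fin_numE ?N1_lty// integral_ge0.
have c0 : 0 <= 2 * fine (N1 f) by rewrite mulr_ge0// fine_ge0// integral_ge0.
have h := Mol_cvg fi e0 (lexx e) c0 (fun z _ => hz z).
apply/integrableP; split; first exact/mEFinP.
rewrite (_ : (\int[mu]_x _)%E = N1 (fun x => (Mol e f x - f x) + f x)); last first.
  by apply: eq_integral => x _; rewrite /= subrK.
apply: le_lt_trans (N1D _ mf) _; first exact: measurable_funB.
apply: lte_add_pinfty; last exact: N1_lty.
by apply: le_lt_trans h _; rewrite ltry.
Qed.

Variables (u : V -> R) (g : 'I_d -> V -> R) (hug : H1grad u g).

Let iu : mu_int (ext u).
Proof. by apply: L2_ext_integrable; have [] := hug. Qed.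
Let ig j : mu_int (ext (g j)).
Proof. by apply: L2_ext_integrable; have [_ /(_ j)[]] := hug. Qed.

Variables (psi : V -> R) (mpsi : mfun psi) (B : R) (B0 : 0 <= B).
Hypothesis psiB : forall x, `|psi x| <= B.
Variables (b : V) (a : R) (a01 : 0 <= a <= 1 / 2) (Vb : R) (Vb0 : 0 <= Vb) (rho : R) (rho0 : 0 < rho).
Let v (x : V) : V := b - a *: x.
Hypothesis psiD : forall x, psi x != 0 ->
  [/\ cbox x rho `<=` D, cbox (x + v x) rho `<=` D & forall j, `|v x 0 j| <= Vb].

Let affE r (x : V) : x + r *: v x = (1 - r * a) *: x + r *: b.
Proof. by apply/rowP => j; rewrite /v !mxE; ring. Qed.

Let ra_gt0 (r : R) : 0 <= r <= 1 -> 0 < 1 - r * a.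
Proof. by move: a01 => /andP[? ?] /andP[? ?]; nra. Qed.

Lemma supp_dom x : psi x != 0 -> (D : set V) x /\ forall j, `|v x 0 j| <= Vb.
Proof.
by move=> /psiD[h _ hv]; split => //; apply: h => j; rewrite subrr normr0 ltW.
Qed.

Lemma integrable_psi : mu_int psi.
Proof. by apply: (@bounded_supp_integrable psi mpsi B psiB b a Vb); exact: supp_dom. Qed.

Lemma integrable_psi_mul f : mu_int f ->
  mu_int ((fun x => psi x * f x)).
Proof.
move=> fi; have := integrable_mul_bounded fi mpsi psiB.
by apply: eq_integrable => // x _ /=; rewrite mulrC.
Qed.

Lemma integrable_shift f r : 0 <= r <= 1 -> mu_int f ->
  mu_int ((fun x => f (x + r *: v x))).
Proof.
move=> r01 fi; have := integrable_affine (r *: b) (ra_gt0 r01) fi.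
by apply: eq_integrable => // x _ /=; rewrite affE.
Qed.

Lemma integrable_shift1 f : mu_int f ->
  mu_int ((fun x => f (x + v x))).
Proof.
move=> fi; have r1 : 0 <= (1 : R) <= 1 by rewrite lexx ler01.
have := integrable_shift r1 fi.
by apply: eq_integrable => // x _; rewrite /= scale1r.
Qed.

(** The mollifier is removed from [u], where its L^1 error is harmless, but kept on the gradient:
    the point x + xi v(x) depends on [e] in an uncontrolled way, and there the mollifier only has to
    preserve the L^2 norm. *)
Lemma mollified_difference (eta : R) : 0 < eta -> exists2 del : R, 0 < del &
  forall e : R, 0 < e <= del -> exists2 xi : R, 0 < xi < 1 &
  `|\int[mu]_x (psi x * (ext u (x + v x) - ext u x)) -
    \int[mu]_x (psi x * \sum_i v x 0 i * Mol e (ext (g i)) (x + xi *: v x))| <= eta.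
Proof.
(* [K] collects the error at x, of weight 1, and the error at x + v(x) = (1 - a) x + b, of weight (1
   - a)^-d by change of variable. *)
move=> eta0; pose K := B * ((1 - a)^-1 ^+ d + 1).
have a1 : 0 < 1 - a by move: a01 => /andP[? ?]; lra.
have K0 : 0 <= K by rewrite mulr_ge0// addr_ge0// exprn_ge0// invr_ge0 ltW.
have [del0 del00 hdel] := Mol_cvg_int iu (divr_gt0 eta0 (ltr_wpDl K0 ltr01)).
exists (Num.min del0 rho); first by rewrite lt_min del00.
move=> e /andP[e0]; rewrite le_min => /andP[ed er].
have psie x (r : R) : psi x != 0 -> 0 < r < 1 -> cbox (x + r *: v x) e `<=` D.
  move=> /psiD[h1 h2 _] r01; apply: cbox_segment => // y.
    by move=> /(cbox_le er); exact: h1.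
  by move=> /(cbox_le er); exact: h2.
have [xi xi01 E] := @segment_identity u g hug psi mpsi B psiB b a Vb e e0 supp_dom psie.
exists xi => //; rewrite -[X in _ - X]E {E}.
have iM := integrable_Mol iu e0; have hM := hdel e; rewrite e0 ed in hM; have {}hM := hM isT.
move: (Mol e (ext u)) iM hM => M iM hM.
pose w x := ext u x - M x.
have iw : Ig mu w by exact: IgB iu iM.
have iw1 : mu_int ((fun x => w (x + v x))).
  exact: integrable_shift1 iw.
have iu1 : mu_int ((fun x => ext u (x + v x))).
  exact: integrable_shift1 iu.
have iM1 : mu_int ((fun x => M (x + v x))).
  exact: integrable_shift1 iM.
have mw := Ig_meas iw; have mw1 := Ig_meas iw1.
rewrite -RintegralB//; first last.
- exact: (integrable_psi_mul (integrableB _ iM1 iM)).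
- exact: (integrable_psi_mul (integrableB _ iu1 iu)).
rewrite (_ : \int[mu]_x _ = \int[mu]_x (psi x * (w (x + v x) - w x))); last first.
  by apply: eq_Rintegral => x _; rewrite /w /v -mulrBr; congr (_ * _); ring.
have id : mu_int ((fun x => w (x + v x) - w x)) by exact: (integrableB _ iw1 iw).
rewrite -lee_fin; apply: (le_trans (Rintegral_le_N1 (integrable_psi_mul id))).
apply: (le_trans (N1_mul_bounded id mpsi B0 psiB)).
have hw : (N1 w <= (eta / (K + 1))%:E)%E.
  apply: le_trans hM; apply: N1_le => //; last by move=> x; rewrite distrC.
  exact: (Ig_meas (IgB iM iu)).
have N1w1 : N1 (fun x => w (x + v x)) = (((1 - a)^-1 ^+ d)%:E * N1 w)%E.
  rewrite -(N1_affine b a1 mw); apply: eq_integral => x _; congr (`|w _|%:E).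
  by have := affE 1 x; rewrite !scale1r mul1r.
apply: (le_via (B%:E * (N1 (fun x => w (x + v x)%R) + N1 w)%E)%E).
  rewrite lee_wpmul2l ?lee_fin//; apply: le_trans (N1D mw1 _) _; first exact: measurableT_comp.
  by rewrite leeD2l//; apply: N1_le => //; [exact: measurableT_comp|move=> x; rewrite normrN].
rewrite N1w1 -[in X in (_ + X)%E](mul1e (N1 w)) -ge0_muleDl ?lee_fin ?exprn_ge0 ?invr_ge0 ?(ltW a1)//.
rewrite muleA -EFinD -EFinM -/K.
apply: (le_via (K%:E * (eta / (K + 1))%:E)%E); first by rewrite lee_wpmul2l ?lee_fin.
rewrite -EFinM lee_fin mulrCA ler_piMr ?(ltW eta0)// ler_pdivrMr ?mul1r ?lerDl//.
exact: ltr_wpDl K0 ltr01.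
Qed.

(** AM-GM with a parameter [t] left free for later absorption. The contraction factor 1 - xi a is at
    least 1/2, whence 2^d, and mollification does not increase the L^2 norm of [g j]. *)
Lemma difference_bound (t : R) : 0 < t ->
  `|\int[mu]_x (psi x * (ext u (x + v x) - ext u x))| <=
  Vb * \sum_j (t * \int[mu]_x (psi x ^+ 2) + t^-1 * 2 ^+ d * \int[mu]_x (ext (g j) x ^+ 2)).
Proof.
move=> t0; apply/ler_addgt0Pr => eta eta0.
have [del del0 /(_ del)] := mollified_difference eta0.
rewrite del0 lexx => /(_ isT)[xi xi01 h].
set J := (X in `|_ - X| <= eta) in h; apply: (le_via (`|J| + eta)).
  have := ler_normD (\int[mu]_x (psi x * (ext u (x + v x) - ext u x)) - J) J.
  rewrite subrK => /le_trans; apply; rewrite addrC lerD2l; exact: h.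
rewrite lerD2r {h}/J.
have xi01' : 0 <= xi <= 1 by move: xi01 => /andP[? ?]; rewrite !ltW.
pose M i x := Mol del (ext (g i)) (x + xi *: v x).
have iMi i : mu_int (M i).
  by apply: integrable_shift => //; exact: integrable_Mol.
have sqg i : mu.-integrable setT (fun x => (ext (g i) x ^+ 2)%:E).
  by apply: L2_ext_sqr; have [_ /(_ i)[]] := hug.
have mMol i : mfun (Mol del (ext (g i))) by exact: measurable_Mol.
have mM i : mfun (M i) by apply/mEFinP; exact: (measurable_int mu).
have M2 i : (\int[mu]_x (M i x ^+ 2)%:E <= (2 ^+ d)%:E * \int[mu]_x (ext (g i) x ^+ 2)%:E)%E.
  have := @ge0_integral_affine R d (fun x => (Mol del (ext (g i)) x ^+ 2)%:E) (1 - xi * a) (xi *: b) (ra_gt0 xi01').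
  move=> E; rewrite (_ : (\int[mu]_x _)%E = \int[mu]_x (Mol del (ext (g i)) ((1 - xi * a) *: x + xi *: b) ^+ 2)%:E)%E; last first.
    by apply: eq_integral => x _; rewrite /M affE.
  rewrite E; [|by apply/mEFinP; exact: measurable_funX|by move=> x; rewrite lee_fin sqr_ge0].
  have ri : 0 <= (1 - xi * a)^-1 <= 2.
    have := ra_gt0 xi01'; move=> p0; rewrite invr_ge0 ltW//= -[leRHS]invrK lef_pV2 ?posrE//.
    by move: a01 xi01' => /andP[? ?] /andP[? ?]; nra.
  apply: lee_pmul.
  - by rewrite lee_fin exprn_ge0//; case/andP: ri.
  - by apply: integral_ge0 => x _; rewrite lee_fin sqr_ge0.
  - by case/andP: ri => ? ?; rewrite lee_fin lerXn2r ?nnegrE.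
  - exact: Mol_sqr_le.
have sqM i : mu.-integrable setT (fun x => (M i x ^+ 2)%:E).
  apply/integrableP; split; first by apply/mEFinP; exact: measurable_funX.
  under eq_integral do rewrite gee0_abs ?lee_fin ?sqr_ge0//.
  apply: le_lt_trans (M2 i) _; rewrite lte_mul_pinfty ?lee_fin ?exprn_ge0//.
  by have /integrableP[_] := sqg i; under eq_integral do rewrite gee0_abs ?lee_fin ?sqr_ge0//.
have sqp : mu.-integrable setT (fun x => (psi x ^+ 2)%:E).
  exact: (integrable_psi_mul integrable_psi).
have iv i : mu.-integrable setT (fun x => (v x 0 i * (psi x * M i x))%:E).
  apply: (@le_integrable _ _ _ mu setT measurableT _ (fun x => (Vb * (psi x * M i x))%:E)).
  - apply/mEFinP; apply: measurable_funM; last exact: measurable_funM.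
    under eq_fun do rewrite !mxE; apply: measurable_funB => //; apply: measurable_funM => //.
    exact: coord_measurable.
  - move=> x _ /=; rewrite lee_fin !normrM; have [->|/psiD[_ _ hv]] := eqVneq (psi x) 0.
      by rewrite normr0 !mul0r !mulr0.
    by rewrite ler_wpM2r ?mulr_ge0// (ger0_norm Vb0).
  - under eq_fun do rewrite EFinM; apply: integrableZl => //; exact: integrable_psi_mul.
have ib i : mu_int ((fun x => t * psi x ^+ 2 + t^-1 * M i x ^+ 2)).
  by apply: (integrableD measurableT (integrableZl measurableT t sqp) (integrableZl measurableT t^-1 (sqM i))).
rewrite (_ : \int[mu]_x _ = \sum_i \int[mu]_x (v x 0 i * (psi x * M i x))); last first.
  rewrite -(RI_sum _ iv); apply: eq_Rintegral => x _.
  by rewrite mulr_sumr; apply: eq_bigr => i _; rewrite mulrCA.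
apply: (le_trans (ler_norm_sum _ _ _)); rewrite mulr_sumr; apply: ler_sum => i _.
apply: (le_trans (RI_norm (iv i))).
apply: (le_via (Vb * \int[mu]_x (t * psi x ^+ 2 + t^-1 * M i x ^+ 2))).
  rewrite -(RI_Z Vb (ib i)); apply: RI_le.
  - exact: (Ig_abs (iv i)).
  - exact: (IgZ Vb (ib i)).
  - move=> x; rewrite !normrM; have [->|/psiD[_ _ hv]] := eqVneq (psi x) 0.
      rewrite normr0 mul0r mulr0 mulr_ge0// addr_ge0// mulr_ge0 ?invr_ge0 ?sqr_ge0// ltW//.
    apply: ler_pM => //; rewrite ?mulr_ge0//.
    rewrite -normrM -(real_normK (num_real (psi x))) -(real_normK (num_real (M i x))) normrM.
    set p := `|psi x|; set q := `|M i x|; have : 0 <= (t * p - q) ^+ 2 / t by rewrite divr_ge0 ?sqr_ge0 ?ltW.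
    have -> : (t * p - q) ^+ 2 / t = t * p ^+ 2 + t^-1 * q ^+ 2 - 2 * (p * q) by field; lra.
    have : 0 <= p * q by rewrite /p /q mulr_ge0.
    by move=> ? ?; lra.
rewrite ler_wpM2l// (RI_D (IgZ t sqp) (IgZ t^-1 (sqM i))) (RI_Z t sqp) (RI_Z t^-1 (sqM i)).
rewrite lerD2l -mulrA ler_wpM2l// ?invr_ge0 ?(ltW t0)//.
by have := M2 i; rewrite (Ig_fin (sqM i)) (Ig_fin (sqg i)) -EFinM lee_fin.
Qed.
End difference_bounds.

(** * Test functions: bounds, margins and mean values *)

Section test_functions.
Implicit Types (f phi : V -> R) (i : 'I_d) (x : V).

Lemma is_derive_along (f : V -> R) (x v : V) (r : R) : derivable f (x + r *: v) v ->
  is_derive r (1 : R) (fun s : R => f (x + s *: v)) ('D_v f (x + r *: v)).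
Proof.
have E : (fun h : R => h^-1 *: ((fun s : R => f (x + s *: v)) (h *: 1 + r) - f (x + r *: v))) =
         (fun h : R => h^-1 *: (f (h *: v + (x + r *: v)) - f (x + r *: v))).
  apply/funext => h; congr (_ *: (f _ - _)).
  by rewrite addrCA -scalerDl /GRing.scale /= mulr1.
by move=> df; apply: DeriveDef; rewrite /derivable /derive E.
Qed.

Lemma compact_supp_bounded (K : set V) f : continuous f -> compact K ->
  (forall x, ~ K x -> f x = 0) -> exists2 C : R, 0 <= C & forall x, `|f x| <= C.
Proof.
move=> cf cK f0; have := compact_bounded (continuous_compact (continuous_subspaceT cf) cK).
move=> [M [Mr hM]]; exists (`|M| + 1); first by rewrite addr_ge0.
move=> x; have [Kx|/f0 ->] := pselect (K x); last by rewrite normr0 addr_ge0.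
by apply: hM; [rewrite (le_lt_trans (ler_norm M))// ltrDl|exists x].
Qed.

Lemma compact_margin (K U : set V) : compact K -> open U -> K `<=` U ->
  exists2 r : R, 0 < r & forall x, K x -> cube x r `<=` U.
Proof.
move=> cK oU KU; have /compact_near_coveringP := cK.
move=> /(_ nat \oo%classic (fun (k : nat) (y : V) => cube y (k.+1%:R^-1 : R) `<=` U) _)[|k _ hk].
  move=> x /KU Ux; have [r r0 hr] := open_cubeP oU Ux.
  have r2 : 0 < r / 2 by rewrite divr_gt0.
  have n2 : nbhs x (cube x (r / 2)) by apply: open_nbhs_nbhs; split; [exact: open_cube|exact: cubexx].
  have nk : \forall k \near \oo, (k.+1%:R^-1 : R) < r / 2.
    exact: (near_infty_natSinv_lt (PosNum r2)).
  exists (cube x (r / 2), [set k : nat | (k.+1%:R^-1 : R) < r / 2]) => //.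
  move=> [y k] /= [xy kr] z yz; apply: hr => j.
  have h2 := xy j; have h1 := yz j; rewrite -(subrKA (y 0 j)) (le_lt_trans (ler_normD _ _))//.
  by rewrite [ltRHS]splitr ltrD// (lt_trans h1).
by exists k.+1%:R^-1 => // x Kx; apply: hk => //=.
Qed.

Section test.
Variables (phi : V -> R) (tphi : test_function D phi).

Lemma test_out x : ~ closure [set x | phi x != 0] x -> phi x = 0.
Proof. by move=> h; apply/eqP; apply: contra_notT h => h; exact: subset_closure. Qed.

Lemma test_continuous : continuous phi.
Proof. by have [/(_ [::])[]] := tphi. Qed.

Lemma test_measurable : mfun phi.
Proof. exact: continuous_measurable_rV test_continuous. Qed.

Lemma test_partial_continuous i : continuous (partial i phi).
Proof. by have [/(_ [:: i])[]] := tphi. Qed.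

Lemma test_partial_measurable i : mfun (partial i phi).
Proof. apply: (@continuous_measurable_rV R d (partial i phi)); exact: test_partial_continuous. Qed.

Lemma test_derivable i x : derivable phi x (delta_mx 0 i).
Proof. by have [/(_ [::])[_]] := tphi. Qed.

Lemma test_bounded : exists2 C : R, 0 <= C & forall x, `|phi x| <= C.
Proof.
have [_ c _] := tphi; apply: (compact_supp_bounded test_continuous c) => x.
exact: test_out.
Qed.

Lemma test_partial_out i x : ~ closure [set x | phi x != 0] x -> partial i phi x = 0.
Proof.
move=> h; have oc : open (~` closure [set x | phi x != 0]) by rewrite openC; exact: closed_closure.
rewrite /partial (@near_eq_derive _ _ _ phi (cst 0)); first by rewrite derive_cst.
have := open_nbhs_nbhs (conj oc h); apply: filterS => y; exact: test_out.
Qed.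

Lemma test_partial_bounded i : exists2 C : R, 0 <= C & forall x, `|partial i phi x| <= C.
Proof.
have [_ c _] := tphi.
apply: (@compact_supp_bounded _ (partial i phi) (@test_partial_continuous i) c) => x.
exact: test_partial_out.
Qed.

Lemma test_margin : exists2 r : R, 0 < r & forall x, phi x != 0 -> cbox x r `<=` D.
Proof.
have [_ c cD] := tphi; have [r r0 hr] := compact_margin c (@dom_open _ _ D) cD.
exists (r / 2); first by rewrite divr_gt0.
move=> x px y hy; apply: (hr x); first exact: subset_closure.
by move=> j; apply: le_lt_trans (hy j) _; rewrite ltr_pdivrMr// mulr_natr mulr2n ltrDl.
Qed.

Lemma test_mvt i x (h : R) : 0 < h -> exists2 s : R, 0 < s < h &
  phi (x + (- h) *: delta_mx 0 i) - phi x = - h * partial i phi (x + (- s) *: delta_mx 0 i).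
Proof.
move=> h0; set v := delta_mx 0 i.
have D1 (r : R) : is_derive r (1 : R) (fun s : R => phi (x + s *: v)) (partial i phi (x + r *: v)).
  by apply: is_derive_along; exact: test_derivable.
have [c] : exists2 c, c \in `]- h, 0[ & phi (x + 0 *: v) - phi (x + (- h) *: v) =
   partial i phi (x + c *: v) * (0 - (- h)).
  have h0' : - h < 0 by rewrite oppr_lt0.
  apply: (@MVT R (fun s : R => phi (x + s *: v)) (fun r => partial i phi (x + r *: v)) _ _ h0' (fun r _ => D1 r)).
  apply: continuous_subspaceT => r; have [dr _] := D1 r.
  have dfr := (derivable1_diffP _ _).1 dr; have cfr := differentiable_continuous dfr; exact: cfr.
rewrite in_itv /= => /andP[c1 c2] E; exists (- c); first by rewrite oppr_gt0 c2/= ltrNl.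
by rewrite scale0r addr0 in E; rewrite opprK -opprB E; ring.
Qed.
End test.
End test_functions.

Section L2_closure.
Implicit Types (f g : V -> R).

Lemma L2D f g : L2 D f -> L2 D g -> L2 D (fun x => f x + g x).
Proof.
move=> hf hg; apply: L2P; first by apply: measurable_funD; exact: (@L2_measurable).
apply: (Ig_ext _ (IgD (IgD (L2_sqr hf) (IgZ 2 (L2_integrable_mul hf hg))) (L2_sqr hg))) => x.
by ring.
Qed.

Lemma L2_mul_bounded f g (B : R) : mfun f -> (forall x, `|f x| <= B) -> L2 D g ->
  L2 D (fun x => f x * g x).
Proof.
move=> mf fB hg; have mg := L2_measurable hg.
apply: L2P; first exact: measurable_funM.
apply: (Ig_le _ (IgZ (B ^+ 2) (L2_sqr hg))); first by apply: measurable_funX; exact: measurable_funM.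
move=> x; rewrite normrX normrM exprMn real_normK ?num_real// -(real_normK (num_real (g x))).
rewrite ler_wpM2r ?sqr_ge0// -(real_normK (num_real (f x))) lerXn2r ?nnegrE//.
exact: le_trans (fB x).
Qed.

Lemma L2Z (c : R) f : L2 D f -> L2 D (fun x => c * f x).
Proof. by move=> hf; apply: (@L2_mul_bounded (cst c) f `|c|) => //; exact: measurable_cst. Qed.

Lemma L2_bounded f (B : R) : mfun f -> (forall x, `|f x| <= B) -> L2 D f.
Proof.
move=> mf fB; have := L2_mul_bounded mf fB (L2_cst 1).
by congr (L2 D _); apply/funext => x; rewrite mulr1.
Qed.
End L2_closure.

(** * First-order expansion of translates of H^1 functions *)

Section difference_quotients.
Implicit Types (f g psi : V -> R) (i : 'I_d) (x : V) (h : R).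

Lemma Ig_translate f (z : V) : Ig mu f -> Ig mu (fun x => f (x + z)).
Proof.
move=> fi; have := integrable_affine z (@ltr01 R) fi.
by apply: Ig_ext => x /=; rewrite scale1r.
Qed.

Lemma RI_translate f (z : V) : Ig mu f -> \int[mu]_x f (x + z) = \int[mu]_x f x.
Proof.
move=> fi; have mf := Ig_meas fi.
have P (g : V -> R) : mfun g -> (forall x, 0 <= g x) ->
    \int[mu]_x g (x + z) = \int[mu]_x g x.
  move=> mg g0; rewrite /Rintegral; congr fine.
  by apply: (@ge0_integral_translate R d (EFin \o g) z); [exact/mEFinP|move=> x; rewrite lee_fin].
have mn : mfun (fun x => `|f x|) by exact: measurableT_comp.
have fn := Ig_abs fi; have ft := Ig_translate z fi; have fnt := Ig_abs ft.
have := P (fun x => f x + `|f x|).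
rewrite (RI_D ft fnt) (RI_D fi fn) (P (fun x => `|f x|) mn) // => H.
apply: (addIr (\int[mu]_x `|f x|)); apply: H; first exact: measurable_funD.
by move=> x; rewrite -lerBlDl sub0r -normrN ler_norm.
Qed.

Section bounded_weight.
Variables (u : V -> R) (g : 'I_d -> V -> R) (hug : H1grad u g).
Let iu : Ig mu (ext u).
Proof. by apply: L2_ext_integrable; have [] := hug. Qed.
Let ig j : Ig mu (ext (g j)).
Proof. by apply: L2_ext_integrable; have [_ /(_ j)[]] := hug. Qed.

Variables (psi : V -> R) (mpsi : mfun psi) (B : R) (B0 : 0 <= B).
Hypothesis psiB : forall x, `|psi x| <= B.
Variables (rho : R) (rho0 : 0 < rho).
Hypothesis psiD : forall x, psi x != 0 -> cbox x rho `<=` D.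

Lemma Ig_bounded_mul f : Ig mu f -> Ig mu (fun x => psi x * f x).
Proof.
move=> fi; have := integrable_mul_bounded fi mpsi psiB.
by apply: Ig_ext => x /=; rewrite mulrC.
Qed.

Lemma RI_bounded_mul f (c : R) : Ig mu f -> (N1 f <= c%:E)%E ->
  `|\int[mu]_x (psi x * f x)| <= B * c.
Proof.
move=> fi fc; rewrite -lee_fin; apply: le_trans (Rintegral_le_N1 (Ig_bounded_mul fi)) _.
apply: le_trans (N1_mul_bounded fi mpsi B0 psiB) _.
by rewrite EFinM lee_wpmul2l ?lee_fin.
Qed.

Let shift_supp i h : 0 <= h <= rho / 2 -> forall x, psi x != 0 ->
  [/\ cbox x (rho / 2) `<=` D, cbox (x + (h *: delta_mx 0 i - 0 *: x)) (rho / 2) `<=` D &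
   forall j, `|(h *: delta_mx 0 i - 0 *: x) 0 j| <= h].
Proof.
move=> /andP[h0 h2] x /psiD px.
have dh j : `|(h *: delta_mx 0 i - 0 *: x) 0 j| <= h.
  rewrite !mxE /= mul0r subr0; case: (j == i); first by rewrite mulr1 ger0_norm.
  by rewrite mulr0 normr0.
split => //.
- by move=> y hy; apply: px; apply: (@cbox_le x (rho / 2)) hy; lra.
- move=> y hy; apply: px => j; have h1 := hy j.
  have -> : y 0 j - x 0 j = (y 0 j - (x + (h *: delta_mx 0 i - 0 *: x)) 0 j) +
     (h *: delta_mx 0 i - 0 *: x) 0 j by rewrite !mxE; ring.
  by rewrite (le_trans (ler_normD _ _))// [leRHS]splitr lerD// (le_trans (dh j)).
Qed.

(** The expansion is proved for bounded weights supported away from the boundary, beyond test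
    functions, so that the bounded coefficients of a chain rule can be absorbed into [psi]. *)
Lemma difference_quotient i (eta : R) : 0 < eta -> exists2 h0 : R, 0 < h0 & forall h, 0 < h <= h0 ->
  `|\int[mu]_x (psi x * (ext u (x + h *: delta_mx 0 i) - ext u x)) -
    h * \int[mu]_x (psi x * ext (g i) x)| <= h * eta.
Proof.
move=> eta0; set c := eta / (4 * (B + 1)).
have c0 : 0 < c by rewrite divr_gt0// mulr_gt0// ltr_wpDl.
have Bc : B * (c + c) <= eta / 2.
  rewrite /c (_ : _ * _ = (eta / 2) * (B / (B + 1))); last by field; rewrite gt_eqF// ltr_wpDl.
  by rewrite ler_piMr ?divr_ge0 ?(ltW eta0)// ler_pdivrMr ?ltr_wpDl// mul1r lerDl.
have [del1 del10 hM] := Mol_cvg_int (ig i) c0.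
have [mgi] := Tc_integrable (ig i); move=> /(_ c c0)[del2 del20 hT].
exists (Num.min (rho / 2) (del2 / 2)); first by rewrite lt_min !divr_gt0.
move=> h /andP[h0]; rewrite le_min => /andP[hr hd].
have h00 : 0 <= h <= rho / 2 by rewrite hr ltW.
have a01 : 0 <= (0 : R) <= 1 / 2 by rewrite lexx divr_ge0.
have rho20 : 0 < rho / 2 by rewrite divr_gt0.
have [del del0 H] := mollified_difference hug mpsi B0 psiB a01 rho20 (shift_supp i h00) (mulr_gt0 h0 (divr_gt0 eta0 (ltr0Sn R 1))).
have [] := H (Num.min del del1); first by rewrite lt_min del0 del10/= ge_min lexx.
set e := Num.min del del1; move=> xi xi01; have e0 : 0 < e by rewrite lt_min del0.
have ed1 : e <= del1 by rewrite ge_min lexx orbT.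
set z := xi *: (h *: delta_mx 0 i) : V.
have iM := integrable_Mol (ig i) e0; have hMe := hM e; rewrite e0 ed1 in hMe; have {}hMe := hMe isT.
rewrite (_ : \int[mu]_x (psi x * \sum_j _) = h * \int[mu]_x (psi x * Mol e (ext (g i)) (x + z))); last first.
  rewrite -RI_Z; last by apply: Ig_bounded_mul; exact: Ig_translate iM.
  apply: RI_ext => x; rewrite mulrCA; congr (_ * _).
  rewrite (bigD1 i)//= big1 ?addr0 => [|j ji]; rewrite scale0r subr0 !mxE !eqxx /=.
    by rewrite mulr1.
  by rewrite (negbTE ji) mulr0 mul0r.
rewrite (RI_ext _ (g := fun x => psi x * (ext u (x + h *: delta_mx 0 i) - ext u x))); last first.
  by move=> x; rewrite scale0r subr0.
move: (Mol e (ext (g i))) iM hMe => M iM hMe.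
set A := \int[mu]_x _; set B1 := \int[mu]_x _; set B2 := \int[mu]_x _ => AB.
have hz : cube 0 del2 z.
  move=> j; rewrite /z !mxE subr0 !normrM normr_nat.
  move: xi01 => /andP[x0 x1]; rewrite !gtr0_norm//.
  case: (_ && _); rewrite ?mulr0 ?mulr1//.
  have : xi * h <= 1 * h by rewrite ler_wpM2r// ltW.
  by rewrite mul1r; lra.
have B12 : `|B1 - B2| <= eta / 2.
  have iMz := Ig_translate z iM; have igz := Ig_translate z (ig i).
  rewrite /B1 /B2 -RI_B; try exact: Ig_bounded_mul.
  rewrite (_ : \int[mu]_x _ = \int[mu]_x (psi x * (M (x + z) - ext (g i) (x + z)) ) +
    \int[mu]_x (psi x * (ext (g i) (x + z) - ext (g i) x))); last first.
    rewrite -RI_D; [by apply: RI_ext => x; ring| |]; apply: Ig_bounded_mul; exact: IgB.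
  apply: le_trans (ler_normD _ _) _; apply: le_trans Bc; rewrite mulrDr lerD//.
    apply: RI_bounded_mul; first exact: IgB.
    rewrite (@N1_translate R d (fun x => M x - ext (g i) x) z)//.
    exact: (Ig_meas (IgB iM (ig i))).
  by apply: RI_bounded_mul; [exact: IgB|exact: hT].
rewrite (_ : A - _ = (A - h * B1) + h * (B1 - B2)); last by ring.
apply: le_trans (ler_normD _ _) _; rewrite [leRHS](_ : _ = h * (eta / 2) + h * (eta / 2)); last by field.
by apply: lerD => //; rewrite normrM gtr0_norm// ler_wpM2l// ltW.
Qed.

Lemma difference_norm i h : 0 < h <= rho / 2 ->
  `|\int[mu]_x (psi x * (ext u (x + h *: delta_mx 0 i) - ext u x))| <=
  (\int[mu]_x (psi x ^+ 2)) / 2 + h ^+ 2 * (2 * d%:R * 2 ^+ d) * \sum_j \int[mu]_x (ext (g j) x ^+ 2).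
Proof.
move=> /andP[h0 hr].
have dp : 0 < d%:R :> R by rewrite ltr0n (leq_trans _ (ltn_ord i)).
have h00 : 0 <= h <= rho / 2 by rewrite hr ltW.
have a01 : 0 <= (0 : R) <= 1 / 2 by rewrite lexx divr_ge0.
have rho20 : 0 < rho / 2 by rewrite divr_gt0.
(* With displacement bound [h], this value of [t] gives the integral of psi^2 the coefficient h d t
   = 1/2. *)
have t0 : 0 < (2 * h * d%:R)^-1 by rewrite invr_gt0 !mulr_gt0.
have := difference_bound hug mpsi B0 psiB a01 (ltW h0) rho20 (shift_supp i h00) t0.
rewrite (RI_ext _ (g := fun x => psi x * (ext u (x + h *: delta_mx 0 i) - ext u x))); last first.
  by move=> x; rewrite scale0r subr0.
move=> /le_trans; apply; rewrite big_split /= sumr_const card_ord -mulr_sumr -mulr_natr invrK.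
rewrite le_eqVlt; apply/orP; left; apply/eqP; field.
by rewrite !gt_eqF.
Qed.
End bounded_weight.
End difference_quotients.

(** * Weak derivatives recovered from differences; the general chain rule *)

Section weak_derivatives.
Implicit Types (f g psi : V -> R) (i : 'I_d) (x : V) (h : R).

Lemma measurable_H1 u (g : 'I_d -> V -> R) : H1grad u g -> mfun u.
Proof. by case=> hu _; exact: L2_measurable hu. Qed.

(** Duality against the difference itself: [psi n] is the difference restricted to the margin and to
    the set where it is at most n in absolute value, so [difference_norm] bounds its square by half
    of itself plus the gradient term. Then n tends to infinity. *)
Lemma difference_square u (g : 'I_d -> V -> R) i : H1grad u g ->
  exists2 C : R, 0 <= C & forall rho h, 0 < rho -> 0 < h <= rho / 2 ->
  Ig mu (fun x => \1_(inner_cubes D (2 * rho)) x * (ext u (x + h *: delta_mx 0 i) - ext u x) ^+ 2) /\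
  \int[mu]_x (\1_(inner_cubes D (2 * rho)) x * (ext u (x + h *: delta_mx 0 i) - ext u x) ^+ 2) <= C * h ^+ 2.
Proof.
move=> hug; set C := 2 * ((2 * d%:R * 2 ^+ d) * \sum_j \int[mu]_x (ext (g j) x ^+ 2)) : R.
have C0 : 0 <= C.
  by rewrite !mulr_ge0// sumr_ge0// => j _; apply: RI_ge0 => x; exact: sqr_ge0.
exists C => // rho h rho0 /[dup] hr /andP[h0 _].
have [hu hg] := hug; have iu : Ig mu (ext u) by exact: L2_ext_integrable.
set v := h *: delta_mx 0 i; set S := inner_cubes D (2 * rho).
have mS : measurable S by exact: measurable_inner_cubes.
pose w x := ext u (x + v) - ext u x.
have iw : Ig mu w by apply: IgB => //; exact: Ig_translate.
have mw := Ig_meas iw.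
have m1 (A : set V) : measurable A -> mfun (\1_A : V -> R) by move=> mA; exact: measurable_indic.
have i2 : Ig mu (fun x => w x ^+ 2).
  have u2 := L2_ext_sqr hu; have u2t := Ig_translate v u2.
  apply: (Ig_le _ (IgZ 2 (IgD u2t u2))); first exact: measurable_funX.
  move=> x; rewrite ger0_norm ?sqr_ge0// /w.
  move: (ext u (x + v)) (ext u x) => p q; have := sqr_ge0 (p + q); nra.
have iS : Ig mu (fun x => \1_S x * w x ^+ 2).
  apply: (Ig_le _ i2); first by apply: measurable_funM; [exact: m1|exact: measurable_funX].
  by move=> x; rewrite normrM ger0_norm// (ger0_norm (sqr_ge0 _)) ler_piMl ?sqr_ge0// indicE ler_nat leq_b1.
split => //.
pose T n : set V := [set x | `|w x| <= n%:R].
have mT n : measurable (T n).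
  have -> : T n = setT `&` (fun x => `|w x|) @^-1` `]-oo, n%:R]%classic.
    by rewrite setTI; apply/seteqP; split => x /=; rewrite /T /= in_itv.
  by apply: (measurableT_comp (@normr_measurable R setT) mw) => //; exact: measurable_itv.
pose psi n x := \1_S x * (\1_(T n) x * w x).
have mpsi n : mfun (psi n).
  by apply: measurable_funM; [exact: m1|apply: measurable_funM => //; exact: m1].
have pb n x : `|psi n x| <= n%:R.
  rewrite /psi !indicE; case: (x \in S); last by rewrite mul0r normr0.
  rewrite mul1r; case: (boolP (x \in T n)) => [|_]; last by rewrite mul0r normr0.
  by rewrite inE mul1r.
have pD n x : psi n x != 0 -> cbox x rho `<=` D.
  rewrite /psi indicE; case: (boolP (x \in S)); last by rewrite mul0r eqxx.
  rewrite inE => Sx _ y hy; apply: Sx => j; apply: le_lt_trans (hy j) _.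
  by rewrite mulr_natl mulr2n ltrDl.
have E n x : psi n x ^+ 2 = psi n x * w x.
  rewrite /psi !indicE; case: (x \in S); case: (x \in T n); rewrite ?mul0r ?mul1r//; ring.
have bnd n : \int[mu]_x (psi n x ^+ 2) <= C * h ^+ 2.
  have := difference_norm hug (mpsi n) (ler0n _ n) (pb n) rho0 (pD n) i hr.
  rewrite -/v (RI_ext _ (g := fun x => psi n x ^+ 2)); last by move=> x; rewrite E.
  rewrite ger0_norm; last by apply: RI_ge0 => x; exact: sqr_ge0.
  move=> H; rewrite /C; set I := \int[mu]_x _ in H *; set J := \sum_j _ in H *; lra.
have [_ cv] : Ig mu (fun x => \1_S x * w x ^+ 2) /\
    \int[mu]_x (psi n x ^+ 2) @[n --> \oo] --> \int[mu]_x (\1_S x * w x ^+ 2).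
  apply: (RI_dominated _ _ i2).
  - by move=> n; exact: measurable_funX.
  - exact: Ig_meas iS.
  - move=> x; apply: cvg_near_cst; exists (Num.truncn `|w x|).+1 => // n /= hn.
    rewrite E /psi (_ : \1_(T n) x = 1); first by rewrite mul1r; ring.
    rewrite indicE mem_set//= /T /=; apply: ltW; apply: lt_le_trans (truncnS_gt _) _.
    by rewrite ler_nat.
  - move=> n x; rewrite ger0_norm ?sqr_ge0// E /psi -!mulrA -expr2 !indicE.
    by case: (x \in S); case: (x \in T n); rewrite ?mul0r ?mul1r ?sqr_ge0.
rewrite -(cvg_lim (@Rhausdorff R) cv); apply: limr_le; first by apply/cvg_ex; eexists; exact: cv.
by apply: nearW => n; exact: bnd.
Qed.

(** Converse of [difference_quotient]: the increment is shifted onto the test function by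
    translation invariance, and the difference quotients of the latter converge boundedly along h =
    1/(n + 1). *)
Lemma weak_partial_of_differences i f G : L2 D f -> L2 D G ->
  (forall phi, test_function D phi -> forall eta : R, 0 < eta -> exists2 h0 : R, 0 < h0 &
    forall h, 0 < h <= h0 -> `|\int[mu]_x (phi x * (ext f (x + h *: delta_mx 0 i) - ext f x)) -
      h * \int[mu]_x (phi x * ext G x)| <= h * eta) ->
  weak_partial D i f G.
Proof.
move=> hf hG H phi tphi.
have mf := L2_measurable hf; have mG := L2_measurable hG.
have mphi := test_measurable tphi; have mdphi := test_partial_measurable tphi i.
rewrite !Rintegral_leb; [|exact: measurable_funM|exact: measurable_funM].
have iF : Ig mu (ext f) by exact: L2_ext_integrable.
have iG : Ig mu (ext G) by exact: L2_ext_integrable.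
have [B B0 phiB] := test_bounded tphi; have [B' B'0 dphiB] := test_partial_bounded tphi i.
set v := delta_mx 0 i : V.
rewrite (RI_ext _ (g := fun x => partial i phi x * ext f x)); last by move=> x; rewrite /ext; ring.
rewrite [in RHS](RI_ext _ (g := fun x => phi x * ext G x)); last by move=> x; rewrite /ext; ring.
have bm psi' (f' : V -> R) C : mfun psi' -> (forall x, `|psi' x| <= C) -> Ig mu f' ->
    Ig mu (fun x => psi' x * f' x).
  move=> mp pC fi; have := integrable_mul_bounded fi mp pC.
  by apply: Ig_ext => x /=; rewrite mulrC.
have shift h : \int[mu]_x (phi x * (ext f (x + h *: v) - ext f x)) =
    \int[mu]_x ((phi (x + (- h) *: v) - phi x) * ext f x).
  have ip : Ig mu (fun x => phi x * ext f x) by exact: bm phiB iF.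
  have ipt : Ig mu (fun x => phi x * ext f (x + h *: v)).
    by apply: (bm _ _ B) => //; exact: Ig_translate.
  have ipt' : Ig mu (fun x => phi (x + (- h) *: v) * ext f x).
    by apply: (bm (fun x => phi (x + (- h) *: v)) _ B) => //; exact: mfun_translate.
  transitivity (\int[mu]_x (phi x * ext f (x + h *: v)) - \int[mu]_x (phi x * ext f x)).
    by rewrite -RI_B//; apply: RI_ext => x; rewrite mulrBr.
  transitivity (\int[mu]_x (phi (x + (- h) *: v) * ext f x) - \int[mu]_x (phi x * ext f x)).
    congr (_ - _); rewrite -[RHS](RI_translate (h *: v) ipt'); apply: RI_ext => x.
    by congr (phi _ * _); rewrite scaleNr addrK.
  by rewrite -RI_B//; apply: RI_ext => x; rewrite mulrBl.
set a := \int[mu]_x _; set b := \int[mu]_x _.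
pose hn (n : nat) : R := n.+1%:R^-1.
have hn0 n : 0 < hn n by rewrite invr_gt0.
pose q n x := (hn n)^-1 * (phi (x + (- hn n) *: v) - phi x).
have mq n : mfun (q n).
  by apply: measurable_funM => //; exact: mfun_diff.
have qb n x : `|q n x| <= B'.
  have [s _ E] := test_mvt tphi i x (hn0 n).
  by rewrite /q /v E mulrA mulrN mulVf ?gt_eqF// mulN1r normrN.
have [_ cv] : Ig mu (fun x => - partial i phi x * ext f x) /\
    \int[mu]_x (q n x * ext f x) @[n --> \oo] --> \int[mu]_x (- partial i phi x * ext f x).
  apply: (@RI_dominated _ _ _ mu (fun n x => q n x * ext f x) _ (fun x => B' * `|ext f x|)).
  - by move=> n; apply: measurable_funM => //; exact: (Ig_meas iF).
  - by apply: measurable_funM; [exact: measurableT_comp|exact: (Ig_meas iF)].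
  - by apply: IgZ; exact: Ig_abs.
  - move=> x; apply: cvgMl.
    have dv : (fun h => h^-1 *: (phi (h *: v + x) - phi x)) @ 0^' --> partial i phi x.
      exact: (@test_derivable _ tphi i x).
    have := (cvgr_dnbhsP _ _ _).1 dv (fun n => - hn n).
    move=> H1; have {H1} cvq : (- hn n)^-1 *: (phi (- hn n *: v + x) - phi x) @[n --> \oo] --> partial i phi x.
      apply: H1; split; first by move=> n; rewrite oppr_eq0 gt_eqF.
      rewrite -[0]oppr0; apply: cvgN; exact: cvg_harmonic.
    rewrite (_ : q ^~ x = fun n => - ((- hn n)^-1 *: (phi ((- hn n) *: v + x) - phi x))).
      by apply: cvgN; exact: cvq.
    by apply/funext => n; rewrite /q invrN [in RHS]/GRing.scale/= mulNr opprK (addrC x).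
  - by move=> n x; rewrite normrM ler_wpM2r.
have cva : \int[mu]_x (q n x * ext f x) @[n --> \oo] --> - a.
  rewrite /a -RI_N; last by exact: bm dphiB iF.
  by rewrite (RI_ext _ (g := fun x => - partial i phi x * ext f x))// => x; rewrite mulNr.
apply/eqP; rewrite eq_sym eqr_oppLR; apply/eqP.
suff : forall eta : R, 0 < eta -> `|- a - b| <= eta.
  move=> h; apply/eqP; rewrite eq_sym -subr_eq0 -normr_le0; apply/ler_addgt0Pr => e e0.
  by rewrite add0r; exact: h.
move=> eta eta0; have [h0 h00 Hh] := H phi tphi eta eta0.
have cvb : `|\int[mu]_x (q n x * ext f x) - b| @[n --> \oo] --> `|- a - b|.
  by apply: cvg_norm; apply: cvgB => //; exact: cvg_cst.
rewrite -(cvg_lim (@Rhausdorff R) cvb); apply: limr_le; first by apply/cvg_ex; eexists; exact: cvb.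
have [N _ hN] := near_infty_natSinv_lt (PosNum h00).
exists N => // n /= Nn; have hnh : hn n <= h0 by apply: ltW; exact: hN.
have := Hh (hn n); rewrite hn0 hnh => /(_ isT); rewrite shift -/b.
have -> : \int[mu]_x ((phi (x + (- hn n) *: v) - phi x) * ext f x) = hn n * \int[mu]_x (q n x * ext f x).
  rewrite -RI_Z; last by exact: bm (qb n) iF.
  by apply: RI_ext => x; rewrite /q !mulrA divff ?gt_eqF// mul1r.
by rewrite -mulrBr normrM gtr0_norm// ler_pM2l.
Qed.

(** One rule behind chain rule, product rule and linear combinations: if the increments of [f] are a
    du + b dw up to a quadratic error, that error integrates to O(h^2) by [difference_square] and
    disappears in the limit. *)
Lemma H1_combine u gu w gw f (a b : V -> R) (B L : R) : H1grad u gu -> H1grad w gw -> L2 D f ->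
  mfun a -> mfun b -> (forall x, `|a x| <= B) -> (forall x, `|b x| <= B) ->
  (forall x y, `|f y - f x - a x * (u y - u x) - b x * (w y - w x)| <= L * ((u y - u x) ^+ 2 + (w y - w x) ^+ 2)) ->
  H1grad f (fun i x => a x * gu i x + b x * gw i x).
Proof.
move=> hu hw hf ma mb aB bB hL; split => // i.
have [hu1 hu2] := hu; have [hw1 hw2] := hw.
have hG : L2 D (fun x => a x * gu i x + b x * gw i x).
  apply: L2D; [exact: L2_mul_bounded aB (hu2 i).1|exact: L2_mul_bounded bB (hw2 i).1].
split => //; apply: weak_partial_of_differences => // phi tphi eta eta0.
have mphi := test_measurable tphi.
have [C C0 phiC] := test_bounded tphi; have [r r0 hr] := test_margin tphi.
have B0 : 0 <= B by exact: le_trans (aB 0).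
have [Cu Cu0 Su] := difference_square i hu; have [Cw Cw0 Sw] := difference_square i hw.
have mpa : mfun (fun x => phi x * a x) by exact: measurable_funM.
have mpb : mfun (fun x => phi x * b x) by exact: measurable_funM.
have paB x : `|phi x * a x| <= C * B by rewrite normrM ler_pM.
have pbB x : `|phi x * b x| <= C * B by rewrite normrM ler_pM.
have pa0 x : phi x * a x != 0 -> cbox x r `<=` D.
  by rewrite mulf_eq0 negb_or => /andP[/hr].
have pb0 x : phi x * b x != 0 -> cbox x r `<=` D.
  by rewrite mulf_eq0 negb_or => /andP[/hr].
have CB0 : 0 <= C * B by exact: mulr_ge0.
have e3 : 0 < eta / 3 by exact: divr_gt0.
have [h1 h10 H1] := difference_quotient hu mpa CB0 paB r0 pa0 i e3.
have [h2 h20 H2] := difference_quotient hw mpb CB0 pbB r0 pb0 i e3.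
have L0 : 0 <= `|L| by [].
pose K := C * `|L| * (Cu + Cw); have K0 : 0 <= K by rewrite !mulr_ge0// addr_ge0.
have h30 : 0 < eta / 3 / (K + 1) by rewrite divr_gt0// ltr_wpDl.
exists (Num.min (Num.min h1 h2) (Num.min (r / 4) (eta / 3 / (K + 1)))).
  by rewrite !lt_min h10 h20 h30 divr_gt0.
move=> h /andP[h0]; rewrite !le_min => /andP[/andP[hh1 hh2] /andP[hh3 hh4]].
have {H1} := H1 h; rewrite h0 hh1 => /(_ isT) H1.
have {H2} := H2 h; rewrite h0 hh2 => /(_ isT) H2.
have r2 : 0 < r / 2 by rewrite divr_gt0.
have hr2 : 0 < h <= r / 2 / 2 by rewrite h0/=; lra.
have [iSu {}Su] := Su _ _ r2 hr2; have [iSw {}Sw] := Sw _ _ r2 hr2.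
rewrite (_ : 2 * (r / 2) = r) in iSu iSw Su Sw; last by field.
set v := h *: delta_mx 0 i : V in H1 H2 iSu iSw Su Sw *.
pose dl (k : V -> R) x := ext k (x + v) - ext k x.
have idl k : L2 D k -> Ig mu (dl k).
  by move=> /L2_ext_integrable hk; apply: IgB => //; exact: Ig_translate.
have bm psi' (f' : V -> R) c : mfun psi' -> (forall x, `|psi' x| <= c) -> Ig mu f' ->
    Ig mu (fun x => psi' x * f' x).
  move=> mp pC fi; have := integrable_mul_bounded fi mp pC.
  by apply: Ig_ext => x /=; rewrite mulrC.
have {}H1 : `|\int[mu]_x (phi x * a x * dl u x) - h * \int[mu]_x (phi x * a x * ext (gu i) x)| <=
  h * (eta / 3) by exact: H1.
have {}H2 : `|\int[mu]_x (phi x * b x * dl w x) - h * \int[mu]_x (phi x * b x * ext (gw i) x)| <=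
  h * (eta / 3) by exact: H2.
have i0 : Ig mu (fun x => phi x * dl f x) by apply: (bm _ _ C) => //; exact: idl.
have i1 : Ig mu (fun x => (phi x * a x) * dl u x) by apply: (bm _ _ (C * B)) => //; exact: idl.
have i2 : Ig mu (fun x => (phi x * b x) * dl w x) by apply: (bm _ _ (C * B)) => //; exact: idl.
have j1 : Ig mu (fun x => (phi x * a x) * ext (gu i) x).
  by apply: (bm _ _ (C * B)) => //; exact: L2_ext_integrable (hu2 i).1.
have j2 : Ig mu (fun x => (phi x * b x) * ext (gw i) x).
  by apply: (bm _ _ (C * B)) => //; exact: L2_ext_integrable (hw2 i).1.
rewrite [X in _ - h * X](RI_ext _ (g := fun x => phi x * a x * ext (gu i) x + phi x * b x * ext (gw i) x)); last first.
  by move=> x; rewrite /ext; ring.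
rewrite (RI_D j1 j2).
set A1 := \int[mu]_x (phi x * a x * ext (gu i) x) in H1 *.
set A2 := \int[mu]_x (phi x * b x * ext (gw i) x) in H2 *.
(* The quadratic remainder, then one first-order expansion for each of [u] and [w]; each of the
   three takes a third of [eta]. *)
rewrite (_ : \int[mu]_x _ - _ = (\int[mu]_x (phi x * dl f x) - \int[mu]_x (phi x * a x * dl u x) -
  \int[mu]_x (phi x * b x * dl w x)) + (\int[mu]_x (phi x * a x * dl u x) - h * A1) +
  (\int[mu]_x (phi x * b x * dl w x) - h * A2)); last by rewrite /dl; ring.
have H0 : `|\int[mu]_x (phi x * dl f x) - \int[mu]_x (phi x * a x * dl u x) -
  \int[mu]_x (phi x * b x * dl w x)| <= h * (eta / 3).
  rewrite -RI_B// -RI_B//; last exact: IgB.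
  set S := inner_cubes D r in iSu iSw Su Sw.
  have iS := IgZ (C * `|L|) (IgD iSu iSw).
  apply: (le_via (\int[mu]_x (C * `|L| * (\1_S x * dl u x ^+ 2 + \1_S x * dl w x ^+ 2)))).
    apply: RI_norm_le => //; first by apply: IgB => //; exact: IgB.
    move=> x; have [p0|pn0] := eqVneq (phi x) 0.
      rewrite p0 !mul0r !subr0 normr0 !mulr_ge0// addr_ge0// mulr_ge0 ?sqr_ge0//; exact: indic_ge0.
    have hx := hr x pn0.
    have xD : (D : set V) x by apply: hx => j; rewrite subrr normr0 ltW.
    have xvD : (D : set V) (x + v).
      apply: hx => j; rewrite /v !mxE addrAC subrr add0r eqxx/= normrM normr_nat gtr0_norm//.
      by case: (j == i); rewrite ?mulr1 ?mulr0 ?(ltW r0)//; lra.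
    have xS : x \in S by rewrite inE => y hy; apply: hx => j; exact: ltW (hy j).
    rewrite indicE xS !mul1r /dl !ext_in// -mulrA -mulrA.
    rewrite (_ : _ - _ - _ = phi x * (f (x + v) - f x - a x * (u (x + v) - u x) - b x * (w (x + v) - w x))); last by ring.
    rewrite normrM [leRHS]mulrAC -mulrA ler_pM//; rewrite [leRHS]mulrC; apply: le_trans (hL _ _) _.
    by rewrite ler_wpM2r ?ler_norm// addr_ge0 ?sqr_ge0.
  rewrite RI_Z; last exact: IgD.
  rewrite RI_D//; apply: (le_via (C * `|L| * (Cu * h ^+ 2 + Cw * h ^+ 2))).
    by rewrite ler_wpM2l ?mulr_ge0// lerD.
  rewrite (_ : _ * _ = h * (K * h)); last by rewrite /K; ring.
  rewrite ler_wpM2l ?(ltW h0)//; apply: (le_via ((K + 1) * h)).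
    by rewrite ler_wpM2r ?(ltW h0)// lerDl.
  by rewrite mulrC -ler_pdivlMr// ltr_wpDl.
rewrite (le_trans (ler_normD _ _))//; have := ler_normD (\int[mu]_x (phi x * dl f x) - \int[mu]_x (phi x * a x * dl u x) -
  \int[mu]_x (phi x * b x * dl w x)) (\int[mu]_x (phi x * a x * dl u x) - h * A1).
rewrite -/(dl u) in H1; rewrite /dl in H0 *; lra.
Qed.
End weak_derivatives.

(** * Nash's inequality on a convex domain *)

Section nash.
Implicit Types (f w : V -> R) (x y : V).

Lemma ext_sqr f x : ext f x ^+ 2 = ext (fun x => f x ^+ 2) x.
Proof. by rewrite /ext exprMn indicE; case: (_ \in _); rewrite ?expr1n ?expr0n. Qed.

Lemma ext_norm f x : `|ext f x| = ext (fun x => `|f x|) x.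
Proof. by rewrite /ext normrM indicE normr_nat. Qed.

Lemma inner_cubes_cbox (r : R) x : 0 < r -> inner_cubes D r x -> cbox x (r / 2) `<=` D.
Proof.
move=> r0 Sx y hy; apply: Sx => j; apply: le_lt_trans (hy j) _.
by rewrite ltr_pdivrMr// mulr_natr mulr2n ltrDl.
Qed.

(** Nash's inequality with a free length [s]. For fixed [y], w(x) is compared with w((1 - s) x + s
    y), a displacement of size O(s) that stays in the domain; averaging over [y] then sees w only
    through its L^1 norm, at the price s^-d of the change of variable. *)
Lemma nash : exists2 C : R, 0 <= C & forall w (g : 'I_d -> V -> R) (B s : R),
  H1grad w g -> (forall x, `|w x| <= B) -> 0 < s <= 1 / 2 ->
  \int[m]_x (w x ^+ 2) <= C * (s ^+ 2 * \sum_j \int[m]_x (g j x ^+ 2) +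
                               s ^- d * (\int[m]_x `|w x|) ^+ 2).
Proof.
have [Rn hR] := dom_box; set Rd : R := Rn%:R + 1.
have Rd0 : 0 < Rd by rewrite ltr_wpDl.
have mD0 := lebD_gt0; have mDy := lebD_lty.
have mDE : leb D setT = mu D by rewrite lebE setTI.
rewrite mDE in mD0 mDy; have mDf : mu D = (fine (mu D))%:E by rewrite fineK// ge0_fin_numE.
set vD := fine (mu D) in mDf; have vD0 : 0 < vD by rewrite -lte_fin -mDf.
set C1 : R := 2 * (2 * Rd) ^+ 2 * (2 * (d%:R + 1)) * 2 ^+ d.
have d10 : 0 < d%:R + 1 :> R by rewrite ltr_wpDl.
have C10 : 0 <= C1 by rewrite !mulr_ge0// ltW.
exists (C1 + 4 / vD); first by rewrite addr_ge0// divr_ge0// ltW.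
move=> w g B s hw wB s12; have s0 : 0 < s by case/andP: s12.
have [hw2 hg] := hw; have mw := L2_measurable hw2.
have B0 : 0 <= B by exact: le_trans (wB 0).
set G := \sum_j _; set L := \int[m]_x `|w x|.
have GE : G = \sum_j \int[mu]_x (ext (g j) x ^+ 2).
  apply: eq_bigr => j _; rewrite Rintegral_leb; last first.
    by apply: measurable_funX; exact: L2_measurable (hg j).1.
  by apply: RI_ext => x; rewrite ext_sqr.
have G0 : 0 <= G by apply: sumr_ge0 => j _; apply: RI_ge0 => x; exact: sqr_ge0.
have L0 : 0 <= L by apply: RI_ge0.
have iw : Ig mu (ext w) by exact: L2_ext_integrable.
have NL : N1 (ext w) = L%:E.
  rewrite /L Rintegral_leb; last exact: measurableT_comp.
  rewrite /N1 -(Ig_fin (Ig_ext (ext_norm w) (Ig_abs iw))).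
  by apply: eq_integral => x _; rewrite ext_norm.
apply/ler_addgt0Pr => eta eta0.
(* [e] bounds the measure of the boundary strip left out: at most half of the volume, so that
   averaging over the margin set [S] costs only a factor 2, and small enough that w^2 <= B^2 loses
   at most [eta] there. *)
set e := Num.min (vD / 2) (eta / (B ^+ 2 + 1)).
have B20 : 0 < B ^+ 2 + 1 by rewrite ltr_wpDl ?sqr_ge0.
have e0 : 0 < e by rewrite lt_min !divr_gt0.
have [k hk] := inner_cubes_cvg (@dom_open _ _ D) mDy e0.
set r : R := k.+1%:R^-1 in hk; have r0 : 0 < r by rewrite invr_gt0.
set S := inner_cubes D r in hk; have mS : measurable S by exact: measurable_inner_cubes.
have SD : S `<=` D by exact: inner_cubes_sub.
have mm := measurable_dom.
have mSfin : (mu S < +oo)%E by apply: le_lt_trans mDy; apply: le_measure; rewrite ?inE.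
have mSE : mu S = (fine (mu S))%:E by rewrite fineK// ge0_fin_numE.
set vS := fine (mu S) in mSE.
have vS2 : vD / 2 <= vS.
  have : (mu D <= mu S + mu (D `\` S))%E.
    rewrite -{1}(setDUK SD); apply: measureU2 => //; exact: measurableD.
  rewrite mDf mSE => h; have := le_trans h (leeD2l _ hk); rewrite -EFinD lee_fin.
  have : e <= vD / 2 by rewrite ge_min lexx.
  lra.
have m1S : mfun (\1_S : V -> R) by exact: measurable_indic.
pose psi x := \1_S x * w x.
have mpsi : mfun psi by exact: measurable_funM.
have psiw x : `|psi x| <= `|w x|.
  by rewrite /psi indicE; case: (x \in S); rewrite ?mul1r// mul0r normr0.
have psiB x : `|psi x| <= B by exact: le_trans (wB x).
have psiS x : psi x != 0 -> S x.
  by rewrite /psi indicE; case: (boolP (x \in S)); rewrite ?inE// mul0r eqxx.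
have psiE x : `|psi x| <= `|ext w x|.
  have [->|/psiS/SD Dx] := eqVneq (psi x) 0; first by rewrite normr0.
  by rewrite ext_in.
have ipsi : Ig mu psi.
  by apply: (Ig_le mpsi (Ig_abs iw)) => x; exact: psiE.
set I := \int[mu]_x (psi x ^+ 2).
have ip2 : Ig mu (fun x => psi x ^+ 2).
  by have := integrable_mul_bounded ipsi mpsi psiB; apply: Ig_ext => x.
have xb x j : S x -> `|x 0 j| <= Rd.
  by move=> /SD/hR/(_ j) h; rewrite ltW// (lt_le_trans h)// lerDl.
have K1 y : S y -> I <= 2 * `|\int[mu]_x (psi x * ext w ((1 - s) *: x + s *: y))| + C1 * s ^+ 2 * G.
  move=> Sy; have a01 : 0 <= s <= 1 / 2 by case/andP: s12 => ? ->; rewrite ltW.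
  set Vb := 2 * Rd * s; have Vb0 : 0 < Vb by rewrite !mulr_gt0.
  have r20 : 0 < r / 2 by rewrite divr_gt0.
  have H x : psi x != 0 -> [/\ cbox x (r / 2) `<=` D, cbox (x + (s *: y - s *: x)) (r / 2) `<=` D &
      forall j, `|(s *: y - s *: x) 0 j| <= Vb].
    move=> /psiS Sx; split; first exact: inner_cubes_cbox.
    - rewrite -scalerBr; apply: cbox_segment; first exact: inner_cubes_cbox.
        by rewrite addrC subrK; exact: inner_cubes_cbox.
      by rewrite s0; case/andP: s12 => _ ?; lra.
    - move=> j; rewrite !mxE -mulrBr normrM gtr0_norm// /Vb mulrC ler_wpM2r ?(ltW s0)//.
      by rewrite (le_trans (ler_normB _ _))// mulr_natl mulr2n lerD// xb.
  (* This parameter makes the term in [I] at most I/2, which is absorbed; the other terms are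
     doubled. *)
  have t0 : 0 < (2 * Vb * (d%:R + 1))^-1 by rewrite invr_gt0 !mulr_gt0.
  have := difference_bound hw mpsi B0 psiB a01 (ltW Vb0) r20 H t0.
  rewrite -/I (_ : \int[mu]_x _ = \int[mu]_x (psi x * ext w ((1 - s) *: x + s *: y)) - I); last first.
    have s1 : 0 < 1 - s by case/andP: s12 => _ ?; lra.
    have i1 : Ig mu (fun x => psi x * ext w ((1 - s) *: x + s *: y)).
      have ia := integrable_affine (s *: y) s1 iw.
      by have := integrable_mul_bounded ia mpsi psiB; apply: Ig_ext => x; rewrite mulrC.
    rewrite /I -RI_B//; apply: RI_ext => x.
    have -> : x + (s *: y - s *: x) = (1 - s) *: x + s *: y.
      by apply/rowP => j; rewrite !mxE; ring.
    have [->|px] := eqVneq (psi x) 0; first by rewrite !mul0r expr0n subr0.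
    have Sx := psiS x px; rewrite mulrBr expr2; congr (_ - _ * _).
    by rewrite ext_in ?/psi ?indicE ?mem_set ?mul1r//; exact: SD.
  rewrite big_split /= sumr_const card_ord -mulr_sumr -GE -[X in Vb * (X + _)]mulr_natr invrK.
  set Z := \int[mu]_x _ => HZ.
  have H2 : I <= `|Z| + Vb * ((2 * Vb * (d%:R + 1))^-1 * I * d%:R + 2 * Vb * (d%:R + 1) * 2 ^+ d * G).
    have : I - `|Z| <= `|Z - I| by rewrite distrC; apply: le_trans (lerB_dist _ _); rewrite lerD2r ler_norm.
    lra.
  have I0 : 0 <= I by apply: RI_ge0 => x; exact: sqr_ge0.
  have : Vb * ((2 * Vb * (d%:R + 1))^-1 * I * d%:R) <= I / 2.
    rewrite [leLHS](_ : _ = I / 2 * (d%:R / (d%:R + 1))); last by field; rewrite !gt_eqF.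
    by rewrite ler_piMr ?divr_ge0// ler_pdivrMr// mul1r lerDl.
  rewrite (_ : C1 * s ^+ 2 * G = 2 * (Vb * (2 * Vb * (d%:R + 1) * 2 ^+ d * G))); last by rewrite /C1 /Vb; ring.
  move: H2; rewrite mulrDr; lra.
pose h (z : V * V) : R := psi z.1 * ext w ((1 - s) *: z.1 + s *: z.2).
have mh : mfun (fun z => `|h z|%:E).
  apply/mEFinP; apply: measurableT_comp => //; apply: measurable_funM.
    exact: (measurableT_comp mpsi).
  apply: (measurableT_comp (measurable_ext mw)); apply: measurable_rV => j.
  under eq_fun do rewrite !mxE; apply: measurable_funD; apply: measurable_funM => //.
    exact: (measurableT_comp (@coord_measurable R d j)).
  exact: (measurableT_comp (@coord_measurable R d j)).
have hh0 z : (0 <= `|h z|%:E)%E by rewrite lee_fin.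
pose H y : \bar R := (\int[mu]_x `|h (x, y)|%:E)%E.
have mH : mfun H by exact: (@measurable_fun_fubini_tonelli_G _ _ _ _ _ mu _ mh).
have H0 y : (0 <= H y)%E by apply: integral_ge0.
have HK y : S y -> (I%:E <= 2%:E * H y + (C1 * s ^+ 2 * G)%:E)%E.
  move=> /K1 h1; apply: (le_via ((2 * `|\int[mu]_x h (x, y)|)%:E + (C1 * s ^+ 2 * G)%:E)%E).
    by rewrite -EFinD lee_fin.
  rewrite leeD2r// EFinM lee_wpmul2l ?lee_fin//; apply: Rintegral_le_N1.
  have s1 : 0 < 1 - s by case/andP: s12 => _ ?; lra.
  have ia := integrable_affine (s *: y) s1 iw.
  by have := integrable_mul_bounded ia mpsi psiB; apply: Ig_ext => x; rewrite /h/= mulrC.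
have mpn := mfun_norm mpsi.
(* For fixed x the map y |-> (1 - s) x + s y has Jacobian s^d, so the inner integral is s^-d times
   the L^1 norm of w. *)
have HI : (\int[mu]_y H y <= (s ^- d * L ^+ 2)%:E)%E.
  rewrite /H -(@fubini_tonelli _ _ _ _ _ mu mu _ mh hh0).
  apply: (le_via (\int[mu]_x (`|psi x|%:E * (s ^- d * L)%:E))%E).
    apply: ge0_le_integral; first exact: measurableT.
    - by move=> x _; apply: integral_ge0 => y _; exact: hh0.
    - exact: (@measurable_fun_fubini_tonelli_F _ _ _ _ _ mu _ mh).

    - by apply: emeasurable_funM => //; apply/mEFinP; exact: measurableT_comp.
    move=> x _; under eq_integral do rewrite /h /= normrM EFinM.
    have ma : mfun (fun y : V => `|ext w ((1 - s) *: x + s *: y)|%:E).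
      have := mfun_norm (measurableT_comp (measurable_ext mw) (measurable_affine s ((1 - s) *: x))).
      by apply: eq_measurable_fun => y _ /=; rewrite addrC.
    rewrite ge0_integralZl_EFin// lee_wpmul2l ?lee_fin//.
    have := N1_affine ((1 - s) *: x) s0 (measurable_ext mw).
    rewrite NL -EFinM -exprVn => <-; rewrite /N1 le_eqVlt; apply/orP; left; apply/eqP.
    by apply: eq_integral => y _; rewrite addrC.
  rewrite ge0_integralZr//; last by rewrite lee_fin !mulr_ge0// invr_ge0 exprn_ge0// ltW.
  apply: (le_via (L%:E * (s ^- d * L)%:E)%E).
    apply: lee_wpmul2r; first by rewrite lee_fin !mulr_ge0// invr_ge0 exprn_ge0// ltW.
    by rewrite -NL; apply: N1_le => //; exact: measurable_ext.
  by rewrite -EFinM lee_fin le_eqVlt; apply/orP; left; apply/eqP; ring.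
have main : I <= C1 * s ^+ 2 * G + 4 / vD * (s ^- d * L ^+ 2).
  have I0 : 0 <= I by apply: RI_ge0 => x; exact: sqr_ge0.
  have P0 : 0 <= s ^- d * L ^+ 2 by rewrite mulr_ge0 ?sqr_ge0// invr_ge0 exprn_ge0// ltW.
  have Q0 : 0 <= C1 * s ^+ 2 * G by exact: mulr_ge0 (mulr_ge0 C10 (sqr_ge0 s)) G0.
  have : (\int[mu]_(y in S) I%:E <= \int[mu]_(y in S) (2%:E * H y + (C1 * s ^+ 2 * G)%:E))%E.
    apply: ge0_le_integral; first exact: mS.
    - by move=> y _; rewrite lee_fin.
    - exact: measurable_cst.

    - by apply: emeasurable_funD => //; apply: emeasurable_funM => //; exact: measurable_funTS.
    - exact: HK.
  have mH2 : measurable_fun S (fun y => (2%:E * H y)%E).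
    by apply: emeasurable_funM => //; exact: measurable_funTS.
  rewrite integral_cst// ge0_integralD//; [|by move=> y _; rewrite mule_ge0 ?lee_fin].
  rewrite integral_cst// ge0_integralZl//; [|exact: measurable_funTS].
  move=> h1; have : (I%:E * mu S <= 2%:E * (s ^- d * L ^+ 2)%:E + (C1 * s ^+ 2 * G)%:E * mu S)%E.
    apply: (le_trans h1); rewrite leeD2r// lee_wpmul2l ?lee_fin//; apply: le_trans HI.
    by apply: ge0_subset_integral.
  rewrite mSE -!EFinM -EFinD lee_fin => h2.
  have vS0 : 0 < vS by rewrite (lt_le_trans _ vS2)// divr_gt0.
  have h3 : I <= 2 * (s ^- d * L ^+ 2) / vS + C1 * s ^+ 2 * G.
    by rewrite -(ler_pM2r vS0) mulrDl divfK// gt_eqF.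
  apply: (le_trans h3); rewrite [leLHS]addrC lerD2l mulrAC ler_wpM2r//.
  rewrite (_ : 4 / vD = 2 * (vD / 2)^-1); last by field; rewrite gt_eqF.
  by rewrite ler_wpM2l// lef_pV2 ?posrE ?divr_gt0.
have Iw : \int[m]_x (w x ^+ 2) <= I + eta.
  have mw2 : mfun (fun x => w x ^+ 2) by exact: measurable_funX.
  rewrite Rintegral_leb// (RI_ext _ (g := fun x => ext w x ^+ 2)); last by move=> x; rewrite ext_sqr.
  have iw2 : Ig mu (fun x => ext w x ^+ 2) by exact: L2_ext_sqr.
  have mDS : measurable (D `\` S) by exact: measurableD.
  have mDSfin : (mu (D `\` S) < +oo)%E by rewrite (le_lt_trans hk)// ltry.
  have iDS : Ig mu (fun x => B ^+ 2 * \1_(D `\` S) x).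
    apply: IgZ; apply: IgP; first exact: measurable_indic.
    by rewrite (_ : (\int[mu]_x _)%E = N1 (\1_(D `\` S)))// N1_indic.
  rewrite -lerBlDl -RI_B//.
  apply: (le_via (\int[mu]_x (B ^+ 2 * \1_(D `\` S) x))).
    apply: RI_le => //; first exact: IgB.
    move=> x; rewrite /psi; have [Dx|nDx] := pselect ((D : set V) x); last first.
      rewrite ext_out// expr0n /= sub0r; apply: (@le_trans _ _ 0); first by rewrite oppr_le0 sqr_ge0.
      by rewrite mulr_ge0 ?sqr_ge0// indic_ge0.
    rewrite ext_in// !indicE; have [Sx|nSx] := pselect (S x).
      by rewrite [x \in S]mem_set// mul1r subrr mulr_ge0 ?sqr_ge0.
    rewrite (memNset nSx) mul0r expr0n subr0 [x \in _ `\` _]mem_set; last by split.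
    by rewrite mulr1 -(real_normK (num_real (w x))) lerXn2r ?nnegrE.
  rewrite RI_Z; last by apply: IgP; [exact: measurable_indic|rewrite (_ : (\int[mu]_x _)%E = N1 (\1_(D `\` S)))// N1_indic].
  have -> : \int[mu]_x (\1_(D `\` S) x : R) = fine (mu (D `\` S)).
    by rewrite /Rintegral integral_indic// setIT.
  have : fine (mu (D `\` S)) <= eta / (B ^+ 2 + 1).
    rewrite -lee_fin fineK ?ge0_fin_numE//; apply: le_trans hk _.
    by rewrite lee_fin ge_min lexx orbT.
  rewrite ler_pdivlMr// mulrDr mulr1 mulrC => h1.
  have : 0 <= fine (mu (D `\` S)) by rewrite fine_ge0.
  lra.
apply: (le_trans Iw); rewrite lerD2r; apply: (le_trans main).
have P0 : 0 <= s ^- d * L ^+ 2 by rewrite mulr_ge0 ?sqr_ge0// invr_ge0 exprn_ge0// ltW.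
have Q0 : 0 <= s ^+ 2 * G by exact: mulr_ge0 (sqr_ge0 s) G0.
have v0 : 0 <= 4 / vD by rewrite divr_ge0// ltW.
rewrite -mulrA mulrDl !mulrDr; have := mulr_ge0 C10 P0; have := mulr_ge0 v0 Q0; lra.
Qed.
End nash.

(** * Chain and product rules in H^1 *)

Section H1_calculus.
Implicit Types (f u w : V -> R) (x : V).

Lemma L2_Ig f : L2 D f -> Ig m f.
Proof. exact: L2_integrable. Qed.

Lemma L2_IgM f w : L2 D f -> L2 D w -> Ig m (fun x => f x * w x).
Proof. exact: L2_integrable_mul. Qed.

Lemma Ig_cst (c : R) : Ig m (cst c).
Proof. exact: L2_Ig (L2_cst c). Qed.

Lemma Ig_mul_bounded f w (B : R) : mfun f -> (forall x, `|f x| <= B) -> Ig m w ->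
  Ig m (fun x => f x * w x).
Proof.
move=> mf fB wi; apply: (Ig_le _ (IgZ B (Ig_abs wi))).
  by apply: measurable_funM => //; exact: Ig_meas wi.
by move=> x; rewrite normrM ler_wpM2r.
Qed.

Lemma Ig_bounded f (B : R) : mfun f -> (forall x, `|f x| <= B) -> Ig m f.
Proof. by move=> mf fB; apply: (Ig_le mf (Ig_cst B)). Qed.

Lemma RI_ae f w : mfun f -> mfun w -> eq_ae D f w ->
  \int[m]_x f x = \int[m]_x w x.
Proof.
move=> mf mw fw; rewrite /Rintegral; congr fine; apply: ae_eq_integral => //; try exact/mEFinP.
by apply: filterS fw => x h _; congr EFin.
Qed.

Lemma eq_ae_refl f : eq_ae D f f.
Proof. exact: aeW. Qed.

Lemma H1_ae u u' (g g' : 'I_d -> V -> R) : H1grad u g -> L2 D u' -> eq_ae D u u' ->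
  (forall i, L2 D (g' i)) -> (forall i, eq_ae D (g i) (g' i)) -> H1grad u' g'.
Proof.
move=> [hu hg] hu' uu' hg' gg'; split => // i; split => // phi tphi.
have mphi := test_measurable tphi; have mdphi := test_partial_measurable tphi i.
have mM f w : mfun f -> L2 D w -> mfun (fun x => w x * f x).
  by move=> mf hw; apply: measurable_funM => //; exact: L2_measurable hw.
rewrite -(RI_ae (mM _ _ mdphi hu) (mM _ _ mdphi hu')); last by apply: filterS uu' => x ->.
rewrite -(RI_ae (mM _ _ mphi (hg i).1) (mM _ _ mphi (hg' i))); last by apply: filterS (gg' i) => x ->.
by have [_ /(_ _ tphi)] := hg i.
Qed.

Lemma H1_chain u (g : 'I_d -> V -> R) (F dF : R -> R) (B L : R) : H1grad u g ->
  L2 D (fun x => F (u x)) -> mfun dF -> (forall t, `|dF t| <= B) ->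
  (forall a b, `|F b - F a - dF a * (b - a)| <= L * (b - a) ^+ 2) ->
  H1grad (fun x => F (u x)) (fun i x => dF (u x) * g i x).
Proof.
move=> hu hF mdF dFB FL; have mu' := measurable_H1 hu.
have B0 : 0 <= B by exact: le_trans (dFB 0).
have -> : (fun i x => dF (u x) * g i x) = (fun i x => dF (u x) * g i x + cst 0 x * g i x).
  by apply/funext => i; apply/funext => x; rewrite mul0r addr0.
apply: (@H1_combine u g u g _ _ _ B `|L| hu hu hF).
- exact: measurableT_comp.
- exact: measurable_cst.
- by move=> x.
- by move=> x; rewrite normr0.
move=> x y; rewrite mul0r subr0; apply: le_trans (FL _ _) _.
apply: (le_via (`|L| * (u y - u x) ^+ 2)); first by rewrite ler_wpM2r ?sqr_ge0// ler_norm.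
by rewrite ler_wpM2l// lerDl sqr_ge0.
Qed.

Lemma H1_mul u (gu : 'I_d -> V -> R) w (gw : 'I_d -> V -> R) (B : R) :
  H1grad u gu -> H1grad w gw ->
  (forall x, `|u x| <= B) -> (forall x, `|w x| <= B) ->
  H1grad (fun x => u x * w x) (fun i x => w x * gu i x + u x * gw i x).
Proof.
move=> hu hw uB wB; have mu' := measurable_H1 hu; have mw := measurable_H1 hw.
have [hu2 _] := hu; have [hw2 _] := hw.
have huw : L2 D (fun x => u x * w x) by exact: L2_mul_bounded uB hw2.
apply: (@H1_combine u gu w gw _ _ _ B 1 hu hw huw) => // x y.
rewrite mul1r (_ : _ - _ - _ = (u y - u x) * (w y - w x)); last by ring.
move: (u y - u x) (w y - w x) => a b; rewrite ler_norml; apply/andP; split; nra.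
Qed.

Lemma H1_D u (gu : 'I_d -> V -> R) w (gw : 'I_d -> V -> R) :
  H1grad u gu -> H1grad w gw ->
  H1grad (fun x => u x + w x) (fun i x => gu i x + gw i x).
Proof.
move=> hu hw; have -> : (fun i x => gu i x + gw i x) = (fun i x => cst 1 x * gu i x + cst 1 x * gw i x).
  by apply/funext => i; apply/funext => x; rewrite !mul1r.
apply: (@H1_combine u gu w gw _ (cst 1) (cst 1) 1 0 hu hw); try exact: measurable_cst.
- by apply: L2D; [case: hu|case: hw].
- by move=> x; rewrite normr1.
- by move=> x; rewrite normr1.
by move=> x y; rewrite mul0r !mul1r (_ : _ - _ - _ = 0) ?normr0//; ring.
Qed.

Lemma H1_Z (c : R) u (gu : 'I_d -> V -> R) :
  H1grad u gu -> H1grad (fun x => c * u x) (fun i x => c * gu i x).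
Proof.
move=> hu; have -> : (fun i x => c * gu i x) = (fun i x => cst c x * gu i x + cst 0 x * gu i x).
  by apply/funext => i; apply/funext => x; rewrite mul0r addr0.
apply: (@H1_combine u gu u gu _ (cst c) (cst 0) `|c| 0 hu hu); try exact: measurable_cst.
- by apply: L2Z; case: hu.
- by move=> x.
- by move=> x; rewrite normr0.
by move=> x y; rewrite !mul0r subr0 (_ : _ - _ - _ = 0) ?normr0//=; ring.
Qed.
End H1_calculus.

(** * Level sets and truncations *)

Section level_sets.
Implicit Types (f u w : V -> R) (x : V) (k dl s : R).

Definition level u k : set V := [set x | k < u x].

Definition levm u k : R := \int[m]_x (\1_(level u k) x).

Lemma measurable_level u k : mfun u -> measurable (level u k).
Proof.
move=> mu'; have -> : level u k = setT `&` u @^-1` `]k, +oo[%classic.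
  by rewrite setTI; apply/seteqP; split => x /=; rewrite /level /= in_itv/= andbT.
by apply: mu' => //; exact: measurable_itv.
Qed.

Lemma measurable_levelI u k : mfun u -> mfun (\1_(level u k) : V -> R).
Proof. by move=> /measurable_level ?; exact: measurable_indic. Qed.

Lemma indic_bound (A : set V) x : `|\1_A x| <= 1 :> R.
Proof. by rewrite indicE normr_nat; case: (_ \in _). Qed.

Lemma Ig_level u k : mfun u -> Ig m (\1_(level u k) : V -> R).
Proof. by move=> mu'; apply: (@Ig_bounded _ 1); [exact: measurable_levelI|move=> x; exact: indic_bound]. Qed.

Lemma indic_ge0 (A : set V) x : 0 <= \1_A x :> R.
Proof. by rewrite indicE ler0n. Qed.

Lemma levm_ge0 u k : 0 <= levm u k.
Proof. by apply: RI_ge0 => x; exact: indic_ge0. Qed.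

Lemma level_indicE u k x : \1_(level u k) x = (k < u x)%R%:R :> R.
Proof. by rewrite indicE; congr (_%:R); congr nat_of_bool; apply/idP/idP; rewrite inE. Qed.

Lemma levm_le u k k' : mfun u -> k <= k' -> levm u k' <= levm u k.
Proof.
move=> mu' kk'; apply: RI_le; try exact: Ig_level.
move=> x; rewrite !level_indicE ler_nat; case: ltP => // h; rewrite lt0b.
by rewrite (le_lt_trans kk' h).
Qed.

Section trunc.
Variables (u : V -> R) (g : 'I_d -> V -> R) (hu : H1grad u g).
Let mu' : mfun u := measurable_H1 hu.

Lemma trunc_bound k dl x : 0 < dl -> 0 <= trunc k dl (u x) <= dl * \1_(level u k) x.
Proof.
move=> dl0; rewrite /trunc level_indicE; have /andP[s0 s1] := sstep_bound ((u x - k) / dl).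
rewrite mulr_ge0 ?(ltW dl0)//= ler_pM2l//; case: ltP => //= h.
by rewrite sstep_le0// pmulr_lle0 ?invr_gt0// subr_le0.
Qed.

Lemma trunc_le k dl x : 0 < dl -> `|trunc k dl (u x)| <= dl.
Proof.
move=> dl0; have /andP[t0 t1] := trunc_bound k x dl0.
rewrite ger0_norm//; apply: le_trans t1 _; rewrite level_indicE.
by case: (_ < _); rewrite ?mulr1// mulr0 ltW.
Qed.

Lemma measurable_trunc_comp k dl : mfun (fun x => trunc k dl (u x)).
Proof. exact: (measurableT_comp (measurable_trunc k dl)). Qed.

Lemma H1_trunc k dl : 0 < dl ->
  H1grad (fun x => trunc k dl (u x)) (fun i x => dtrunc k dl (u x) * g i x).
Proof.
move=> dl0; apply: (@H1_chain u g _ _ (3 / 2) (9 / dl) hu).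
- by apply: (@L2_bounded _ dl); [exact: measurable_trunc_comp|move=> x; exact: trunc_le].
- exact: measurable_dtrunc.
- by move=> t; have /andP[h0 h1] := dsstep_bound ((t - k) / dl); rewrite ger0_norm.
- by move=> a b; exact: trunc_taylor.
Qed.
End trunc.
End level_sets.

(** * De Giorgi's supremum bound for the weak Neumann problem *)

Section de_giorgi.
Implicit Types (f u w : V -> R) (x : V) (k dl s : R).

(** Nash for the truncation between the levels k and k + dl: it equals dl above k + dl, while it is
    at most dl and vanishes outside {u > k}. *)
Lemma trunc_nash : exists2 C : R, 0 < C & forall u (g : 'I_d -> V -> R) k dl s,
  H1grad u g -> 0 < dl -> 0 < s <= 1 / 2 ->
  dl ^+ 2 * levm u (k + dl) <=
  C * (s ^+ 2 * \sum_j \int[m]_x ((dtrunc k dl (u x) * g j x) ^+ 2) +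
       s ^- d * (dl * levm u k) ^+ 2).
Proof.
have [C C0 hC] := nash; exists (C + 1); first by rewrite ltr_wpDl.
move=> u g k dl s hu dl0 s12; have mu' := measurable_H1 hu.
have s0 : 0 < s by case/andP: s12.
have h := hC _ _ dl s (H1_trunc hu k dl0) (fun x => trunc_le u k x dl0) s12.
have mt := measurable_trunc_comp hu k dl.
have it : Ig m (fun x => trunc k dl (u x)).
  by apply: (@Ig_bounded _ dl mt) => x; exact: trunc_le.
have it2 : Ig m (fun x => trunc k dl (u x) ^+ 2).
  by apply: L2_sqr; exact: (L2_bounded mt (fun x => trunc_le u k x dl0)).
have b1 : dl ^+ 2 * levm u (k + dl) <= \int[m]_x (trunc k dl (u x) ^+ 2).
  rewrite /levm -RI_Z; last exact: Ig_level.
  apply: RI_le => //; first by apply: IgZ; exact: Ig_level.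
  move=> x; rewrite level_indicE; case: ltP => [h1|_]; last by rewrite mulr0 sqr_ge0.
  rewrite mulr1 /trunc sstep_ge1 ?mulr1// ler_pdivlMr// mul1r; lra.
have b2 : \int[m]_x `|trunc k dl (u x)| <= dl * levm u k.
  rewrite /levm -RI_Z; last exact: Ig_level.
  apply: RI_le; [exact: Ig_abs|by apply: IgZ; exact: Ig_level|].
  by move=> x; have /andP[h1 h2] := trunc_bound u k x dl0; rewrite ger0_norm.
apply: (le_trans b1); apply: (le_trans h).
set P := \sum_j _; have P0 : 0 <= P by apply: sumr_ge0 => j _; apply: RI_ge0 => x; exact: sqr_ge0.
apply: ler_pM => //.
- by rewrite addr_ge0// mulr_ge0 ?sqr_ge0// invr_ge0 exprn_ge0// ltW.
- by rewrite lerDl.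
- rewrite lerD2l ler_wpM2l//; first by rewrite invr_ge0 exprn_ge0// ltW.
  by rewrite lerXn2r ?nnegrE// ?mulr_ge0 ?(ltW dl0) ?levm_ge0// RI_ge0.
Qed.

Lemma level_null u k : mfun u -> levm u k = 0 -> {ae m, forall x, u x <= k}.
Proof.
move=> mu' h0; exists (level u k); split; first exact: measurable_level.
  have := Ig_fin (Ig_level k mu'); rewrite -/(levm u k) h0 integral_indic ?setIT//.
  exact: measurable_level.
by move=> x /= h; rewrite /level /= ltNge; apply/negP.
Qed.

(** The test space is all of H^1, not only functions vanishing near the boundary: the Neumann
    condition is encoded by the choice of test functions. *)
Definition weak_solution (g : 'I_d -> V -> R) f := forall phi (q : 'I_d -> V -> R), H1grad phi q ->
  \sum_j \int[m]_x (g j x * q j x) = \int[m]_x (f x * phi x).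

(** The equation is tested with the truncation itself. As dtrunc^2 <= (3/2) dtrunc, its energy is at
    most (3/2) P with P the integral of f times the truncation, which Cauchy-Schwarz bounds on the
    level set. *)
Lemma dtrunc_energy u g f k dl : H1grad u g -> L2 D f -> weak_solution g f -> 0 < dl ->
  exists P : R, \sum_j \int[m]_x ((dtrunc k dl (u x) * g j x) ^+ 2) <= 3 / 2 * P /\
   P ^+ 2 <= \int[m]_x (f x ^+ 2) * (dl ^+ 2 * levm u k).
Proof.
move=> hu hf wf dl0; have mu' := measurable_H1 hu; have [_ hg] := hu.
have mdt : mfun (fun x => dtrunc k dl (u x)) by exact: (measurableT_comp (measurable_dtrunc k dl)).
have dtb t : 0 <= dtrunc k dl t <= 3 / 2 by exact: dsstep_bound.
have ht := H1_trunc hu k dl0; have mt := measurable_trunc_comp hu k dl.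
exists (\int[m]_x (f x * trunc k dl (u x))); split.
  rewrite -(wf _ _ ht) mulr_sumr; apply: ler_sum => j _.
  have i1 : Ig m (fun x => g j x * (dtrunc k dl (u x) * g j x)).
    by apply: L2_IgM; [exact: (hg j).1|exact: (ht.2 j).1].
  rewrite -RI_Z//; apply: RI_le; [exact: (L2_sqr (ht.2 j).1)|exact: IgZ|].
  move=> x; rewrite (_ : (_ * _) ^+ 2 = dtrunc k dl (u x) * (dtrunc k dl (u x) * g j x ^+ 2)); last by ring.
  rewrite (_ : 3 / 2 * _ = 3 / 2 * (dtrunc k dl (u x) * g j x ^+ 2)); last by ring.
  by have /andP[h1 h2] := dtb (u x); rewrite ler_wpM2r// mulr_ge0 ?sqr_ge0.
have hT : L2 D (fun x => trunc k dl (u x)) by case: ht.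
apply: (le_trans (RI_CS (L2_measurable hf) (L2_measurable hT) (L2_sqr hf) (L2_sqr hT))).
rewrite ler_wpM2l ?RI_ge0// => [x|]; first exact: sqr_ge0.
rewrite /levm -RI_Z; last exact: Ig_level.
apply: RI_le; [exact: (L2_sqr hT)|by apply: IgZ; exact: Ig_level|].
move=> x; have /andP[h1 h2] := trunc_bound u k x dl0.
apply: (le_via ((dl * \1_(level u k) x) ^+ 2)); first by rewrite lerXn2r ?nnegrE// mulr_ge0 ?(ltW dl0)// indic_ge0.
by rewrite level_indicE exprMn; case: (_ < _); rewrite ?expr1n ?expr0n.
Qed.

(* De Giorgi iteration over the levels k0 (2 - 2^-n). *)
Lemma sup_bound : exists2 C : R, 0 < C & forall u g f s k0, H1grad u g -> L2 D f ->
  weak_solution g f -> 0 < s <= 1 / 2 -> 0 < k0 ->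
  C * (s ^- d * \int[m]_x (u x ^+ 2) + s ^+ 4 * s ^- d * \int[m]_x (f x ^+ 2)) <= k0 ^+ 2 ->
  {ae m, forall x, u x <= 2 * k0}.
Proof.
have [C C0 hC] := trunc_nash.
have /andP[d1 d3] := d_range.
set th : R := 4^-1 ^+ d; have th0 : 0 < th by rewrite exprn_gt0.
have th1 : th < 1 by rewrite exprn_ilt1 -?lt0n// invf_lt1// ltr1n.
(* [c] and the ratio [th] are fixed by the recursion: for the lengths s_n = s 4^-n one has s_n^-d =
   s^-d th^-n, so the quadratic term C s_n^-d (dl A_n)^2 is exactly half of dl^2 A_(n+1). The other
   half is left for the source. *)
set c := th / (2 * C); have c0 : 0 < c by rewrite divr_gt0// mulr_gt0.
set C1 : R := 36 * C ^+ 2 / (th ^+ 2 * c).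
have C10 : 0 < C1 by apply: divr_gt0; apply: mulr_gt0 => //; exact: exprn_gt0.
exists (c^-1 + C1); first by rewrite addr_gt0// invr_gt0.
move=> u g f s k0 hu hf wf /andP[s0 s12] k00.
set U := \int[m]_x (u x ^+ 2); set F := \int[m]_x (f x ^+ 2) => hk.
have mu' := measurable_H1 hu; have [hu2 _] := hu.
have U0 : 0 <= U by apply: RI_ge0 => x; exact: sqr_ge0.
have F0 : 0 <= F by apply: RI_ge0 => x; exact: sqr_ge0.
have sd : 0 < s ^+ d by rewrite exprn_gt0.
have s4 : 0 < s ^+ 4 by rewrite exprn_gt0.
have hkU : c^-1 * (s ^- d * U) <= k0 ^+ 2.
  apply: le_trans hk; have p1 : 0 <= s ^- d * U by rewrite mulr_ge0// invr_ge0 ltW.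
  have p2 : 0 <= s ^+ 4 * s ^- d * F by rewrite !mulr_ge0// ?invr_ge0 ltW.
  have ci : 0 < c^-1 by rewrite invr_gt0.
  nra.
have hkF : C1 * (s ^+ 4 * s ^- d * F) <= k0 ^+ 2.
  apply: le_trans hk; have p1 : 0 <= s ^- d * U by rewrite mulr_ge0// invr_ge0 ltW.
  have p2 : 0 <= s ^+ 4 * s ^- d * F by rewrite !mulr_ge0// ?invr_ge0 ltW.
  have ci : 0 < c^-1 by rewrite invr_gt0.
  nra.
pose kn n : R := k0 * (2 - 2^-1 ^+ n).
pose An n : R := c * s ^+ d * th ^+ n.
have An0 n : 0 < An n by rewrite /An; pos.
have key n : levm u (kn n) <= An n.
  elim: n => [|n ih].
    rewrite /kn /An !expr0 mulr1 (_ : 2 - 1 = 1) ?mulr1; last by ring.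
    have : k0 ^+ 2 * levm u k0 <= U.
      rewrite /levm -RI_Z; last exact: Ig_level.
      apply: RI_le; [by apply: IgZ; exact: Ig_level|exact: L2_sqr|].
      move=> x; rewrite level_indicE; case: ltP => [h1|_]; last by rewrite mulr0 sqr_ge0.
      by rewrite mulr1 lerXn2r ?nnegrE ?(ltW k00)// ltW// (lt_trans k00).
    move: hkU; rewrite mulrA -invfM (ler_pdivrMl _ _ (mulr_gt0 c0 sd)) => h1 h2.
    by rewrite -(ler_pM2l (exprn_gt0 2 k00)) (le_trans h2)// mulrC.
  set dl := k0 * 2^-1 ^+ n.+1; have dl0 : 0 < dl by rewrite mulr_gt0// exprn_gt0.
  have -> : kn n.+1 = kn n + dl by rewrite /kn /dl exprS; field.
  set sn := s * 4^-1 ^+ n; have sn0 : 0 < sn by rewrite mulr_gt0// exprn_gt0.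
  have sn12 : 0 < sn <= 1 / 2.
    rewrite sn0/=; apply: le_trans s12; rewrite ler_piMr ?(ltW s0)// exprn_ile1//.
    by rewrite invf_le1// ler1n.
  have := hC u g (kn n) dl sn hu dl0 sn12.
  have [P [hP1 hP2]] := dtrunc_energy (kn n) hu hf wf dl0.
  set G := \sum_j _ in hP1 *; rewrite -/F in hP2; set a := levm u (kn n) in hP2 ih *.
  set a' := levm u _ => h; have a0 : 0 <= a by exact: levm_ge0.
  have G0 : 0 <= G by apply: sumr_ge0 => j _; apply: RI_ge0 => x; exact: sqr_ge0.
  have P0 : 0 <= P by lra.
  have An0n := An0 n.
  have dl20 : 0 < dl ^+ 2 by rewrite exprn_gt0.
  rewrite -(ler_pM2l dl20); apply: (le_trans h).
  have h1 : C * (sn ^- d * (dl * a) ^+ 2) <= dl ^+ 2 * (th * An n) / 2.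
    apply: (le_via (C * (sn ^- d * (dl ^+ 2 * An n ^+ 2)))).
      rewrite ler_wpM2l ?(ltW C0)// ler_wpM2l ?invr_ge0 ?exprn_ge0 ?(ltW sn0)//.
      by rewrite exprMn ler_wpM2l ?sqr_ge0// lerXn2r ?nnegrE// ltW.
    rewrite le_eqVlt; apply/orP; left; apply/eqP; rewrite /An /sn exprMn -exprM mulnC exprM -/th /c.
    by field; rewrite !gt_eqF ?exprn_gt0.
  have h2 : C * (sn ^+ 2 * (3 / 2 * P)) <= dl ^+ 2 * (th * An n) / 2.
    rewrite -[leLHS]ger0_norm; last by pos.
    rewrite -[leRHS]ger0_norm; last by pos.
    rewrite -ler_sqr ?nnegrE// !real_normK ?num_real//.
    rewrite (_ : (C * _) ^+ 2 = (C * (sn ^+ 2 * (3 / 2))) ^+ 2 * P ^+ 2); last by ring.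
    apply: (le_via ((C * (sn ^+ 2 * (3 / 2))) ^+ 2 * (F * (dl ^+ 2 * An n)))).
      rewrite ler_wpM2l ?sqr_ge0//; apply: (le_trans hP2).
      by rewrite ler_wpM2l// ler_wpM2l// ltW.
    rewrite (_ : _ * (F * _) = (dl ^+ 2 * An n / 4) * (9 * C ^+ 2 * sn ^+ 4 * F)); last by field.
    rewrite (_ : (_ / 2) ^+ 2 = (dl ^+ 2 * An n / 4) * (dl ^+ 2 * (th ^+ 2 * An n))); last by field.
    apply: ler_wpM2l; first by pos.
    apply: (le_via (k0 ^+ 2 * (4^-1 ^+ n.+1 * (th ^+ 2 * An n)))); last first.
      have e4 : (2^-1 : R) ^+ 2 = 4^-1 by field.
      have <- : k0 ^+ 2 * 4^-1 ^+ n.+1 = dl ^+ 2 by rewrite /dl exprMn -e4 -!exprM mulnC.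
      by rewrite -[leRHS]mulrA.
    rewrite -ler_pdivrMr; last by pos.
    apply: le_trans hkF; rewrite ler_pdivrMr; last by pos.
    rewrite /C1 /An /sn.
    rewrite (_ : (s * 4^-1 ^+ n) ^+ 4 = s ^+ 4 * (4^-1 ^+ n) ^+ 4); last by rewrite exprMn.
    rewrite [leRHS](_ : _ = 9 * C ^+ 2 * s ^+ 4 * F * (4^-1 ^+ n * th ^+ n)); last first.
      rewrite (exprS 4^-1 n); move: (4^-1 ^+ n) (th ^+ n) => q tn.
      by field; rewrite !gt_eqF.
    rewrite (_ : _ * F = 9 * C ^+ 2 * s ^+ 4 * F * (4^-1 ^+ n) ^+ 4); last by ring.
    rewrite ler_wpM2l//; first by pos.
    (* The source term needs 4^(-4n) <= 4^(-n) 4^(-dn), that is d <= 3. *)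
    rewrite /th -!exprM -exprD ler_wiXn2l ?invr_ge0 ?invf_le1 ?ler1n//.
    by rewrite -mulSn mulnC leq_mul2l ltnS d3 orbT.
  have : C * (sn ^+ 2 * G) <= C * (sn ^+ 2 * (3 / 2 * P)).
    by rewrite ler_wpM2l ?(ltW C0)// ler_wpM2l ?sqr_ge0.
  have -> : An n.+1 = th * An n by rewrite /An exprS; ring.
  by rewrite mulrDr; lra.
apply: (level_null mu'); apply/eqP; rewrite -normr_le0 ger0_norm ?levm_ge0//.
apply/ler_addgt0Pr => eta eta0; rewrite add0r.
have cv : An n @[n --> \oo] --> (c * s ^+ d * 0 : R).
  by apply: cvgMr; apply: cvg_expr; rewrite ger0_norm ?(ltW th0).
rewrite mulr0 in cv; have := (cvgrPdist_le _ _).1 cv eta eta0 => -[N _ /(_ N (leqnn N))].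
rewrite sub0r normrN ger0_norm ?(ltW (An0 N))// => /= h.
apply: le_trans h; apply: le_trans (key N); apply: levm_le => //.
by rewrite mulrC ler_wpM2l ?(ltW k00)// gerBl exprn_ge0.
Qed.
End de_giorgi.

(** * The Sobolev embedding of H^1 into L^6 *)

Section sobolev.
Implicit Types (f u w : V -> R) (x : V).

Lemma cube_root (a : R) : 0 <= a -> exists2 r : R, 0 <= r & r ^+ 3 = a.
Proof.
move=> a0; exists (a `^ 3^-1); first exact: powR_ge0.
by rewrite -powR_mulrn ?powR_ge0// -powRrM mulVf ?pnatr_eq0// powRr1.
Qed.

(** A dyadic layer-cake bound: the largest level below t already gives t^6 <= 64 (t0 2^k)^6. *)
Lemma dyadic_sixth (t0 : R) (n : nat) (t : R) : 0 < t0 -> t <= t0 * 2 ^+ n ->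
  Num.max t 0 ^+ 6 <= t0 ^+ 6 + 64 * \sum_(k < n) (t0 * 2 ^+ k) ^+ 6 * (t0 * 2 ^+ k < t)%R%:R.
Proof.
move=> t00; elim: n t => [t|n ih t].
  rewrite mulr1 big_ord0 mulr0 addr0 => h; rewrite lerXn2r ?nnegrE ?le_max ?lexx ?orbT ?(ltW t00)//.
  by rewrite ge_max h ltW.
move=> h; rewrite big_ord_recr /=; case: (ltP (t0 * 2 ^+ n) t) => [h1|/ih]; last by rewrite mulr0 addr0.
rewrite mulr1 mulrDr; apply: (le_via (64 * (t0 * 2 ^+ n) ^+ 6)).
  rewrite (_ : 64 * _ = (t0 * 2 ^+ n.+1) ^+ 6); last by rewrite (exprS 2 n); move: (2 ^+ n) => q; ring.
  have tn0 : 0 < t0 * 2 ^+ n by pos.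
  rewrite max_l ?lerXn2r ?nnegrE//; first by rewrite ltW// (lt_trans tn0).
  by rewrite (le_trans _ h)// ltW// (lt_trans tn0).
  by rewrite ltW// (lt_trans tn0).
rewrite addrA lerDr addr_ge0//; first by pos.
by rewrite mulr_ge0// sumr_ge0// => i _; rewrite mulr_ge0 ?ler0n//; pos.
Qed.

(** The derivatives of truncations at dyadic levels live on the disjoint intervals (t0 2^k, t0
    2^(k+1)), so at most one term is nonzero. Hence the energies of all truncations together cost at
    most 9/4 of the full energy. *)
Lemma dtrunc_disjoint (t0 : R) (n : nat) (t : R) : 0 < t0 ->
  \sum_(k < n) dtrunc (t0 * 2 ^+ k) (t0 * 2 ^+ k) t ^+ 2 <= 9 / 4.
Proof.
move=> t00; elim: n => [|n ih]; first by rewrite big_ord0.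
rewrite big_ord_recr /=.
have tk (k : nat) : 0 < t0 * 2 ^+ k by pos.
have dz (k : nat) : ~~ (t0 * 2 ^+ k < t < t0 * 2 ^+ k.+1) -> dtrunc (t0 * 2 ^+ k) (t0 * 2 ^+ k) t = 0.
  move=> h; apply: dsstep_eq0; apply: contra h => /andP[h1 h2].
  move: h1 h2; rewrite pmulr_lgt0 ?invr_gt0// subr_gt0 ltr_pdivrMr// mul1r => -> /=.
  by rewrite exprS; lra.
case: (ltP (t0 * 2 ^+ n) t) => h; last first.
  by rewrite (dz n) ?expr0n ?addr0// negb_and -leNgt h.
rewrite big1 ?add0r => [|k _]; last first.
  rewrite dz ?expr0n// negb_and -!leNgt; apply/orP; right; apply: le_trans (ltW h).
  by rewrite ler_pM2l// ler_eXn2l ?ltr1n//; case: k.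
have /andP[h1 h2] := dsstep_bound ((t - t0 * 2 ^+ n) / (t0 * 2 ^+ n)).
have -> : 9 / 4 = (3 / 2) ^+ 2 :> R by field.
by rewrite lerXn2r ?nnegrE.
Qed.

(** Maz'ya's truncation method: Nash on each dyadic slab, at a length adapted to the measure of the
    level set, bounds t_(k+1)^6 a_(k+1) by the energy of the slab plus half of t_k^6 a_k. The slab
    energies are summable by disjointness. *)
Lemma sixth_bound : exists2 C : R, 0 < C & forall w (g : 'I_d -> V -> R) (B : R),
  H1grad w g -> (forall x, `|w x| <= B) ->
  0 < \sum_j \int[m]_x (g j x ^+ 2) + \int[m]_x (w x ^+ 2) ->
  \int[m]_x (Num.max (w x) 0 ^+ 6) <= C * (\sum_j \int[m]_x (g j x ^+ 2) + \int[m]_x (w x ^+ 2)) ^+ 3.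
Proof.
have [C C0 hC] := trunc_nash; have /andP[d1 d3] := d_range.
set K := 128 * C; have K0 : 0 < K by rewrite /K; pos.
set La := 8 * K; have La0 : 0 < La by rewrite /La; pos.
set vD := \int[m]_x (1 : R); have vD0 : 0 <= vD by apply: RI_ge0.
set C2 := 4 * K * La ^+ 2 + (6 * K ^+ 2) ^+ 3; have C20 : 0 < C2 by rewrite /C2; pos.
exists (La ^+ 3 * vD + 64 * (C2 / K)); first by pos.
move=> w g B hw wB; set E := _ + _ => E0.
have mw := measurable_H1 hw; have [hw2 hg] := hw.
set U := \int[m]_x (w x ^+ 2) in E E0 *; set G := \sum_j _ in E E0 *.
have U0 : 0 <= U by apply: RI_ge0 => x; exact: sqr_ge0.
have G0 : 0 <= G by apply: sumr_ge0 => j _; apply: RI_ge0 => x; exact: sqr_ge0.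
(* By Chebyshev all level sets from [t0] on have measure at most 1/La, which keeps the lengths
   chosen below at most 1/2. *)
set t0 := Num.sqrt (La * E); have LE0 : 0 < La * E by pos.
have t02 : t0 ^+ 2 = La * E by rewrite sqr_sqrtr// ltW.
have t00 : 0 < t0 by rewrite sqrtr_gt0.
pose t (k : nat) : R := t0 * 2 ^+ k; have tk0 k : 0 < t k by rewrite /t; pos.
pose a k := levm w (t k); have a0 k : 0 <= a k by exact: levm_ge0.
have aL k : a k <= La^-1.
  have : t k ^+ 2 * a k <= U.
    rewrite /a /levm -RI_Z; last exact: Ig_level.
    apply: RI_le; [by apply: IgZ; exact: Ig_level|exact: L2_sqr|].
    move=> x; rewrite level_indicE; case: ltP => [h1|_]; last by rewrite mulr0 sqr_ge0.
    by rewrite mulr1 lerXn2r ?nnegrE ?(ltW (tk0 k))// ltW// (lt_trans (tk0 k)).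
  have tt : t0 ^+ 2 <= t k ^+ 2.
    by rewrite lerXn2r ?nnegrE ?(ltW t00) ?(ltW (tk0 k))// /t ler_peMr ?(ltW t00)// exprn_ege1// ler1n.
  move=> h; have {}h : La * E * a k <= E.
    rewrite -t02; apply: (le_via (t k ^+ 2 * a k)); first by rewrite ler_wpM2r.
    by apply: (le_trans h); rewrite /E lerDr.
  rewrite -(ler_pM2l LE0); apply: (le_trans h).
  by rewrite mulrAC divff ?mul1r// gt_eqF.
have [n hn] : exists n : nat, B <= t n.
  exists (Num.truncn (B / t0)).+1; rewrite /t mulrC -ler_pdivrMr//.
  apply: (le_trans (ltW (truncnS_gt _))); rewrite -natrX ler_nat; exact: ltnW (ltn_expl _ _).
pose Gk k := \sum_j \int[m]_x ((dtrunc (t k) (t k) (w x) * g j x) ^+ 2).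
have Gk0 k : 0 <= Gk k by apply: sumr_ge0 => j _; apply: RI_ge0 => x; exact: sqr_ge0.
have iGk k j : Ig m (fun x => (dtrunc (t k) (t k) (w x) * g j x) ^+ 2).
  have [_ /(_ j)[h _]] := H1_trunc hw (t k) (tk0 k); exact: L2_sqr h.
have sumG : \sum_(k < n) Gk k <= 9 / 4 * G.
  rewrite /Gk exchange_big /= mulr_sumr; apply: ler_sum => j _.
  rewrite -RI_Z; last exact: L2_sqr (hg j).1.
  rewrite -(RI_sum _ (fun k : 'I_n => iGk k j)); apply: RI_le.
  - by apply: Ig_sum.
  - by apply: IgZ; exact: L2_sqr (hg j).1.
  move=> x; under eq_bigr do rewrite exprMn.
  by rewrite -mulr_suml ler_wpM2r ?sqr_ge0//; exact: dtrunc_disjoint.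
set S := \sum_(k < n.+1) t k ^+ 6 * a k.
have S0 : 0 <= S by apply: sumr_ge0 => k _; rewrite mulr_ge0// exprn_ge0// ltW.
(* rho^3 = K S dominates every (t_k^2 s)^3 = K t_k^6 a_k, so each gradient term is at most rho^2
   times the slab energy. The final inequality closes because rho^2 is of order S^(2/3). *)
have [rho rho0 rho3] : exists2 r : R, 0 <= r & r ^+ 3 = K * S by apply: cube_root; rewrite mulr_ge0// ltW.
have step k : (k < n)%N -> t k.+1 ^+ 6 * a k.+1 <= 64 * C * rho ^+ 2 * Gk k + 2^-1 * (t k ^+ 6 * a k).
  move=> kn; have tS : t k.+1 = t k + t k by rewrite /t exprS; ring.
  have -> : t k.+1 ^+ 6 = 64 * t k ^+ 6 by rewrite tS; ring.
  have [ak0|ak0] := eqVneq (a k) 0.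
    have -> : a k.+1 = 0.
      apply/eqP; rewrite eq_le a0 andbT -ak0; apply: levm_le => //.
      by rewrite tS lerDl ltW.
    by have Gk0k := Gk0 k; have tkk := tk0 k; have a0k := a0 k; rewrite mulr0; pos.
  have ak : 0 < a k by rewrite lt_neqAle eq_sym ak0 a0.
  (* s^3 = K a_k makes the Nash term C s^-3 a_k equal to 1/128, hence 1/2 after the factor 64 from
     doubling the level. As s <= 1 and d <= 3, s^-d is at most s^-3. *)
  have [s s0' s3] : exists2 r : R, 0 <= r & r ^+ 3 = K * a k by apply: cube_root; pos.
  have s0 : 0 < s.
    have Ka : 0 < s ^+ 3 by rewrite s3; pos.
    by rewrite lt_neqAle s0' andbT; apply: contraTneq Ka => <-; rewrite expr0n ltxx.
  have s12 : s <= 1 / 2.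
    rewrite -(@ler_pXn2r _ 3) ?nnegrE//.
    rewrite s3; apply: (le_via (K * La^-1)); first by rewrite ler_pM2l.
    by rewrite /La invfM mulrCA divff ?gt_eqF// mulr1; lra.
  have := hC w g (t k) (t k) s hw (tk0 k); rewrite s0 s12 -tS => /(_ isT).
  rewrite -/(a k.+1) -/(a k) -/(Gk k) => h.
  have sd : s ^- d <= s ^- 3.
    by rewrite lef_pV2 ?posrE ?exprn_gt0// ler_wiXn2l ?(ltW s0)//; lra.
  have h1 : t k ^+ 2 * a k.+1 <= C * s ^+ 2 * Gk k + 128^-1 * (t k ^+ 2 * a k).
    apply: (le_trans h); rewrite mulrDr mulrA lerD2l.
    apply: (le_via (C * (s ^- 3 * (t k * a k) ^+ 2))).
      by rewrite ler_pM2l// ler_wpM2r ?sqr_ge0.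
    rewrite s3 /K le_eqVlt; apply/orP; left; apply/eqP; field.
    by rewrite !gt_eqF.
  have ts : t k ^+ 2 * s <= rho.
    rewrite -(@ler_pXn2r _ 3) ?nnegrE//; last by rewrite mulr_ge0 ?sqr_ge0.
    rewrite rho3 exprMn s3 -exprM [leLHS](_ : _ = K * (t k ^+ 6 * a k)); last by ring.
    rewrite ler_pM2l// /S (bigD1 (Ordinal (ltnW kn : k < n.+1)%N))//= lerDl.
    by apply: sumr_ge0 => i _; rewrite mulr_ge0// exprn_ge0// ltW.
  have ts2 : (t k ^+ 2 * s) ^+ 2 <= rho ^+ 2 by rewrite lerXn2r ?nnegrE// mulr_ge0 ?sqr_ge0.
  rewrite (_ : 64 * t k ^+ 6 * _ = 64 * t k ^+ 4 * (t k ^+ 2 * a k.+1)); last by ring.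
  have t4 : 0 < 64 * t k ^+ 4 by rewrite mulr_gt0// exprn_gt0.
  apply: (le_via (64 * t k ^+ 4 * (C * s ^+ 2 * Gk k + 128^-1 * (t k ^+ 2 * a k)))).
    by rewrite ler_pM2l.
  rewrite mulrDr (_ : 64 * t k ^+ 4 * (128^-1 * _) = 2^-1 * (t k ^+ 6 * a k)); last by field.
  rewrite lerD2r (_ : 64 * t k ^+ 4 * _ = 64 * C * (t k ^+ 2 * s) ^+ 2 * Gk k); last by ring.
  by rewrite ler_wpM2r// ler_pM2l//; pos.
have Sb : S <= 2 * (La ^+ 2 * E ^+ 3) + 3 * K * rho ^+ 2 * E.
  have h1 : S <= t 0%N ^+ 6 * a 0%N + \sum_(k < n) (64 * C * rho ^+ 2 * Gk k + 2^-1 * (t k ^+ 6 * a k)).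
    by rewrite /S big_ord_recl lerD2l; apply: ler_sum => k _; apply: step.
  have h2 : \sum_(k < n) (t k ^+ 6 * a k) <= S.
    by rewrite /S big_ord_recr /= lerDl mulr_ge0// exprn_ge0// ltW.
  have h3 : t 0%N ^+ 6 * a 0%N <= La ^+ 2 * E ^+ 3.
    rewrite /t mulr1 (_ : t0 ^+ 6 = (t0 ^+ 2) ^+ 3); last by ring.
    rewrite t02; apply: (le_via ((La * E) ^+ 3 * La^-1)); first by rewrite ler_wpM2l ?exprn_ge0 ?(ltW LE0)//; exact: aL.
    by rewrite le_eqVlt; apply/orP; left; apply/eqP; field; rewrite gt_eqF.
  rewrite big_split /= -!mulr_sumr in h1.
  have h4 : 64 * C * rho ^+ 2 * \sum_(k < n) Gk k <= 64 * C * rho ^+ 2 * (9 / 4 * E).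
    rewrite ler_wpM2l//; first by pos.
    by apply: (le_trans sumG); rewrite ler_pM2l ?divr_gt0// /E lerDl.
  have h5 : 64 * C * rho ^+ 2 * (9 / 4 * E) <= 3 / 2 * K * rho ^+ 2 * E.
    rewrite /K (_ : 3 / 2 * _ * _ * _ = 64 * C * rho ^+ 2 * (3 * E)); last by field.
    by apply: ler_wpM2l; [pos|rewrite ler_pM2r//; lra].
  lra.
(* Either rho is already of order E, or the term in rho^2 is at most half of rho^3 and is
   absorbed. *)
have rb : rho ^+ 3 <= C2 * E ^+ 3.
  have E3 : 0 < E ^+ 3 by pos.
  have [h|h] := lerP rho (6 * K ^+ 2 * E).
    apply: (le_via ((6 * K ^+ 2 * E) ^+ 3)); first by rewrite lerXn2r ?nnegrE//; pos.
    by rewrite exprMn ler_pM2r// /C2 lerDr; pos.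
  have h1 : rho ^+ 3 <= K * (2 * (La ^+ 2 * E ^+ 3) + 3 * K * rho ^+ 2 * E) by rewrite rho3 ler_pM2l.
  have h2 : rho ^+ 2 * (6 * K ^+ 2 * E) <= rho ^+ 2 * rho by rewrite ler_wpM2l ?sqr_ge0// ltW.
  have h3 : rho ^+ 3 <= 4 * K * La ^+ 2 * E ^+ 3 by rewrite -exprSr in h2; lra.
  apply: (le_trans h3); rewrite ler_pM2r// /C2 lerDl; pos.
have Sb2 : S <= C2 / K * E ^+ 3 by rewrite mulrAC ler_pdivlMr// mulrC -rho3.
have m6 : mfun (fun x => Num.max (w x) 0 ^+ 6).
  by apply: measurable_funX; exact: (@measurable_maxr _ _ _ _ w (cst 0)).
have i6 : Ig m (fun x => Num.max (w x) 0 ^+ 6).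
  apply: (@Ig_bounded _ (B ^+ 6) m6) => x; rewrite normrX lerXn2r ?nnegrE//.
    exact: le_trans (wB x).
  by rewrite ger0_norm ?le_max ?lexx ?orbT// ge_max (le_trans (ler_norm _) (wB x)) (le_trans _ (wB x)).
have iL k : Ig m (fun x => t k ^+ 6 * (\1_(level w (t k)) x : R)) by apply: IgZ; exact: Ig_level.
apply: (le_via (\int[m]_x (t0 ^+ 6 * 1 + 64 * \sum_(k < n.+1) t k ^+ 6 * \1_(level w (t k)) x))).
  apply: RI_le => //.
    apply: IgD; first by apply: IgZ; exact: (Ig_cst 1).
    by apply: IgZ; apply: Ig_sum => k.
  move=> x; have wt : w x <= t0 * 2 ^+ n by rewrite (le_trans (ler_norm _))// (le_trans (wB x)).
  apply: le_trans (dyadic_sixth t00 wt) _; rewrite mulr1 lerD2l ler_pM2l// big_ord_recr /=.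
  under [in leRHS]eq_bigr do rewrite level_indicE.
  by rewrite lerDl mulr_ge0 ?indic_ge0// exprn_ge0// ltW.
rewrite RI_D; [|by apply: IgZ; exact: (Ig_cst 1)|by apply: IgZ; apply: Ig_sum => k].
rewrite (RI_Z (t0 ^+ 6) (Ig_cst 1)).
rewrite RI_Z; last by apply: Ig_sum => k.
rewrite (RI_sum _ (fun k : 'I_n.+1 => iL k)).
rewrite (eq_bigr (fun k : 'I_n.+1 => t k ^+ 6 * a k)) => [|k _]; last by rewrite RI_Z//; exact: Ig_level.
rewrite -/S [leRHS]mulrDl; apply: lerD.
  have -> : \int[m]_x (cst 1 x : R) = vD by [].
  have -> : t0 ^+ 6 = (La * E) ^+ 3 by rewrite -t02; ring.
  by rewrite le_eqVlt; apply/orP; left; apply/eqP; rewrite exprMn mulrAC.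
by rewrite -mulrA ler_pM2l.
Qed.

(** Positive and negative parts are treated by [sixth_bound] separately. A vanishing energy is set
    apart: the L^2 norm is then 0 and w^6 <= B^4 w^2. *)
Lemma sobolev_bounded : exists2 C : R, 0 < C & forall w (g : 'I_d -> V -> R) (B : R),
  H1grad w g -> (forall x, `|w x| <= B) ->
  \int[m]_x (w x ^+ 6) <= C * (\sum_j \int[m]_x (g j x ^+ 2) + \int[m]_x (w x ^+ 2)) ^+ 3.
Proof.
have [C C0 hC] := sixth_bound; exists (2 * C); first by pos.
move=> w g B hw wB; have mw := measurable_H1 hw; have [hw2 _] := hw.
set E := _ + _; have i6 : Ig m (fun x => w x ^+ 6).
  apply: (@Ig_bounded _ (B ^+ 6)); first exact: measurable_funX.
  by move=> x; rewrite normrX lerXn2r ?nnegrE// (le_trans _ (wB x)).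
have U0 : 0 <= \int[m]_x (w x ^+ 2) by apply: RI_ge0 => x; exact: sqr_ge0.
have G0 : 0 <= \sum_j \int[m]_x (g j x ^+ 2).
  by apply: sumr_ge0 => j _; apply: RI_ge0 => x; exact: sqr_ge0.
have E0 : 0 <= E by exact: addr_ge0.
move: (E0); rewrite le_eqVlt => /predU1P[Ez|Ep].
  have Uz : \int[m]_x (w x ^+ 2) = 0 by apply/eqP; rewrite eq_le U0 andbT Ez /E lerDr.
  apply: (le_via (\int[m]_x (B ^+ 4 * w x ^+ 2))).
    apply: RI_le => //; first by apply: IgZ; exact: L2_sqr.
    move=> x; rewrite (_ : w x ^+ 6 = w x ^+ 4 * w x ^+ 2); last by ring.
    rewrite ler_wpM2r ?sqr_ge0// (_ : w x ^+ 4 = `|w x| ^+ 4).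
      by rewrite lerXn2r ?nnegrE// (le_trans _ (wB x)).
    by rewrite -normrX ger0_norm// (_ : w x ^+ 4 = (w x ^+ 2) ^+ 2) ?sqr_ge0//; ring.
  by rewrite RI_Z ?Uz ?mulr0; [pos|exact: L2_sqr].
have hwN := H1_Z (-1) hw.
have h1 := hC _ _ B hw wB Ep.
have eN : \sum_j \int[m]_x ((-1 * g j x) ^+ 2) + \int[m]_x ((-1 * w x) ^+ 2) = E.
  by congr (_ + _); [apply: eq_bigr => j _|]; apply: RI_ext => x; ring.
have h2 := hC _ _ B hwN; rewrite eN in h2.
have {}h2 := h2 (fun x => _) Ep.
have mx (f : V -> R) : mfun f -> (forall x, `|f x| <= B) -> Ig m (fun x => Num.max (f x) 0 ^+ 6).
  move=> mf fB; apply: (@Ig_bounded _ (B ^+ 6)).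
    by apply: measurable_funX; exact: (@measurable_maxr _ _ _ _ f (cst 0)).
  move=> x; rewrite normrX lerXn2r ?nnegrE//; first exact: le_trans (fB x).
  by rewrite ger0_norm ?le_max ?lexx ?orbT// ge_max (le_trans (ler_norm _) (fB x)) (le_trans _ (fB x)).
have wN x : `|-1 * w x| <= B by rewrite mulN1r normrN.
apply: (le_via (\int[m]_x (Num.max (w x) 0 ^+ 6 + Num.max (-1 * w x) 0 ^+ 6))).
  apply: RI_le => //; first by apply: IgD; apply: mx => //; exact: measurable_funM.
  move=> x; rewrite mulN1r; case: (lerP (w x) 0) => h.
    by rewrite expr0n add0r /= max_l ?oppr_ge0// (_ : (- w x) ^+ 6 = w x ^+ 6) //; ring.
  by rewrite lerDl exprn_ge0// le_max lexx orbT.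
rewrite RI_D; [|by apply: mx|by apply: mx => //; exact: measurable_funM].
have {}h2 := h2 wN; rewrite -mulrA mulr_natl mulr2n; exact: lerD.
Qed.
End sobolev.

(** * Bounded representatives of the eigenfunctions *)

Section spectral_system.
Implicit Types (f u w : V -> R) (x : V).

(** The nonconstant eigenfunctions, shifted by one index, in representatives bounded at every point:
    powers of finite sums are then integrable and products stay in H^1. [ss_weak] is the eigenvalue
    equation tested against all of H^1. *)
Record spectral_system (eb : nat -> V -> R) (gb : nat -> 'I_d -> V -> R) (la : nat -> R) : Prop := {
  ss_H1 : forall i, H1grad (eb i) (gb i) ;
  ss_bounded : forall i, exists B, forall x, `|eb i x| <= B ;
  ss_orthonormal : forall i j, \int[m]_x (eb i x * eb j x) = (i == j)%:R ;
  ss_weak : forall i, weak_solution (gb i) (fun x => la i * eb i x) ;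
  ss_mean : forall i, \int[m]_x eb i x = 0 ;
  ss_pos : forall i, 0 < la i ;
  ss_mono : forall i, la 0%N <= la i }.

Lemma vol_gt0 : 0 < vol D.
Proof.
rewrite /vol -lte_fin fineK; first exact: lebD_gt0.
by rewrite ge0_fin_numE// lebD_lty.
Qed.

Lemma RI_cst (c : R) : \int[m]_x c = c * vol D.
Proof.
rewrite /Rintegral integral_cst// fineM//.
by rewrite ge0_fin_numE// lebD_lty.
Qed.

Variables (e : nat -> V -> R) (lam : nat -> R) (he : neumann_eigenbasis D e lam).

Lemma lam_ge j : lam 1%N <= lam j.+1.
Proof. exact: (eig_nondecreasing he). Qed.

Lemma lam_gt0 j : 0 < lam j.+1.
Proof. exact: lt_le_trans (eig_lam1 he) (lam_ge j). Qed.

Lemma eig_mean j : \int[m]_x e j.+1 x = 0.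
Proof.
have hj := eig_L2 he j.+1; have mj := L2_measurable hj.
have := eig_orthonormal he j.+1 0%N; rewrite /inner /= => E.
set c := vol D `^ (- 2^-1); have c0 : 0 < c by rewrite powR_gt0 ?vol_gt0.
have E2 : \int[m]_x (e j.+1 x * c) = 0.
  rewrite -[RHS]E; apply: RI_ae.
  - exact: measurable_funM.
  - by apply: measurable_funM => //; exact: L2_measurable (eig_L2 he 0).
  - by apply: filterS (eig_e0 he) => x ->.
move: E2; rewrite RI_Zr; last exact: L2_Ig.
by move/eqP; rewrite mulf_eq0 (gt_eqF c0) orbF => /eqP.
Qed.

Lemma eig_proj0 j : proj0 D (e j.+1) = e j.+1.
Proof. by apply/funext => x; rewrite /proj0 /mean eig_mean mulr0 subr0. Qed.

(** The normal derivative is defined as the Green functional, so its vanishing is the weak equation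
    itself; the projection in [neumann_graph] is the identity here because e_(j+1) has mean zero. *)
Lemma eig_weak j : exists g, H1grad (e j.+1) g /\
  weak_solution g (fun x => lam j.+1 * e j.+1 x).
Proof.
have [_] := eig_A he j.+1; rewrite eig_proj0 => -[_ [g [h /= [H2 hn hl]]]].
have [hg hh] := H2.
exists g; split; first exact: hg.
move=> phi q hphi; have := hn _ _ hphi; rewrite /normal_derivative.
have [hp hq] := hphi.
have i1 i : Ig m (fun x => g i x * q i x) by apply: L2_IgM; [exact: (hg.2 i).1|exact: (hq i).1].
have mp := L2_measurable hp; have me := L2_measurable (eig_L2 he j.+1).
have mh i : mfun (h i i) by exact: L2_measurable ((hh i).2 i).1.
have i2 : Ig m (fun x => (\sum_(i < d) h i i x) * phi x).
  apply: (Ig_ext _ (@Ig_sum _ _ _ m _ (index_enum 'I_d) (fun i x => h i i x * phi x) _)) => [x|i].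
    by rewrite mulr_suml.
  by apply: L2_IgM => //; exact: ((hh i).2 i).1.
rewrite (RI_sum _ i1) => /eqP; rewrite addr_eq0 => /eqP ->.
rewrite -RI_N//; apply: RI_ae.
- by apply: measurableT_comp => //; apply: measurable_funM => //; apply: measurable_sum.
- by apply: measurable_funM => //; exact: measurable_funM.
- by apply: filterS hl => x /= E; rewrite -mulNr -E.
Qed.

Lemma H1_clamp u (g : 'I_d -> V -> R) (B : R) : H1grad u g -> 0 <= B ->
  {ae m, forall x, `|u x| <= B} ->
  exists2 u', eq_ae D u u' & (forall x, `|u' x| <= B) /\ H1grad u' g.
Proof.
move=> hu B0 uB; have mu' := measurable_H1 hu.
pose u' x := Num.max (- B) (Num.min (u x) B).
have u'B x : `|u' x| <= B.
  by rewrite ler_norml /u' le_max lexx /= ge_max ge_min lexx orbT andbT lerNl (le_trans _ B0)// oppr_le0.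
have mu2 : mfun u'.
  apply: (@measurable_maxr _ _ _ _ (cst (- B)) (fun x => Num.min (u x) B)) => //.
  exact: (@measurable_minr _ _ _ _ u (cst B)).
have uu : eq_ae D u u'.
  apply: filterS uB => x; rewrite ler_norml => /andP[h1 h2].
  by rewrite /u' (min_idPl _)// (max_idPr _).
exists u' => //; split => //; apply: (H1_ae hu) => //.
- exact: (L2_bounded mu2 u'B).
- by move=> i; exact: (hu.2 i).1.
- by move=> i; exact: eq_ae_refl.
Qed.

(** The one-sided bound for u and for -u; the level k0 = 0 is reached through k0 + 1/(n + 1), as the
    iteration works with a positive level. *)
Lemma two_sided_sup : exists2 C : R, 0 < C & forall u g f (s k0 : R), H1grad u g -> L2 D f ->
  weak_solution g f -> 0 < s <= 1 / 2 -> 0 <= k0 ->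
  C * (s ^- d * \int[m]_x (u x ^+ 2) + s ^+ 4 * s ^- d * \int[m]_x (f x ^+ 2)) <= k0 ^+ 2 ->
  {ae m, forall x, `|u x| <= k0}.
Proof.
have [C C0 hC] := sup_bound; exists (4 * C); first by pos.
have strict u g f (s k0 : R) : H1grad u g -> L2 D f ->
  weak_solution g f -> 0 < s <= 1 / 2 -> 0 < k0 ->
  4 * C * (s ^- d * \int[m]_x (u x ^+ 2) + s ^+ 4 * s ^- d * \int[m]_x (f x ^+ 2)) <= k0 ^+ 2 ->
  {ae m, forall x, `|u x| <= k0}.
  move=> hu hf wf s12 k00 h; have k20 : 0 < k0 / 2 by pos.
  have h' : C * (s ^- d * \int[m]_x (u x ^+ 2) + s ^+ 4 * s ^- d * \int[m]_x (f x ^+ 2)) <= (k0 / 2) ^+ 2.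
    rewrite (_ : (k0 / 2) ^+ 2 = k0 ^+ 2 / 4); last by field.
    by rewrite ler_pdivlMr// mulrC mulrA.
  have h1 := hC u g f s (k0 / 2) hu hf wf s12 k20 h'.
  have huN := H1_Z (-1) hu; have hfN := L2Z (-1) hf.
  have wfN : weak_solution (fun i x => -1 * g i x) (fun x => -1 * f x).
    move=> phi q hphi; have [hp hq] := hphi.
    rewrite (RI_ext _ (g := fun x => -1 * (f x * phi x))); last by move=> x; rewrite mulrA.
    rewrite RI_Z; last exact: L2_IgM.
    rewrite -(wf _ _ hphi) mulr_sumr; apply: eq_bigr => j _.
    rewrite -RI_Z; last by apply: L2_IgM; [exact: (hu.2 j).1|exact: (hq j).1].
    by apply: RI_ext => x; rewrite mulrA.
  have h2 := hC _ _ _ s (k0 / 2) huN hfN wfN s12 k20.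
  have E1 (k : V -> R) : \int[m]_x ((-1 * k x) ^+ 2) = \int[m]_x (k x ^+ 2).
    by apply: RI_ext => x; ring.
  rewrite !E1 in h2; have {}h2 := h2 h'.
  have k2 : 2 * (k0 / 2) = k0 by field.
  rewrite k2 in h1 h2; apply: filterS2 h1 h2 => x h3 h4; rewrite ler_norml h3 andbT lerNl.
  by rewrite -mulN1r.
move=> u g f s k0 hu hf wf s12 k00 h.
have P n : {ae m, forall x, `|u x| <= k0 + n.+1%:R^-1}.
  have n0 : 0 < n.+1%:R^-1 :> R by pos.
  apply: (strict u g f s) => //; first by exact: ltr_wpDl.
  by apply: (le_trans h); rewrite lerXn2r ?nnegrE ?addr_ge0 ?(ltW n0)// lerDl ltW.
have := (ae_foralln P); apply: filterS => x h1; apply/ler_addgt0Pr => e1 e10.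
have [N _ hN] := near_infty_natSinv_lt (PosNum e10).
apply: (le_trans (h1 N)); rewrite lerD2l ltW//; exact: (hN N (leqnn N)).
Qed.

(** An eigenfunction solves the weak Neumann problem whose source is a multiple of itself, so De
    Giorgi's bound makes it essentially bounded; clamping at that bound changes it on a null set
    only. *)
Lemma exists_spectral_system : exists eb gb, spectral_system eb gb (fun i => lam i.+1) /\
  forall i, eq_ae D (e i.+1) (eb i).
Proof.
have [C C0 hC] := two_sided_sup.
have P i : exists ug : (V -> R) * ('I_d -> V -> R), [/\ eq_ae D (e i.+1) ug.1,
    exists B, forall x, `|ug.1 x| <= B, H1grad ug.1 ug.2 &
    weak_solution ug.2 (fun x => lam i.+1 * ug.1 x)].
  have [g [hg wg]] := eig_weak i; have hf := L2Z (lam i.+1) (eig_L2 he i.+1).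
  have s12 : 0 < (1 / 2 : R) <= 1 / 2 by rewrite lexx divr_gt0.
  set X := C * ((1 / 2) ^- d * \int[m]_x (e i.+1 x ^+ 2) +
     (1 / 2) ^+ 4 * (1 / 2) ^- d * \int[m]_x ((lam i.+1 * e i.+1 x) ^+ 2)).
  have X0 : 0 <= X.
    have i0 (k : V -> R) : 0 <= \int[m]_x (k x ^+ 2) by apply: RI_ge0 => x; exact: sqr_ge0.
    by rewrite /X; pos; rewrite ?i0.
  have kX : X <= Num.sqrt X ^+ 2 by rewrite sqr_sqrtr.
  have h := hC _ _ _ (1 / 2) (Num.sqrt X) hg hf wg s12 (sqrtr_ge0 _) kX.
  have [u' uu [u'B hu']] := H1_clamp hg (sqrtr_ge0 _) h.
  exists (u', g); split => //; first by exists (Num.sqrt X).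
  move=> phi q hphi; rewrite (wg _ _ hphi); apply: RI_ae.
  - apply: measurable_funM; last by exact: (measurable_H1 hphi).
    by apply: measurable_funM => //; exact: (measurable_H1 hg).
  - apply: measurable_funM; last by exact: (measurable_H1 hphi).
    by apply: measurable_funM => //; exact: (measurable_H1 hu').
  - by apply: filterS uu => x ->.
have [ug hug] := choice P.
have me i : mfun (ug i).1 by have [_ _ h _] := hug i; exact: measurable_H1 h.
have mi i : mfun (e i.+1) by exact: L2_measurable (eig_L2 he i.+1).
exists (fun i => (ug i).1), (fun i => (ug i).2); split; last by move=> i; have [] := hug i.
split => [i|i|i j|i|i|i|i].
- by have [] := hug i.
- by have [] := hug i.
- rewrite -(eig_orthonormal he i.+1 j.+1); apply/esym/RI_ae; try exact: measurable_funM.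
  have [h1 _ _ _] := hug i; have [h2 _ _ _] := hug j.
  by apply: filterS2 h1 h2 => x -> ->.
- by have [] := hug i.
- rewrite -(eig_mean i); apply/esym/RI_ae => //.
  by have [] := hug i.
- exact: lam_gt0.
- exact: lam_ge.
Qed.
End spectral_system.

(** * Norms of finite eigenfunction sums and embeddings *)

Section spectral_estimates.
Implicit Types (f u w : V -> R) (x : V) (c y o : nat -> R) (N : nat).

Lemma RI_le_ae f w : Ig m f -> Ig m w -> {ae m, forall x, f x <= w x} ->
  \int[m]_x f x <= \int[m]_x w x.
Proof.
move=> fi wi h; pose k x := Num.min (f x) (w x).
have mk : mfun k by apply: (@measurable_minr _ _ _ _ f w); [exact: Ig_meas fi|exact: Ig_meas wi].
have ki : Ig m k.
  apply: (Ig_le mk (IgD (Ig_abs fi) (Ig_abs wi))) => x; rewrite /k.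
  by case: (leP (f x) (w x)) => _; rewrite ?lerDl ?lerDr.
rewrite (@RI_ae f k) //; first by apply: RI_le => // x; rewrite /k ge_min lexx orbT.
- exact: Ig_meas fi.
- by apply: filterS h => x hx; rewrite /k min_l.
Qed.

Variables (eb : nat -> V -> R) (gb : nat -> 'I_d -> V -> R) (la : nat -> R).
Hypothesis hs : spectral_system eb gb la.

Definition S N c : V -> R := fun x => \sum_(i < N) c i * eb i x.
Definition G N c : 'I_d -> V -> R := fun j x => \sum_(i < N) c i * gb i j x.
Local Notation sup_le N o Q := {ae m, forall x, S N o x ^+ 2 <= Q}.
(** The square of |.|_s of a finite sum: s = 0 is the squared L^2 norm, 1 the Dirichlet energy, 2
    the squared norm of A applied to it, -1 the squared dual norm. *)
Definition nr N (s : R) c : R := \sum_(i < N) la i `^ s * c i ^+ 2.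
Definition cf f (i : nat) : R := \int[m]_x (f x * eb i x).
Definition lc c : nat -> R := fun i => la i * c i.

Lemma nr_ge0 N s c : 0 <= nr N s c.
Proof. by apply: sumr_ge0 => i _; rewrite mulr_ge0 ?powR_ge0 ?sqr_ge0. Qed.

Lemma nr0E N c : nr N 0 c = \sum_(i < N) c i ^+ 2.
Proof. by apply: eq_bigr => i _; rewrite powRr0 mul1r. Qed.

Lemma nr1E N c : nr N 1 c = \sum_(i < N) la i * c i ^+ 2.
Proof. by apply: eq_bigr => i _; rewrite powRr1// ltW ?(ss_pos hs). Qed.

Lemma nr2E N c : nr N 2 c = \sum_(i < N) lc c i ^+ 2.
Proof.
apply: eq_bigr => i _; rewrite -[2]/(2%:R) powR_mulrn ?exprMn//.
by rewrite ltW ?(ss_pos hs).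
Qed.

Lemma eb_L2 i : L2 D (eb i). Proof. by have [] := ss_H1 hs i. Qed.

Lemma S_H1 N c : H1grad (S N c) (G N c).
Proof.
elim: N => [|N ih].
  have -> : S 0 c = fun x => 0 * eb 0%N x by apply/funext => x; rewrite /S big_ord0 mul0r.
  have -> : G 0 c = fun j x => 0 * gb 0%N j x.
    by apply/funext => j; apply/funext => x; rewrite /G big_ord0 mul0r.
  exact: H1_Z (ss_H1 hs 0).
have -> : S N.+1 c = fun x => S N c x + c N * eb N x by apply/funext => x; rewrite /S big_ord_recr.
have -> : G N.+1 c = fun j x => G N c j x + c N * gb N j x.
  by apply/funext => j; apply/funext => x; rewrite /G big_ord_recr.
exact: H1_D ih (H1_Z (c N) (ss_H1 hs N)).
Qed.

Lemma S_bounded N c : exists2 B, 0 <= B & forall x, `|S N c x| <= B.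
Proof.
have /choice[B hB] := ss_bounded hs.
exists (\sum_(i < N) `|c i| * B i) => [|x].
  by apply: sumr_ge0 => i _; rewrite mulr_ge0// (le_trans _ (hB i 0)).
apply: (le_trans (ler_norm_sum _ _ _)); apply: ler_sum => i _.
by rewrite normrM ler_wpM2l.
Qed.

Lemma S_L2 N c : L2 D (S N c). Proof. by have [] := S_H1 N c. Qed.

Lemma G_L2 N c j : L2 D (G N c j). Proof. by have [_ /(_ j)[]] := S_H1 N c. Qed.

Lemma S_meas N c : mfun (S N c). Proof. exact: L2_measurable (S_L2 N c). Qed.

Lemma S_inner_f N c f : L2 D f -> \int[m]_x (S N c x * f x) = \sum_(i < N) c i * cf f i.
Proof.
move=> hf; have ii i : Ig m (fun x => c i * (f x * eb i x)).
  by apply: IgZ; apply: L2_IgM => //; exact: eb_L2.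
rewrite (RI_ext _ (g := fun x => \sum_(i < N) c i * (f x * eb i x))); last first.
  by move=> x; rewrite /S mulr_suml; apply: eq_bigr => i _; ring.
rewrite (RI_sum _ (fun i : 'I_N => ii i)); apply: eq_bigr => i _.
by rewrite RI_Z//; apply: L2_IgM => //; exact: eb_L2.
Qed.

Lemma cf_S N c (i : nat) : (i < N)%N -> cf (S N c) i = c i.
Proof.
move=> iN; rewrite /cf S_inner_f; last exact: eb_L2.
rewrite (bigD1 (Ordinal iN))//= /cf (ss_orthonormal hs) eqxx mulr1 big1 ?addr0// => j ji.
rewrite (ss_orthonormal hs) (_ : (i == j) = false) ?mulr0//.
by apply/negbTE; move: ji; rewrite -val_eqE /= eq_sym.
Qed.

Lemma S_inner N c c' : \int[m]_x (S N c x * S N c' x) = \sum_(i < N) c i * c' i.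
Proof. by rewrite S_inner_f; [apply: eq_bigr => i _; rewrite cf_S|exact: S_L2]. Qed.

Lemma S_sqr N c : \int[m]_x (S N c x ^+ 2) = nr N 0 c.
Proof.
rewrite nr0E -[RHS](S_inner N c c).
by apply: RI_ext => x.
Qed.

Lemma S_green N c : weak_solution (G N c) (S N (lc c)).
Proof.
move=> phi q hphi; have [hp hq] := hphi.
have i1 i j : Ig m (fun x => c i * (gb i j x * q j x)).
  by apply: IgZ; apply: L2_IgM; [have [_ /(_ j)[]] := ss_H1 hs i|exact: (hq j).1].
transitivity (\sum_j \sum_(i < N) c i * \int[m]_x (gb i j x * q j x)).
  apply: eq_bigr => j _; rewrite (RI_ext _ (g := fun x => \sum_(i < N) c i * (gb i j x * q j x))).
    rewrite (RI_sum _ (fun i : 'I_N => i1 i j)); apply: eq_bigr => i _; rewrite RI_Z//.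
    by apply: L2_IgM; [have [_ /(_ j)[]] := ss_H1 hs i|exact: (hq j).1].
  by move=> x; rewrite /G mulr_suml; apply: eq_bigr => i _; rewrite mulrA.
rewrite exchange_big S_inner_f//; apply: eq_bigr => i _; rewrite -mulr_sumr (ss_weak hs i hphi).
rewrite /lc mulrAC mulrC; congr (_ * _); rewrite /cf -RI_Z; last by apply: L2_IgM => //; exact: eb_L2.
by apply: RI_ext => x; ring.
Qed.

Lemma S_grad N c : \sum_j \int[m]_x (G N c j x ^+ 2) = nr N 1 c.
Proof.
rewrite nr1E; have := @S_green N c _ _ (S_H1 N c); rewrite S_inner => E.
transitivity (\sum_j \int[m]_x (G N c j x * G N c j x)).
  by apply: eq_bigr => j _; apply: RI_ext => x.
by rewrite E; apply: eq_bigr => i _; rewrite /lc; ring.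
Qed.

Lemma bessel N f : L2 D f -> \sum_(i < N) cf f i ^+ 2 <= \int[m]_x (f x ^+ 2).
Proof.
move=> hf; have h := RI_CS (S_meas N (cf f)) (L2_measurable hf) (L2_sqr (S_L2 N (cf f))) (L2_sqr hf).
rewrite S_inner_f// S_sqr nr0E in h.
rewrite (eq_bigr (fun i : 'I_N => cf f i ^+ 2)) in h; last by move=> i _; rewrite expr2.
move: h; set A := \sum_(i < N) _; set B := \int[m]_x _ => h.
have A0 : 0 <= A by apply: sumr_ge0 => i _; exact: sqr_ge0.
have B0 : 0 <= B by apply: RI_ge0 => x; exact: sqr_ge0.
by move: A0; rewrite le_eqVlt => /predU1P[<-//|A0]; rewrite -(ler_pM2l A0) -expr2.
Qed.

(** The eigenfunctions are orthogonal for the Dirichlet form too, so spectral projection does not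
    increase the gradient energy. This bounds the projected nonlinearity in H^1. *)
Lemma grad_bessel N f (q : 'I_d -> V -> R) : H1grad f q ->
  \sum_(i < N) la i * cf f i ^+ 2 <= \sum_j \int[m]_x (q j x ^+ 2).
Proof.
move=> hf; have [hf2 hq] := hf; set A := \sum_(i < N) _; set B := \sum_j _.
have A0 : 0 <= A by apply: sumr_ge0 => i _; rewrite mulr_ge0 ?sqr_ge0// ltW ?(ss_pos hs).
have E := @S_green N (cf f) _ _ hf; rewrite S_inner_f// in E.
have {}E : \sum_j \int[m]_x (G N (cf f) j x * q j x) = A.
  by rewrite E; apply: eq_bigr => i _; rewrite /lc expr2 mulrA.
have E2 := S_grad N (cf f); rewrite nr1E -/A in E2.
have h j : 2 * \int[m]_x (G N (cf f) j x * q j x) <= \int[m]_x (G N (cf f) j x ^+ 2) + \int[m]_x (q j x ^+ 2).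
  have i1 := L2_sqr (G_L2 N (cf f) j); have i2 := L2_sqr (hq j).1.
  have i3 := L2_IgM (G_L2 N (cf f) j) (hq j).1.
  rewrite -RI_Z// -RI_D//; apply: RI_le; [exact: IgZ|exact: IgD|].
  by move=> x; have := sqr_ge0 (G N (cf f) j x - q j x); lra.
have : 2 * A <= A + B.
  by rewrite -{1}E -{1}E2 mulr_sumr /B -big_split /=; apply: ler_sum => j _; exact: h.
by lra.
Qed.

Lemma nr_mono (s t : R) : s <= t -> exists2 C, 0 < C & forall N c, nr N s c <= C * nr N t c.
Proof.
move=> st; have l0 := ss_pos hs 0; exists (la 0%N `^ (s - t)); first by rewrite powR_gt0.
move=> N c; rewrite /nr mulr_sumr; apply: ler_sum => i _.
rewrite [leRHS]mulrA ler_wpM2r ?sqr_ge0//.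
have li := ss_pos hs i.
rewrite (_ : la i `^ s = la i `^ (s - t) * la i `^ t); last by rewrite -powRD ?subrK// (gt_eqF li) implybT.
rewrite ler_wpM2r ?powR_ge0//.
have -> : s - t = - (t - s) by ring.
rewrite !powRN lef_pV2 ?posrE ?powR_gt0//.
by apply: ge0_ler_powR; rewrite ?nnegrE ?subr_ge0 ?(ltW l0) ?(ltW li)//; exact: (ss_mono hs).
Qed.

(** Sobolev with the L^2 term absorbed by the spectral gap, as only positive eigenvalues occur. *)
Lemma F1 : exists2 C : R, 0 < C & forall N c, \int[m]_x (S N c x ^+ 6) <= C * nr N 1 c ^+ 3.
Proof.
have [C C0 hC] := sobolev_bounded.
have [C1 C10 hC1] := nr_mono (ler01 : 0 <= 1 :> R).
exists (C * (1 + C1) ^+ 3); first by pos.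
move=> N c; have [B B0 SB] := S_bounded N c.
apply: (le_trans (hC _ _ B (S_H1 N c) SB)); rewrite S_grad S_sqr -mulrA ler_pM2l// -exprMn.
have n1 := nr_ge0 N 1 c; have n0 := nr_ge0 N 0 c.
by rewrite lerXn2r ?nnegrE//; pos; rewrite mulrDl mul1r lerD2l.
Qed.

(** A finite sum is the weak solution whose source is A applied to it, so De Giorgi's bound reads in
    terms of [nr] 0 and [nr] 2. *)
Lemma sup_S : exists2 C : R, 0 < C & forall N c (s : R), 0 < s <= 1 / 2 ->
  {ae m, forall x, S N c x ^+ 2 <= C * (s ^- d * nr N 0 c + s ^+ 4 * s ^- d * nr N 2 c)}.
Proof.
have [C C0 hC] := two_sided_sup; exists C => // N c s s12.
have s0 : 0 < s by case/andP: s12.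
set X := C * _; have n0 := nr_ge0 N 0 c; have n2 := nr_ge0 N 2 c.
have X0 : 0 <= X by rewrite /X; pos.
have := hC (S N c) (G N c) (S N (lc c)) s (Num.sqrt X) (S_H1 N c) (S_L2 N (lc c)) (@S_green N c) s12 (sqrtr_ge0 _).
rewrite sqr_sqrtr// S_sqr [X in _ + _ * X](_ : _ = nr N 2 c); last first.
  by rewrite S_sqr nr0E nr2E.
move=> /(_ (lexx _)); apply: filterS => x h.
rewrite -(real_normK (num_real (S N c x))) -[leRHS]sqr_sqrtr// lerXn2r ?nnegrE//.
Qed.

Definition blk_ex (i : nat) : exists k, la i < 4 ^+ k.+1.
Proof.
exists (Num.truncn (la i)); apply: (lt_le_trans (truncnS_gt _)); rewrite -natrX ler_nat.
exact: ltnW (ltn_expl _ _).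
Qed.

(** The Littlewood-Paley block of an eigenvalue: 4^k <= la i < 4^(k+1), that is frequency about 2^k;
    everything below 4 goes to block 0. *)
Definition kb i := ex_minn (blk_ex i).

Lemma kb_lt i : la i < 4 ^+ (kb i).+1.
Proof. by rewrite /kb; case: ex_minnP. Qed.

Lemma kb_ge i k : kb i = k.+1 -> 4 ^+ k.+1 <= la i.
Proof.
rewrite /kb; case: ex_minnP => n h1 h2 E; rewrite leNgt; apply/negP => h.
by have := h2 _ h; rewrite E ltnn.
Qed.

Definition blk (k : nat) c : nat -> R := fun i => (kb i == k)%:R * c i.

Definition nb N := (\max_(i < N) kb i).+1.

Lemma blk_sum N c (i : nat) : (i < N)%N -> \sum_(k < nb N) blk k c i = c i.
Proof.
move=> iN; have h : (kb i < nb N)%N by rewrite ltnS (leq_bigmax (Ordinal iN)).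
rewrite (bigD1 (Ordinal h))//= /blk eqxx mul1r big1 ?addr0// => k hk.
rewrite (_ : (kb i == k) = false) ?mul0r//; apply/negbTE; move: hk.
by rewrite -val_eqE /= eq_sym.
Qed.

Lemma S_blk N c x : S N c x = \sum_(k < nb N) S N (blk k c) x.
Proof.
rewrite /S exchange_big /=; apply: eq_bigr => i _; rewrite -mulr_suml blk_sum//.
Qed.

Lemma G_blk N c j x : G N c j x = \sum_(k < nb N) G N (blk k c) j x.
Proof. by rewrite /G exchange_big /=; apply: eq_bigr => i _; rewrite -mulr_suml blk_sum. Qed.

Lemma nr_blk N s c : \sum_(k < nb N) nr N s (blk k c) = nr N s c.
Proof.
rewrite /nr exchange_big /=; apply: eq_bigr => i _; rewrite -mulr_sumr; congr (_ * _).
rewrite -[in RHS](blk_sum c (ltn_ord i)) expr2 mulr_suml; apply: eq_bigr => k _.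
rewrite blk_sum// /blk; case: (kb i == k); last by rewrite !mul0r expr0n.
by rewrite !mul1r.
Qed.

Lemma nr_blk_le N (n : nat) k c : nr N n%:R (blk k c) <= (4 ^+ k.+1) ^+ n * nr N 0 (blk k c).
Proof.
rewrite nr0E /nr mulr_sumr; apply: ler_sum => i _.
rewrite /blk; case: eqP => [<-|_]; last by rewrite mul0r expr0n !mulr0.
have li := ss_pos hs i; rewrite powR_mulrn ?(ltW li)// ler_wpM2r ?sqr_ge0//.
by rewrite lerXn2r ?nnegrE ?(ltW li)// ltW// kb_lt.
Qed.

(** Since 2^sg < 4^ga, the ratio r = 2^sg / 4^ga is below 1, and the weight r^-k turns 2^(sg k) into
    4^(ga k), which is at most la^ga on block k > 0. On block 0 the first eigenvalue is the only
    lower bound, whence the constant. *)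
Lemma dyadic_sum (sg : nat) (ga : R) : sg%:R / 2 < ga -> exists C r : R, [/\ 0 < C, 0 < r < 1 &
  forall N c (X : nat -> R) (A : R), 0 <= A ->
  (forall k, X k <= A * 2 ^+ (sg * k) * nr N 0 (blk k c)) ->
  \sum_(k < nb N) r ^- k * X k <= C * A * nr N ga c].
Proof.
move=> hga; set q := 4 `^ ga : R; have q0 : 0 < q by rewrite powR_gt0.
have l0 := ss_pos hs 0.
have ga0 : 0 < ga by apply: le_lt_trans hga; rewrite divr_ge0.
have qE : 2 ^+ sg < q.
  rewrite /q (_ : 4 = 2 ^+ 2 :> R); last by ring.
  rewrite -powR_mulrn// -powRrM -powR_mulrn//.
  rewrite /powR pnatr_eq0 /= ltr_expR ltr_pM2r ?ln_gt0 ?ltr1n//; lra.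
set C := 1 + la 0%N `^ (- ga); have C0 : 0 < C by rewrite /C ltr_wpDr ?powR_ge0.
exists C, (2 ^+ sg / q); split => //.
  by rewrite divr_gt0 ?exprn_gt0//= ltr_pdivrMr// mul1r.
move=> N c X A A0 hX; rewrite -(nr_blk N ga c) mulr_sumr; apply: ler_sum => k _.
have r0 : 0 <= (2 ^+ sg / q) ^- k by rewrite invr_ge0 exprn_ge0// divr_ge0 ?ltW ?exprn_gt0.
apply: (le_trans (ler_wpM2l r0 (hX k))).
have h : nr N 0 (blk k c) <= C * q ^- k * nr N ga (blk k c).
  rewrite nr0E /nr mulr_sumr; apply: ler_sum => i _.
  rewrite /blk; case: eqP => [E|_]; last by rewrite mul0r expr0n !mulr0.
  rewrite mul1r mulrA ler_peMl ?sqr_ge0//.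
  have li := ss_pos hs i.
  move: E; case: (k : nat) => [|k'] E.
    rewrite expr0 invr1 mulr1 mulrDl mul1r ler_wpDl ?powR_ge0//.
    rewrite powRN mulrC -ler_pdivrMr ?invr_gt0 ?powR_gt0// mul1r invrK.
    by apply: ge0_ler_powR; rewrite ?nnegrE ?(ltW ga0) ?(ltW l0) ?(ltW li)//; exact: (ss_mono hs).
  have h := kb_ge E; rewrite mulrAC -mulrA.
  apply: (le_via (1 * (la i `^ ga * q ^- k'.+1))); last first.
    by rewrite ler_wpM2r ?lerDl ?powR_ge0// mulr_ge0 ?powR_ge0 ?invr_ge0 ?exprn_ge0 ?(ltW q0).
  rewrite mul1r ler_pdivlMr ?exprn_gt0// mul1r /q -powR_mulrn ?powR_ge0// -powRrM mulrC powRrM powR_mulrn//.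
  by apply: ge0_ler_powR; rewrite ?nnegrE ?exprn_ge0 ?(ltW ga0) ?(ltW li).
have p2 : 0 <= A * 2 ^+ (sg * k) by pos.
apply: (le_trans (ler_wpM2l r0 (ler_wpM2l p2 h))).
rewrite le_eqVlt; apply/orP; left; apply/eqP; rewrite exprM exprMn exprVn.
have : 2 ^+ sg ^+ k != 0 :> R by rewrite !expf_eq0 !pnatr_eq0 !andbF.
have : q ^+ k != 0 by rewrite expf_eq0 (gt_eqF q0) andbF.
move: (q ^+ k) (2 ^+ sg ^+ k) => qk sk qk0 sk0; field.
by rewrite qk0 sk0.
Qed.

(** Bernstein's inequality on a block: [sup_S] at the length s = 2^-(k+1), for which s^4 la^2 <= 1
    throughout the block. *)
Lemma sup_blk : exists2 C : R, 0 < C & forall N c k,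
  {ae m, forall x, S N (blk k c) x ^+ 2 <= C * 2 ^+ (d * k) * nr N 0 (blk k c)}.
Proof.
have [C C0 hC] := sup_S; exists (C * (2 * 2 ^+ d)); first by pos.
move=> N c k; set s : R := 2^-1 ^+ k.+1; have s0 : 0 < s by rewrite /s; pos.
have s12 : 0 < s <= 1 / 2.
  rewrite s0 /s exprS div1r ler_piMr//; first by rewrite exprn_ile1// invf_le1// ler1n.
apply: filterS (hC N (blk k c) s s12) => x h; apply: (le_trans h).
have n0 := nr_ge0 N 0 (blk k c).
have sd : s ^- d = 2 ^+ d * 2 ^+ (d * k).
  by rewrite /s -exprM exprVn invrK mulSn exprD (mulnC k).
have h2 : s ^+ 4 * nr N 2 (blk k c) <= nr N 0 (blk k c).
  apply: (le_via (s ^+ 4 * ((4 ^+ k.+1) ^+ 2 * nr N 0 (blk k c)))).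
    by rewrite ler_wpM2l ?(nr_blk_le N 2)//; pos.
  rewrite mulrA [X in X * _](_ : _ = 1) ?mul1r// /s -!exprM.
  have -> : (4 ^+ (k.+1 * 2) : R) = 2 ^+ (k.+1 * 4).
    by rewrite (_ : 4 = 2 ^+ 2 :> R) -?exprM; [rewrite (mulnC k.+1 2) mulnA mulnC|ring].
  by rewrite exprVn mulVf// expf_neq0// pnatr_eq0.
apply: (le_via (C * (s ^- d * (2 * nr N 0 (blk k c))))).
  rewrite ler_pM2l// (_ : s ^+ 4 * s ^- d * _ = s ^- d * (s ^+ 4 * nr N 2 (blk k c))); last by ring.
  rewrite -mulrDr ler_wpM2l ?invr_ge0 ?exprn_ge0 ?(ltW s0)//.
  by rewrite mulr_natl mulr2n lerD2l.
by rewrite sd le_eqVlt; apply/orP; left; apply/eqP; ring.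
Qed.

(** Bernstein on the blocks, summed by [geometric_CS]; the strict inequality leaves the room for a
    ratio r < 1. *)
Lemma F2 (ga : R) : d%:R / 2 < ga -> exists2 C : R, 0 < C & forall N c,
  {ae m, forall x, S N c x ^+ 2 <= C * nr N ga c}.
Proof.
move=> /dyadic_sum[C1 [r [C10 /[dup] r01 /andP[r0 r1] hC1]]].
have [C2 C20 hC2] := sup_blk.
exists ((1 - r)^-1 * (C1 * C2)); first by rewrite mulr_gt0 ?invr_gt0 ?subr_gt0//; pos.
move=> N c; have := ae_foralln (fun k => hC2 N c k); apply: filterS => x h.
rewrite S_blk; apply: (le_trans (geometric_CS _ (fun k => S N (blk k c) x) r01)).
rewrite -mulrA ler_wpM2l ?invr_ge0 ?subr_ge0 ?(ltW r1)//.
by apply: (hC1 N c (fun k => S N (blk k c) x ^+ 2) C2 (ltW C20)) => k.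
Qed.

Lemma H1_ext u u' (g g' : 'I_d -> V -> R) : H1grad u g -> u =1 u' -> (forall j, g j =1 g' j) ->
  H1grad u' g'.
Proof.
move=> h /funext <- gg; congr (H1grad u _): h.
by apply/funext => j; apply/funext => x; rewrite gg.
Qed.

Lemma cube_H1 N c : H1grad (fun x => S N c x ^+ 3) (fun j x => 3 * S N c x ^+ 2 * G N c j x).
Proof.
have [B B0 SB] := S_bounded N c; have h := S_H1 N c.
have SB' x : `|S N c x| <= B + B ^+ 2 by rewrite (le_trans (SB x))// lerDl sqr_ge0.
have SSB x : `|S N c x * S N c x| <= B + B ^+ 2.
  rewrite normrM -expr2; apply: (le_via (B ^+ 2)); first by rewrite lerXn2r ?nnegrE.
  by rewrite lerDr.
apply: (H1_ext (H1_mul (H1_mul h h SB SB) h SSB SB')) => [x|j x]; ring.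
Qed.

Lemma cubic_energy N c : \int[m]_x (S N (lc c) x * S N c x ^+ 3) =
  3 * \sum_j \int[m]_x (S N c x ^+ 2 * G N c j x ^+ 2).
Proof.
rewrite -(@S_green N c _ _ (cube_H1 N c)) mulr_sumr; apply: eq_bigr => j _.
have [B B0 SB] := S_bounded N c.
rewrite -RI_Z; first by apply: RI_ext => x; ring.
apply: (@Ig_mul_bounded _ _ (B ^+ 2)); last exact: L2_sqr (G_L2 N c j).
  by apply: measurable_funX; exact: S_meas N c.
by move=> x; rewrite normrX lerXn2r ?nnegrE.
Qed.

Lemma young_cubic (x y mu : R) : 0 <= x -> 0 <= y -> 0 < mu ->
  x ^+ 2 * y <= mu * x ^+ 3 + mu ^- 2 * y ^+ 3.
Proof.
move=> x0 y0 mu0; have [h|h] := lerP y (mu * x).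
  apply: (le_via (x ^+ 2 * (mu * x))); first by rewrite ler_wpM2l ?sqr_ge0.
  rewrite (_ : x ^+ 2 * (mu * x) = mu * x ^+ 3); last by ring.
  by rewrite lerDl; pos.
apply: (le_via (mu ^- 2 * y ^+ 3)); last by rewrite lerDr; pos.
rewrite [leRHS]mulrC ler_pdivlMr ?exprn_gt0// (_ : x ^+ 2 * y * mu ^+ 2 = (mu * x) ^+ 2 * y); last by ring.
rewrite (_ : y ^+ 3 = y ^+ 2 * y); last by ring.
by rewrite ler_wpM2r// lerXn2r ?nnegrE ?(ltW h)//; pos.
Qed.

(** A Caccioppoli estimate on one block: testing the equation of O_k with phi^2 O_k bounds the
    integral of phi^2 |grad O_k|^2 by that of O_k^2 |grad phi|^2, controlled by Bernstein, and that
    of (A O_k) phi^2 O_k, controlled by Sobolev for phi and O_k. Gradients are thus used in L^2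
    only. *)
Lemma gradient_multiplier_blk : exists2 C : R, 0 < C & forall N c k phi (q : 'I_d -> V -> R) (B Psi : R),
  H1grad phi q -> (forall x, `|phi x| <= B) ->
  \sum_j \int[m]_x (q j x ^+ 2) + \int[m]_x (phi x ^+ 2) <= Psi -> 0 < Psi ->
  \sum_j \int[m]_x (phi x ^+ 2 * G N (blk k c) j x ^+ 2) <= C * Psi * 2 ^+ (3 * k) * nr N 0 (blk k c).
Proof.
have [C1 C10 hC1] := sup_blk; have [C2 C20 hC2] := sobolev_bounded.
have [C3 C30 hC3] := F1; have /andP[d1 d3] := d_range.
set K := C2 + C3; have K0 : 0 < K by rewrite /K; pos.
exists (2 * (8 * (K + 1)) + 4 * C1); first by pos.
move=> N c k phi q B Psi hphi phiB hPsi Psi0.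
have [hp hq] := hphi; have mphi := L2_measurable hp.
set ck := blk k c; set n0 := nr N 0 ck; have n00 : 0 <= n0 by exact: nr_ge0.
have B0 : 0 <= B by exact: le_trans (phiB 0).
have [BO BO0 OB] := S_bounded N ck; have hO := S_H1 N ck.
have mO := S_meas N ck; have [BW BW0 WB] := S_bounded N (lc ck).
have mW := S_meas N (lc ck).
set Gj := fun j => G N ck j; have hG j : L2 D (Gj j) by exact: (G_L2).
have p2B x : `|phi x * phi x| <= B ^+ 2 + BO.
  rewrite normrM -expr2; apply: (le_via (B ^+ 2)); last by rewrite lerDl.
  by rewrite lerXn2r ?nnegrE.
have OB2 x : `|S N ck x| <= B ^+ 2 + BO by rewrite (le_trans (OB x))// lerDr sqr_ge0.
have hPhi := H1_mul (H1_mul hphi hphi phiB phiB) hO p2B OB2.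
have mp2 : mfun (fun x => phi x ^+ 2) by exact: measurable_funX.
have iT j : Ig m (fun x => phi x ^+ 2 * Gj j x ^+ 2).
  apply: (@Ig_mul_bounded _ _ (B ^+ 2)) => //; last exact: L2_sqr (hG j).
  by move=> x; rewrite normrX lerXn2r ?nnegrE.
have iP j : Ig m (fun x => S N ck x ^+ 2 * q j x ^+ 2).
  apply: (@Ig_mul_bounded _ _ (BO ^+ 2)); last exact: L2_sqr (hq j).1.
    exact: measurable_funX.
  by move=> x; rewrite normrX lerXn2r ?nnegrE.
have iX j : Ig m (fun x => 2 * (phi x * S N ck x) * (Gj j x * q j x)).
  apply: (@Ig_mul_bounded _ _ (2 * (B * BO))); last by apply: L2_IgM; [exact: hG|exact: (hq j).1].
    by apply: measurable_funM => //; exact: measurable_funM.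
  by move=> x; rewrite normrM (ger0_norm (ler0n _ 2)) normrM ler_pM2l// ler_pM.
set T := \sum_j \int[m]_x (phi x ^+ 2 * Gj j x ^+ 2).
set P := \sum_j \int[m]_x (S N ck x ^+ 2 * q j x ^+ 2).
set M := \int[m]_x (S N (lc ck) x * (phi x * phi x * S N ck x)).
have E : M = T + \sum_j \int[m]_x (2 * (phi x * S N ck x) * (Gj j x * q j x)).
  rewrite /M -(@S_green N ck _ _ hPhi) /T -big_split /=; apply: eq_bigr => j _.
  by rewrite -RI_D//; apply: RI_ext => x; rewrite /Gj; ring.
have TMP : T <= 2 * M + 4 * P.
  have h j : - (\int[m]_x (2 * (phi x * S N ck x) * (Gj j x * q j x))) <=
     2^-1 * \int[m]_x (phi x ^+ 2 * Gj j x ^+ 2) + 2 * \int[m]_x (S N ck x ^+ 2 * q j x ^+ 2).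
    rewrite -RI_N// -RI_Z// -RI_Z// -RI_D; try exact: IgZ.
    apply: RI_le; [exact: IgN|by apply: IgD; exact: IgZ|].
    move=> x; have := sqr_ge0 (phi x * Gj j x + 2 * (S N ck x * q j x)); lra.
  have : - (\sum_j \int[m]_x (2 * (phi x * S N ck x) * (Gj j x * q j x))) <= 2^-1 * T + 2 * P.
    by rewrite -sumrN /T /P !mulr_sumr -big_split; apply: ler_sum => j _; exact: h.
  by lra.
have e2k : (2 ^+ (d * k) : R) <= 2 ^+ (3 * k) by rewrite ler_eXn2l ?ltr1n// leq_mul2r d3 orbT.
have q20 : 0 <= \sum_j \int[m]_x (q j x ^+ 2) by apply: sumr_ge0 => j _; apply: RI_ge0 => x; exact: sqr_ge0.
have p20 : 0 <= \int[m]_x (phi x ^+ 2) by apply: RI_ge0 => x; exact: sqr_ge0.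
have Pb : P <= C1 * 2 ^+ (3 * k) * n0 * Psi.
  apply: (le_via (C1 * 2 ^+ (d * k) * n0 * \sum_j \int[m]_x (q j x ^+ 2))).
    rewrite mulr_sumr; apply: ler_sum => j _; rewrite -RI_Z; last exact: L2_sqr (hq j).1.
    apply: RI_le_ae => //; first by apply: IgZ; exact: L2_sqr (hq j).1.
    by apply: filterS (hC1 N c k) => x h; rewrite ler_wpM2r ?sqr_ge0.
  apply: ler_pM => //; first by pos.
    by rewrite ler_wpM2r// ler_pM2l.
  by apply: le_trans hPsi; rewrite lerDl.
have Mb : M <= 8 * (K + 1) * 2 ^+ (3 * k) * n0 * Psi.
  have rhs0 : 0 <= 8 * (K + 1) * 2 ^+ (3 * k) * n0 * Psi by pos.
  apply: (le_trans (ler_norm _)); rewrite -[leRHS]ger0_norm// -ler_sqr ?nnegrE// !real_normK ?num_real//.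
  have hppO : L2 D (fun x => phi x * phi x * S N ck x) by case: hPhi.
  apply: (le_trans (RI_CS mW (L2_measurable hppO) (L2_sqr (S_L2 N (lc ck))) (L2_sqr hppO))).
  have -> : \int[m]_x (S N (lc ck) x ^+ 2) = nr N 2 ck by rewrite (S_sqr) nr0E (nr2E).
  have n2 := nr_blk_le N 2 k c; have n1 := nr_blk_le N 1 k c.
  rewrite -/ck -/n0 in n1 n2; rewrite expr1 in n1.
  have e4 : 4 ^+ k.+1 = 4 * 4 ^+ k :> R by rewrite exprS.
  have e8 : (2 ^+ (3 * k)) ^+ 2 = (4 ^+ k) ^+ 3 :> R.
    have e42 : 4 = 2 ^+ 2 :> R by ring.
    have e8n : (3 * k * 2 = 2 * k * 3)%N by rewrite mulnAC (mulnC 3 2) -!mulnA (mulnC 3 k).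
    by rewrite -[LHS]exprM e8n [2 ^+ (2 * k * 3)]exprM [2 ^+ (2 * k)]exprM -e42.
  set kk : R := 4 ^+ k in e4 e8; have kk0 : 0 < kk by rewrite /kk; pos.
  set V1 := nr N 1 ck in n1; have V10 : 0 <= V1 by exact: nr_ge0.
  have n20 : 0 <= nr N 2 ck by exact: nr_ge0.
  (* Hölder for phi^4 O^2 with exponents 3/2 and 3, written as Young's inequality at the ratio W /
     Psi that balances both terms. The ratio must be positive, so a vanishing block is set apart. *)
  have Z : \int[m]_x ((phi x * phi x * S N ck x) ^+ 2) <= K * (4 * kk * n0) * Psi ^+ 2 \/ n0 = 0.
    move: n00; rewrite le_eqVlt => /predU1P[<-|n0p]; [by right|left].
    set W := 4 * kk * n0; have W0 : 0 < W by rewrite /W; pos.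
    set mu1 := W / Psi; have mu0 : 0 < mu1 by rewrite /mu1; pos.
    have p6 := hC2 phi q B hphi phiB; have O6 := hC3 N ck.
    have ip6 : Ig m (fun x => phi x ^+ 6).
      apply: (@Ig_bounded _ (B ^+ 6)); first exact: measurable_funX.
      by move=> x; rewrite normrX lerXn2r ?nnegrE.
    have iO6 : Ig m (fun x => S N ck x ^+ 6).
      apply: (@Ig_bounded _ (BO ^+ 6)); first exact: measurable_funX.
      by move=> x; rewrite normrX lerXn2r ?nnegrE.
    apply: (le_via (\int[m]_x (mu1 * phi x ^+ 6 + mu1 ^- 2 * S N ck x ^+ 6))).
      apply: RI_le; [exact: L2_sqr hppO|by apply: IgD; exact: IgZ|] => x.
      have := young_cubic (sqr_ge0 (phi x)) (sqr_ge0 (S N ck x)) mu0.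
      rewrite -!exprM /=; apply: le_trans; rewrite le_eqVlt; apply/orP; left; apply/eqP; ring.
    rewrite RI_D; [|exact: IgZ|exact: IgZ]; rewrite !RI_Z//.
    have p6' : \int[m]_x (phi x ^+ 6) <= C2 * Psi ^+ 3.
      apply: (le_trans p6); rewrite ler_pM2l// lerXn2r ?nnegrE//; [exact: addr_ge0|exact: ltW].
    have O6' : \int[m]_x (S N ck x ^+ 6) <= C3 * W ^+ 3.
      apply: (le_trans O6); rewrite ler_pM2l// lerXn2r ?nnegrE//; first exact: ltW.
      by rewrite /W -e4.
    apply: (le_via (mu1 * (C2 * Psi ^+ 3) + mu1 ^- 2 * (C3 * W ^+ 3))).
      by apply: lerD; rewrite ler_wpM2l//; pos.
    rewrite /mu1 /K le_eqVlt; apply/orP; left; apply/eqP; field.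
    by rewrite !gt_eqF.
  case: Z => [Z|n0z]; last first.
    have -> : nr N 2 ck = 0 by apply/eqP; rewrite eq_le n20 andbT (le_trans n2)// n0z mulr0.
    by rewrite mul0r sqr_ge0.
  apply: (le_via ((4 ^+ k.+1) ^+ 2 * n0 * (K * (4 * kk * n0) * Psi ^+ 2))).
    by apply: ler_pM => //; apply: RI_ge0 => x; exact: sqr_ge0.
  set z : R := 2 ^+ (3 * k) in e8 *.
  rewrite e4 [leRHS](_ : _ = (8 * n0 * Psi) ^+ 2 * (kk ^+ 3) * (K + 1) ^+ 2); last by rewrite -e8; ring.
  rewrite [leLHS](_ : _ = (8 * n0 * Psi) ^+ 2 * (kk ^+ 3) * K); last by ring.
  rewrite ler_wpM2l//; first by pos.
  by have : 0 <= K ^+ 2; [exact: sqr_ge0|have := ltW K0; lra].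
apply: (le_trans TMP); rewrite [leRHS](_ : _ = 2 * (8 * (K + 1) * 2 ^+ (3 * k) * n0 * Psi) +
   4 * (C1 * 2 ^+ (3 * k) * n0 * Psi)); last by ring.
by apply: lerD; rewrite ler_pM2l.
Qed.

(** The block bounds grow like 2^(3k), which is summable against [nr] ga for ga > 3/2. *)
Lemma gradient_multiplier (ga : R) : 3 / 2 < ga -> exists2 C : R, 0 < C &
  forall N c phi (q : 'I_d -> V -> R) (B : R), H1grad phi q -> (forall x, `|phi x| <= B) ->
  \sum_j \int[m]_x (phi x ^+ 2 * G N c j x ^+ 2) <=
  C * nr N ga c * (\sum_j \int[m]_x (q j x ^+ 2) + \int[m]_x (phi x ^+ 2)).
Proof.
move=> hga; have [C [r [C0 /[dup] r01 /andP[r0 r1] hC]]] := dyadic_sum (hga : 3%:R / 2 < ga).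
have [C1 C10 hC1] := gradient_multiplier_blk.
exists ((1 - r)^-1 * (C * C1)); first by rewrite mulr_gt0 ?invr_gt0 ?subr_gt0//; pos.
move=> N c phi q B hphi phiB; have [hp hq] := hphi; have mphi := L2_measurable hp.
set Psi := _ + \int[m]_x (phi x ^+ 2).
have Psi0 : 0 <= Psi.
  by apply: addr_ge0; [apply: sumr_ge0 => j _|]; apply: RI_ge0 => x; exact: sqr_ge0.
have n0 := nr_ge0 N ga c; have r2 : 0 < 1 - r by lra.
set A := (1 - r)^-1 * (C * C1) * nr N ga c; have A0 : 0 <= A by rewrite /A; pos.
have iT c' j : Ig m (fun x => phi x ^+ 2 * G N c' j x ^+ 2).
  apply: (@Ig_mul_bounded _ _ (B ^+ 2)); last exact: L2_sqr (G_L2 N c' j).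
    exact: measurable_funX.
  by move=> x; rewrite normrX lerXn2r ?nnegrE// (le_trans _ (phiB x)).
(* The block estimate asks for a positive energy; eta / (A + 1) provides it and costs at most
   [eta]. *)
apply/ler_addgt0Pr => eta eta0; set Psi' := Psi + eta / (A + 1).
have Psi'0 : 0 < Psi' by rewrite /Psi'; pos.
apply: (le_via (A * Psi')); last first.
  rewrite mulrDr lerD2l mulrA ler_pdivrMr; last by pos.
  by rewrite mulrC ler_wpM2l ?(ltW eta0)// lerDl.
apply: (le_via ((1 - r)^-1 * \sum_(k < nb N) r ^- k *
    \sum_j \int[m]_x (phi x ^+ 2 * G N (blk k c) j x ^+ 2))).
  rewrite mulr_sumr; under [leRHS]eq_bigr do rewrite mulr_sumr mulr_sumr.
  rewrite exchange_big /=; apply: ler_sum => j _.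
  under [leRHS]eq_bigr do (rewrite -RI_Z//; rewrite -RI_Z; last exact: IgZ).
  rewrite -(RI_sum _ (fun k : 'I_(nb N) => IgZ _ (IgZ _ (iT (blk k c) j)))).
  apply: RI_le => //; first by apply: Ig_sum => k; apply: IgZ; exact: IgZ.
  move=> x; have := geometric_CS (nb N) (fun k => G N (blk k c) j x) r01.
  rewrite -G_blk => h; apply: (le_trans (ler_wpM2l (sqr_ge0 (phi x)) h)).
  rewrite mulrCA !mulr_sumr le_eqVlt; apply/orP; left; apply/eqP; apply: eq_bigr => k _; ring.
rewrite /A -!mulrA ler_wpM2l//; first by rewrite invr_ge0 ltW.
apply: le_trans (hC N c (fun k => \sum_j \int[m]_x (phi x ^+ 2 * G N (blk k c) j x ^+ 2)) (C1 * Psi') _ _) _.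
- by pos.
- by move=> k; apply: (hC1 _ _ _ _ _ B) => //; rewrite /Psi' lerDl; pos.
by rewrite le_eqVlt; apply/orP; left; apply/eqP; ring.
Qed.

(** * The cubic nonlinearity on finite sums *)

Definition Fc N c : nat -> R := cf (nonlinearity (S N c)).
Definition p4 N c : R := \int[m]_x (S N c x ^+ 4).
Definition p6 N c : R := \int[m]_x (S N c x ^+ 6).
Definition I2 N c : R := \sum_j \int[m]_x (S N c x ^+ 2 * G N c j x ^+ 2).

Definition bmf f := mfun f /\ exists B, forall x, `|f x| <= B.

Lemma bmf_S N c : bmf (S N c).
Proof. by split; [exact: S_meas N c|have [B _ h] := S_bounded N c; exists B]. Qed.

Lemma bmf_cst (a : R) : bmf (cst a).
Proof. by split; [exact: measurable_cst|exists `|a| => x]. Qed.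

Lemma bmf_D f w : bmf f -> bmf w -> bmf (fun x => f x + w x).
Proof.
move=> [mf [B hB]] [mw [B' hB']]; split; first exact: measurable_funD.
by exists (B + B') => x; rewrite (le_trans (ler_normD _ _))// lerD.
Qed.

Lemma bmf_M f w : bmf f -> bmf w -> bmf (fun x => f x * w x).
Proof.
move=> [mf [B hB]] [mw [B' hB']]; split; first exact: measurable_funM.
by exists (B * B') => x; rewrite normrM ler_pM.
Qed.

Lemma bmf_X f n : bmf f -> bmf (fun x => f x ^+ n).
Proof.
move=> [mf [B hB]]; split; first exact: measurable_funX.
by exists (B ^+ n) => x; rewrite normrX lerXn2r ?nnegrE// (le_trans _ (hB x)).
Qed.

Lemma bmf_N f : bmf f -> bmf (fun x => - f x).
Proof.
move=> [mf [B hB]]; split; first exact: measurableT_comp.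
by exists B => x; rewrite normrN.
Qed.

Lemma bmf_B f w : bmf f -> bmf w -> bmf (fun x => f x - w x).
Proof. by move=> hf hw; exact: bmf_D hf (bmf_N hw). Qed.

Lemma bmf_Ig f : bmf f -> Ig m f.
Proof. by move=> [mf [B hB]]; exact: Ig_bounded hB. Qed.

Lemma Ig_SX N c n : Ig m (fun x => S N c x ^+ n).
Proof. by apply: bmf_Ig; apply: bmf_X; exact: bmf_S. Qed.

Lemma bmf_L2 f : bmf f -> L2 D f.
Proof. by move=> [mf [B hB]]; exact: L2_bounded hB. Qed.

Lemma bmf_IgM f w : bmf f -> Ig m w -> Ig m (fun x => f x * w x).
Proof. by move=> [mf [B hB]] wi; exact: Ig_mul_bounded hB wi. Qed.

Lemma bmf_F f : bmf f -> bmf (nonlinearity f).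
Proof. by move=> hf; apply: bmf_B => //; exact: bmf_X. Qed.

Lemma p4_ge0 N c : 0 <= p4 N c.
Proof. by apply: RI_ge0 => x; rewrite (_ : _ ^+ 4 = (S N c x ^+ 2) ^+ 2) ?sqr_ge0//; ring. Qed.

Lemma p6_ge0 N c : 0 <= p6 N c.
Proof. by apply: RI_ge0 => x; rewrite (_ : _ ^+ 6 = (S N c x ^+ 3) ^+ 2) ?sqr_ge0//; ring. Qed.

Lemma I2_ge0 N c : 0 <= I2 N c.
Proof. by apply: sumr_ge0 => j _; apply: RI_ge0 => x; rewrite mulr_ge0 ?sqr_ge0. Qed.

Lemma S_D N c c' x : S N (fun i => c i + c' i) x = S N c x + S N c' x.
Proof. by rewrite /S -big_split; apply: eq_bigr => i _; rewrite mulrDl. Qed.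

Lemma S_B N c c' x : S N (fun i => c i - c' i) x = S N c x - S N c' x.
Proof. by rewrite /S -sumrB; apply: eq_bigr => i _; rewrite mulrBl. Qed.

Lemma G_D N c c' j x : G N (fun i => c i + c' i) j x = G N c j x + G N c' j x.
Proof. by rewrite /G -big_split; apply: eq_bigr => i _; rewrite mulrDl. Qed.

Lemma pair_cf N c f : L2 D f -> \sum_(i < N) c i * cf f i = \int[m]_x (S N c x * f x).
Proof. by move=> hf; rewrite (S_inner_f). Qed.

Lemma vol_RI (a : R) : \int[m]_x (cst a x) = a * vol D.
Proof. exact: RI_cst. Qed.

Lemma coercivity_point (y o : R) : 4^-1 * y ^+ 4 - 18 * (1 + o ^+ 4) <= y * ((y + o) ^+ 3 - (y + o)).
Proof.
have -> : y * ((y + o) ^+ 3 - (y + o)) = 2^-1 * y ^+ 4 + 2^-1 * (y ^+ 2 + 3 * (y * o)) ^+ 2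
  - (3 / 2) * (y * o) ^+ 2 + (y * o) * o ^+ 2 - y ^+ 2 - y * o by field.
have h1 := sqr_ge0 (y ^+ 2 + 3 * (y * o)).
have h2 : - (2^-1 * ((y * o) ^+ 2 + o ^+ 4)) <= (y * o) * o ^+ 2.
  have : 0 <= (y * o + o ^+ 2) ^+ 2 by exact: sqr_ge0.
  have -> : (y * o + o ^+ 2) ^+ 2 = (y * o) ^+ 2 + o ^+ 4 + 2 * ((y * o) * o ^+ 2) by ring.
  lra.
have h3 : 2 * (y * o) ^+ 2 <= y ^+ 4 / 16 + 16 * o ^+ 4.
  have : 0 <= (y ^+ 2 / 4 - 4 * o ^+ 2) ^+ 2 by exact: sqr_ge0.
  have -> : (y ^+ 2 / 4 - 4 * o ^+ 2) ^+ 2 = y ^+ 4 / 16 + 16 * o ^+ 4 - 2 * (y * o) ^+ 2 by field.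
  lra.
have h4 : 3 / 2 * y ^+ 2 <= y ^+ 4 / 16 + 9.
  have : 0 <= (y ^+ 2 / 4 - 3) ^+ 2 by exact: sqr_ge0.
  have -> : (y ^+ 2 / 4 - 3) ^+ 2 = y ^+ 4 / 16 + 9 - 3 / 2 * y ^+ 2 by field.
  lra.
have h5 : y * o <= 2^-1 * y ^+ 2 + 2^-1 * o ^+ 2 by have := sqr_ge0 (y - o); lra.
have h6 : o ^+ 2 <= o ^+ 4 + 1.
  have : 0 <= (o ^+ 2 - 1) ^+ 2 by exact: sqr_ge0.
  have -> : (o ^+ 2 - 1) ^+ 2 = o ^+ 4 - 2 * o ^+ 2 + 1 by ring.
  by have := sqr_ge0 o; lra.
have h7 : 0 <= o ^+ 4 by rewrite (_ : o ^+ 4 = (o ^+ 2) ^+ 2) ?sqr_ge0//; ring.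
have h8 : 0 <= y ^+ 4 by rewrite (_ : y ^+ 4 = (y ^+ 2) ^+ 2) ?sqr_ge0//; ring.
lra.
Qed.

Lemma coercivity : exists2 C : R, 0 < C & forall N y o (Q : R), 0 <= Q ->
  sup_le N o Q ->
  4^-1 * p4 N y - C * (1 + Q ^+ 2) <= \sum_(i < N) y i * Fc N (fun i => y i + o i) i.
Proof.
have v0 := vol_gt0; exists (18 * vol D); first by pos.
move=> N y o Q Q0 hQ; rewrite pair_cf; last by apply: bmf_L2; apply: bmf_F; exact: bmf_S.
have iY : Ig m (fun x => 4^-1 * S N y x ^+ 4) by apply: IgZ; exact: Ig_SX.
rewrite /p4 -RI_Z; last by exact: Ig_SX.
rewrite (_ : 18 * vol D * (1 + Q ^+ 2) = \int[m]_x (cst (18 * (1 + Q ^+ 2)) x)); last by rewrite vol_RI; ring.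
rewrite -RI_B//; last exact: Ig_cst.
apply: RI_le_ae; first by apply: IgB => //; exact: Ig_cst.
  by apply: bmf_Ig; apply: bmf_M; [exact: bmf_S|apply: bmf_F; exact: bmf_S].
apply: filterS hQ => x hx; rewrite /nonlinearity S_D /=.
apply: le_trans (coercivity_point _ _); rewrite lerD2l lerN2 ler_pM2l// lerD2l.
by rewrite (_ : _ ^+ 4 = (S N o x ^+ 2) ^+ 2) ?lerXn2r ?nnegrE ?sqr_ge0//; ring.
Qed.

(** Green's formula turns the cubic part, tested with A y, into three times the integral of S^2
    |grad S|^2: the good term of the L^2 energy estimate. *)
Lemma Fc_pair_lc N c : \sum_(i < N) lc c i * Fc N c i = 3 * I2 N c - nr N 1 c.
Proof.
rewrite /Fc pair_cf; last by apply: bmf_L2; apply: bmf_F; exact: bmf_S.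
rewrite (RI_ext _ (g := fun x => S N (lc c) x * S N c x ^+ 3 - S N (lc c) x * S N c x)); last first.
  by move=> x; rewrite /nonlinearity; ring.
rewrite RI_B; [|by apply: bmf_Ig; apply: bmf_M; [|apply: bmf_X]; exact: bmf_S
  |by apply: bmf_Ig; apply: bmf_M; exact: bmf_S].
rewrite (cubic_energy) (S_inner) (nr1E); congr (_ - _); apply: eq_bigr => i _.
by rewrite /lc; ring.
Qed.

Lemma G0_point (y o Q : R) : o ^+ 2 <= Q ->
  ((y + o) ^+ 3 - (y + o) - (y ^+ 3 - y)) ^+ 2 <= 100 * (1 + Q ^+ 3) * (1 + y ^+ 4).
Proof.
move=> oQ; have Q0 : 0 <= Q by exact: le_trans (sqr_ge0 o) oQ.
have -> : (y + o) ^+ 3 - (y + o) - (y ^+ 3 - y) = o * (3 * y ^+ 2 + 3 * (y * o) + (o ^+ 2 - 1)) by ring.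
rewrite exprMn; set z := y ^+ 2; have z0 : 0 <= z by exact: sqr_ge0.
have -> : y ^+ 4 = z ^+ 2 by rewrite /z; ring.
have h : (3 * z + 3 * (y * o) + (o ^+ 2 - 1)) ^+ 2 <= 4 * (9 * z ^+ 2 + 9 * (z * Q) + Q ^+ 2 + 1).
  have e1 : (y * o) ^+ 2 <= z * Q by rewrite exprMn ler_wpM2l.
  have e2 : (o ^+ 2) ^+ 2 <= Q ^+ 2 by rewrite lerXn2r ?nnegrE ?sqr_ge0.
  have := sqr_ge0 (3 * z - 3 * (y * o)); have := sqr_ge0 (3 * z - o ^+ 2); have := sqr_ge0 (3 * z + 1).
  have := sqr_ge0 (3 * (y * o) - o ^+ 2); have := sqr_ge0 (3 * (y * o) + 1); have := sqr_ge0 (o ^+ 2 + 1).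
  lra.
apply: (le_via (Q * (4 * (9 * z ^+ 2 + 9 * (z * Q) + Q ^+ 2 + 1)))).
  by apply: ler_pM => //; exact: sqr_ge0.
have q3 : 0 <= Q ^+ 3 by exact: exprn_ge0.
have a1 : Q <= 1 + Q ^+ 3.
  have [h1|h1] := lerP Q 1; first lra.
  have : Q * 1 <= Q * Q ^+ 2 by rewrite ler_wpM2l// expr_ge1// ltW.
  by rewrite mulr1 -exprS; lra.
have a2 : Q ^+ 2 <= 1 + Q ^+ 3.
  have [h1|h1] := lerP Q 1; first by have : Q ^+ 2 <= 1; [rewrite expr_le1|lra].
  have : Q ^+ 2 * 1 <= Q ^+ 2 * Q by rewrite ler_wpM2l ?sqr_ge0// ltW.
  by rewrite mulr1 -exprSr; lra.
have b1 : z <= 1 + z ^+ 2 by have := sqr_ge0 (z - 1); have := sqr_ge0 z; lra.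
have z2 := sqr_ge0 z.
have c1 : Q * z ^+ 2 <= (1 + Q ^+ 3) * z ^+ 2 by rewrite ler_wpM2r.
have c2 : Q ^+ 2 * z <= (1 + Q ^+ 3) * (1 + z ^+ 2) by apply: ler_pM => //; exact: sqr_ge0.
have -> : Q * (4 * (9 * z ^+ 2 + 9 * (z * Q) + Q ^+ 2 + 1)) =
  36 * (Q * z ^+ 2) + 36 * (Q ^+ 2 * z) + 4 * Q ^+ 3 + 4 * Q by ring.
have c3 : 0 <= Q ^+ 3 * z ^+ 2 by exact: mulr_ge0.
lra.
Qed.

Lemma diff_sqr : exists2 C : R, 0 < C & forall N y o (Q : R), 0 <= Q ->
  sup_le N o Q ->
  \int[m]_x ((nonlinearity (S N (fun i => y i + o i)) x - nonlinearity (S N y) x) ^+ 2) <=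
  C * (1 + Q ^+ 3) * (1 + p4 N y).
Proof.
have v0 := vol_gt0; exists (100 * (1 + vol D)); first by pos.
move=> N y o Q Q0 hQ; have q3 : 0 <= Q ^+ 3 by exact: exprn_ge0.
have p40 := p4_ge0 N y.
have iY : Ig m (fun x => S N y x ^+ 4) by exact: Ig_SX.
apply: (le_via (\int[m]_x (100 * (1 + Q ^+ 3) * (cst 1 x + S N y x ^+ 4)))).
  apply: RI_le_ae.
  - by apply: bmf_Ig; apply: bmf_X; apply: bmf_B; apply: bmf_F; exact: bmf_S.
  - by apply: IgZ; apply: IgD => //; exact: Ig_cst.
  - by apply: filterS hQ => x hx; rewrite /nonlinearity S_D; exact: G0_point.
rewrite RI_Z; last by apply: IgD => //; exact: Ig_cst.
rewrite RI_D//; last exact: Ig_cst.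
rewrite vol_RI mul1r -/(p4 N y) [leRHS](_ : _ = 100 * (1 + Q ^+ 3) * ((1 + vol D) * (1 + p4 N y))); last by ring.
by rewrite ler_wpM2l//; [pos|nra].
Qed.

(** F(y + o) - F(y) is measured in L^2 and paired with A y by AM-GM, so no derivative falls on [o]
    and its supremum suffices. *)
Lemma dissipation : exists2 C : R, 0 < C & forall N y o (Q : R), 0 <= Q ->
  sup_le N o Q ->
  3 * I2 N y - nr N 1 y - nr N 2 y / 4 - C * (1 + Q ^+ 3) * (1 + p4 N y) <=
  \sum_(i < N) lc y i * Fc N (fun i => y i + o i) i.
Proof.
have [C C0 hC] := diff_sqr; exists C => // N y o Q Q0 hQ.
have bF c : bmf (nonlinearity (S N c)) by apply: bmf_F; exact: bmf_S.
have := Fc_pair_lc N y; rewrite /Fc !pair_cf; try exact: bmf_L2.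
move=> E; have h := hC N y o Q Q0 hQ.
set X := nonlinearity (S N (fun i => y i + o i)); set Y := nonlinearity (S N y) in E *.
have bX : bmf X := bF _; have bY : bmf Y := bF _.
have iX : Ig m (fun x => S N (lc y) x * X x) by apply: bmf_Ig; apply: bmf_M bX; exact: bmf_S.
have iY : Ig m (fun x => S N (lc y) x * Y x) by apply: bmf_Ig; apply: bmf_M bY; exact: bmf_S.
have iG : Ig m (fun x => (X x - Y x) ^+ 2) by apply: bmf_Ig; apply: bmf_X; exact: bmf_B.
have iS : Ig m (fun x => S N (lc y) x ^+ 2) by apply: L2_sqr; exact: S_L2 N (lc y).
have e2 : \int[m]_x (S N (lc y) x ^+ 2) = nr N 2 y by rewrite (S_sqr) nr0E (nr2E).
have : \int[m]_x (S N (lc y) x * Y x - (4^-1 * S N (lc y) x ^+ 2 + (X x - Y x) ^+ 2)) <=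
       \int[m]_x (S N (lc y) x * X x).
  apply: RI_le => //; first by apply: IgB => //; apply: IgD => //; exact: IgZ.
  by move=> x; have := sqr_ge0 (2^-1 * S N (lc y) x + (X x - Y x)); lra.
rewrite RI_B//; last by apply: IgD => //; exact: IgZ.
rewrite RI_D//; last exact: IgZ.
by rewrite RI_Z// e2 E; lra.
Qed.

(** [nash] applied to the square of the sum, whose L^1 norm is the squared L^2 norm of the sum. *)
Lemma p4_nash : exists2 C : R, 0 < C & forall N y (s : R), 0 < s <= 1 / 2 ->
  p4 N y <= C * (s ^+ 2 * I2 N y + s ^- d * nr N 0 y ^+ 2).
Proof.
have [C C0 hC] := nash; exists (4 * (C + 1)); first by pos.
move=> N y s s12; have [B B0 SB] := S_bounded N y; have h := S_H1 N y.
have SSB x : `|S N y x * S N y x| <= B ^+ 2 by rewrite normrM -expr2 lerXn2r ?nnegrE.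
have s0 : 0 < s by case/andP: s12.
have := hC _ _ (B ^+ 2) s (H1_mul h h SB SB) SSB s12.
have iI j : Ig m (fun x => S N y x ^+ 2 * G N y j x ^+ 2).
  by apply: bmf_IgM; [apply: bmf_X; exact: bmf_S|exact: L2_sqr (G_L2 N y j)].
have -> : \int[m]_x ((S N y x * S N y x) ^+ 2) = p4 N y by apply: RI_ext => x; ring.
have -> : \int[m]_x `|S N y x * S N y x| = nr N 0 y.
  rewrite -(S_sqr); apply: RI_ext => x; by rewrite -expr2 ger0_norm ?sqr_ge0.
have -> : \sum_j \int[m]_x ((S N y x * G N y j x + S N y x * G N y j x) ^+ 2) = 4 * I2 N y.
  rewrite mulr_sumr; apply: eq_bigr => j _; rewrite -RI_Z//.
  by apply: RI_ext => x; ring.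
have I0 := I2_ge0 N y; have X0 : 0 <= s ^- d * nr N 0 y ^+ 2 by pos.
have Z0 : 0 <= s ^+ 2 * I2 N y by pos.
move=> /le_trans; apply; rewrite [leRHS](_ : _ = (C + 1) * (s ^+ 2 * (4 * I2 N y) + 4 * (s ^- d * nr N 0 y ^+ 2))); last by ring.
apply: ler_pM => //; [pos|by rewrite lerDl|by rewrite lerD2l; lra].
Qed.

Lemma Fc_sqr : exists2 C : R, 0 < C & forall N c, \sum_(i < N) Fc N c i ^+ 2 <= C * (1 + p6 N c).
Proof.
have v0 := vol_gt0; exists (4 * (1 + vol D)); first by pos.
move=> N c; have bF : bmf (nonlinearity (S N c)) by apply: bmf_F; exact: bmf_S.
apply: (le_trans (bessel N (bmf_L2 bF))); have p60 := p6_ge0 N c.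
have iY : Ig m (fun x => S N c x ^+ 6) by exact: Ig_SX.
apply: (le_via (\int[m]_x (4 * (cst 1 x + S N c x ^+ 6)))).
  apply: RI_le; [by apply: bmf_Ig; exact: bmf_X|by apply: IgZ; apply: IgD => //; exact: Ig_cst|].
  move=> x; rewrite /nonlinearity /=; set t := S N c x.
  have -> : t ^+ 6 = (t ^+ 3) ^+ 2 by ring.
  have h1 : t ^+ 2 <= 1 + (t ^+ 3) ^+ 2.
    have -> : (t ^+ 3) ^+ 2 = (t ^+ 2) ^+ 3 by ring.
    move: (sqr_ge0 t); move: (t ^+ 2) => z z0.
    have [hz|hz] := lerP z 1; first by have : 0 <= z ^+ 3; [exact: exprn_ge0|lra].
    have : z * 1 <= z * z ^+ 2 by rewrite ler_wpM2l// expr_ge1// ltW.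
    by rewrite mulr1 -exprS; lra.
  have := sqr_ge0 (t ^+ 3 + t); lra.
rewrite RI_Z; last by apply: IgD => //; exact: Ig_cst.
rewrite RI_D//; last exact: Ig_cst.
by rewrite vol_RI mul1r -/(p6 N c) -mulrA ler_pM2l//; nra.
Qed.

Let bS N c : bmf (S N c) := bmf_S N c.

Lemma Fc_diff N c c' : \sum_(i < N) (Fc N c i - Fc N c' i) ^+ 2 <=
  \int[m]_x ((nonlinearity (S N c) x - nonlinearity (S N c') x) ^+ 2).
Proof.
have bF c0 : bmf (nonlinearity (S N c0)) by apply: bmf_F.
have := bessel N (bmf_L2 (bmf_B (bF c) (bF c'))); congr (_ <= _); apply: eq_bigr => i _.
congr (_ ^+ 2); rewrite /Fc /cf -RI_B.
- by apply: RI_ext => x; rewrite mulrBl.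
- by apply: bmf_IgM => //; apply: L2_Ig; exact: (eb_L2).
- by apply: bmf_IgM => //; apply: L2_Ig; exact: (eb_L2).
Qed.

(** Convexity of t^4 with the derivative taken at the new point: [Fc] plus the coefficient itself is
    the coefficient of the cube. *)
Lemma quartic_convex N c c' :
  p4 N c' - p4 N c <= 4 * \sum_(i < N) (c' i - c i) * (Fc N c' i + c' i).
Proof.
have E : \sum_(i < N) (c' i - c i) * (Fc N c' i + c' i) = \int[m]_x (S N (fun i => c' i - c i) x * S N c' x ^+ 3).
  rewrite -(pair_cf); last by apply: (bmf_L2); exact: bmf_X.
  apply: eq_bigr => i _; congr (_ * _); rewrite -(cf_S c' (ltn_ord i)) /Fc /cf -RI_D.
  - by apply: RI_ext => x; rewrite /nonlinearity; ring.
  - by apply: bmf_IgM; [exact: bmf_F|apply: L2_Ig; exact: (eb_L2)].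
  - by apply: bmf_IgM => //; apply: L2_Ig; exact: (eb_L2).
have i4 c0 : Ig m (fun x => S N c0 x ^+ 4) by exact: Ig_SX.
rewrite E /p4 -RI_B// -RI_Z; last by apply: bmf_Ig; apply: bmf_M => //; exact: bmf_X.
apply: RI_le; [exact: IgB|by apply: IgZ; apply: bmf_Ig; apply: bmf_M => //; exact: bmf_X|].
move=> x; rewrite S_B; move: (S N c x) (S N c' x) => p q.
rewrite -subr_ge0 (_ : _ - _ = (p - q) ^+ 2 * ((p + q) ^+ 2 + 2 * q ^+ 2)); last by ring.
by pos.
Qed.

(** F' >= -1. The stability of the implicit step in H^-1 rests on this bound. *)
Lemma one_sided N c c' : - \sum_(i < N) (c i - c' i) ^+ 2 <=
  \sum_(i < N) (c i - c' i) * (Fc N c i - Fc N c' i).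
Proof.
have bF c0 : bmf (nonlinearity (S N c0)) by apply: bmf_F.
have E : \sum_(i < N) (c i - c' i) * (Fc N c i - Fc N c' i) =
   \int[m]_x (S N (fun i => c i - c' i) x * (nonlinearity (S N c) x - nonlinearity (S N c') x)).
  rewrite -(pair_cf); last by apply: (bmf_L2); exact: bmf_B.
  apply: eq_bigr => i _; congr (_ * _); rewrite /Fc /cf -RI_B.
  - by apply: RI_ext => x; rewrite [RHS]mulrBl.
  - by apply: bmf_IgM => //; apply: L2_Ig; exact: (eb_L2).
  - by apply: bmf_IgM => //; apply: L2_Ig; exact: (eb_L2).
rewrite E -(nr0E N (fun i => c i - c' i)) -(S_sqr) -RI_N; last by apply: bmf_Ig; exact: bmf_X.
apply: RI_le; [by apply: IgN; apply: bmf_Ig; exact: bmf_X|by apply: bmf_Ig; apply: bmf_M => //; exact: bmf_B|].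
move=> x; rewrite !S_B /nonlinearity; move: (S N c x) (S N c' x) => p q.
rewrite -subr_ge0 (_ : _ - _ = (p - q) ^+ 2 * (2^-1 * (p + q) ^+ 2 + 2^-1 * (p ^+ 2 + q ^+ 2))); last by field.
by pos.
Qed.

Lemma cubic_abs (a b : R) : `|a ^+ 2 + a * b + b ^+ 2 - 1| ^+ 3 <= 100 * (1 + a ^+ 6 + b ^+ 6).
Proof.
have h : `|a ^+ 2 + a * b + b ^+ 2 - 1| <= 1 + 3 / 2 * a ^+ 2 + 3 / 2 * b ^+ 2.
  by rewrite ler_norml; apply/andP; split; have := sqr_ge0 (a - b); have := sqr_ge0 (a + b); have := sqr_ge0 a; have := sqr_ge0 b; lra.
have {h} : `|a ^+ 2 + a * b + b ^+ 2 - 1| ^+ 3 <= (1 + 3 / 2 * a ^+ 2 + 3 / 2 * b ^+ 2) ^+ 3.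
  by rewrite lerXn2r ?nnegrE//; pos.
move=> /le_trans; apply.
have -> : a ^+ 6 = (a ^+ 2) ^+ 3 by ring.
have -> : b ^+ 6 = (b ^+ 2) ^+ 3 by ring.
move: (a ^+ 2) (b ^+ 2) (sqr_ge0 a) (sqr_ge0 b) => p q p0 q0.
pose M := Num.max 1 (Num.max p q).
have M1 : 1 <= M by rewrite le_max lexx.
have Mp : p <= M by rewrite !le_max lexx orbT.
have Mq : q <= M by rewrite !le_max lexx !orbT.
have M3 : M ^+ 3 <= 1 + p ^+ 3 + q ^+ 3.
  have p3 : 0 <= p ^+ 3 by exact: exprn_ge0.
  have q3 : 0 <= q ^+ 3 by exact: exprn_ge0.
  rewrite /M; case: (leP p q) => _; first by case: (leP 1 q) => _; rewrite ?expr1n; lra.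
  by case: (leP 1 p) => _; rewrite ?expr1n; lra.
apply: (le_via ((4 * M) ^+ 3)).
  by apply: lerXn2r; rewrite ?nnegrE; [pos|rewrite mulr_ge0// (le_trans ler01)|lra].
have -> : (4 * M) ^+ 3 = 64 * M ^+ 3 by ring.
have : 0 <= M ^+ 3 by rewrite exprn_ge0// (le_trans ler01).
lra.
Qed.

(** With u the divided difference of F, u^2 dd^2 is split by Hölder with exponents 3/2 and 3,
    written as Young at the scale [de] of the difference itself. [de] = 0 forces equal coefficients
    and is set apart. *)
Lemma Fc_lipschitz : exists2 C : R, 0 < C & forall N c c',
  \sum_(i < N) (Fc N c i - Fc N c' i) ^+ 2 <=
  C * (1 + p6 N c + p6 N c') * nr N 1 (fun i => c i - c' i).
Proof.
have [C C0 hC] := F1; have v0 := vol_gt0.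
exists (100 * (1 + vol D) + C); first by pos.
move=> N c c'; set dd := fun i => c i - c' i; set de := nr N 1 dd.
have de0 : 0 <= de by exact: nr_ge0.
have P0 : 0 <= p6 N c by exact: p6_ge0.
have P0' : 0 <= p6 N c' by exact: p6_ge0.
move: (de0); rewrite le_eqVlt => /predU1P[dz|dp].
  have z (i : 'I_N) : c i = c' i.
    apply/eqP; rewrite -subr_eq0 -(sqrf_eq0 (dd i)).
    have li := ss_pos hs i.
    have : la i * dd i ^+ 2 <= 0.
      rewrite dz /de (nr1E) (bigD1 i)//= lerDl; apply: sumr_ge0 => j _.
      by rewrite mulr_ge0 ?sqr_ge0// ltW ?(ss_pos hs).
    by rewrite pmulr_rle0// le_eqVlt ltNge sqr_ge0 orbF.
  rewrite -dz mulr0 big1// => i _.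
  have -> : Fc N c = Fc N c'; last by rewrite subrr expr0n.
  apply/funext => k; rewrite /Fc /cf; apply: RI_ext => x; rewrite /nonlinearity.
  by have -> : S N c x = S N c' x by apply: eq_bigr => j _; rewrite z.
apply: (le_trans (Fc_diff N c c')).
pose u x := S N c x ^+ 2 + S N c x * S N c' x + S N c' x ^+ 2 - 1.
have bu : bmf u.
  by apply: bmf_B; [apply: bmf_D; [apply: bmf_D|]; [exact: bmf_X|exact: bmf_M|exact: bmf_X]|exact: bmf_cst].
have i6 c0 : Ig m (fun x => S N c0 x ^+ 6) by exact: Ig_SX.
have iA : Ig m (fun x => cst 1 x + S N c x ^+ 6 + S N c' x ^+ 6).
  by apply: IgD => //; apply: IgD => //; exact: Ig_cst.
apply: (le_via (\int[m]_x (de * (100 * (cst 1 x + S N c x ^+ 6 + S N c' x ^+ 6)) +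
   de ^- 2 * S N dd x ^+ 6))).
  apply: RI_le.
  - by apply: bmf_Ig; apply: bmf_X; apply: bmf_B; exact: bmf_F.
  - by apply: IgD; apply: IgZ => //; exact: IgZ.
  move=> x; have := young_cubic (normr_ge0 (u x)) (sqr_ge0 (S N dd x)) dp.
  rewrite real_normK ?num_real// => h.
  have -> : (nonlinearity (S N c) x - nonlinearity (S N c') x) ^+ 2 = u x ^+ 2 * S N dd x ^+ 2.
    by rewrite /u /dd S_B /nonlinearity; ring.
  apply: (le_trans h); rewrite -exprM lerD2r ler_pM2l//; exact: cubic_abs.
rewrite RI_D; [|by apply: IgZ; exact: IgZ|exact: IgZ].
rewrite !RI_Z//; last exact: IgZ.
rewrite RI_D//; last by apply: IgD => //; exact: Ig_cst.
rewrite RI_D//; last exact: Ig_cst.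
rewrite vol_RI mul1r -/(p6 N c) -/(p6 N c') -/(p6 N dd).
apply: (le_via (de * (100 * (vol D + p6 N c + p6 N c')) + de ^- 2 * (C * de ^+ 3))).
  by rewrite lerD2l ler_wpM2l ?hC// invr_ge0 exprn_ge0.
have -> : de ^- 2 * (C * de ^+ 3) = de * C by field; rewrite gt_eqF.
rewrite -mulrDr mulrC ler_pM2r//.
have : 0 <= vol D * p6 N c by rewrite mulr_ge0// ltW.
have : 0 <= vol D * p6 N c' by rewrite mulr_ge0// ltW.
have : 0 <= C * (p6 N c + p6 N c') by rewrite mulr_ge0 ?addr_ge0// ltW.
lra.
Qed.

Lemma gradient_difference : exists2 C : R, 0 < C & forall N y o (Q : R), 0 <= Q ->
  sup_le N o Q ->
  \sum_(i < N) la i * (Fc N (fun i => y i + o i) i - Fc N y i) ^+ 2 <=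
  C * (Q * I2 N y + Q ^+ 2 * nr N 1 y + \sum_j \int[m]_x (S N y x ^+ 4 * G N o j x ^+ 2) +
       (1 + Q ^+ 2) * nr N 1 o).
Proof.
exists 288 => // N y o Q Q0 hQ; set z := fun i => y i + o i.
have h (c : nat -> R) : H1grad (nonlinearity (S N c)) (fun j x => (3 * S N c x ^+ 2 - 1) * G N c j x).
  apply: (H1_ext (H1_D (cube_H1 N c) (H1_Z (-1) (S_H1 N c)))) => [x|j x]; rewrite ?/nonlinearity; ring.
have hd := H1_D (h z) (H1_Z (-1) (h y)).
have := grad_bessel N hd.
rewrite (eq_bigr (fun i : 'I_N => la i * (Fc N z i - Fc N y i) ^+ 2)); last first.
  move=> i _; congr (_ * _ ^+ 2); rewrite /Fc /cf -RI_B.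
  - by apply: RI_ext => x; ring.
  - by apply: bmf_IgM; [exact: bmf_F|apply: L2_Ig; exact: (eb_L2)].
  - by apply: bmf_IgM; [exact: bmf_F|apply: L2_Ig; exact: (eb_L2)].
move=> /le_trans; apply.
rewrite /I2 -!(S_grad) !mulrDr !mulr_sumr -!big_split /=; apply: ler_sum => j _.
have iY : Ig m (fun x => G N y j x ^+ 2) by exact: L2_sqr (G_L2 N y j).
have iO : Ig m (fun x => G N o j x ^+ 2) by exact: L2_sqr (G_L2 N o j).
have i1 : Ig m (fun x => S N y x ^+ 2 * G N y j x ^+ 2) by apply: bmf_IgM => //; exact: bmf_X.
have i2 : Ig m (fun x => S N y x ^+ 4 * G N o j x ^+ 2) by apply: bmf_IgM => //; exact: bmf_X.
apply: (le_via (\int[m]_x (288 * (Q * (S N y x ^+ 2 * G N y j x ^+ 2)) + 288 * (Q ^+ 2 * G N y j x ^+ 2) +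
   288 * (S N y x ^+ 4 * G N o j x ^+ 2) + 288 * ((1 + Q ^+ 2) * G N o j x ^+ 2)))).
  have j1 := IgZ 288 (IgZ Q i1); have j2 := IgZ 288 (IgZ (Q ^+ 2) iY).
  have j3 := IgZ 288 i2; have j4 := IgZ 288 (IgZ (1 + Q ^+ 2) iO).
  apply: RI_le_ae; [exact: L2_sqr (hd.2 j).1|exact: IgD (IgD (IgD j1 j2) j3) j4|].
  apply: filterS hQ => x; rewrite /z S_D G_D.
  move: (S N y x) (S N o x) (G N y j x) (G N o j x) => Y O p q OQ.
  have -> : (3 * (Y + O) ^+ 2 - 1) * (p + q) + -1 * ((3 * Y ^+ 2 - 1) * p) =
     3 * (2 * (Y * O) + O ^+ 2) * p + (3 * (Y + O) ^+ 2 - 1) * q by ring.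
  have e1 : (2 * (Y * O) + O ^+ 2) ^+ 2 <= 8 * (Q * Y ^+ 2) + 2 * Q ^+ 2.
    have : (Y * O) ^+ 2 <= Q * Y ^+ 2 by rewrite exprMn mulrC ler_wpM2r ?sqr_ge0.
    have : (O ^+ 2) ^+ 2 <= Q ^+ 2 by rewrite lerXn2r ?nnegrE ?sqr_ge0.
    by have := sqr_ge0 (2 * (Y * O) - O ^+ 2); lra.
  have e2 : (3 * (Y + O) ^+ 2 - 1) ^+ 2 <= 144 * Y ^+ 4 + 144 * Q ^+ 2 + 2.
    have : (O ^+ 2) ^+ 2 <= Q ^+ 2 by rewrite lerXn2r ?nnegrE ?sqr_ge0.
    have a1 : (Y + O) ^+ 2 <= 2 * Y ^+ 2 + 2 * O ^+ 2 by have := sqr_ge0 (Y - O); lra.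
    have : ((Y + O) ^+ 2) ^+ 2 <= (2 * Y ^+ 2 + 2 * O ^+ 2) ^+ 2 by rewrite lerXn2r ?nnegrE ?sqr_ge0//; pos.
    have := sqr_ge0 (Y ^+ 2 - O ^+ 2); have := sqr_ge0 (3 * (Y + O) ^+ 2 + 1).
    have -> : Y ^+ 4 = (Y ^+ 2) ^+ 2 by ring.
    lra.
  apply: (le_via (18 * ((2 * (Y * O) + O ^+ 2) ^+ 2 * p ^+ 2) + 2 * ((3 * (Y + O) ^+ 2 - 1) ^+ 2 * q ^+ 2))).
    have := sqr_ge0 (3 * (2 * (Y * O) + O ^+ 2) * p - (3 * (Y + O) ^+ 2 - 1) * q).
    move: (2 * (Y * O) + O ^+ 2) (3 * (Y + O) ^+ 2 - 1) => k l; lra.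
  have := ler_wpM2r (sqr_ge0 p) e1; have := ler_wpM2r (sqr_ge0 q) e2.
  have : 0 <= Y ^+ 4 * q ^+ 2 by rewrite (_ : Y ^+ 4 * q ^+ 2 = (Y ^+ 2 * q) ^+ 2) ?sqr_ge0//; ring.
  have : 0 <= Q * (Y ^+ 2 * p ^+ 2) by pos.
  have : 0 <= Q ^+ 2 * p ^+ 2 by pos.
  have : 0 <= Q ^+ 2 * q ^+ 2 by pos.
  have := sqr_ge0 q; lra.
have j1 := IgZ 288 (IgZ Q i1); have j2 := IgZ 288 (IgZ (Q ^+ 2) iY).
have j3 := IgZ 288 i2; have j4 := IgZ 288 (IgZ (1 + Q ^+ 2) iO).
rewrite (RI_D (IgD (IgD j1 j2) j3) j4) (RI_D (IgD j1 j2) j3) (RI_D j1 j2).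
rewrite (RI_Z _ (IgZ Q i1)) (RI_Z _ (IgZ (Q ^+ 2) iY)) (RI_Z _ i2) (RI_Z _ (IgZ (1 + Q ^+ 2) iO)).
by rewrite (RI_Z _ i1) (RI_Z _ iY) (RI_Z _ iO).
Qed.

Lemma nr_zero N c (s t : R) : nr N s c = 0 -> nr N t c = 0.
Proof.
move=> h; apply: big1 => i _; have li := ss_pos hs i.
have : la i `^ s * c i ^+ 2 <= 0.
  rewrite -h /nr (bigD1 i)//= lerDl; apply: sumr_ge0 => j _.
  by rewrite mulr_ge0 ?powR_ge0 ?sqr_ge0.
rewrite pmulr_rle0 ?powR_gt0// le_eqVlt ltNge sqr_ge0 orbF => /eqP ->.
by rewrite mulr0.
Qed.

(** Agmon's choice of the length: s^4 balances [nr] 0 against [nr] 2. When this would exceed 1/2,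
    [nr] 2 is dominated by [nr] 0 and s = 1/2 will do. *)
Lemma sup_split : exists2 C : R, 0 < C & forall N y,
  exists2 s : R, 0 < s <= 1 / 2 &
   ((nr N 2 y <= 16 * nr N 0 y /\ s = 1 / 2) \/ s ^+ 4 * nr N 2 y = nr N 0 y) /\
   {ae m, forall x, S N y x ^+ 2 <= C * (s ^- d * nr N 0 y + s ^+ 4 * s ^- d * nr N 2 y)}.
Proof.
have [C C0 hC] := sup_S; exists C => // N y.
have n0 := nr_ge0 N 0 y; have n2 := nr_ge0 N 2 y.
have [h|h] := lerP (nr N 2 y) (16 * nr N 0 y).
  have s12 : 0 < (1 / 2 : R) <= 1 / 2 by rewrite lexx divr_gt0.
  by exists (1 / 2) => //; split; [left|exact: hC].
have p2 : 0 < nr N 2 y by apply: le_lt_trans h; rewrite mulr_ge0.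
have p0 : 0 < nr N 0 y.
  rewrite lt_neqAle n0 andbT eq_sym; apply: contraTneq p2 => /(@nr_zero _ _ _ 2) ->.
  by rewrite ltxx.
set q := nr N 0 y / nr N 2 y; have q0 : 0 < q by rewrite /q; pos.
set s := Num.sqrt (Num.sqrt q).
have s0 : 0 < s by rewrite !sqrtr_gt0.
have s4 : s ^+ 4 = q.
  rewrite (_ : s ^+ 4 = (s ^+ 2) ^+ 2); last by ring.
  by rewrite !sqr_sqrtr ?sqrtr_ge0// ltW.
have s12 : 0 < s <= 1 / 2.
  rewrite s0 -(@ler_pXn2r _ 4) ?nnegrE ?divr_ge0 ?(ltW s0)// s4 /q ler_pdivrMr//.
  have -> : (1 / 2 : R) ^+ 4 = 16^-1 by field.
  by rewrite /=; lra.
exists s => //; split; last exact: hC.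
by right; rewrite s4 /q divfK// gt_eqF.
Qed.

Lemma sup2 : (d <= 2)%N -> exists2 C : R, 0 < C & forall N y,
  {ae m, forall x, S N y x ^+ 4 <= C * (nr N 0 y ^+ 2 + nr N 0 y * nr N 2 y)}.
Proof.
move=> d2; have [C C0 hC] := sup_split; exists (64 * (2 * C) ^+ 2); first by pos.
move=> N y; have [s s12 [hs4 h]] := hC N y.
have n0 := nr_ge0 N 0 y; have n2 := nr_ge0 N 2 y.
case/andP: s12 => s0 s12.
have sd : s ^- d <= s ^- 2.
  by rewrite lef_pV2 ?posrE ?exprn_gt0// ler_wiXn2l ?(ltW s0)//; lra.
apply: filterS h => x h.
have P0 : 0 <= nr N 0 y + s ^+ 4 * nr N 2 y by pos.
have h1 : S N y x ^+ 2 <= C * (s ^- 2 * (nr N 0 y + s ^+ 4 * nr N 2 y)).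
  apply: (le_trans h); rewrite ler_pM2l// [leLHS](_ : _ = s ^- d * (nr N 0 y + s ^+ 4 * nr N 2 y)); last by ring.
  by rewrite ler_wpM2r.
have h2 : S N y x ^+ 4 <= (C * (s ^- 2 * (nr N 0 y + s ^+ 4 * nr N 2 y))) ^+ 2.
  rewrite (_ : S N y x ^+ 4 = (S N y x ^+ 2) ^+ 2); last by ring.
  by rewrite lerXn2r ?nnegrE ?sqr_ge0//; pos.
apply: (le_trans h2); case: hs4 => [[h3 ->]|h4].
  have -> : (1 / 2 : R) ^- 2 = 4 by field.
  have -> : (1 / 2 : R) ^+ 4 = 16^-1 by field.
  have h5 : nr N 0 y + 16^-1 * nr N 2 y <= 2 * nr N 0 y by lra.
  apply: (le_via ((C * (4 * (2 * nr N 0 y))) ^+ 2)).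
    by rewrite lerXn2r ?nnegrE//; pos; rewrite ler_pM2l// ler_pM2l.
  rewrite (_ : _ ^+ 2 = 64 * C ^+ 2 * nr N 0 y ^+ 2); last by ring.
  rewrite [leRHS](_ : _ = 64 * C ^+ 2 * nr N 0 y ^+ 2 + 64 * C ^+ 2 * (3 * nr N 0 y ^+ 2 + 4 * (nr N 0 y * nr N 2 y))); last by ring.
  by rewrite lerDl; pos.
have e0 : s ^- 4 * nr N 0 y = nr N 2 y by rewrite -h4 mulrA mulVf ?mul1r// expf_neq0// gt_eqF.
rewrite h4 (_ : _ ^+ 2 = 4 * C ^+ 2 * (s ^- 4 * nr N 0 y * nr N 0 y)); last by field; rewrite gt_eqF.
rewrite e0.
rewrite [leRHS](_ : _ = 4 * C ^+ 2 * (nr N 2 y * nr N 0 y) + 4 * C ^+ 2 * (64 * nr N 0 y ^+ 2 + 63 * (nr N 0 y * nr N 2 y))); last by ring.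
by rewrite lerDl; pos.
Qed.

(** In one dimension S^8 is bounded by nr0^4 + nr0^3 nr2, so p6^2 is only linear in [nr] 2, the
    quantity that the L^2 energy sums in time. *)
Lemma p6_d1 : d = 1%N -> exists2 C : R, 0 < C & forall N y,
  p6 N y ^+ 2 <= C * (nr N 0 y ^+ 6 + nr N 0 y ^+ 5 * nr N 2 y).
Proof.
move=> d1; have [C C0 hC] := sup_split; exists ((4 * C) ^+ 4); first by pos.
move=> N y; have [s s12 [hs4 h]] := hC N y.
have n0 := nr_ge0 N 0 y; have n2 := nr_ge0 N 2 y; case/andP: s12 => s0 s12.
have [X [X0 hX bX]] : exists X : R, [/\ 0 <= X, {ae m, forall x, S N y x ^+ 2 <= X} &
    X ^+ 4 <= (4 * C) ^+ 4 * (nr N 0 y ^+ 4 + nr N 0 y ^+ 3 * nr N 2 y)].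
  exists (C * (s ^- d * nr N 0 y + s ^+ 4 * s ^- d * nr N 2 y)); split => //; first by pos.
  rewrite d1 expr1; case: hs4 => [[h3 ->]|h4].
    have -> : (1 / 2 : R) ^-1 = 2 by field.
    have -> : (1 / 2 : R) ^+ 4 = 16^-1 by field.
    have h5 : 2 * nr N 0 y + 16^-1 * 2 * nr N 2 y <= 4 * nr N 0 y by lra.
    apply: (le_via ((C * (4 * nr N 0 y)) ^+ 4)).
      by rewrite lerXn2r ?nnegrE//; pos; rewrite ler_pM2l.
    rewrite (_ : (C * _) ^+ 4 = (4 * C) ^+ 4 * nr N 0 y ^+ 4); last by ring.
    by rewrite ler_wpM2l//; [pos|rewrite lerDl; pos].
  rewrite (_ : s ^+ 4 * s^-1 * nr N 2 y = s^-1 * (s ^+ 4 * nr N 2 y)); last by ring.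
  have e0 : s ^- 4 * nr N 0 y = nr N 2 y by rewrite -h4 mulrA mulVf ?mul1r// expf_neq0// gt_eqF.
  rewrite h4 (_ : (C * _) ^+ 4 = 16 * C ^+ 4 * (s ^- 4 * nr N 0 y * nr N 0 y ^+ 3)); last by field; rewrite gt_eqF.
  rewrite e0.
  rewrite [leRHS](_ : _ = 16 * C ^+ 4 * (nr N 2 y * nr N 0 y ^+ 3) + 16 * C ^+ 4 * (16 * nr N 0 y ^+ 4 + 15 * (nr N 0 y ^+ 3 * nr N 2 y))); last by ring.
  by rewrite lerDl; pos.
have h1 : p6 N y <= X ^+ 2 * nr N 0 y.
  rewrite -(S_sqr) /p6 -RI_Z; last by apply: bmf_Ig; exact: bmf_X.
  apply: RI_le_ae; [by apply: bmf_Ig; exact: bmf_X|by apply: IgZ; apply: bmf_Ig; exact: bmf_X|].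
  apply: filterS hX => x hx; rewrite (_ : S N y x ^+ 6 = (S N y x ^+ 2) ^+ 2 * S N y x ^+ 2); last by ring.
  by rewrite ler_wpM2r ?sqr_ge0// lerXn2r ?nnegrE ?sqr_ge0.
apply: (le_via ((X ^+ 2 * nr N 0 y) ^+ 2)).
  by rewrite lerXn2r ?nnegrE ?p6_ge0//; pos.
rewrite (_ : _ ^+ 2 = X ^+ 4 * nr N 0 y ^+ 2); last by ring.
rewrite [leRHS](_ : _ = (4 * C) ^+ 4 * (nr N 0 y ^+ 4 + nr N 0 y ^+ 3 * nr N 2 y) * nr N 0 y ^+ 2); last by ring.
by rewrite ler_wpM2r ?sqr_ge0.
Qed.

(** In d = 2, where [ga] may lie below 3/2, S^4 is bounded pointwise by [sup2]; in d = 3,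
    [gradient_multiplier] is applied with phi = S^2, whose gradient energy is 4 times [I2]. *)
Lemma quartic_gradient (ga : R) : (2 <= d)%N -> d%:R / 2 < ga -> exists2 C : R, 0 < C & forall N y o,
  \sum_j \int[m]_x (S N y x ^+ 4 * G N o j x ^+ 2) <=
  C * nr N ga o * (I2 N y + nr N 0 y ^+ 2 + nr N 0 y * nr N 2 y).
Proof.
move=> d2 hga; have /andP[d1 d3] := d_range.
have i4 N y o j : Ig m (fun x => S N y x ^+ 4 * G N o j x ^+ 2).
  by apply: bmf_IgM; [exact: bmf_X|exact: L2_sqr (G_L2 N o j)].
have [d2'|dge] := leqP d 2.
  have [C C0 hC] := sup2 d2'; have g1 : 1 <= ga.
    apply: le_trans (ltW hga); rewrite ler_pdivlMr// mul1r.
    by rewrite (_ : 2 = 2%:R :> R)// ler_nat.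
  have [C1 C10 hC1] := nr_mono g1.
  exists (C * C1); first by pos.
  move=> N y o; have n0 := nr_ge0 N 0 y; have n2 := nr_ge0 N 2 y.
  have ng := nr_ge0 N ga o; have I0 := I2_ge0 N y.
  apply: (le_via (C * (nr N 0 y ^+ 2 + nr N 0 y * nr N 2 y) * nr N 1 o)).
    rewrite -(S_grad) mulr_sumr; apply: ler_sum => j _.
    have iG : Ig m (fun x => G N o j x ^+ 2) by exact: L2_sqr (G_L2 N o j).
    rewrite -RI_Z//; apply: RI_le_ae => //; first exact: IgZ.
    by apply: filterS (hC N y) => x h; rewrite ler_wpM2r ?sqr_ge0.
  apply: (le_via (C * (nr N 0 y ^+ 2 + nr N 0 y * nr N 2 y) * (C1 * nr N ga o))).
    by apply: ler_wpM2l (hC1 N o); pos.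
  rewrite [leRHS](_ : _ = C * (nr N 0 y ^+ 2 + nr N 0 y * nr N 2 y) * (C1 * nr N ga o) +
    C * C1 * nr N ga o * I2 N y); last by ring.
  by rewrite lerDl; pos.
have dE : d = 3%N by apply/eqP; rewrite eqn_leq d3.
have hga3 : 3 / 2 < ga by move: hga; rewrite dE.
have [C C0 hC] := gradient_multiplier hga3.
have [C1 C10 hC1] := p4_nash.
have s12 : 0 < (1 / 2 : R) <= 1 / 2 by rewrite lexx divr_gt0.
exists (C * (4 + C1 * (1 + 2 ^+ d))); first by pos.
move=> N y o; have n0 := nr_ge0 N 0 y; have n2 := nr_ge0 N 2 y.
have ng := nr_ge0 N ga o; have I0 := I2_ge0 N y.
have [B B0 SB] := S_bounded N y; have h := S_H1 N y.
have SSB x : `|S N y x * S N y x| <= B ^+ 2 by rewrite normrM -expr2 lerXn2r ?nnegrE.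
have := hC N o _ _ _ (H1_mul h h SB SB) SSB.
rewrite (eq_bigr (fun j => \int[m]_x (S N y x ^+ 4 * G N o j x ^+ 2))); last first.
  by move=> j _; apply: RI_ext => x; ring.
have iI j : Ig m (fun x => S N y x ^+ 2 * G N y j x ^+ 2).
  by apply: bmf_IgM; [exact: bmf_X|exact: L2_sqr (G_L2 N y j)].
have -> : \int[m]_x ((S N y x * S N y x) ^+ 2) = p4 N y by apply: RI_ext => x; ring.
have -> : \sum_j \int[m]_x ((S N y x * G N y j x + S N y x * G N y j x) ^+ 2) = 4 * I2 N y.
  rewrite mulr_sumr; apply: eq_bigr => j _; rewrite -RI_Z//.
  by apply: RI_ext => x; ring.
move=> /le_trans; apply; rewrite [leRHS](_ : _ = C * nr N ga o * ((4 + C1 * (1 + 2 ^+ d)) *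
  (I2 N y + nr N 0 y ^+ 2 + nr N 0 y * nr N 2 y))); last by ring.
apply: ler_wpM2l; first by pos.
have := hC1 N y _ s12.
have -> : (1 / 2 : R) ^+ 2 = 4^-1 by field.
have -> : (1 / 2 : R) ^- d = 2 ^+ d by rewrite div1r exprVn invrK.
have k0 : 0 < 2 ^+ d :> R by pos.
move: (2 ^+ d : R) k0 => k k0 h1; apply: (le_via (4 * I2 N y + C1 * (4^-1 * I2 N y + k * nr N 0 y ^+ 2))).
  by rewrite lerD2l.
rewrite [leRHS](_ : _ = 4 * I2 N y + C1 * (4^-1 * I2 N y + k * nr N 0 y ^+ 2) + (4 * (nr N 0 y ^+ 2 + nr N 0 y * nr N 2 y) +
  C1 * ((4^-1 * 3 + k) * I2 N y + nr N 0 y ^+ 2 + (1 + k) * (nr N 0 y * nr N 2 y)))); last by field.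
by rewrite lerDl; pos.
Qed.

(** * Existence of the implicit Euler step by minimisation *)

Definition coefs N (v : 'rV[R]_N) : nat -> R := fun i =>
  if insub i is Some j then v 0 j else 0.

Lemma coefsE N (v : 'rV[R]_N) (i : 'I_N) : coefs v i = v 0 i.
Proof. by rewrite /coefs valK. Qed.

(** The moment is a polynomial in the coefficients; peeling off one factor expresses it through
    moments of lower order. *)
Lemma continuous_moment N n f : bmf f ->
  continuous (fun v : 'rV[R]_N => \int[m]_x (S N (coefs v) x ^+ n * f x)).
Proof.
elim: n f => [|n ih] f hf.
  rewrite (_ : (fun v : 'rV[R]_N => \int[m]_x (S N (coefs v) x ^+ 0 * f x)) = cst (\int[m]_x (1 * f x))); last by apply/funext => v.
  exact: cst_continuous.
have be i : bmf (eb i).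
  by split; [exact: L2_measurable (eb_L2 i)|have [B hB] := ss_bounded hs i; exists B].
rewrite (_ : (fun v : 'rV[R]_N => \int[m]_x (S N (coefs v) x ^+ n.+1 * f x)) = fun v => \sum_(i < N) v 0 i * \int[m]_x (S N (coefs v) x ^+ n * (f x * eb i x))).
  apply: (@continuous_fsum _ _ _ (fun (i : 'I_N) (v : 'rV[R]_N) => v 0 i * \int[m]_x (S N (coefs v) x ^+ n * (f x * eb i x)))) => i.
  apply: continuous_fmul; first by move=> v; exact: coord_continuous.
  by apply: ih; exact: bmf_M.
apply/funext => v; rewrite (RI_ext _ (g := fun x => S N (coefs v) x * (S N (coefs v) x ^+ n * f x))); last first.
  by move=> x; rewrite exprS mulrA.
rewrite (S_inner_f); last by apply: (bmf_L2); apply: bmf_M => //; exact: bmf_X.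
apply: eq_bigr => i _; rewrite coefsE; congr (_ * _).
by apply: RI_ext => x; rewrite mulrA.
Qed.

Lemma S_congr N c c' : (forall i : 'I_N, c i = c' i) -> S N c = S N c'.
Proof. by move=> h; apply/funext => x; apply: eq_bigr => i _; rewrite h. Qed.

Section minimise.
Variables (N : nat) (tau : R) (tau0 : 0 < tau) (a o : nat -> R).

(** Together with the quartic term this is the functional of one minimising-movement step in the
    H^-1 metric for the Cahn-Hilliard energy, in the variable c = y' + o with a = y + o. Its
    critical points satisfy the implicit Euler equation divided by tau la_i. *)
Let g (i : nat) (u : R) : R := (u - a i) ^+ 2 / (2 * tau * la i) + la i * (u - o i) ^+ 2 / 2 - u ^+ 2 / 2.
Let Psi c : R := \sum_(i < N) g i (c i) + p4 N c / 4.

Let Psi_ge c : \sum_(i < N) (c i - a i) ^+ 2 / (2 * tau * la i) - vol D / 4 <= Psi c.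
Proof.
have h : - (vol D / 4) <= p4 N c / 4 - nr N 0 c / 2.
  rewrite -(S_sqr) /p4 -[p in p - _]mulrC -[p in _ - p]mulrC.
  have i4 : Ig m (fun x => S N c x ^+ 4) by exact: Ig_SX.
  have i2 : Ig m (fun x => S N c x ^+ 2) by exact: Ig_SX.
  rewrite -!RI_Z// -RI_B; [|exact: IgZ|exact: IgZ].
  rewrite (_ : - (vol D / 4) = - 4^-1 * vol D); last by field.
  rewrite -(vol_RI (- 4^-1)); apply: RI_le; [exact: Ig_cst|by apply: IgB; exact: IgZ|].
  move=> x /=; rewrite -subr_ge0; move: (S N c x) => t.
  rewrite (_ : _ - _ = 4^-1 * (t ^+ 2 - 1) ^+ 2); last by field.
  by pos.
rewrite nr0E in h.
have h2 : 0 <= \sum_(i < N) la i * (c i - o i) ^+ 2 / 2.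
  by apply: sumr_ge0 => i _; have := ss_pos hs i => li; pos.
rewrite -mulr_suml in h2.
rewrite /Psi /g sumrB big_split /= -!mulr_suml.
lra.
Qed.

Let Psi_continuous : continuous (fun v : 'rV[R]_N => Psi (coefs v)).
Proof.
have h1 : continuous (fun v : 'rV[R]_N => \sum_(i < N) g i (coefs v i)).
  apply: (@continuous_fsum _ _ _ (fun (i : 'I_N) (v : 'rV[R]_N) => g i (coefs v i))) => i.
  rewrite (_ : (fun v => _) = (fun v : 'rV[R]_N => g i (v 0 i))); last by apply/funext => z; rewrite coefsE.
  have c0 : continuous (fun v : 'rV[R]_N => v 0 i) by move=> v; exact: coord_continuous.
  have cc (b : R) : continuous (fun v : 'rV[R]_N => (v 0 i - b) ^+ 2).
    by apply: continuous_fmul; apply: continuous_subC.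
  rewrite /g; apply: continuous_fsub; [apply: continuous_fadd|] => /=.
  - by apply: continuous_fmul => //; exact: cst_continuous.
  - apply: continuous_fmul; last exact: cst_continuous.
    by apply: continuous_fmul => //; exact: cst_continuous.
  - apply: continuous_fmul; last exact: cst_continuous.
    by apply: continuous_fmul.
have h2 : continuous (fun v : 'rV[R]_N => p4 N (coefs v)).
  rewrite /p4 (_ : (fun v => _) = (fun v : 'rV[R]_N => \int[m]_x (S N (coefs v) x ^+ 4 * cst 1 x))).
    by apply: continuous_moment; exact: bmf_cst.
  by apply/funext => z; apply: RI_ext => x; rewrite mulr1.
apply: (continuous_fadd h1).
by apply: (continuous_fmul h2); exact: cst_continuous.
Qed.

Let bump c (k : nat) (t : R) : nat -> R := fun i => c i + (if i == k then t else 0).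

(** A variation of one coordinate with an explicit quadratic remainder, in place of differentiating
    [Psi]; [Fc_lipschitz] controls the change of the nonlinear coefficient. *)
Let Psi_bump c (k : 'I_N) (t : R) : exists2 K : R, 0 <= K & forall t : R, `|t| <= 1 ->
  Psi (bump c k t) - Psi c <=
  t * ((c k - a k) / (tau * la k) + la k * (c k - o k) + Fc N c k) + K * t ^+ 2.
Proof.
have lk := ss_pos hs k.
have [C C0 hC] := F1; have [C1 C10 hC1] := Fc_lipschitz.
have nd (s : R) : nr N 1 (fun i => bump c k s i - c i) = la k * s ^+ 2.
  rewrite (nr1E) (bigD1 k)//= big1 => [|i ik]; first by rewrite /bump eqxx addr0 addrC addKr.
  by rewrite /bump (_ : (i == k :> nat) = false) ?addr0 ?subrr ?expr0n ?mulr0//; apply/negbTE.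
have nb (s : R) : `|s| <= 1 -> nr N 1 (bump c k s) <= 2 * nr N 1 c + 2 * la k.
  move=> s1; have s2 : s ^+ 2 <= 1 by rewrite -real_normK ?num_real// -(expr1n R 2) lerXn2r ?nnegrE.
  have : nr N 1 (bump c k s) <= 2 * nr N 1 c + 2 * nr N 1 (fun i => bump c k s i - c i).
    rewrite !(nr1E) !mulr_sumr -big_split; apply: ler_sum => i _ /=.
    have li := ss_pos hs i; rewrite (_ : 2 * (la i * c i ^+ 2) + _ = la i * (2 * c i ^+ 2 + 2 * (bump c k s i - c i) ^+ 2)); last by ring.
    rewrite ler_pM2l//; have := sqr_ge0 (bump c k s i - c i - c i); lra.
  rewrite nd => /le_trans; apply; rewrite lerD2l; apply: ler_wpM2l => //.
  by rewrite -[leRHS]mulr1 ler_pM2l.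
set B := 1 + C * (2 * nr N 1 c + 2 * la k) ^+ 3 + p6 N c.
have n1 := nr_ge0 N 1 c; have p60 := p6_ge0 N c.
have B0 : 0 <= B by rewrite /B; pos.
have Fl (s : R) : `|s| <= 1 -> `|Fc N (bump c k s) k - Fc N c k| <= (1 + C1 * B * la k) * `|s|.
  move=> s1; rewrite -(ler_pXn2r (n:=2)) ?nnegrE//; last by apply: mulr_ge0 => //; pos.
  rewrite real_normK ?num_real// exprMn real_normK ?num_real//.
  have := hC1 N (bump c k s) c; rewrite nd => h.
  have h1 : (Fc N (bump c k s) k - Fc N c k) ^+ 2 <= C1 * (1 + p6 N (bump c k s) + p6 N c) * (la k * s ^+ 2).
    by apply: le_trans h; rewrite (bigD1 k)//= lerDl; apply: sumr_ge0 => i _; exact: sqr_ge0.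
  apply: (le_trans h1); apply: (le_via (C1 * B * la k * s ^+ 2)).
    rewrite -[leRHS]mulrA; apply: ler_wpM2r; first by pos.
    apply: ler_wpM2l; first by pos.
    rewrite /B lerD2r lerD2l; apply: (le_trans (hC N _)); apply: ler_wpM2l; first by pos.
    by rewrite lerXn2r ?nnegrE ?nr_ge0//; [pos|exact: nb].
  apply: ler_wpM2r; first by pos.
  have : 0 <= C1 * B * la k by pos.
  by move: (C1 * B * la k) => z z0; have := sqr_ge0 z; lra.
set L := 1 + C1 * B * la k; have L0 : 0 <= L by rewrite /L; pos.
have q0 : 0 <= 1 / (2 * tau * la k) + la k / 2 by apply: addr_ge0; [rewrite div1r|]; pos.
exists (1 + L + (1 / (2 * tau * la k) + la k / 2)); first by pos.
move=> s s1; have h := quartic_convex N c (bump c k s).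
have E1 : \sum_(i < N) (bump c k s i - c i) * (Fc N (bump c k s) i + bump c k s i) = s * (Fc N (bump c k s) k + (c k + s)).
  rewrite (bigD1 k)//= big1 => [|i ik]; first by rewrite /bump eqxx addr0; congr (_ * _); rewrite addrC addKr.
  by rewrite /bump (_ : (i == k :> nat) = false) ?addr0 ?subrr ?mul0r//; apply/negbTE.
have E2 : \sum_(i < N) g i (bump c k s i) - \sum_(i < N) g i (c i) = g k (c k + s) - g k (c k).
  rewrite -sumrB (bigD1 k)//= big1 => [|i ik]; first by rewrite /bump eqxx addr0.
  by rewrite /bump (_ : (i == k :> nat) = false) ?addr0 ?subrr//; apply/negbTE.
have E3 : s * (Fc N (bump c k s) k - Fc N c k) <= L * s ^+ 2.
  apply: (le_trans (ler_norm _)); rewrite normrM -(real_normK (num_real s)).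
  apply: (le_via (`|s| * (L * `|s|))); first by apply: ler_wpM2l => //; exact: Fl.
  by rewrite [leLHS](_ : _ = L * `|s| ^+ 2)//; ring.
have E4 : g k (c k + s) - g k (c k) = s * ((c k - a k) / (tau * la k) + la k * (c k - o k) - c k) +
   s ^+ 2 * (1 / (2 * tau * la k) + la k / 2 - 1 / 2).
  by rewrite /g; field; rewrite !gt_eqF.
rewrite E1 in h; have E5 : Psi (bump c k s) - Psi c = g k (c k + s) - g k (c k) + (p4 N (bump c k s) - p4 N c) / 4.
  by rewrite /Psi -E2; field.
rewrite E5 E4; have := sqr_ge0 s.
move: h E3; move: (Fc N _ k) (Fc N c k) (1 / (2 * tau * la k)) ((c k - a k) / _) => F' FF rr qq; lra.
Qed.

Lemma implicit_euler_min : exists c : nat -> R, forall k : 'I_N,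
  (c k - a k) / (tau * la k) + la k * (c k - o k) + Fc N c k = 0.
Proof.
set E := Psi a + vol D / 4; have v0 := vol_gt0.
have E0 : 0 <= E.
  have := Psi_ge a; rewrite big1 => [|i _]; first by rewrite /E; lra.
  by rewrite subrr expr0n mul0r.
(* By [Psi_ge] a point with [Psi] at most [Psi a] satisfies |c_i - a_i| <= 1 + 2 tau la_i E. The
   radius exceeds this by at least 1, so unit variations of the minimiser stay in the cube. *)
set rho := 1 + \sum_(i < N) (1 + 2 * tau * la i * E).
have lt i := ss_pos hs i.
have r1 (i : 'I_N) : 2 + 2 * tau * la i * E <= rho.
  rewrite /rho (bigD1 i)//= (_ : 2 = 1 + 1)// -!addrA !lerD2l lerDl.
  by apply: sumr_ge0 => j _; have := lt j => lj; pos.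
have rho0 : 0 <= rho by rewrite /rho; apply: addr_ge0 => //; apply: sumr_ge0 => j _; have := lt j => lj; pos.
pose av : 'rV[R]_N := \row_i a i; pose A := cbox av rho.
have avA : A av by move=> j; rewrite subrr normr0.
have [cs csA hmin] : exists2 c, c \in A & forall t, t \in A -> Psi (coefs c) <= Psi (coefs t).
  apply: (@EVT_min_rV R N (fun v => Psi (coefs v)) A).
  - by exists av.
  - exact: compact_cbox.
  - exact: continuous_subspaceT.
pose c := coefs cs; exists c => k.
have Pav : Psi (coefs av) = Psi a.
  rewrite /Psi /p4 (S_congr (c' := a)) => [|i]; last by rewrite coefsE mxE.
  by congr (_ + _); apply: eq_bigr => i _; rewrite coefsE mxE.
have close (i : 'I_N) : `|c i - a i| <= 1 + 2 * tau * la i * E.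
  have h1 : (c i - a i) ^+ 2 / (2 * tau * la i) <= E.
    have := hmin av; rewrite inE Pav => /(_ avA) h2; have := Psi_ge c.
    rewrite (bigD1 i)//=; set rest := \sum_(j < N | _) _.
    have : 0 <= rest by apply: sumr_ge0 => j _; have := lt j => lj; pos.
    by rewrite /E; move: h2; rewrite -/c; lra.
  have ti : 0 < 2 * tau * la i by have := lt i => li; pos.
  move: h1; rewrite ler_pdivrMr// mulrC => h1.
  rewrite -(ler_pXn2r (n:=2)) ?nnegrE//; last by pos.
  rewrite real_normK ?num_real//; apply: (le_trans h1).
  have : 0 <= 2 * tau * la i * E by pos.
  by move: (2 * tau * la i * E) => z z0; have := sqr_ge0 z; lra.
have [K K0 hK] := Psi_bump c k 0.
apply: (stationary K0) => s s1; apply: le_trans (hK s s1).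
pose w : 'rV[R]_N := \row_i bump c k s i.
have wA : A w.
  move=> j; rewrite /w /av !mxE /bump; apply: (le_via (`|c j - a j| + 1)).
    rewrite -addrA [_ - a j]addrC addrA; apply: (le_trans (ler_normD _ _)); rewrite lerD2l.
    by case: ifP => // _; rewrite normr0.
  by have := close j; have := r1 j; lra.
have := hmin w; rewrite inE => /(_ wA); rewrite subr_ge0 => /le_trans; apply.
rewrite le_eqVlt; apply/orP; left; apply/eqP.
rewrite /Psi /p4 (S_congr (c' := bump c k s)) => [|i]; last by rewrite coefsE mxE.
by congr (_ + _); apply: eq_bigr => i _; rewrite coefsE mxE.
Qed.
End minimise.

Lemma implicit_euler N (tau : R) y o : 0 < tau -> exists y', forall i : 'I_N,
  y' i - y i = - (tau * la i * (la i * y' i + Fc N (fun j => y' j + o j) i)).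
Proof.
move=> t0; have [c hc] := implicit_euler_min N t0 (fun i => y i + o i) o.
exists (fun i => c i - o i) => i; have li := ss_pos hs i.
have -> : (fun j => c j - o j + o j) = c by apply/funext => j; rewrite subrK.
have := hc i; move: (Fc N c i) => F h.
have {h} -> : F = - ((c i - (y i + o i)) / (tau * la i) + la i * (c i - o i)) by lra.
by field; rewrite !gt_eqF.
Qed.

(** * One-step energy estimates for the implicit scheme *)

Let lp i := ss_pos hs i.

Definition istep N (tau : R) y o y' := forall i : 'I_N,
  y' i - y i = - (tau * la i * (la i * y' i + Fc N (fun j => y' j + o j) i)).

Lemma nrN1E N c : nr N (-1) c = \sum_(i < N) (la i)^-1 * c i ^+ 2.
Proof. by apply: eq_bigr => i _; rewrite powR_inv1// ltW. Qed.

Lemma interp_sqr N c : nr N 0 c ^+ 2 <= nr N (-1) c * nr N 1 c.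
Proof.
have := sum_CS N (fun i => Num.sqrt (la i)^-1 * c i) (fun i => Num.sqrt (la i) * c i).
rewrite nr0E nrN1E (nr1E); congr (_ ^+ 2 <= _ * _); apply: eq_bigr => i _ /=.
- rewrite [LHS](_ : _ = (Num.sqrt (la i)^-1 * Num.sqrt (la i)) * c i ^+ 2); last by ring.
  by rewrite -sqrtrM ?invr_ge0 ?(ltW (lp i))// mulVf ?gt_eqF// sqrtr1 mul1r.
- by rewrite exprMn sqr_sqrtr// invr_ge0 ltW.
- by rewrite exprMn sqr_sqrtr// ltW.
Qed.

Lemma interp_sqr1 N c : nr N 1 c ^+ 2 <= nr N 0 c * nr N 2 c.
Proof.
have := sum_CS N c (lc c).
rewrite nr0E (nr2E) (nr1E); congr (_ ^+ 2 <= _); apply: eq_bigr => i _ /=.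
by rewrite /lc; ring.
Qed.

Lemma interp_cube N c : nr N 0 c ^+ 3 <= nr N (-1) c ^+ 2 * nr N 2 c.
Proof.
have h1 := interp_sqr N c; have h2 := interp_sqr1 N c.
have n0 := nr_ge0 N 0 c; have n1 := nr_ge0 N 1 c; have n2 := nr_ge0 N 2 c; have nm := nr_ge0 N (-1) c.
move: n0; rewrite le_eqVlt => /orP[/eqP <-|n0]; first by rewrite exprS mul0r; pos.
rewrite -(ler_pM2l n0) -exprS; apply: (le_via ((nr N (-1) c * nr N 1 c) ^+ 2)).
  by rewrite (_ : _ ^+ 4 = (nr N 0 c ^+ 2) ^+ 2) ?lerXn2r ?nnegrE ?sqr_ge0//; [pos|ring].
rewrite exprMn (_ : nr N 0 c * _ = nr N (-1) c ^+ 2 * (nr N 0 c * nr N 2 c)); last by ring.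
by rewrite ler_wpM2l// sqr_ge0.
Qed.

Lemma nr1_le N c : nr N 1 c <= nr N 2 c / 16 + 4 * nr N 0 c.
Proof.
rewrite (nr1E) (nr2E) nr0E mulr_suml mulr_sumr -big_split; apply: ler_sum => i _ /=.
rewrite /lc exprMn -subr_ge0 (_ : _ - _ = (la i / 4 - 2) ^+ 2 * c i ^+ 2); last by field.
by rewrite mulr_ge0 ?sqr_ge0.
Qed.

(** The increment is tested with A^-1 y', so the nonlinearity is paired with y' and [coercivity]
    applies directly. *)
Lemma step_neg1 : exists2 C : R, 0 < C & forall N (tau : R) y o y' (Q : R), 0 < tau ->
  istep N tau y o y' -> 0 <= Q -> sup_le N o Q ->
  nr N (-1) y' - nr N (-1) y + 2 * tau * nr N 1 y' <= tau * (C * (1 + Q ^+ 2)).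
Proof.
have [C C0 hC] := coercivity; exists (2 * C); first by pos.
move=> N tau y o y' Q t0 st Q0 hQ; have := hC N y' o Q Q0 hQ; have p40 := p4_ge0 N y'.
have : nr N (-1) y' - nr N (-1) y <= 2 * \sum_(i < N) (la i)^-1 * ((y' i - y i) * y' i).
  rewrite !nrN1E -sumrB mulr_sumr; apply: ler_sum => i _.
  rewrite -mulrBr [leRHS](_ : _ = (la i)^-1 * (2 * ((y' i - y i) * y' i))); last by ring.
  by rewrite ler_pM2l ?invr_gt0//; have := sqr_ge0 (y' i - y i); lra.
rewrite (eq_bigr (fun i : 'I_N => - tau * (la i * y' i ^+ 2) - tau * (y' i * Fc N (fun j => y' j + o j) i))); last first.
  by move=> i _; rewrite st; field; rewrite gt_eqF.
rewrite sumrB -!mulr_sumr -(nr1E); set s := \sum_(i < N) _ => h1 h2.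
have h3 : tau * (4^-1 * p4 N y' - C * (1 + Q ^+ 2)) <= tau * s by rewrite ler_pM2l.
have h4 : 0 <= tau * p4 N y' by pos.
lra.
Qed.

(** Tested with y'. The quartic term is split by [p4_nash] at length 1/(2 W), W of order (1 + Q)^3,
    which leaves W^4 nr0^2. This is absorbed into [nr] 2 through nr0^3 <= nr(-1)^2 nr2 and Young, at
    the cost of (W^4)^3 and nr(-1)^4. Hence the exponents 36 and 4, and the later requirement 36 <=
    q. *)
Lemma step_0 : exists2 C : R, 0 < C & forall N (tau : R) y o y' (Q : R), 0 < tau ->
  istep N tau y o y' -> 0 <= Q -> sup_le N o Q ->
  nr N 0 y' - nr N 0 y + tau * nr N 2 y' <= tau * (C * ((1 + Q) ^+ 36 * (1 + nr N (-1) y') ^+ 4)).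
Proof.
have [C C0 hC] := dissipation; have [Cn Cn0 hCn] := p4_nash.
set E := 1 + 2 * C * Cn; have E0 : 0 < E by rewrite /E; pos.
have E1 : 1 <= E by rewrite /E lerDl; pos.
exists (2 * (2 * C + 4 + 256 * (9 * E ^+ 4) ^+ 3)); first by pos.
move=> N tau y o y' Q t0 st Q0 hQ; have := hC N y' o Q Q0 hQ; have p40 := p4_ge0 N y'.
set U := 1 + Q; have U0 : 0 < U by rewrite /U ltr_wpDr.
have U1 : 1 <= U by rewrite /U lerDl.
have n0 := nr_ge0 N 0 y'; have n1 := nr_ge0 N 1 y'; have n2 := nr_ge0 N 2 y'.
have nm := nr_ge0 N (-1) y'; have I0 := I2_ge0 N y'.
set K := nr N (-1) y' in nm *; set X := nr N 0 y' in n0 *.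
have : nr N 0 y' - nr N 0 y <= 2 * \sum_(i < N) (y' i - y i) * y' i.
  rewrite !nr0E -sumrB mulr_sumr; apply: ler_sum => i _.
  by have := sqr_ge0 (y' i - y i); lra.
rewrite (eq_bigr (fun i : 'I_N => - tau * (lc y' i ^+ 2) - tau * (lc y' i * Fc N (fun j => y' j + o j) i))); last first.
  by move=> i _; rewrite st /lc; ring.
rewrite sumrB -!mulr_sumr -(nr2E); set s := \sum_(i < N) _ => h1 h2.
have h3 : tau * (3 * I2 N y' - nr N 1 y' - nr N 2 y' / 4 - C * (1 + Q ^+ 3) * (1 + p4 N y')) <= tau * s by rewrite ler_pM2l.
have Q3 : 1 + Q ^+ 3 <= 2 * U ^+ 3.
  rewrite -subr_ge0 (_ : _ - _ = 1 + 6 * Q + 6 * Q ^+ 2 + Q ^+ 3); last by rewrite /U; ring.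
  by pos.
have h4 : C * (1 + Q ^+ 3) * (1 + p4 N y') <= 2 * C * U ^+ 3 * (1 + p4 N y').
  apply: ler_wpM2r; first by pos.
  by rewrite (_ : 2 * C * U ^+ 3 = C * (2 * U ^+ 3)) ?ler_pM2l//; ring.
have EU : 1 <= E * U ^+ 3 by rewrite -(mulr1 1) ler_pM// exprn_ege1.
set W := E * U ^+ 3 in EU; have W0 : 0 < W by rewrite /W; pos.
have CW : 2 * C * U ^+ 3 * Cn <= W.
  by rewrite /W (_ : 2 * C * U ^+ 3 * Cn = (2 * C * Cn) * U ^+ 3) ?ler_wpM2r ?exprn_ge0 ?(ltW U0)// /E ?lerDr//; ring.
have s12 : 0 < (2 * W)^-1 <= 1 / 2.
  by rewrite invr_gt0 mulr_gt0//= div1r lef_pV2 ?posrE ?mulr_gt0// -[leLHS]mulr1 ler_pM2l.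
have h5 : 2 * C * U ^+ 3 * p4 N y' <= I2 N y' / 4 + 8 * W ^+ 4 * X ^+ 2.
  apply: (le_via (2 * C * U ^+ 3 * (Cn * ((2 * W)^-1 ^+ 2 * I2 N y' + (2 * W)^-1 ^- d * X ^+ 2)))).
    by apply: ler_wpM2l; [pos|exact: hCn].
  rewrite mulrA; apply: (le_via (W * ((2 * W)^-1 ^+ 2 * I2 N y' + (2 * W) ^+ 3 * X ^+ 2))).
    have h2W : 1 <= 2 * W by lra.
    apply: ler_pM => //; [by pos|by case/andP: s12 => si _; pos|].
    rewrite lerD2l exprVn invrK; apply: ler_wpM2r; first exact: sqr_ge0.
    by apply: ler_weXn2l => //; case/andP: d_range.
  rewrite (_ : W * _ = (4 * W)^-1 * I2 N y' + 8 * W ^+ 4 * X ^+ 2); last by field; rewrite gt_eqF.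
  rewrite lerD2r mulrC; apply: ler_wpM2l => //.
  by rewrite lef_pV2 ?posrE ?mulr_gt0// -[leLHS]mulr1 ler_pM2l.
have h6 := nr1_le N y'; rewrite -/X in h6.
have [D1 [D1E D10]] : exists D1, D1 = 9 * W ^+ 4 /\ 0 < D1 by exists (9 * W ^+ 4); split => //; pos.
have h7 : (8 * W ^+ 4 + 1) * X ^+ 2 <= nr N 2 y' / 16 + 256 * (1 + K ^+ 2) ^+ 2 * D1 ^+ 3.
  have K2 : 0 < 1 + K ^+ 2 by apply: ltr_wpDr => //; exact: sqr_ge0.
  have := @young_cubic X D1 (16 * (1 + K ^+ 2))^-1.
  have -> : (16 * (1 + K ^+ 2))^-1 ^- 2 * D1 ^+ 3 = 256 * (1 + K ^+ 2) ^+ 2 * D1 ^+ 3 by field; rewrite gt_eqF.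
  move=> /(_ n0 (ltW D10)) hy; have {hy} : X ^+ 2 * D1 <= (16 * (1 + K ^+ 2))^-1 * X ^+ 3 + 256 * (1 + K ^+ 2) ^+ 2 * D1 ^+ 3.
    by apply: hy; rewrite invr_gt0; pos.
  have hc : (16 * (1 + K ^+ 2))^-1 * X ^+ 3 <= nr N 2 y' / 16.
    rewrite ler_pdivrMl; last by pos.
    apply: (le_trans (interp_cube N y')); rewrite -/K (_ : 16 * (1 + K ^+ 2) * (nr N 2 y' / 16) = K ^+ 2 * nr N 2 y' + nr N 2 y'); last by field.
    by rewrite lerDl.
  have hd : (8 * W ^+ 4 + 1) * X ^+ 2 <= X ^+ 2 * D1.
    rewrite mulrC; apply: ler_wpM2l; first exact: sqr_ge0.
    by rewrite D1E; have := exprn_ege1 4 EU; lra.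
  by lra.
set P := U ^+ 36 * (1 + K) ^+ 4.
have P1 : 1 <= P.
  rewrite /P -[leLHS]mulr1; apply: ler_pM => //; first exact: exprn_ege1.
  by apply: exprn_ege1; rewrite lerDl.
have h8 : 256 * (1 + K ^+ 2) ^+ 2 * D1 ^+ 3 <= 256 * (9 * E ^+ 4) ^+ 3 * P.
  rewrite /P D1E /W (_ : 256 * (9 * E ^+ 4) ^+ 3 * (U ^+ 36 * (1 + K) ^+ 4) = (256 * (9 * E ^+ 4) ^+ 3 * U ^+ 36) * ((1 + K) ^+ 2) ^+ 2); last by ring.
  rewrite (_ : 256 * (1 + K ^+ 2) ^+ 2 * _ = (256 * (9 * E ^+ 4) ^+ 3 * U ^+ 36) * (1 + K ^+ 2) ^+ 2); last by ring.
  apply: ler_wpM2l; first by pos.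
  rewrite lerXn2r ?nnegrE//; [by pos|by pos|].
  by rewrite -subr_ge0 (_ : _ - _ = 2 * K); [pos|ring].
have h9 : 2 * C * U ^+ 3 <= 2 * C * P.
  apply: ler_wpM2l; first by pos.
  rewrite /P -[leLHS]mulr1 ler_pM ?exprn_ge0 ?(ltW U0)//; first exact: ler_weXn2l.
  by rewrite exprn_ege1// lerDl.
have h10 : 4 * X <= 4 + X ^+ 2 by have := sqr_ge0 (X - 2); lra.
have h11 : 3 * I2 N y' - nr N 1 y' - nr N 2 y' / 4 - C * (1 + Q ^+ 3) * (1 + p4 N y') >=
  - (3 / 8) * nr N 2 y' - (2 * C + 4 + 256 * (9 * E ^+ 4) ^+ 3) * P.
  move: h4 h5 h6 h7 h8 h9 h10 P1 I0; move: (C * (1 + Q ^+ 3) * _) (256 * (1 + K ^+ 2) ^+ 2 * _) (E ^+ 4) => z1 z2 z3; lra.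
have h12 : tau * (- (3 / 8) * nr N 2 y' - (2 * C + 4 + 256 * (9 * E ^+ 4) ^+ 3) * P) <= tau * s.
  by apply: le_trans h3; rewrite ler_pM2l.
have h13 : 0 <= tau * nr N 2 y' by pos.
move: h1 h12 h13; rewrite -/X -[2 * _ * P]mulrA; move: ((2 * C + 4 + 256 * (9 * E ^+ 4) ^+ 3) * P) => z; lra.
Qed.

(** * Discrete parabolic smoothing *)

Lemma nr_sum N (s : R) n (v : nat -> nat -> R) (be : nat -> R) :
  (forall k, (k < n)%N -> 0 <= be k) -> (forall k, (k < n)%N -> nr N s (v k) <= be k ^+ 2) ->
  nr N s (fun i => \sum_(k < n) v k i) <= (\sum_(k < n) be k) ^+ 2.
Proof.
elim: n => [|n ih] h0 h.
  by rewrite /nr big1 ?sqr_ge0// => i _; rewrite big_ord0 expr0n mulr0.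
have B0 : 0 <= \sum_(k < n) be k by apply: sumr_ge0 => k _; exact: h0 (ltnW (ltn_ord k)).
have {ih}ih := ih (fun k kn => h0 k (ltnW kn)) (fun k kn => h k (ltnW kn)).
have hn := h n (ltnSn n); have b0 := h0 n (ltnSn n).
rewrite big_ord_recr /=; move: ih; set z := fun i => \sum_(k < n) v k i => ih.
have -> : nr N s (fun i => \sum_(k < n.+1) v k i) = nr N s z + 2 * (\sum_(i < N) la i `^ s * (z i * v n i)) + nr N s (v n).
  rewrite /nr mulr_sumr -!big_split; apply: eq_bigr => i _ /=; rewrite big_ord_recr /= -/(z i); ring.
set p := \sum_(i < N) _; suff hp : p <= (\sum_(k < n) be k) * be n by move: ih hn hp; set B := \sum_(k < n) be k; lra.
apply: (le_trans (ler_norm _)); rewrite -(ler_pXn2r (n:=2)) ?nnegrE//; last by pos.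
rewrite real_normK ?num_real// exprMn.
apply: (le_via (nr N s z * nr N s (v n))); last by rewrite ler_pM ?nr_ge0.
have := sum_CS N (fun i => Num.sqrt (la i `^ s) * z i) (fun i => Num.sqrt (la i `^ s) * v n i).
rewrite /p /nr; congr (_ ^+ 2 <= _ * _); apply: eq_bigr => i _ /=.
- rewrite [LHS](_ : _ = (Num.sqrt (la i `^ s)) ^+ 2 * (z i * v n i)); last by ring.
  by rewrite sqr_sqrtr ?powR_ge0.
- by rewrite exprMn sqr_sqrtr ?powR_ge0.
- by rewrite exprMn sqr_sqrtr ?powR_ge0.
Qed.

(** With x = (j + 1) tau la^2 this is x^p <= 1 + x: decay of the kernel in time is traded for powers
    of the eigenvalue. *)
Lemma kernel_bound (p tau : R) (i j : nat) : 0 < tau -> 0 <= p <= 1 ->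
  la i `^ (2 * p - 1) * (2 * la i * tau / (1 + j.+1%:R * (tau * la i ^+ 2))) <=
  2 * tau * (tau * j.+1%:R) `^ (- p).
Proof.
move=> t0 p01; have li := lp i; have tj : 0 < tau * j.+1%:R by rewrite mulr_gt0.
have x0 : 0 <= j.+1%:R * (tau * la i ^+ 2) by pos.
rewrite powRN [leLHS](_ : _ = 2 * tau * ((la i `^ (2 * p - 1) * la i) / (1 + j.+1%:R * (tau * la i ^+ 2)))); last by ring.
apply: ler_wpM2l; first by pos.
rewrite -{2}(powRr1 (ltW li)) -powRD; last by rewrite (gt_eqF li) implybT.
rewrite subrK ler_pdivrMr; last by lra.
rewrite ler_pdivlMl; last by rewrite powR_gt0.
rewrite mulrC.
have -> : la i `^ (2 * p) = (la i ^+ 2) `^ p by rewrite powRrM -[2]/(2%:R) powR_mulrn// ltW.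
rewrite -powRM ?sqr_ge0 ?(ltW tj)// (_ : la i ^+ 2 * (tau * j.+1%:R) = j.+1%:R * (tau * la i ^+ 2)); last by ring.
exact: powR_le_add1.
Qed.

(** Duhamel's formula and Minkowski. The kernel hypothesis is met both by the resolvent
    ([euler_kernel]) and by the semigroup ([exp_kernel]), so both schemes gain the same regularity
    from the same bound on the forcing. *)
Lemma smoothing N (p tau : R) (ka be : nat -> R) (u f : nat -> nat -> R) (Phi : nat -> R) n :
  0 < tau -> 0 <= p <= 1 ->
  (forall i j, `|ka i ^+ j * be i| <= 2 * la i * tau / (1 + j.+1%:R * (tau * la i ^+ 2))) ->
  (forall i : 'I_N, u 0%N i = 0) ->
  (forall k (i : 'I_N), (k < n)%N -> u k.+1 i = ka i * u k i + be i * f k i) ->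
  (forall k, (k < n)%N -> 0 <= Phi k) ->
  (forall k, (k < n)%N -> \sum_(i < N) f k i ^+ 2 <= Phi k ^+ 2) ->
  nr N (4 * p - 2) (u n) <= (\sum_(k < n) 2 * tau * (tau * (n - k)%:R) `^ (- p) * Phi k) ^+ 2.
Proof.
move=> t0 p01 hk u0 uS P0 hP.
pose v k i := ka i ^+ (n - k).-1 * be i * f k i.
have vE (i : 'I_N) : u n i = \sum_(k < n) v k i.
  have : forall l, (l <= n)%N -> u l i = \sum_(k < l) ka i ^+ (l - k).-1 * be i * f k i.
    elim=> [|l ih] ln; first by rewrite big_ord0 u0.
    rewrite uS// ih ?(ltnW ln)// big_ord_recr /= subSnn expr0 mul1r; congr (_ + _).
    rewrite mulr_sumr; apply: eq_bigr => k _; rewrite !mulrA -exprS; congr (_ ^+ _ * _ * _).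
    by rewrite subSn ?(ltnW (ltn_ord k))//= prednK// subn_gt0.
  by move=> h; rewrite h.
have -> : nr N (4 * p - 2) (u n) = nr N (4 * p - 2) (fun i => \sum_(k < n) v k i).
  by apply: eq_bigr => i _; rewrite vE.
apply: (@nr_sum N _ n v (fun k => 2 * tau * (tau * (n - k)%:R) `^ (- p) * Phi k)) => k kn; first by rewrite mulr_ge0 ?P0// mulr_ge0 ?powR_ge0//; pos.
rewrite exprMn; set w := 2 * tau * _; have w0 : 0 <= w by rewrite /w mulr_ge0 ?powR_ge0//; pos.
apply: (le_via (w ^+ 2 * \sum_(i < N) f k i ^+ 2)); last by rewrite ler_wpM2l ?sqr_ge0 ?hP.
rewrite /nr mulr_sumr; apply: ler_sum => i _; rewrite /v exprMn mulrA ler_wpM2r ?sqr_ge0//.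
have kn' : (n - k).-1.+1 = (n - k)%N by rewrite prednK// subn_gt0.
have := kernel_bound i (n - k).-1 t0 p01; rewrite kn' -/w => h.
have h1 : la i `^ (2 * p - 1) * `|ka i ^+ (n - k).-1 * be i| <= w.
  by apply: le_trans h; rewrite ler_wpM2l ?powR_ge0//; have := hk i (n - k).-1; rewrite kn'.
have -> : la i `^ (4 * p - 2) = (la i `^ (2 * p - 1)) ^+ 2.
  by rewrite -powR_mulrn ?powR_ge0// -powRrM; congr (_ `^ _); ring.
rewrite -(real_normK (num_real (ka i ^+ _ * _))) -exprMn.
by rewrite lerXn2r ?nnegrE// mulr_ge0 ?powR_ge0.
Qed.

Lemma smoothing_cst N (tau Phi : R) (ka be : nat -> R) (u f : nat -> nat -> R) n :
  0 < tau ->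
  (forall i j, `|ka i ^+ j * be i| <= 2 * la i * tau / (1 + j.+1%:R * (tau * la i ^+ 2))) ->
  (forall i : 'I_N, u 0%N i = 0) ->
  (forall k (i : 'I_N), (k < n)%N -> u k.+1 i = ka i * u k i + be i * f k i) ->
  0 <= Phi -> (forall k, (k < n)%N -> \sum_(i < N) f k i ^+ 2 <= Phi ^+ 2) ->
  nr N (3 / 2) (u n) <= (16 * (tau * n%:R) `^ (1 / 8) * Phi) ^+ 2.
Proof.
move=> t0 hk u0 uS P0 hP.
(* p = 7/8 gives 4 p - 2 = 3/2 and leaves the singularity that [fractional_sum] integrates. *)
have p01 : 0 <= (7 / 8 : R) <= 1 by apply/andP; split; lra.
have := smoothing t0 p01 hk u0 uS (fun k _ => P0) hP.
rewrite (_ : 4 * (7 / 8) - 2 = 3 / 2 :> R); last by field.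
move=> /le_trans; apply; rewrite -mulr_suml; apply: lerXn2r; rewrite ?nnegrE.
- by apply: mulr_ge0 => //; apply: sumr_ge0 => k _; rewrite mulr_ge0 ?powR_ge0//; pos.
- by apply: mulr_ge0 => //; apply: mulr_ge0 => //; exact: powR_ge0.
- apply: ler_wpM2r => //; have := fractional_sum n t0.
  rewrite (reindex_inj rev_ord_inj) /= => h.
  apply: (le_via (2 * (8 * (tau * n%:R) `^ (1 / 8)))); last by rewrite mulrA; lra.
  apply: (le_trans _ (ler_wpM2l (_ : 0 <= 2) h)) => //; rewrite mulr_sumr; apply: ler_sum => k _.
  by rewrite -mulrA subnSK.
Qed.

Lemma euler_kernel (tau : R) (i j : nat) : 0 < tau ->
  `|(1 + tau * la i ^+ 2)^-1 ^+ j * (- (tau * la i) / (1 + tau * la i ^+ 2))| <=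
  2 * la i * tau / (1 + j.+1%:R * (tau * la i ^+ 2)).
Proof.
move=> t0; have li := lp i; have x0 : 0 < tau * la i ^+ 2 by pos.
have y0 : 0 < 1 + tau * la i ^+ 2 by lra.
rewrite mulNr mulrN normrN ger0_norm; last by pos.
rewrite [leLHS](_ : _ = la i * tau / (1 + tau * la i ^+ 2) ^+ j.+1); last by rewrite [_ ^+ j.+1]exprS invfM exprVn; ring.
have jx : 0 < 1 + j.+1%:R * (tau * la i ^+ 2) by apply: ltr_wpDr => //; pos.
apply: (le_via (la i * tau / (1 + j.+1%:R * (tau * la i ^+ 2)))).
  apply: ler_wpM2l; first by pos.
  rewrite lef_pV2 ?posrE//; last by pos.
  elim: j {jx} => [|j ih]; first by rewrite mul1r expr1.
  rewrite [_ ^+ j.+2]exprSr; apply: le_trans (ler_wpM2r (ltW y0) ih).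
  rewrite -subr_ge0 -[j.+2%:R]natr1 (_ : _ - _ = j.+1%:R * (tau * la i ^+ 2) ^+ 2); last by ring.
  by pos.
apply: ler_wpM2r; first by pos.
rewrite -mulrA; have : 0 < la i * tau by pos.
by move: (la i * tau) => z; lra.
Qed.

(** Bernoulli's inequality for (1 + x)^j together with 1 - exp(-x) <= 2 x / (1 + x), which is where
    the factor 2 of the common kernel bound comes from. *)
Lemma exp_kernel (tau : R) (i j : nat) : 0 < tau ->
  `|expR (- (tau * la i ^+ 2)) ^+ j * (- ((1 - expR (- (tau * la i ^+ 2))) / la i))| <=
  2 * la i * tau / (1 + j.+1%:R * (tau * la i ^+ 2)).
Proof.
move=> t0; have li := lp i; set x := tau * la i ^+ 2; have x0 : 0 < x by rewrite /x; pos.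
have e1 : expR (- x) <= (1 + x)^-1.
  rewrite expRN lef_pV2 ?posrE ?expR_gt0//; last by lra.
  exact: expR_ge1Dx.
have e0 := expR_gt0 (- x).
have y1 : (1 + x)^-1 <= 1 by rewrite invf_le1; lra.
have f0 : 0 <= 1 - expR (- x) by lra.
rewrite mulrN normrN ger0_norm; last by pos.
have jx k : 0 < 1 + k%:R * x by apply: ltr_wpDr => //; pos.
have h1 : expR (- x) ^+ j <= (1 + j%:R * x)^-1.
  apply: (le_via ((1 + x)^-1 ^+ j)); first by rewrite lerXn2r ?nnegrE ?(ltW e0)// invr_ge0; lra.
  rewrite exprVn lef_pV2 ?posrE//; last by apply: exprn_gt0; lra.
  elim: j => [|j ih]; first by rewrite mul0r addr0 expr0.
  rewrite exprSr; apply: le_trans (ler_wpM2r (_ : 0 <= 1 + x) ih); last by lra.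
  rewrite -subr_ge0 -natr1 (_ : _ - _ = j%:R * x ^+ 2); last by ring.
  by pos.
have h2 : 1 - expR (- x) <= 2 * x / (1 + x).
  have e2 : 1 - x <= expR (- x) by exact: expR_ge1Dx.
  rewrite ler_pdivlMr; last by lra.
  have [hx|hx] := lerP x 1.
    by apply: (le_via (x * (1 + x))); [rewrite ler_wpM2r//; lra|rewrite (_ : 2 * x = x * 2) ?ler_pM2l//; lra].
  by apply: (le_via (1 * (1 + x))); [rewrite ler_wpM2r//; lra|lra].
apply: (le_via ((1 + j%:R * x)^-1 * ((2 * x / (1 + x)) / la i))).
  apply: ler_pM => //.

  - by rewrite divr_ge0// ltW.
  by rewrite ler_pM2r ?invr_gt0.
have j0 := jx j; have j1 := jx j.+1; have y0 : 0 < 1 + x by lra.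
rewrite [leLHS](_ : _ = 2 * la i * tau / ((1 + j%:R * x) * (1 + x))); last by rewrite /x; field; rewrite !gt_eqF.
apply: ler_wpM2l; first by pos.
rewrite lef_pV2 ?posrE//; last by pos.
rewrite -subr_ge0 -natr1 (_ : _ - _ = j%:R * x ^+ 2); last by ring.
by pos.
Qed.

(** The algebra of [step_J]: L, a, b are [nr] 0, 1, 2, I is [I2], m2 the dissipation, pr the pairing
    of the chemical potential with y'. The pairing controls b + 3 I and is itself absorbed into m2,
    which makes the term L b of the forcing affordable. *)
Lemma energy_absorb (Z L I a b m2 pr g2 : R) : 1 <= Z -> 0 <= L -> 0 <= I -> 0 <= a -> 0 <= b -> 0 <= m2 ->
  b + 3 * I <= pr + a -> Z * (1 + L) * pr <= m2 / 4 + (Z * (1 + L)) ^+ 2 * a ->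
  5 / 2 * g2 <= Z * (I + a + L ^+ 2 + L * b + 1) ->
  - (3 / 4) * m2 + 5 / 2 * a + 5 / 2 * g2 <= (Z * (1 + L)) ^+ 2 * (6 * a + 1).
Proof.
move=> Z1 L0 I0 a0 b0 m0 h1 h2 h3; have Z0 : 0 <= Z by lra.
have h4 : Z * (I + L * b) <= Z * (1 + L) * (pr + a).
  apply: (le_via (Z * (1 + L) * (b + 3 * I))).
    rewrite -subr_ge0 (_ : _ - _ = Z * (b + 2 * I + 3 * (L * I))); last by ring.
    by pos.
  by apply: ler_wpM2l; pos.
set W := Z * (1 + L) in h2 h4 *.
have W1 : 1 <= W by rewrite /W -[leLHS]mulr1; apply: ler_pM => //; lra.
have W2 : W <= W ^+ 2 by rewrite expr2 ler_peMl//; lra.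
have ZW : Z <= W by rewrite /W ler_peMr//; lra.
have h5 : W * a <= W ^+ 2 * a by apply: ler_wpM2r.
have h6 : Z * a <= W ^+ 2 * a by apply: ler_wpM2r => //; lra.
have h7 : 1 * a <= W ^+ 2 * a by apply: ler_wpM2r => //; lra.
have h8 : Z * (L ^+ 2 + 1) <= W ^+ 2.
  apply: (le_via (Z * (1 + L) ^+ 2)).
    by apply: ler_wpM2l => //; rewrite -subr_ge0 (_ : _ - _ = 2 * L); [pos|ring].
  rewrite /W exprMn; apply: ler_wpM2r; first exact: sqr_ge0.
  by rewrite expr2 ler_peMl.
have h9 : Z * (I + a + L ^+ 2 + L * b + 1) = Z * (I + L * b) + Z * a + Z * (L ^+ 2 + 1) by ring.
lra.
Qed.

(** The Ginzburg-Landau energy without its concave part -u^2/2, hence convex: increments are bounded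
    by pairing with the derivative at the new point. *)
Definition Jp N c : R := nr N 1 c / 2 + p4 N c / 4.

(** The increment is paired with mu + y', where mu = A y' + P_N F(y') is the chemical potential and
    y' makes up for the concave part left out of [Jp]. The noise enters through [g] in H^1, which
    costs its gradient; hence d >= 2, where ga > 1. *)
Lemma step_J (ga : R) : (2 <= d)%N -> d%:R / 2 < ga -> exists2 C : R, 0 < C &
  forall N (tau : R) y o y' (Q : R), 0 < tau ->
  istep N tau y o y' -> 0 <= Q -> sup_le N o Q ->
  Jp N y' - Jp N y <= tau * (C * ((1 + nr N 0 y') ^+ 3 * ((1 + Q + nr N ga o) ^+ 12 + nr N 2 y'))).
Proof.
move=> d2 hga; have [C1 C10 hC1] := gradient_difference.
have [C2 C20 hC2] := quartic_gradient d2 hga.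
have g1 : 1 <= ga.
  apply: le_trans (ltW hga); rewrite ler_pdivlMr// mul1r.
  by rewrite (_ : 2 = 2%:R :> R)// ler_nat.
have [C3 C30 hC3] := nr_mono g1.
set C := 5 / 2 * (C1 * (1 + C2 + C3) + 1); have C0 : 0 < C by rewrite /C mulr_gt0// ltr_wpDl//; pos.
have Cge : 1 <= C.
  have : 0 <= C1 * (1 + C2 + C3) by pos.
  by rewrite /C; lra.
exists (7 * C ^+ 2); first by pos.
move=> N tau y o y' Q t0 st Q0 hQ; have p40 := p4_ge0 N y'.
have L0 := nr_ge0 N 0 y'; have a0 := nr_ge0 N 1 y'; have b0 := nr_ge0 N 2 y'.
have I0 := I2_ge0 N y'; have n0 := nr_ge0 N ga o.
pose mu i := lc y' i + Fc N y' i; pose g i := Fc N (fun j => y' j + o j) i - Fc N y' i.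
pose m2 := \sum_(i < N) la i * mu i ^+ 2; pose g2 := \sum_(i < N) la i * g i ^+ 2.
pose pr := \sum_(i < N) la i * (mu i * y' i).
have m20 : 0 <= m2 by apply: sumr_ge0 => i _; have := lp i => li; pos.
have A : Jp N y' - Jp N y <= \sum_(i < N) (y' i - y i) * (mu i + y' i).
  have := quartic_convex N y y'.
  have : nr N 1 y' - nr N 1 y <= 2 * \sum_(i < N) (y' i - y i) * lc y' i.
    rewrite !(nr1E) -sumrB mulr_sumr; apply: ler_sum => i _.
    rewrite -mulrBr [leRHS](_ : _ = la i * (2 * ((y' i - y i) * y' i))); last by rewrite /lc; ring.
    by rewrite ler_pM2l//; have := sqr_ge0 (y' i - y i); lra.
  have -> : \sum_(i < N) (y' i - y i) * (mu i + y' i) = \sum_(i < N) (y' i - y i) * lc y' i +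
     \sum_(i < N) (y' i - y i) * (Fc N y' i + y' i).
    by rewrite -big_split; apply: eq_bigr => i _ /=; rewrite /mu; ring.
  by rewrite /Jp; lra.
apply: (le_trans A).
have B : \sum_(i < N) (y' i - y i) * (mu i + y' i) <= tau * (- (3 / 4) * m2 + 5 / 2 * nr N 1 y' + 5 / 2 * g2).
  rewrite /m2 /g2 (nr1E) !mulr_sumr -!big_split mulr_sumr; apply: ler_sum => i _ /=.
  rewrite st (_ : _ * _ = tau * la i * (- ((mu i + g i) * (mu i + y' i)))); last by rewrite /mu /g /lc; ring.
  rewrite [leRHS](_ : _ = tau * la i * (- (3 / 4) * mu i ^+ 2 + 5 / 2 * y' i ^+ 2 + 5 / 2 * g i ^+ 2)); last by ring.
  have li := lp i; rewrite ler_pM2l; last by pos.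
  rewrite -subr_ge0 (_ : _ - _ = 8^-1 * (mu i + 4 * y' i) ^+ 2 + 8^-1 * (mu i + 4 * g i) ^+ 2 + 2^-1 * (y' i + g i) ^+ 2); last by field.
  by pos.
apply: (le_trans B); rewrite ler_pM2l//; set rho := 1 + Q + nr N ga o.
have rho1 : 1 <= rho by rewrite /rho; lra.
have rho0 : 0 < rho by lra.
have Z1 : 1 <= C * rho ^+ 3 by rewrite -[leLHS]mulr1; apply: ler_pM => //; exact: exprn_ege1.
have prE : nr N 2 y' + 3 * I2 N y' <= pr + nr N 1 y'.
  rewrite /pr (eq_bigr (fun i : 'I_N => lc y' i ^+ 2 + lc y' i * Fc N y' i)); last by move=> i _; rewrite /mu /lc; ring.
  by rewrite big_split /= (Fc_pair_lc) -(nr2E); lra.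
have prZ (z : R) : z * pr <= m2 / 4 + z ^+ 2 * nr N 1 y'.
  rewrite /pr /m2 (nr1E) mulr_suml !mulr_sumr -big_split; apply: ler_sum => i _ /=.
  have li := lp i; rewrite -subr_ge0 (_ : _ - _ = la i * (mu i / 2 - z * y' i) ^+ 2); last by field.
  by pos.
have hg : 5 / 2 * g2 <= C * rho ^+ 3 * (I2 N y' + nr N 1 y' + nr N 0 y' ^+ 2 + nr N 0 y' * nr N 2 y' + 1).
  clear Z1; have := hC1 N y' o Q Q0 hQ; have := hC2 N y' o; have := hC3 N o; rewrite -/(g2).
  set SS := \sum_j _; set I := I2 N y' in I0 *; set a := nr N 1 y' in a0 *; set L := nr N 0 y' in L0 *; set b := nr N 2 y' in b0 *.
  set n := nr N ga o in n0 rho rho1 rho0 *; set o1 := nr N 1 o => k3 k2 k1.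
  have q1 : Q <= rho ^+ 3 by apply: (@le_trans _ _ rho); [rewrite /rho; lra|rewrite -[leLHS]expr1; exact: ler_weXn2l].
  have q2 : Q ^+ 2 <= rho ^+ 3.
    apply: (le_via (rho ^+ 2)); last exact: ler_weXn2l.
    by rewrite lerXn2r ?nnegrE//; [lra|rewrite /rho; lra].
  have q3 : n <= rho ^+ 3 by apply: (@le_trans _ _ rho); [rewrite /rho; lra|rewrite -[leLHS]expr1; exact: ler_weXn2l].
  have q4 : (1 + Q ^+ 2) * n <= rho ^+ 3.
    rewrite -subr_ge0 /rho (_ : _ - _ = 1 + 3 * Q + 3 * Q ^+ 2 + Q ^+ 3 + 2 * n + 6 * (Q * n) + 2 * (Q ^+ 2 * n) + 3 * n ^+ 2 + 3 * (Q * n ^+ 2) + n ^+ 3); last by ring.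
    by pos.
  set E := I + a + L ^+ 2 + L * b + 1; have E1 : 0 <= E by rewrite /E; pos.
  have r0 : 0 <= rho ^+ 3 by pos.
  have t1 : Q * I + Q ^+ 2 * a <= rho ^+ 3 * (I + a).
    by rewrite mulrDr; apply: lerD; exact: ler_wpM2r.
  have t2 : SS <= C2 * (rho ^+ 3 * E).
    apply: (le_trans k2); rewrite -mulrA ler_pM2l//; apply: ler_pM => //; first by pos.
    by rewrite /E; lra.
  have t3 : (1 + Q ^+ 2) * o1 <= C3 * (rho ^+ 3 * 1).
    apply: (le_via ((1 + Q ^+ 2) * (C3 * n))); first by apply: ler_wpM2l => //; pos.
    by rewrite mulr1 [leLHS](_ : _ = C3 * ((1 + Q ^+ 2) * n)) ?ler_pM2l//; ring.
  have Lb : 0 <= L * b by pos.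
  have t4 : rho ^+ 3 * (I + a) <= rho ^+ 3 * E by apply: ler_wpM2l => //; rewrite /E; have := sqr_ge0 L; lra.
  have t5 : rho ^+ 3 * 1 <= rho ^+ 3 * E by apply: ler_wpM2l => //; rewrite /E; have := sqr_ge0 L; lra.
  have t6 : C3 * (rho ^+ 3 * 1) <= C3 * (rho ^+ 3 * E) by rewrite ler_pM2l.
  have t7 : g2 <= C1 * ((1 + C2 + C3) * (rho ^+ 3 * E)).
    by apply: (le_trans k1); rewrite ler_pM2l//; lra.
  have t8 : 0 <= rho ^+ 3 * E by pos.
  rewrite /C [leRHS](_ : _ = 5 / 2 * (C1 * ((1 + C2 + C3) * (rho ^+ 3 * E)) + rho ^+ 3 * E)); last by ring.
  lra.
have := energy_absorb Z1 L0 I0 a0 b0 m20 prE (prZ _) hg.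
move=> /le_trans; apply.
have ab := interp_sqr1 N y'.
move: ab L0 a0 b0; move: (nr N 0 y') (nr N 1 y') (nr N 2 y') => L a b ab L0 a0 b0.
rewrite [leLHS](_ : _ = C ^+ 2 * ((1 + L) ^+ 2 * (rho ^+ 6 * (6 * a + 1)))); last by ring.
rewrite [leRHS](_ : _ = C ^+ 2 * ((1 + L) ^+ 2 * (7 * ((1 + L) * (rho ^+ 12 + b))))); last by ring.
apply: ler_wpM2l; first by pos.
apply: ler_wpM2l; first by pos.
have r12 : rho ^+ 6 <= rho ^+ 12 by exact: ler_weXn2l.
have r6a : rho ^+ 6 * (2 * a) <= rho ^+ 12 + a ^+ 2.
  by rewrite -subr_ge0 (_ : _ - _ = (rho ^+ 6 - a) ^+ 2) ?sqr_ge0//; ring.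
have : 0 <= L * rho ^+ 12 by pos.
have : 0 <= L * b by pos.
have : 0 <= rho ^+ 12 by pos.
by move: r12 r6a; move: (rho ^+ 6) (rho ^+ 12) => r6 r12; lra.
Qed.

Lemma p6_sum N y o : p6 N (fun i => y i + o i) <= 32 * (p6 N y + p6 N o).
Proof.
have i6 c : Ig m (fun x => S N c x ^+ 6) by exact: Ig_SX.
rewrite /p6 -RI_D// -RI_Z; last by apply: IgD.
apply: RI_le => //; first by apply: IgZ; apply: IgD.
move=> x /=; rewrite S_D; move: (S N y x) (S N o x) => p q.
have h1 : (p + q) ^+ 2 <= 2 * (p ^+ 2 + q ^+ 2) by have := sqr_ge0 (p - q); lra.
rewrite (_ : (p + q) ^+ 6 = ((p + q) ^+ 2) ^+ 3); last by ring.
apply: (le_via ((2 * (p ^+ 2 + q ^+ 2)) ^+ 3)); first by rewrite lerXn2r ?nnegrE//; pos.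
rewrite -subr_ge0 (_ : _ - _ = 24 * ((p ^+ 2 + q ^+ 2) * (p ^+ 2 - q ^+ 2) ^+ 2)); last by ring.
by pos.
Qed.

Lemma p6_add N y o (Q : R) : 0 <= Q -> sup_le N o Q ->
  p6 N (fun i => y i + o i) <= 32 * (p6 N y + vol D * Q ^+ 3).
Proof.
move=> Q0 hQ; apply: (le_trans (p6_sum N y o)); rewrite ler_pM2l// lerD2l mulrC -(vol_RI (Q ^+ 3)).
apply: RI_le_ae; [by exact: Ig_SX|exact: Ig_cst|].
apply: filterS hQ => x h /=; rewrite (_ : S N o x ^+ 6 = (S N o x ^+ 2) ^+ 3); last by ring.
by rewrite lerXn2r ?nnegrE// sqr_ge0.
Qed.

(** A time integral over the whole grid, so one number serves every index. As one summand is at most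
    the sum, it also bounds each 1 + nr by (A / tau)^(1/q); a large [q] makes this loss in tau as
    small as desired. *)
Definition Aux N (ga tau : R) M q (O : nat -> nat -> R) : R :=
  1 + \sum_(k < M) tau * (1 + nr N ga (O k)) ^+ q.

Lemma Aux_ge1 N ga tau M q O : 0 <= tau -> 1 <= Aux N ga tau M q O.
Proof.
move=> t0; rewrite /Aux lerDl; apply: sumr_ge0 => k _.
by have := nr_ge0 N ga (O k) => n0; pos.
Qed.

Lemma Aux_sum N ga tau M q (O : nat -> nat -> R) n j : 0 <= tau -> (n <= M)%N -> (j <= q)%N ->
  \sum_(k < n) tau * (1 + nr N ga (O k)) ^+ j <= Aux N ga tau M q O.
Proof.
move=> t0 nM jq; have n0 k := nr_ge0 N ga (O k).
apply: (le_via (\sum_(k < n) tau * (1 + nr N ga (O k)) ^+ q)).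
  apply: ler_sum => k _; apply: ler_wpM2l => //; apply: ler_weXn2l => //.
  by rewrite lerDl.
apply: (le_via (\sum_(k < M) tau * (1 + nr N ga (O k)) ^+ q)); last by rewrite /Aux lerDr.
rewrite -!(big_mkord xpredT (fun k => tau * (1 + nr N ga (O k)) ^+ q)) [leRHS](big_cat_nat (n := n))//= lerDl.
by apply: sumr_ge0 => k _; have := n0 k => nk; pos.
Qed.

Definition euler_path N (tau : R) M (O Y : nat -> nat -> R) := (forall i : 'I_N, Y 0%N i = 0) /\
  forall k, (k < M)%N -> istep N tau (Y k) (O k) (Y k.+1).

Lemma nr_null N s c : (forall i : 'I_N, c i = 0) -> nr N s c = 0.
Proof. by move=> h; rewrite /nr big1// => i _; rewrite h expr0n mulr0. Qed.

Lemma p4_null N c : (forall i : 'I_N, c i = 0) -> p4 N c = 0.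
Proof.
move=> h; rewrite /p4 (RI_ext _ (g := fun=> 0)) ?RI_0// => x.
by rewrite /S big1 ?expr0n// => i _; rewrite h mul0r.
Qed.

(** * Energy bounds along the implicit path *)

Section path.
Variables (ga : R) (hga : d%:R / 2 < ga).

Lemma path_neg1 : exists2 C : R, 0 < C & forall N tau M q O Y n, 0 < tau -> (36 <= q)%N ->
  euler_path N tau M O Y -> (n <= M)%N -> nr N (-1) (Y n) <= C * Aux N ga tau M q O.
Proof.
have [C C0 hC] := step_neg1; have [C2 C20 hC2] := F2 hga.
exists (C * (1 + C2) ^+ 2); first by pos.
move=> N tau M q O Y n t0 q36 [Y0 st] nM.
have n0 k := nr_ge0 N ga (O k).
have := @telescope_le R n (fun k => nr N (-1) (Y k)) (fun k => 2 * tau * nr N 1 (Y k.+1))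
  (fun k => C * (1 + C2) ^+ 2 * (tau * (1 + nr N ga (O k)) ^+ 2)).
rewrite (nr_null _ Y0) subr0 => h; have {h}h : nr N (-1) (Y n) + \sum_(k < n) 2 * tau * nr N 1 (Y k.+1) <=
    \sum_(k < n) C * (1 + C2) ^+ 2 * (tau * (1 + nr N ga (O k)) ^+ 2).
  apply: h => k kn; have Q0 : 0 <= C2 * nr N ga (O k) by have := n0 k => nk; pos.
  apply: (le_trans (hC N tau (Y k) (O k) (Y k.+1) _ t0 (st k (leq_trans kn nM)) Q0 (hC2 N (O k)))).
  rewrite [leRHS](_ : _ = tau * (C * ((1 + C2) * (1 + nr N ga (O k))) ^+ 2)); last by ring.
  rewrite !ler_pM2l//; have := n0 k; move: (nr N ga (O k)) => z z0.
  by rewrite -subr_ge0 (_ : _ - _ = 2 * C2 + C2 ^+ 2 + 2 * ((1 + C2) ^+ 2 * z) + (1 + 2 * C2) * z ^+ 2); [pos|ring].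
rewrite -[in X in _ <= X]mulr_sumr in h.
have s0 : 0 <= \sum_(k < n) 2 * tau * nr N 1 (Y k.+1).
  by apply: sumr_ge0 => k _; have := nr_ge0 N 1 (Y k.+1) => nk; pos.
apply: (le_via (C * (1 + C2) ^+ 2 * \sum_(k < n) tau * (1 + nr N ga (O k)) ^+ 2)); first by lra.
apply: ler_wpM2l; first by pos.
by apply: Aux_sum => //; [exact: ltW|exact: leq_trans q36].
Qed.

(** Exponent 5: four factors A from (1 + nr(-1))^4 in [step_0], and one from the time integral of
    the noise. *)
Lemma path_0 : exists2 C : R, 0 < C & forall N tau M q O Y n, 0 < tau -> (36 <= q)%N ->
  euler_path N tau M O Y -> (n <= M)%N ->
  nr N 0 (Y n) + \sum_(k < n) tau * nr N 2 (Y k.+1) <= C * Aux N ga tau M q O ^+ 5.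
Proof.
have [C C0 hC] := step_0; have [C2 C20 hC2] := F2 hga.
have [C1 C10 hC1] := path_neg1.
exists (C * (1 + C2) ^+ 36 * (1 + C1) ^+ 4); first by apply: mulr_gt0; [apply: mulr_gt0 => //|]; apply: exprn_gt0; lra.
move=> N tau M q O Y n t0 q36 hY nM; have [Y0 st] := hY.
have A1 := Aux_ge1 N ga M q O (ltW t0); set A := Aux N ga tau M q O in A1 *.
have n0 k := nr_ge0 N ga (O k).
have := @telescope_le R n (fun k => nr N 0 (Y k)) (fun k => tau * nr N 2 (Y k.+1))
  (fun k => C * (1 + C2) ^+ 36 * ((1 + C1) * A) ^+ 4 * (tau * (1 + nr N ga (O k)) ^+ 36)).
rewrite (nr_null _ Y0) subr0 => h; apply: (le_via (\sum_(k < n) C * (1 + C2) ^+ 36 * ((1 + C1) * A) ^+ 4 * (tau * (1 + nr N ga (O k)) ^+ 36))).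
  apply: h => k kn; have kM := leq_trans kn nM; have Q0 : 0 <= C2 * nr N ga (O k) by have := n0 k => nk; pos.
  apply: (le_trans (hC N tau (Y k) (O k) (Y k.+1) _ t0 (st k kM) Q0 (hC2 N (O k)))).
  rewrite [leRHS](_ : _ = tau * (C * (((1 + C2) * (1 + nr N ga (O k))) ^+ 36 * ((1 + C1) * A) ^+ 4))); last first.
    by rewrite [((1 + C2) * (1 + _)) ^+ 36]exprMn; ring.
  rewrite !ler_pM2l//; have nk := n0 k; apply: ler_pM.
  - by apply: exprn_ge0; lra.
  - by apply: exprn_ge0; have := nr_ge0 N (-1) (Y k.+1); lra.
  - apply: lerXn2r; rewrite ?nnegrE; [by lra|by apply: mulr_ge0; lra|].
    by rewrite -subr_ge0 (_ : _ - _ = C2 + nr N ga (O k)); [pos|ring].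
  - apply: lerXn2r; rewrite ?nnegrE; [by have := nr_ge0 N (-1) (Y k.+1); lra|by apply: mulr_ge0; lra|].
    by have := hC1 N tau M q O Y k.+1 t0 q36 hY kM; rewrite -/A; lra.
rewrite -mulr_sumr [leRHS](_ : _ = C * (1 + C2) ^+ 36 * ((1 + C1) * A) ^+ 4 * A); last by rewrite exprMn; ring.
apply: ler_wpM2l; last by apply: Aux_sum => //; exact: ltW.
apply: mulr_ge0; [apply: mulr_ge0; [exact: ltW|]|]; apply: exprn_ge0; [lra|apply: mulr_ge0; lra].
Qed.

(** Exponent 20: (1 + nr0)^3 gives A^15, and the time integral of [nr] 2 gives A^5. *)
Lemma path_J : (2 <= d)%N -> exists2 C : R, 0 < C & forall N tau M q O Y n, 0 < tau -> (36 <= q)%N ->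
  euler_path N tau M O Y -> (n <= M)%N -> Jp N (Y n) <= C * Aux N ga tau M q O ^+ 20.
Proof.
move=> d2; have [C C0 hC] := step_J d2 hga; have [C2 C20 hC2] := F2 hga.
have [C1 C10 hC1] := path_0.
exists (C * (1 + C1) ^+ 3 * ((1 + C2) ^+ 12 + C1)); first by pos.
move=> N tau M q O Y n t0 q36 hY nM; have [Y0 st] := hY.
have A1 := Aux_ge1 N ga M q O (ltW t0); set A := Aux N ga tau M q O in A1 *.
have A0 : 0 < A by lra.
have A5 : 1 <= A ^+ 5 by exact: exprn_ege1.
have n0 k := nr_ge0 N ga (O k).
have hL k : (k <= M)%N -> 1 + nr N 0 (Y k) <= (1 + C1) * A ^+ 5.
  move=> kM; have := hC1 N tau M q O Y k t0 q36 hY kM; rewrite -/A.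
  have : 0 <= \sum_(k0 < k) tau * nr N 2 (Y k0.+1).
    by apply: sumr_ge0 => l _; have := nr_ge0 N 2 (Y l.+1) => nl; pos.
  lra.
have := @telescope_le R n (fun k => Jp N (Y k)) (fun k => 0)
  (fun k => C * ((1 + C1) * A ^+ 5) ^+ 3 * ((1 + C2) ^+ 12 * (tau * (1 + nr N ga (O k)) ^+ 12) + tau * nr N 2 (Y k.+1))).
rewrite [Jp N (Y 0%N)]/Jp (nr_null _ Y0) (p4_null Y0) !mul0r addr0 subr0 big1// addr0 => h.
apply: (le_via (\sum_(k < n) C * ((1 + C1) * A ^+ 5) ^+ 3 * ((1 + C2) ^+ 12 * (tau * (1 + nr N ga (O k)) ^+ 12) + tau * nr N 2 (Y k.+1)))).
  apply: h => k kn; have kM := leq_trans kn nM; have Q0 : 0 <= C2 * nr N ga (O k) by have := n0 k => nk; pos.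
  rewrite addr0; apply: (le_trans (hC N tau (Y k) (O k) (Y k.+1) _ t0 (st k kM) Q0 (hC2 N (O k)))).
  rewrite [leRHS](_ : _ = tau * (C * (((1 + C1) * A ^+ 5) ^+ 3 * (((1 + C2) * (1 + nr N ga (O k))) ^+ 12 + nr N 2 (Y k.+1))))); last first.
    by rewrite [((1 + C2) * (1 + _)) ^+ 12]exprMn; ring.
  have nk := n0 k; have b0 := nr_ge0 N 2 (Y k.+1); have L0 := nr_ge0 N 0 (Y k.+1).
  rewrite !ler_pM2l//; apply: ler_pM; [by pos|by pos| |].
    by apply: lerXn2r; rewrite ?nnegrE; [pos|pos|exact: hL].
  rewrite lerD2r; apply: lerXn2r; rewrite ?nnegrE; [by pos|by pos|].
  by rewrite -subr_ge0 (_ : _ - _ = C2); [pos|ring].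
rewrite -mulr_sumr big_split /= -mulr_sumr.
apply: (le_via (C * ((1 + C1) * A ^+ 5) ^+ 3 * ((1 + C2) ^+ 12 * A + C1 * A ^+ 5))).
  apply: ler_wpM2l; first by pos.
  apply: lerD.
    by apply: ler_wpM2l; [pos|apply: Aux_sum => //; [exact: ltW|exact: leq_trans q36]].
  by have := hC1 N tau M q O Y n t0 q36 hY nM; have := nr_ge0 N 0 (Y n); rewrite -/A; lra.
rewrite [leRHS](_ : _ = C * ((1 + C1) * A ^+ 5) ^+ 3 * (((1 + C2) ^+ 12 + C1) * A ^+ 5)); last by ring.
apply: ler_wpM2l; first by pos.
rewrite mulrDl lerD2r; apply: ler_wpM2l; first by pos.
by rewrite -[leLHS]expr1; exact: ler_weXn2l.
Qed.
End path.

(** Young with exponents 4/3 and 4, as 21/32 = (3/4)(7/8): the weight keeps the integrable exponent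
    7/8, and the forcing appears to the fourth power, which the L^2 energy can sum. *)
Lemma weight_split (t h : R) : 0 < t -> 0 <= h -> t `^ (- (21 / 32)) * h <= t `^ (- (7 / 8)) + h ^+ 4.
Proof.
move=> t0 h0; set w := t `^ (- (7 / 32)); have w0 : 0 <= w by exact: powR_ge0.
have -> : t `^ (- (21 / 32)) = w ^+ 3 by rewrite /w -powR_mulrn ?powR_ge0// -powRrM; congr (_ `^ _); field.
have -> : t `^ (- (7 / 8)) = w ^+ 4 by rewrite /w -powR_mulrn ?powR_ge0// -powRrM; congr (_ `^ _); field.
have [hw|hw] := lerP h w.
  apply: (le_via (w ^+ 4)); last by rewrite lerDl; pos.
  by rewrite [leRHS]exprSr; apply: ler_wpM2l => //; pos.
apply: (le_via (h ^+ 4)); last by rewrite lerDr; pos.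
by rewrite [leRHS]exprSr; apply: ler_wpM2r => //; rewrite lerXn2r ?nnegrE// ltW.
Qed.

Lemma Fc_sqr_add : exists2 C : R, 0 < C & forall N y o (Q : R), 0 <= Q ->
  sup_le N o Q ->
  \sum_(i < N) Fc N (fun j => y j + o j) i ^+ 2 <= C * (1 + p6 N y + Q ^+ 3).
Proof.
have [C C0 hC] := Fc_sqr; have v0 := vol_gt0.
exists (C * (33 + 32 * vol D)); first by pos.
move=> N y o Q Q0 hQ; apply: (le_trans (hC N _)); rewrite -mulrA ler_pM2l//.
have := p6_add y Q0 hQ; have p60 := p6_ge0 N y.
have : 0 <= vol D * p6 N y by pos.
have : 0 <= Q ^+ 3 by pos.
lra.
Qed.

Lemma euler_step_explicit N tau y o y' (i : 'I_N) : 0 < tau -> istep N tau y o y' ->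
  y' i = (1 + tau * la i ^+ 2)^-1 * y i +
   (- (tau * la i) / (1 + tau * la i ^+ 2)) * Fc N (fun j => y' j + o j) i.
Proof.
move=> t0 /(_ i) st; have li := lp i.
have x0 : 0 < 1 + tau * la i ^+ 2 by apply: ltr_wpDr => //; pos.
apply: (@mulfI _ (1 + tau * la i ^+ 2)); first by rewrite gt_eqF.
rewrite [RHS](_ : _ = y i - tau * la i * Fc N (fun j => y' j + o j) i); last by field; rewrite gt_eqF.
by move: st; move: (Fc N _ i) => F st; lra.
Qed.

(** * The L^6 bound along the implicit path *)

Section sixth.
Variables (ga : R) (hga : d%:R / 2 < ga) (T : R) (T0 : 0 < T).

(** In d = 1 the noise may have no gradient, so only the L^2 energy is at hand. Smoothing with p =
    21/32 reaches 4 p - 2 = 5/8 > 1/2, and H^(5/8) embeds into bounded functions. The exponent is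
    180 = 6 * 30, with A^30 from the sixth power of [nr] 0. *)
Lemma hat_p6_d1 : d = 1%N -> exists2 C : R, 0 < C & forall N tau M q O Y n, 0 < tau -> tau * M%:R <= T ->
  (36 <= q)%N -> euler_path N tau M O Y -> (n <= M)%N -> p6 N (Y n) <= C * Aux N ga tau M q O ^+ 180.
Proof.
move=> d1; have [C2 C20 hC2] := F2 hga.
have [Cs Cs0 hCs] := Fc_sqr_add; have [Cd Cd0 hCd] := p6_d1 d1.
have [c0 c00 hc0] := path_0 hga.
have [Cf Cf0 hCf] : exists2 C : R, 0 < C & forall N c, {ae m, forall x, S N c x ^+ 2 <= C * nr N (5 / 8) c}.
  by apply: (F2); rewrite d1; lra.
have v0 := vol_gt0.
set E : R := 3 * (T + Cd * (c0 ^+ 6 * T + c0 ^+ 6) + C2 ^+ 6); have E0 : 0 < E by rewrite /E; pos.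
set k8 := T `^ (1 / 8); have k80 : 0 <= k8 by exact: powR_ge0.
set H := 2 * (8 * k8 + Cs ^+ 2 * E); have H0 : 0 <= H by rewrite /H; pos.
exists (vol D * (Cf * (1 + H) ^+ 2) ^+ 3); first by have : 0 < 1 + H; [lra|move=> h; pos].
move=> N tau M q O Y n t0 tM q36 hY nM; have [Y0 st] := hY.
have A1 := Aux_ge1 N ga M q O (ltW t0); set A := Aux N ga tau M q O in A1 *.
have A0 : 0 < A by lra.
have n0 k := nr_ge0 N ga (O k).
have tn : tau * n%:R <= T by apply: le_trans tM; rewrite ler_pM2l// ler_nat.
set f := fun k => Fc N (fun j => Y k.+1 j + O k j).
set Phi := fun k => Num.sqrt (\sum_(i < N) f k i ^+ 2).
have F0 k : 0 <= \sum_(i < N) f k i ^+ 2 by apply: sumr_ge0 => i _; exact: sqr_ge0.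
have := @smoothing N (21 / 32) tau (fun i => (1 + tau * la i ^+ 2)^-1)
  (fun i => - (tau * la i) / (1 + tau * la i ^+ 2)) Y f Phi n t0.
rewrite (_ : 4 * (21 / 32) - 2 = 5 / 8 :> R); last by field.
move=> sm; have {sm}sm : nr N (5 / 8) (Y n) <= (\sum_(k < n) 2 * tau * (tau * (n - k)%:R) `^ (- (21 / 32)) * Phi k) ^+ 2.
  apply: sm => //.
  - by apply/andP; split; lra.
  - by move=> i j; exact: euler_kernel.
  - by move=> k i kn; apply: euler_step_explicit => //; exact: st (leq_trans kn nM).
  - by move=> k _; exact: sqrtr_ge0.
  - by move=> k _; rewrite /Phi sqr_sqrtr.
have L0 k : 0 <= nr N 0 (Y k) by exact: nr_ge0.
have b0 k : 0 <= nr N 2 (Y k) by exact: nr_ge0.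
have sb k : 0 <= \sum_(l < k) tau * nr N 2 (Y l.+1) by apply: sumr_ge0 => l _; have := b0 l.+1 => bl; pos.
have hL k : (k <= M)%N -> nr N 0 (Y k) <= c0 * A ^+ 5.
  by move=> kM; have := hc0 N tau M q O Y k t0 q36 hY kM; rewrite -/A; have := sb k; lra.
have hP k : (k < n)%N -> tau * Phi k ^+ 4 <= Cs ^+ 2 * 3 * (tau * A ^+ 30 +
   Cd * (c0 ^+ 6 * (tau * A ^+ 30) + c0 ^+ 5 * A ^+ 25 * (tau * nr N 2 (Y k.+1))) + C2 ^+ 6 * (tau * (1 + nr N ga (O k)) ^+ 6)).
  move=> kn; have kM := leq_trans kn nM; have nk := n0 k.
  have Q0 : 0 <= C2 * nr N ga (O k) by pos.
  have := hCs N (Y k.+1) (O k) _ Q0 (hC2 N (O k)); rewrite -/(f k).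
  have p60 := p6_ge0 N (Y k.+1); have p2 := hCd N (Y k.+1).
  rewrite (_ : Phi k ^+ 4 = (Phi k ^+ 2) ^+ 2); last by ring.
  rewrite /Phi sqr_sqrtr//; set s := \sum_(i < N) _ => hS.
  rewrite [leRHS](_ : _ = tau * (Cs ^+ 2 * (3 * (A ^+ 30 + Cd * (c0 ^+ 6 * A ^+ 30 + c0 ^+ 5 * A ^+ 25 * nr N 2 (Y k.+1)) + C2 ^+ 6 * (1 + nr N ga (O k)) ^+ 6)))); last by ring.
  rewrite ler_pM2l//; apply: (le_via ((Cs * (1 + p6 N (Y k.+1) + (C2 * nr N ga (O k)) ^+ 3)) ^+ 2)).
    by rewrite lerXn2r ?nnegrE//; [exact: F0|pos].
  rewrite exprMn; apply: ler_wpM2l; first by pos.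
  have h3 (x y z : R) : (x + y + z) ^+ 2 <= 3 * (x ^+ 2 + y ^+ 2 + z ^+ 2).
    by have := sqr_ge0 (x - y); have := sqr_ge0 (y - z); have := sqr_ge0 (x - z); lra.
  apply: (le_trans (h3 _ _ _)); rewrite ler_pM2l//; apply: lerD; first apply: lerD.
  - by rewrite expr1n; exact: exprn_ege1.
  - apply: (le_trans p2); rewrite ler_pM2l//; apply: lerD.
      rewrite (_ : c0 ^+ 6 * A ^+ 30 = (c0 * A ^+ 5) ^+ 6); last by ring.
      by rewrite lerXn2r ?nnegrE//; [pos|exact: hL].
    rewrite (_ : c0 ^+ 5 * A ^+ 25 = (c0 * A ^+ 5) ^+ 5); last by ring.
    by apply: ler_wpM2r => //; rewrite lerXn2r ?nnegrE//; [pos|exact: hL].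
  - rewrite (_ : ((C2 * nr N ga (O k)) ^+ 3) ^+ 2 = C2 ^+ 6 * nr N ga (O k) ^+ 6); last by ring.
    by apply: ler_wpM2l; [pos|rewrite lerXn2r ?nnegrE//; [pos|lra]].
have hsum : \sum_(k < n) tau * Phi k ^+ 4 <= Cs ^+ 2 * E * A ^+ 30.
  apply: (le_trans (ler_sum _ (fun (k : 'I_n) _ => hP k (ltn_ord k)))).
  have cst : \sum_(i < n) tau * A ^+ 30 = tau * n%:R * A ^+ 30.
    by rewrite sumr_const card_ord -mulr_natl; ring.
  rewrite [leLHS](_ : _ = Cs ^+ 2 * 3 * (tau * n%:R * A ^+ 30 + Cd * (c0 ^+ 6 * (tau * n%:R * A ^+ 30) +
    c0 ^+ 5 * A ^+ 25 * \sum_(i < n) tau * nr N 2 (Y i.+1)) + C2 ^+ 6 * \sum_(i < n) tau * (1 + nr N ga (O i)) ^+ 6)); last first.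
    rewrite -[LHS]mulr_sumr; congr (_ * _); rewrite big_split big_split /=; congr (_ + _ + _) => //.
    - rewrite -mulr_sumr; congr (_ * _); rewrite big_split /=; congr (_ + _); last by rewrite -mulr_sumr.
      by rewrite -mulr_sumr cst.
    - by rewrite -mulr_sumr.
  have a1 : tau * n%:R * A ^+ 30 <= T * A ^+ 30 by apply: ler_wpM2r => //; pos.
  have a2 : \sum_(i < n) tau * nr N 2 (Y i.+1) <= c0 * A ^+ 5.
    have := hc0 N tau M q O Y n t0 q36 hY nM; rewrite -/A; have := L0 n; lra.
  have a3 : \sum_(i < n) tau * (1 + nr N ga (O i)) ^+ 6 <= A ^+ 30.
    apply: (@le_trans _ _ A); first by apply: Aux_sum => //; [exact: ltW|exact: leq_trans q36].
    by rewrite -[leLHS]expr1; exact: ler_weXn2l.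
  rewrite [leRHS](_ : _ = Cs ^+ 2 * 3 * (T * A ^+ 30 + Cd * (c0 ^+ 6 * (T * A ^+ 30) + c0 ^+ 5 * A ^+ 25 * (c0 * A ^+ 5)) + C2 ^+ 6 * A ^+ 30)); last by rewrite /E; ring.
  apply: ler_wpM2l; first by pos.
  apply: lerD; [apply: lerD => //|by apply: ler_wpM2l; pos].
  apply: ler_wpM2l; first by pos.
  by apply: lerD; apply: ler_wpM2l => //; pos.
have hw : \sum_(k < n) 2 * tau * (tau * (n - k)%:R) `^ (- (21 / 32)) * Phi k <= H * A ^+ 30.
  apply: (le_via (2 * (\sum_(k < n) tau * (tau * (n - k)%:R) `^ (- (7 / 8)) + \sum_(k < n) tau * Phi k ^+ 4))).
    rewrite -big_split mulr_sumr; apply: ler_sum => k _ /=.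
    rewrite -!mulrA ler_pM2l// -mulrDr ler_pM2l//; apply: weight_split; last exact: sqrtr_ge0.
    by rewrite mulr_gt0// ltr0n subn_gt0.
  have h1 : \sum_(k < n) tau * (tau * (n - k)%:R) `^ (- (7 / 8)) <= 8 * k8.
    have h := fractional_sum n t0; rewrite (reindex_inj rev_ord_inj) /= in h.
    apply: (le_via (8 * (tau * n%:R) `^ (1 / 8))).
      by apply: le_trans h; apply: ler_sum => k _; rewrite subnSK.
    rewrite ler_pM2l// /k8; apply: ge0_ler_powR; rewrite ?nnegrE ?(ltW T0)//.
    by rewrite mulr_ge0// ltW.
  have h2 : 8 * k8 <= 8 * k8 * A ^+ 30 by rewrite ler_peMr ?exprn_ege1//; pos.
  by rewrite /H; lra.
have hnr : nr N (5 / 8) (Y n) <= ((1 + H) * A ^+ 30) ^+ 2.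
  apply: (le_trans sm); rewrite lerXn2r ?nnegrE//.
  - apply: sumr_ge0 => k _; rewrite mulr_ge0 ?sqrtr_ge0// mulr_ge0 ?powR_ge0//; pos.
  - by apply: mulr_ge0; [lra|pos].
  - by apply: (le_trans hw); apply: ler_wpM2r; [pos|lra].
set X := Cf * nr N (5 / 8) (Y n).
have X0 : 0 <= X by rewrite /X; have := nr_ge0 N (5 / 8) (Y n) => nn; pos.
apply: (le_via (vol D * X ^+ 3)).
  have i6 c : Ig m (fun x => S N c x ^+ 6) by exact: Ig_SX.
  rewrite mulrC -(vol_RI (X ^+ 3)); apply: RI_le_ae => //; first exact: Ig_cst.
  apply: filterS (hCf N (Y n)) => x h; rewrite (_ : S N (Y n) x ^+ 6 = (S N (Y n) x ^+ 2) ^+ 3); last by ring.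
  by rewrite lerXn2r ?nnegrE ?sqr_ge0.
rewrite -mulrA ler_pM2l// (_ : _ * A ^+ 180 = (Cf * ((1 + H) * A ^+ 30) ^+ 2) ^+ 3); last by ring.
by rewrite lerXn2r ?nnegrE//; [pos|rewrite /X ler_pM2l].
Qed.

(** For d >= 2 the H^1 energy gives A^60, weakened to A^180 to match d = 1. *)
Lemma hat_p6 : exists2 C : R, 0 < C & forall N tau M q O Y n, 0 < tau -> tau * M%:R <= T ->
  (36 <= q)%N -> euler_path N tau M O Y -> (n <= M)%N -> p6 N (Y n) <= C * Aux N ga tau M q O ^+ 180.
Proof.
have [d2|d2] := leqP 2 d; last first.
  by apply: hat_p6_d1; have /andP[d1 _] := d_range; apply/eqP; rewrite eqn_leq d1 -ltnS d2.
have [C C0 hC] := path_J hga d2; have [C1 C10 hC1] := F1.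
exists (C1 * (2 * C) ^+ 3); first by pos.
move=> N tau M q O Y n t0 tM q36 hY nM.
have A1 := Aux_ge1 N ga M q O (ltW t0); have := hC N tau M q O Y n t0 q36 hY nM.
move: A1; set A := Aux N ga tau M q O => A1 hJ; have A0 : 0 < A by lra.
apply: (le_trans (hC1 N (Y n))); rewrite -mulrA ler_pM2l//.
apply: (le_via ((2 * C * A ^+ 20) ^+ 3)).
  rewrite lerXn2r ?nnegrE ?nr_ge0//; first by pos.
  by have := p4_ge0 N (Y n); move: hJ; rewrite /Jp; lra.
rewrite exprMn ler_pM2l; last by pos.
by rewrite -exprM; exact: ler_weXn2l.
Qed.
End sixth.

(** The left side is at most min(1, x^4). The exponent 9/4 is tuned to the residual: for x = tau
    la^2 and the weight la^-3 it leaves la^(3/2), the regularity that smoothing provides. *)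
Lemma exp_defect (x : R) : 0 <= x -> (1 - (1 + x) * expR (- x)) ^+ 2 <= x `^ (9 / 4).
Proof.
move=> x0; set z := 1 - _; have e0 := expR_gt0 (- x).
have e1 : 1 - x <= expR (- x) by exact: expR_ge1Dx.
have e2 : (1 + x) * expR (- x) <= 1.
  by rewrite expRN ler_pdivrMr ?expR_gt0// mul1r; exact: expR_ge1Dx.
have z0 : 0 <= z by rewrite /z; lra.
have z1 : z <= 1 by rewrite /z; have : 0 <= (1 + x) * expR (- x); [apply: mulr_ge0; lra|lra].
have zx : z <= x ^+ 2.
  have : (1 + x) * (1 - x) <= (1 + x) * expR (- x) by apply: ler_wpM2l => //; lra.
  by rewrite /z; lra.
have [h|h] := lerP x 1; last first.
  apply: (@le_trans _ _ 1); first by rewrite -(expr1n R 2) lerXn2r ?nnegrE.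
  by have : x `^ 0 <= x `^ (9 / 4); [apply: ler_powR; lra|rewrite powRr0].
apply: (le_via (x ^+ 4)).
  by rewrite (_ : x ^+ 4 = (x ^+ 2) ^+ 2) ?lerXn2r ?nnegrE ?sqr_ge0//; ring.
move: x0; rewrite le_eqVlt => /orP[/eqP <-|x0]; first by rewrite exprS mul0r powR_ge0.
rewrite -powR_mulrn ?(ltW x0)//; apply: ger_powR; first by rewrite x0.
lra.
Qed.

(** The same device with the exponent tuned to the increment in H^1: la times la^(1/2) is again
    la^(3/2). *)
Lemma exp_decay (x : R) : 0 <= x -> (1 - expR (- x)) ^+ 2 <= x `^ (1 / 4).
Proof.
move=> x0; set z := 1 - _; have e0 := expR_gt0 (- x).
have e1 : 1 - x <= expR (- x) by exact: expR_ge1Dx.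
have e2 : expR (- x) <= 1 by rewrite -expR0 ler_expR; lra.
have z0 : 0 <= z by rewrite /z; lra.
have [h|h] := lerP x 1; last first.
  apply: (@le_trans _ _ 1); first by rewrite -(expr1n R 2) lerXn2r ?nnegrE// /z; lra.
  by have : x `^ 0 <= x `^ (1 / 4); [apply: ler_powR; lra|rewrite powRr0].
apply: (le_via (x ^+ 2)); first by rewrite lerXn2r ?nnegrE// /z; lra.
move: x0; rewrite le_eqVlt => /orP[/eqP <-|x0]; first by rewrite exprS mul0r powR_ge0.
rewrite -powR_mulrn ?(ltW x0)//; apply: ger_powR; first by rewrite x0.
lra.
Qed.

(** * The tamed scheme in coefficients and its consistency *)

Definition decay (tau : R) i := expR (- (tau * la i ^+ 2)).
Definition Fnorm N c := Num.sqrt (\sum_(i < N) Fc N c i ^+ 2).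

Definition sstep_rel N (tau : R) y o y' := forall i : 'I_N,
  y' i = decay tau i * y i - (1 + tau * Fnorm N (fun j => y j + o j))^-1 *
   ((1 - decay tau i) / la i) * Fc N (fun j => y j + o j) i.

Definition scheme_path N (tau : R) M (O Y : nat -> nat -> R) := (forall i : 'I_N, Y 0%N i = 0) /\
  forall k, (k < M)%N -> sstep_rel N tau (Y k) (O k) (Y k.+1).

(** The last bound, a forcing of norm at most 1/tau whatever the state, is what taming buys; the
    third measures the inconsistency it causes. *)
Lemma taming_bounds N (tau : R) c : 0 < tau -> let th := (1 + tau * Fnorm N c)^-1 in
  [/\ 0 < th, th <= 1, 1 - th <= tau * Fnorm N c & th * Fnorm N c <= tau^-1].
Proof.
move=> t0 th; have f0 : 0 <= Fnorm N c by exact: sqrtr_ge0.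
have x0 : 0 <= tau * Fnorm N c by pos.
have y0 : 0 < 1 + tau * Fnorm N c by lra.
split.
- by rewrite /th invr_gt0.
- by rewrite /th invf_le1//; lra.
- have -> : 1 - th = tau * Fnorm N c * th by rewrite /th; field; rewrite gt_eqF.
  by rewrite ler_piMr// /th invf_le1//; lra.
- by rewrite /th mulrC ler_pdivrMr// mulrDr mulr1 mulrA mulVf ?gt_eqF// mul1r lerDr invr_ge0 ltW.
Qed.

Lemma Fnorm_sqr N c : Fnorm N c ^+ 2 = \sum_(i < N) Fc N c i ^+ 2.
Proof. by rewrite sqr_sqrtr//; apply: sumr_ge0 => i _; exact: sqr_ge0. Qed.

Lemma pow_scale (tau : R) (i : nat) (s : R) : 0 < tau -> (tau * la i ^+ 2) `^ s = tau `^ s * la i `^ (2 * s).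
Proof.
move=> t0; have li := lp i; rewrite powRM ?sqr_ge0 ?(ltW t0)//; congr (_ * _).
by rewrite powRrM -[2]/(2%:R) powR_mulrn// ltW.
Qed.

(** Half a derivative is given up, from H^(3/2) to H^1. For the fourth-order semigroup this is worth
    tau^(1/8), or tau^(1/4) in squares. *)
Lemma increment : exists2 C : R, 0 < C & forall N (tau : R) y o y', 0 < tau ->
  sstep_rel N tau y o y' ->
  nr N 1 (fun i => y' i - y i) <=
  C * tau `^ (1 / 4) * (nr N (3 / 2) y + Fnorm N (fun j => y j + o j) ^+ 2).
Proof.
have le_C : - (1 / 2) <= 0 :> R by lra.
have [C C0 hC] := nr_mono le_C.
exists (2 * (1 + C)); first by pos.
move=> N tau y o y' t0 st; have [th0 th1 _ _] := taming_bounds N (fun j => y j + o j) t0.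
set th := (1 + _)^-1 in th0 th1; set F := Fc N (fun j => y j + o j).
have n0 := nr_ge0 N (3 / 2) y; have tp : 0 < tau `^ (1 / 4) by rewrite powR_gt0.
have h : nr N 1 (fun i => y' i - y i) <= 2 * tau `^ (1 / 4) * (nr N (3 / 2) y + nr N (- (1 / 2)) F).
  rewrite (nr1E) mulrDr !mulr_sumr -big_split; apply: ler_sum => i _ /=; have li := lp i.
  have x0 : 0 <= tau * la i ^+ 2 by pos.
  have hd := exp_decay x0; rewrite pow_scale// in hd.
  rewrite st -/th -/F; move: hd; rewrite -/(decay tau i); set q := 1 - decay tau i => hd.
  apply: (le_via (2 * (la i * (q ^+ 2 * y i ^+ 2)) + 2 * (la i * (q ^+ 2 * (la i ^- 2 * F i ^+ 2))))).
    rewrite -mulrDr -mulrDr [leRHS]mulrCA ler_pM2l//.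
    have h1 : (th * F i) ^+ 2 <= F i ^+ 2.
      rewrite exprMn -[leRHS]mul1r; apply: ler_wpM2r; first exact: sqr_ge0.
      by rewrite -[leRHS](expr1n R 2) lerXn2r ?nnegrE ?(ltW th0).
    have h2 : q ^+ 2 * (la i ^- 2 * (th * F i) ^+ 2) <= q ^+ 2 * (la i ^- 2 * F i ^+ 2).
      by do 2 (apply: ler_wpM2l; first by pos).
    rewrite (_ : decay tau i * y i - _ - y i = - (q * y i) - q * ((la i)^-1 * (th * F i))); last by rewrite /q; ring.
    have := sqr_ge0 (q * y i - q * ((la i)^-1 * (th * F i))).
    move: h2; rewrite -exprVn; lra.
  have e1 : la i * la i `^ (2 * (1 / 4)) = la i `^ (3 / 2).
    rewrite -{1}(powRr1 (ltW li)) -powRD; last by rewrite (gt_eqF li) implybT.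
    by congr (_ `^ _); field.
  have e2 : la i ^- 2 * la i * la i `^ (2 * (1 / 4)) = la i `^ (- (1 / 2)).
    rewrite -{2}(powRr1 (ltW li)) -powR_inv1 ?exprn_ge0 ?(ltW li)// -powR_mulrn ?(ltW li)// -powRrM -!powRD; first by congr (_ `^ _); field.
    - by rewrite (gt_eqF li) implybT.
    - by rewrite (gt_eqF li) implybT.
  rewrite -e1 -e2; apply: lerD.
    rewrite -!mulrA ler_pM2l//.
    rewrite [leLHS](_ : _ = q ^+ 2 * (la i * y i ^+ 2)); last by ring.
    rewrite [leRHS](_ : _ = (tau `^ (1 / 4) * la i `^ (2 * (1 / 4))) * (la i * y i ^+ 2)); last by ring.
    by apply: ler_wpM2r => //; pos.
  rewrite -!mulrA ler_pM2l//.
  rewrite [leLHS](_ : _ = q ^+ 2 * (la i * (la i ^- 2 * F i ^+ 2))); last by ring.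
  rewrite [leRHS](_ : _ = (tau `^ (1 / 4) * la i `^ (2 * (1 / 4))) * (la i * (la i ^- 2 * F i ^+ 2))); last by ring.
  by apply: ler_wpM2r => //; pos.
apply: (le_trans h); have := hC N F; rewrite nr0E -Fnorm_sqr => h2.
rewrite [leRHS](_ : _ = 2 * tau `^ (1 / 4) * ((1 + C) * (nr N (3 / 2) y + Fnorm N (fun j => y j + o j) ^+ 2))); last by ring.
apply: ler_wpM2l; first by pos.
have := sqr_ge0 (Fnorm N (fun j => y j + o j)).
have : 0 <= C * nr N (3 / 2) y by pos.
lra.
Qed.

(** The defect of a tamed step inserted into the implicit Euler equation. *)
Definition residual N (tau : R) y o y' (i : nat) : R :=
  (1 + tau * la i ^+ 2) * y' i - y i + tau * la i * Fc N (fun j => y' j + o j) i.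

(** The weight la^-3 is the one produced when the defect is paired in H^-1 and absorbed by the
    dissipation in H^1. In it every part of the defect is of order tau^(9/4), given H^(3/2) bounds
    before and after the step. *)
Lemma residual_bound : exists2 C : R, 0 < C & forall N (tau : R) y o y' (Q B : R), 0 < tau <= 1 ->
  sstep_rel N tau y o y' -> 0 <= Q -> sup_le N o Q -> 1 <= B ->
  Q ^+ 3 <= B -> nr N (3 / 2) y <= B -> nr N (3 / 2) y' <= B -> Fnorm N (fun j => y j + o j) ^+ 2 <= B ->
  nr N (- 3) (residual N tau y o y') <= C * tau `^ (9 / 4) * B ^+ 4.
Proof.
have le_C1 : - 1 <= 0 :> R by lra.
have [C1 C10 hC1] := nr_mono le_C1.
have le_C2 : - (1 / 2) <= 0 :> R by lra.
have [C2 C20 hC2] := nr_mono le_C2.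
have [C3 C30 hC3] := increment; have [C4 C40 hC4] := Fc_lipschitz.
have [C5 C50 hC5] := F1.
have le_C6 : 1 <= 3 / 2 :> R by lra.
have [C6 C60 hC6] := nr_mono le_C6.
have v0 := vol_gt0.
set L := C4 * (1 + 64 * (C5 * C6 ^+ 3 + vol D)); have L0 : 0 < L by rewrite /L; pos.
exists (4 * (1 + C1 * (L * (2 * C3)) + C2 + 4 * C1)); first by pos.
move=> N tau y o y' Q B /andP[t0 t1] st Q0 hQ B1 QB yB y'B FB.
have [th0 th1 th2 _] := taming_bounds N (fun j => y j + o j) t0.
set th := (1 + _)^-1 in th0 th1 th2; set F := Fc N (fun j => y j + o j); set F' := Fc N (fun j => y' j + o j).
set Fn := Fnorm N _ in th2 FB; have Fn0 : 0 <= Fn by exact: sqrtr_ge0.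
have B0 : 0 < B by lra.
set t9 := tau `^ (9 / 4); have t90 : 0 < t9 by rewrite powR_gt0.
have h : nr N (- 3) (residual N tau y o y') <= 4 * (t9 * nr N (3 / 2) y + tau ^+ 2 * nr N (-1) (fun i => F' i - F i) +
   t9 * nr N (- (1 / 2)) F + 4 * tau ^+ 4 * Fn ^+ 2 * nr N (-1) F).
  rewrite !mulrDr !mulr_sumr -!big_split; apply: ler_sum => i _ /=; have li := lp i.
  set x := tau * la i ^+ 2; have x0 : 0 < x by rewrite /x; pos.
  have hd := exp_defect (ltW x0); rewrite pow_scale// -/t9 in hd.
  set E := expR (- x) in hd; have E0 : 0 < E by exact: expR_gt0.
  have E1 : 1 - x <= E by exact: expR_ge1Dx.
  have h4 : 0 <= (1 + x) * (1 - E) <= 2 * x.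
    have Ele : E <= 1 by rewrite /E -expR0 ler_expR; lra.
    apply/andP; split; first by apply: mulr_ge0; lra.
    have [hx|hx] := lerP x 1.
      apply: (le_via (2 * (1 - E))); last by lra.
      by apply: ler_wpM2r; lra.
    apply: (le_via ((1 + x) * 1)); last by lra.
    by apply: ler_wpM2l; lra.
  (* Four sources: semigroup against resolvent on [y], change of F over the step, semigroup against
     resolvent on the forcing, and taming. *)
  have -> : residual N tau y o y' i = - (1 - (1 + x) * E) * y i + tau * la i * (F' i - F i)
      + (1 - (1 + x) * E) * (- (la i)^-1 * F i) + (1 + x) * (1 - E) * ((1 - th) * ((la i)^-1 * F i)).
    by rewrite /residual st -/th -/F -/F' /decay -/x -/E /x; field; rewrite gt_eqF.
  have e3 : la i `^ (- 3) = (la i ^- 3) by rewrite powRN -[3]/(3%:R) powR_mulrn// ltW.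
  have e1 : la i `^ (-1) = la i ^- 1 by rewrite powR_inv1// ltW.
  have p3 : 0 < la i ^- 3 by pos.
  have h4s (a b c e : R) : (a + b + c + e) ^+ 2 <= 4 * (a ^+ 2 + b ^+ 2 + c ^+ 2 + e ^+ 2).
    by have := sqr_ge0 (a - b); have := sqr_ge0 (a - c); have := sqr_ge0 (a - e); have := sqr_ge0 (b - c);
       have := sqr_ge0 (b - e); have := sqr_ge0 (c - e); lra.
  rewrite e3 e1; apply: (le_trans (ler_wpM2l (ltW p3) (h4s _ _ _ _))).
  have f1 : la i ^- 3 * la i `^ (2 * (9 / 4)) = la i `^ (3 / 2).
    rewrite -e3 -powRD; last by rewrite (gt_eqF li) implybT.
    by congr (_ `^ _); field.
  have f2 : la i ^- 3 * la i `^ (2 * (9 / 4)) * la i ^- 2 = la i `^ (- (1 / 2)).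
    rewrite f1 (_ : la i ^- 2 = la i `^ (- 2)); last by rewrite powRN -[2]/(2%:R) powR_mulrn// ltW.
    rewrite -powRD; last by rewrite (gt_eqF li) implybT.
    by congr (_ `^ _); field.
  rewrite -f2 -f1 mulrCA -!mulrDr ler_pM2l// !exprMn !sqrrN.
  rewrite mulrDr mulrDr mulrDr; apply: lerD; first apply: lerD; first apply: lerD.
  - rewrite [leLHS](_ : _ = (1 - (1 + x) * E) ^+ 2 * (la i ^- 3 * y i ^+ 2)); last by ring.
    rewrite [leRHS](_ : _ = t9 * la i `^ (2 * (9 / 4)) * (la i ^- 3 * y i ^+ 2)); last by ring.
    by apply: ler_wpM2r => //; pos.
  - rewrite le_eqVlt; apply/orP; left; apply/eqP; field; rewrite gt_eqF//.
  - rewrite exprVn [leLHS](_ : _ = (1 - (1 + x) * E) ^+ 2 * (la i ^- 3 * la i ^- 2 * F i ^+ 2)); last by ring.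
    rewrite [leRHS](_ : _ = t9 * la i `^ (2 * (9 / 4)) * (la i ^- 3 * la i ^- 2 * F i ^+ 2)); last by ring.
    by apply: ler_wpM2r => //; pos.
  - have k1 : ((1 + x) * (1 - E)) ^+ 2 <= (2 * x) ^+ 2 by case/andP: h4 => k0 k1; rewrite lerXn2r ?nnegrE//; pos.
    have k2 : (1 - th) ^+ 2 <= (tau * Fn) ^+ 2 by rewrite lerXn2r ?nnegrE//; [lra|pos].
    rewrite -exprMn exprVn [leLHS](_ : _ = (la i ^- 3 * la i ^- 2 * F i ^+ 2) * (((1 + x) * (1 - E)) ^+ 2 * (1 - th) ^+ 2)); last by ring.
    rewrite [leRHS](_ : _ = (la i ^- 3 * la i ^- 2 * F i ^+ 2) * ((2 * x) ^+ 2 * (tau * Fn) ^+ 2)); last by rewrite /x; field; rewrite gt_eqF.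
    by apply: ler_wpM2l; [pos|apply: ler_pM => //; exact: sqr_ge0].
apply: (le_trans h).
have BB : B <= B ^+ 4 by rewrite -[leLHS]expr1; exact: ler_weXn2l.
have BB2 : B ^+ 2 <= B ^+ 4 by exact: ler_weXn2l.
have FF : \sum_(i < N) F i ^+ 2 <= B by rewrite -Fnorm_sqr.
have p6b c : nr N (3 / 2) c <= B -> p6 N (fun j => c j + o j) <= 32 * (C5 * C6 ^+ 3 + vol D) * B ^+ 3.
  move=> cB; apply: (le_trans (p6_add c Q0 hQ)); rewrite -mulrA ler_pM2l// mulrDl; apply: lerD.
    apply: (le_trans (hC5 N c)); rewrite -mulrA -exprMn ler_pM2l// lerXn2r ?nnegrE ?nr_ge0//; first by pos.
    by apply: (le_trans (hC6 N c)); rewrite ler_pM2l.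
  rewrite ler_pM2l//; apply: (le_trans QB); rewrite -[leLHS]expr1; exact: ler_weXn2l.
have DF : nr N 0 (fun i => F' i - F i) <= L * (2 * C3) * tau `^ (1 / 4) * B ^+ 4.
  rewrite nr0E; apply: (le_trans (hC4 N _ _)).
  have -> : nr N 1 (fun i => y' i + o i - (y i + o i)) = nr N 1 (fun i => y' i - y i).
    by apply: eq_bigr => i _; congr (_ * _ ^+ 2); ring.
  rewrite [leRHS](_ : _ = (L * B ^+ 3) * (C3 * tau `^ (1 / 4) * (2 * B))); last by ring.
  apply: ler_pM; [|exact: nr_ge0| |].
  - by apply: mulr_ge0; [pos|have := p6_ge0 N (fun j => y' j + o j); have := p6_ge0 N (fun j => y j + o j); lra].
  - rewrite /L -mulrA ler_pM2l// mulrDl mul1r; have := p6b y' y'B; have := p6b y yB.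
    have : 1 <= B ^+ 3 by exact: exprn_ege1.
    lra.
  - apply: (le_trans (hC3 N tau y o y' t0 st)); apply: ler_wpM2l; last by move: yB FB; rewrite -/Fn; lra.
    by have : 0 < tau `^ (1 / 4); [rewrite powR_gt0|move=> h'; pos].
have t94 : tau ^+ 2 * tau `^ (1 / 4) = t9.
  rewrite -powR_mulrn ?(ltW t0)// -powRD; last by rewrite (gt_eqF t0) implybT.
  by rewrite /t9; congr (_ `^ _); field.
have t4 : tau ^+ 4 <= t9.
  by rewrite /t9 -powR_mulrn ?(ltW t0)//; apply: ger_powR; [rewrite t0|lra].
have DF1 : nr N (-1) (fun i => F' i - F i) <= C1 * (L * (2 * C3) * tau `^ (1 / 4) * B ^+ 4).
  by apply: (le_trans (hC1 N _)); rewrite ler_pM2l.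
have F1' : nr N (-1) F <= C1 * B by apply: (le_trans (hC1 N _)); rewrite nr0E ler_pM2l.
have F2' : nr N (- (1 / 2)) F <= C2 * B by apply: (le_trans (hC2 N _)); rewrite nr0E ler_pM2l.
rewrite [leRHS](_ : _ = 4 * (t9 * B ^+ 4 + tau ^+ 2 * (C1 * (L * (2 * C3) * tau `^ (1 / 4) * B ^+ 4)) + t9 * (C2 * B ^+ 4) + 4 * (C1 * (t9 * B ^+ 4)))); last first.
  by rewrite -t94; ring.
rewrite ler_pM2l//.
apply: lerD; first apply: lerD; first apply: lerD.
- by rewrite ler_pM2l//; lra.
- by apply: ler_wpM2l => //; pos.
- rewrite ler_pM2l//; apply: (le_trans F2'); rewrite ler_pM2l//.
- rewrite [leLHS](_ : _ = 4 * (tau ^+ 4 * (Fn ^+ 2 * nr N (-1) F))); last by ring.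
  rewrite ler_pM2l//; apply: (le_via (t9 * (B * (C1 * B)))).
    apply: ler_pM => //; [by pos|by apply: mulr_ge0; [exact: sqr_ge0|exact: nr_ge0]|].
    by apply: ler_pM => //; [exact: sqr_ge0|exact: nr_ge0].
  rewrite [leLHS](_ : _ = C1 * (t9 * B ^+ 2)); last by ring.
  by rewrite ler_pM2l// ler_pM2l.
Qed.

Lemma power_expansion (g t c a u : R) :
  (g * t * (c * (a * u ^+ 3)) ^+ 8) ^+ 8 = g ^+ 8 * c ^+ 64 * a ^+ 64 * t ^+ 8 * u ^+ (3 * 64).
Proof.
rewrite exprMn -exprM [(_ * _) ^+ (8 * 8)]exprMn [(_ * _) ^+ (8 * 8)]exprMn -exprM exprMn.
rewrite (_ : 8 * 8 = 64)%N//.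
by move: (g ^+ 8) (t ^+ 8) (c ^+ 64) (a ^+ 64) (u ^+ (3 * 64)) => g' t' c' a' u'; ring.
Qed.

Lemma discrete_gronwall (n : nat) (rho : nat -> R) (e De : R) : 1 <= e -> 0 <= De -> rho 0%N = 0 ->
  (forall k, (k < n)%N -> rho k.+1 <= e * (rho k + De)) -> rho n <= n%:R * e ^+ n * De.
Proof.
move=> e1 D0 r0; have e0 : 0 <= e by lra.
elim: n => [_|n ih h]; first by rewrite r0 !mul0r.
have {ih}ih := ih (fun k kn => h k (ltnW kn)); apply: (le_trans (h n (ltnSn n))).
rewrite -natr1 [leRHS](_ : _ = e * (n%:R * e ^+ n * De + e ^+ n * De)); last by rewrite exprS; ring.
apply: ler_wpM2l => //; apply: lerD => //.
by rewrite -[leLHS]mul1r; apply: ler_wpM2r => //; exact: exprn_ege1.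
Qed.

(** Pointwise in the eigenvalue, by cases on z la^(1/2) >= 1. The parameter balances a large H^(3/2)
    bound against a small H^-1 one. *)
Lemma interp_three_halves N (z : R) c : 0 < z ->
  nr N 1 c <= z * nr N (3 / 2) c + z ^- 4 * nr N (-1) c.
Proof.
move=> z0; rewrite /nr !mulr_sumr -big_split; apply: ler_sum => i _ /=.
rewrite [leRHS](_ : _ = (z * la i `^ (3 / 2) + z ^- 4 * la i `^ (-1)) * c i ^+ 2); last by ring.
apply: ler_wpM2r; first exact: sqr_ge0.
have li := lp i; set s := Num.sqrt (la i); have s0 : 0 < s by rewrite sqrtr_gt0.
have -> : la i `^ 1 = s ^+ 2 by rewrite sqr_sqrtr ?powRr1 ?(ltW li).
have -> : la i `^ (3 / 2) = s ^+ 3.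
  have -> : s = la i `^ (1 / 2) by rewrite /s -powR12_sqrt ?(ltW li)// div1r.
  by rewrite -powR_mulrn ?powR_ge0// -powRrM; congr (_ `^ _); field.
have -> : la i `^ (-1) = s ^- 2 by rewrite sqr_sqrtr ?powR_inv1 ?(ltW li).
have [h|h] := lerP 1 (z * s).
  apply: (le_via (z * s ^+ 3)); last by rewrite lerDl; pos.
  rewrite (_ : z * s ^+ 3 = (z * s) * s ^+ 2); last by ring.
  by rewrite ler_peMl//; pos.
apply: (le_via (z ^- 4 * s ^- 2)); last by rewrite lerDr; pos.
rewrite -invfM -[leRHS]mul1r ler_pdivlMr; last by pos.
rewrite (_ : s ^+ 2 * _ = (z * s) ^+ 4); last by ring.
by rewrite -(expr1n R 4) lerXn2r ?nnegrE//; [pos|exact: ltW].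
Qed.

(** [one_sided] costs tau nr0, which is split between nr1 and nr(-1); the defect is paired as la^-1
    de r <= (tau/4) la r^2 + la^-3 de^2 / tau. For tau <= 1/2, 1/(1 - tau) is at most exp(2 tau). *)
Lemma comparison_step N (tau : R) y o y' z z' : 0 < tau <= 1 / 2 -> istep N tau z o z' ->
  nr N (-1) (fun i => y' i - z' i) <=
  expR (2 * tau) * (nr N (-1) (fun i => y i - z i) + 2 / tau * nr N (-3) (residual N tau y o y')).
Proof.
move=> /andP[t0 t2] st; set de := residual N tau y o y'.
set r := fun i => y i - z i; set r' := fun i => y' i - z' i.
have h1 := one_sided N (fun j => y' j + o j) (fun j => z' j + o j).
have h2 : nr N (-1) r' - nr N (-1) r <= 2 * \sum_(i < N) (la i)^-1 * ((r' i - r i) * r' i).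
  rewrite !(nrN1E) -sumrB mulr_sumr; apply: ler_sum => i _.
  rewrite -mulrBr [leRHS](_ : _ = (la i)^-1 * (2 * ((r' i - r i) * r' i))); last by ring.
  by rewrite ler_pM2l ?invr_gt0//; have := sqr_ge0 (r' i - r i); lra.
set g := fun i => Fc N (fun j => y' j + o j) i - Fc N (fun j => z' j + o j) i.
have h1' : - nr N 0 r' <= \sum_(i < N) r' i * g i.
  move: h1; rewrite nr0E; congr (_ <= _).
    by congr (- _); apply: eq_bigr => i _; congr (_ ^+ 2); rewrite /r'; ring.
  by apply: eq_bigr => i _; congr (_ * _); rewrite /r'; ring.
have h3 : \sum_(i < N) (la i)^-1 * ((r' i - r i) * r' i) <=
   tau / 4 * nr N 1 r' + tau^-1 * nr N (-3) de - tau * nr N 1 r' - tau * \sum_(i < N) r' i * g i.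
  rewrite (nr1E) /nr !mulr_sumr -big_split -!sumrB; apply: ler_sum => i _ /=.
  have li := lp i.
  have -> : la i `^ (-3) = la i ^- 3 by rewrite powRN -[3]/(3%:R) powR_mulrn// ltW.
  have E : r' i - r i = de i - tau * la i ^+ 2 * r' i - tau * la i * g i.
    by rewrite /de /residual /r' /r /g; have := st i; move: (Fc N _ i) (Fc N _ i) => F1 F2; lra.
  rewrite E -subr_ge0 (_ : _ - _ = tau * (la i)^-1 * (la i * r' i / 2 - (tau * la i)^-1 * de i) ^+ 2); last by field; rewrite !gt_eqF.
  by pos.
have h4 : nr N 0 r' <= 2^-1 * nr N 1 r' + 2^-1 * nr N (-1) r'.
  rewrite nr0E (nr1E) (nrN1E) !mulr_sumr -big_split; apply: ler_sum => i _ /=.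
  have li := lp i; rewrite -subr_ge0 (_ : _ - _ = 2^-1 * (la i)^-1 * (la i - 1) ^+ 2 * r' i ^+ 2); last by field; rewrite gt_eqF.
  by pos.
have n1 := nr_ge0 N 1 r'; have nm := nr_ge0 N (-1) r'; have nr0 := nr_ge0 N (-1) r; have n3 := nr_ge0 N (-3) de.
have h5 : nr N (-1) r' * (1 - tau) <= nr N (-1) r + 2 * tau^-1 * nr N (-3) de.
  have k1 : tau * - nr N 0 r' <= tau * \sum_(i < N) r' i * g i by rewrite ler_pM2l.
  have k2 : tau * nr N 0 r' <= tau * (2^-1 * nr N 1 r' + 2^-1 * nr N (-1) r') by rewrite ler_pM2l.
  have k3 : 0 <= tau * nr N 1 r' by pos.
  lra.
have h6 : 1 <= expR (2 * tau) * (1 - tau).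
  apply: (le_via ((1 + 2 * tau) * (1 - tau))).
    rewrite -subr_ge0 (_ : _ - _ = tau * (1 - 2 * tau)); last by ring.
    by apply: mulr_ge0; lra.
  by apply: ler_wpM2r; [lra|exact: expR_ge1Dx].
apply: (le_via (expR (2 * tau) * (1 - tau) * nr N (-1) r')); first by rewrite ler_peMl.
by rewrite -mulrA; apply: ler_wpM2l; [exact: expR_ge0|rewrite mulrC].
Qed.

Lemma euler_path_exists N (tau : R) M O : 0 < tau -> exists Z, euler_path N tau M O Z.
Proof.
move=> t0; have /choice[f hf] : forall p : nat * (nat -> R), exists y', istep N tau p.2 (O p.1) y'.
  by move=> [k y]; exact: (implicit_euler N y (O k) t0).
exists (fix Z k := if k is k'.+1 then f (k', Z k') else fun=> 0); split => // k _ /=.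
exact: hf (k, _).
Qed.

(** * Comparison of the tamed path with the implicit path *)

Section theorem.
Variables (ga : R) (hga : d%:R / 2 < ga) (T : R) (T0 : 0 < T).

(** Taming keeps the forcing below 1/tau in norm and smoothing does the rest; useful when 1/tau
    itself is under control. *)
Lemma crude_bound N (tau : R) M O Y n : 0 < tau -> tau * M%:R <= T -> scheme_path N tau M O Y -> (n <= M)%N ->
  nr N (3 / 2) (Y n) <= (16 * T `^ (1 / 8) * tau^-1) ^+ 2.
Proof.
move=> t0 tM [Y0 st] nM.
pose th k := (1 + tau * Fnorm N (fun j => Y k j + O k j))^-1.
have := @smoothing_cst N tau tau^-1 (decay tau) (fun i => - ((1 - decay tau i) / la i)) Y
  (fun k i => th k * Fc N (fun j => Y k j + O k j) i) n t0.
move=> sm; apply: (le_via ((16 * (tau * n%:R) `^ (1 / 8) * tau^-1) ^+ 2)).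
  apply: sm => //.
  - by move=> i j; exact: exp_kernel.
  - by move=> k i kn; rewrite (st k (leq_trans kn nM) i) -/(th k); ring.
  - by rewrite invr_ge0 ltW.
  - move=> k kn; have [h0 _ _ h3] := taming_bounds N (fun j => Y k j + O k j) t0.
    rewrite (eq_bigr (fun i : 'I_N => th k ^+ 2 * Fc N (fun j => Y k j + O k j) i ^+ 2)); last by move=> i _; rewrite exprMn.
    rewrite -mulr_sumr -Fnorm_sqr -exprMn lerXn2r ?nnegrE ?invr_ge0 ?(ltW t0)//.
    by rewrite mulr_ge0 ?sqrtr_ge0// ltW.
have tn : tau * n%:R <= T by apply: le_trans tM; rewrite ler_pM2l// ler_nat.
have tn0 : 0 <= tau * n%:R by rewrite mulr_ge0// ltW.
have p0 := powR_ge0 (tau * n%:R) (1 / 8); have p1 := powR_ge0 T (1 / 8).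
rewrite lerXn2r ?nnegrE//; [by pos|by pos|].
apply: ler_wpM2r; first by pos.
by rewrite ler_pM2l//; apply: ge0_ler_powR; rewrite ?nnegrE// ltW.
Qed.

(** A bootstrap over time. As long as nr1 (Y - Z) <= 1, F along Y is bounded like F along the
    implicit path Z, so smoothing bounds Y in H^(3/2) up to the next step. The defects are then
    small, and Gronwall with interpolation returns nr1 (Y - Z) <= 1 there. *)
Lemma scheme_p6 : exists (C : R) (r q : nat), 0 < C /\ forall N tau M O Y n, 0 < tau -> tau * M%:R <= T ->
  scheme_path N tau M O Y -> (n <= M)%N -> p6 N (Y n) <= C * Aux N ga tau M q O ^+ r.
Proof.
have [H H0 hH] := hat_p6 hga T0; have [C1 C10 hC1] := F1.
have [C2 C20 hC2] := F2 hga; have [Cs Cs0 hCs] := Fc_sqr_add.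
have [C7 C70 hC7] := residual_bound.
have le32 : 1 <= 3 / 2 :> R by lra.
have [C6 C60 hC6] := nr_mono le32.
set k8 := T `^ (1 / 8); have k80 : 0 <= k8 by exact: powR_ge0.
set G1 := Cs * (1 + 32 * (H + C1) + C2 ^+ 3); have G10 : 0 < G1 by rewrite /G1; pos.
have HC : H <= 32 * (H + C1) by lra.
have h12 : 1 / 2 <= 1 :> R by lra.
have h11 : 1 / 2 + 1 / 2 <= 1 :> R by lra.
have sq (a b : R) : (a - b) ^+ 2 <= 2 * a ^+ 2 + 2 * b ^+ 2 by have := sqr_ge0 (a + b); lra.
have add4 (a b c : R) : a <= c -> b <= c -> 2 * a + 2 * b <= 4 * c by lra.
set Cb := 1 + G1 + C2 ^+ 3 + (16 * k8) ^+ 2 * G1.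
have [Cb0 G1Cb C2Cb] : [/\ 0 < Cb, G1 <= Cb & C2 ^+ 3 <= Cb].
  have : 0 <= C2 ^+ 3 by pos.
  have : 0 <= (16 * k8) ^+ 2 * G1 by pos.
  by rewrite /Cb; split; lra.
set G2 := T * expR (2 * T) * 2 * C7; have G20 : 0 < G2 by have := expR_gt0 (2 * T) => ee; rewrite /G2; pos.
set G3 := 2 * 8 ^+ 4 * G2; have G30 : 0 < G3 by rewrite /G3; pos.
set G4 := G3 ^+ 8 * Cb ^+ 64; have G40 : 0 < G4 by rewrite /G4; pos.
set Cc := C1 * C6 ^+ 3 * (16 * k8) ^+ 6; have Cc0 : 0 <= Cc by rewrite /Cc; pos.
(* [q] must reach 36 for the energy bounds and 192 = 3 * 64 for the dichotomy below, where U^192 is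
   compared with U^q = A / tau. The exponent [r] is six times that of [X], because p6 costs
   tau^-6. *)
have [q [q36 q192 q0]] : exists q, [/\ (36 <= q)%N, (192 <= q)%N & (0 < q)%N] by exists 200.
have [r [r180 rE]] : exists r, (180 <= r)%N /\ r = ((180 * 64).+1 * 6)%N.
  by exists ((180 * 64).+1 * 6)%N.
exists (32 * (H + C1) + Cc * (2 + G4) ^+ 6), r, q; split.
  by apply: ltr_wpDr; [apply: mulr_ge0 => //; apply: exprn_ge0; lra|pos].
move=> N tau M O Y n t0 tM sp nM.
have A1 := Aux_ge1 N ga M q O (ltW t0); set A := Aux N ga tau M q O in A1 *.
have A0 : 0 < A := lt_le_trans ltr01 A1.
have Ar1 : 1 <= A ^+ r by exact: exprn_ege1.
have n0 k := nr_ge0 N ga (O k).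
(* The crude H^(3/2) bound is of size tau^-2 in squares; the spectral gap and Sobolev turn it into
   tau^-6 for [p6]. *)
have crude X : tau^-1 <= (2 + G4) * X -> X ^+ 6 = A ^+ r ->
   p6 N (Y n) <= (32 * (H + C1) + Cc * (2 + G4) ^+ 6) * A ^+ r.
  move=> hX XE; apply: (le_trans (hC1 N (Y n))).
  apply: (le_via (C1 * (C6 * (16 * k8 * tau^-1) ^+ 2) ^+ 3)).
    rewrite ler_pM2l// lerXn2r ?nnegrE ?nr_ge0//; first by pos.
    by apply: (le_trans (hC6 N (Y n))); rewrite ler_pM2l//; exact: crude_bound sp nM.
  rewrite (_ : C1 * _ = Cc * tau^-1 ^+ 6); last by rewrite /Cc; ring.
  rewrite mulrDl; apply: (le_via (Cc * (2 + G4) ^+ 6 * A ^+ r)); last by rewrite lerDr; pos.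
  rewrite -XE -mulrA -exprMn; apply: ler_wpM2l => //.
  by rewrite lerXn2r ?nnegrE// ?invr_ge0 ?(ltW t0)//; apply: le_trans hX; rewrite invr_ge0 ltW.
set X := (A ^+ 180) ^+ 64 * A.
have XE : X ^+ 6 = A ^+ r by rewrite rE /X -exprM -exprSr -exprM.
have X1 : 1 <= X by rewrite /X -[leLHS]mulr1; apply: ler_pM => //; do 2 apply: exprn_ege1.
have [t2|t2] := lerP tau (1 / 2); last first.
  apply: (crude X) => //; apply: (@le_trans _ _ 2).
    by rewrite -[leRHS]invrK lef_pV2 ?posrE ?invr_gt0//; move: t2; rewrite div1r; exact: ltW.
  by rewrite -[leLHS]mulr1; apply: ler_pM => //; lra.
(* Each summand tau (1 + nr)^q of [A] is at most [A], so [U] bounds 1 + nr of the noise at every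
   single time. *)
set U := (A / tau) `^ q%:R^-1.
have Ut : 1 <= A / tau by rewrite ler_pdivlMr// mul1r; lra.
have U0 : 0 < U by rewrite powR_gt0// (lt_le_trans ltr01 Ut).
have UE : U ^+ q = A / tau.
  by rewrite -powR_mulrn ?(ltW U0)// -powRrM mulVf ?powRr1// ?pnatr_eq0 -?lt0n// (le_trans ler01 Ut).
have U1 : 1 <= U by rewrite -(@ler_pXn2r _ q) ?nnegrE ?(ltW U0)// expr1n UE.
have OU k : (k < M)%N -> 1 + nr N ga (O k) <= U.
  move=> kM; have nk := n0 k; rewrite -(@ler_pXn2r _ q) ?nnegrE ?(ltW U0)//; last by pos.
  rewrite UE ler_pdivlMr// mulrC /A /Aux (bigD1 (Ordinal kM))//= addrCA lerDl.
  by apply: addr_ge0 => //; apply: sumr_ge0 => l _; have := n0 l => nl; pos.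
set W := A ^+ 180 * U ^+ 3; set B := Cb * W.
have W1 : 1 <= W by rewrite /W -[leLHS]mulr1; apply: ler_pM => //; exact: exprn_ege1.
have W0 : 0 < W := lt_le_trans ltr01 W1.
have B1 : 1 <= B.
  rewrite /B -[leLHS]mulr1; apply: ler_pM => //; rewrite /Cb -!addrA lerDl; pos.
have B0 : 0 < B := lt_le_trans ltr01 B1.
(* If the smallness fails, its eighth power gives 1 <= G4 (A^180)^64 tau^2 U^192 with U^192 <= A /
   tau. Hence 1/tau <= G4 X, and the crude bound is already a power of [A]. *)
have [hsmall|hlarge] := lerP (G3 * tau `^ (1 / 4) * B ^+ 8) 1; last first.
  apply: (crude X) => //; apply: (le_via (G4 * X)); last first.
    by apply: ler_wpM2r; [exact: le_trans ler01 X1|rewrite lerDr].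
  rewrite -[leLHS]mul1r ler_pdivrMr//.
  apply: (le_via ((G3 * tau `^ (1 / 4) * B ^+ 8) ^+ 8)); first by apply: exprn_ege1; exact: ltW.
  rewrite /B /W power_expansion.
  have -> : (tau `^ (1 / 4)) ^+ 8 = tau ^+ 2.
    by rewrite -powR_mulrn ?powR_ge0// -powRrM -powR_mulrn ?(ltW t0)//; congr (_ `^ _); field.
  have UU : U ^+ (3 * 64) <= A / tau by rewrite -UE; apply: ler_weXn2l.
  apply: (le_via (G4 * (A ^+ 180) ^+ 64 * tau ^+ 2 * (A / tau))).
    apply: ler_wpM2l UU; apply: mulr_ge0; [apply: mulr_ge0; [exact: ltW|]|exact: sqr_ge0].
    by apply: exprn_ge0; apply: exprn_ge0; exact: ltW.
  rewrite le_eqVlt; apply/orP; left; apply/eqP.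
  by rewrite /X; move: ((A ^+ 180) ^+ 64) => a; field; rewrite gt_eqF.
have [Z hZ] := euler_path_exists N M O t0; have [Z0 stZ] := hZ.
have [Y0 st] := sp.
have tn k : (k <= M)%N -> (tau * k%:R) `^ (1 / 8) <= k8.
  move=> kM; apply: ge0_ler_powR; rewrite ?nnegrE ?(ltW T0)//; first by rewrite mulr_ge0// ltW.
  by apply: le_trans tM; rewrite ler_pM2l// ler_nat.
have QU k : (k < M)%N -> 0 <= C2 * nr N ga (O k) /\ (C2 * nr N ga (O k)) ^+ 3 <= C2 ^+ 3 * U ^+ 3.
  move=> kM; have nk := n0 k; split; first by pos.
  by rewrite exprMn ler_pM2l ?exprn_gt0// lerXn2r ?nnegrE//; [exact: ltW|apply: le_trans (OU k kM); rewrite lerDr].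
have A180 : 1 <= A ^+ 180 by exact: exprn_ege1.
have U3 : 1 <= U ^+ 3 by exact: exprn_ege1.
(* The constant 32 (H + C1) covers both paths: Z by its own bound [H], and Y, under the bootstrap
   hypothesis, through [p6_sum] and nr1 (Y - Z) <= 1. *)
have Fbound k c : (k < M)%N -> p6 N c <= 32 * (H + C1) * A ^+ 180 ->
    \sum_(i < N) Fc N (fun j => c j + O k j) i ^+ 2 <= G1 * W.
  move=> kM hc; have [Q0 Q3] := QU k kM.
  apply: (le_trans (hCs N c (O k) _ Q0 (hC2 N (O k)))); rewrite /G1 -mulrA ler_pM2l//.
  rewrite 2!mulrDl mul1r; apply: lerD; [apply: lerD => //|apply: (le_trans Q3)].
    apply: (le_trans hc); apply: ler_wpM2l; first by pos.
    by rewrite /W ler_peMr// (le_trans ler01 A180).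
  by apply: ler_wpM2l; [pos|rewrite /W ler_peMl// (le_trans ler01 U3)].
set Phi := Num.sqrt (G1 * W); have Phi2 : Phi ^+ 2 = G1 * W by rewrite sqr_sqrtr//; pos.
have Phi0 : 0 <= Phi by exact: sqrtr_ge0.
have smB k (x : R) : (k <= M)%N -> x <= (16 * (tau * k%:R) `^ (1 / 8) * Phi) ^+ 2 -> x <= B.
  move=> kM /le_trans; apply; apply: (le_via ((16 * k8) ^+ 2 * G1 * W)).
    have -> : (16 * k8) ^+ 2 * G1 * W = (16 * k8 * Phi) ^+ 2.
      by rewrite -(mulrA ((16 * k8) ^+ 2)) -Phi2; exact/esym/exprMn.
    have := tn k kM; have := powR_ge0 (tau * k%:R) (1 / 8).
    move: ((tau * k%:R) `^ (1 / 8)) => p p0 pk.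
    rewrite lerXn2r ?nnegrE//; [by pos|by pos|].
    by apply: ler_wpM2r => //; rewrite ler_pM2l.
  rewrite /B; apply: ler_wpM2r; first exact: ltW.
  by rewrite /Cb lerDr; pos.
have hatp k : (k <= M)%N -> p6 N (Z k) <= H * A ^+ 180.
  by move=> kM; exact: hH N tau M q O Z k t0 tM q36 hZ kM.
have Zb k : (k <= M)%N -> nr N (3 / 2) (Z k) <= B.
  move=> kM; apply: (smB k) => //.
  apply: (@smoothing_cst N tau Phi (fun i => (1 + tau * la i ^+ 2)^-1)
    (fun i => - (tau * la i) / (1 + tau * la i ^+ 2)) Z (fun l => Fc N (fun j => Z l.+1 j + O l j))) => //.
  - by move=> i j; exact: euler_kernel.
  - by move=> l i lk; apply: (euler_step_explicit) => //; exact: stZ (leq_trans lk kM).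
  - move=> l lk; have lM := leq_trans lk kM; rewrite Phi2; apply: Fbound => //.
    apply: (le_trans (hatp _ lM)); apply: ler_wpM2r; [by pos|exact: HC].
pose rr k i := Y k i - Z k i.
(* Stated for all l <= k, because the bounds at step k + 1 use the whole past through Duhamel's
   formula. *)
suff main : forall k, (k <= M)%N -> forall l, (l <= k)%N -> nr N 1 (rr l) <= 1.
  have h1 := main n nM n (leqnn n).
  have -> : p6 N (Y n) = p6 N (fun i => Z n i + rr n i).
    by congr p6; apply/funext => i; rewrite /rr; ring.
  apply: (le_trans (p6_sum N (Z n) (rr n))).
  have hr : p6 N (rr n) <= C1.
    apply: (le_trans (hC1 N (rr n))); rewrite -[leRHS]mulr1 ler_pM2l// -[leRHS](expr1n R 3).
    by rewrite lerXn2r ?nnegrE ?nr_ge0.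
  apply: (le_via (32 * (H + C1) * A ^+ r)).
    rewrite -mulrA ler_pM2l// mulrDl; apply: lerD.
      by apply: (le_trans (hatp n nM)); rewrite ler_pM2l//; exact: ler_weXn2l.
    by apply: (le_trans hr); rewrite ler_peMr//; exact: ltW.
  by apply: ler_wpM2r; [pos|rewrite lerDl; pos].
elim=> [_ l|k ih kM l].
  by rewrite leqn0 => /eqP ->; rewrite nr_null// => i; rewrite /rr Y0 Z0 subrr.
rewrite leq_eqVlt ltnS => /orP[/eqP ->|lk]; last exact: ih (ltnW kM) l lk.
have {}ih := ih (ltnW kM).
have Yp l' : (l' <= k)%N -> p6 N (Y l') <= 32 * (H + C1) * A ^+ 180.
  move=> lk; have -> : p6 N (Y l') = p6 N (fun i => Z l' i + rr l' i).
    by congr p6; apply/funext => i; rewrite /rr; ring.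
  apply: (le_trans (p6_sum N (Z l') (rr l'))).
  have hr : p6 N (rr l') <= C1.
    apply: (le_trans (hC1 N (rr l'))); rewrite -[leRHS]mulr1 ler_pM2l// -[leRHS](expr1n R 3).
    by rewrite lerXn2r ?nnegrE ?nr_ge0//; exact: ih.
  rewrite -mulrA ler_pM2l// mulrDl; apply: lerD; first exact: hatp (leq_trans lk (ltnW kM)).
  by apply: (le_trans hr); rewrite ler_peMr//; exact: ltW.
have YF l' : (l' <= k)%N -> Fnorm N (fun j => Y l' j + O l' j) ^+ 2 <= G1 * W.
  by move=> lk; rewrite Fnorm_sqr; apply: Fbound; [exact: leq_ltn_trans lk kM|exact: Yp].
have Yb l' : (l' <= k.+1)%N -> nr N (3 / 2) (Y l') <= B.
  move=> lk; have lM := leq_trans lk kM; apply: (smB l') => //.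
  pose th j0 := (1 + tau * Fnorm N (fun j => Y j0 j + O j0 j))^-1.
  apply: (@smoothing_cst N tau Phi (decay tau) (fun i => - ((1 - decay tau i) / la i)) Y
    (fun j0 i => th j0 * Fc N (fun j => Y j0 j + O j0 j) i)) => //.
  - by move=> i j; exact: exp_kernel.
  - by move=> j0 i jl; rewrite (st j0 (leq_trans jl lM) i) -/(th j0); ring.
  - move=> j0 jl; have [h0 h1 _ _] := taming_bounds N (fun j => Y j0 j + O j0 j) t0.
    rewrite (eq_bigr (fun i : 'I_N => th j0 ^+ 2 * Fc N (fun j => Y j0 j + O j0 j) i ^+ 2)); last by move=> i _; rewrite exprMn.
    rewrite -mulr_sumr -Fnorm_sqr Phi2 -[leRHS]mul1r; apply: ler_pM; [exact: sqr_ge0|exact: sqr_ge0| |].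
      by rewrite -(expr1n R 2) lerXn2r ?nnegrE// ltW.
    by apply: YF; rewrite -ltnS; exact: leq_trans jl lk.
have WB : G1 * W <= B.
  by rewrite /B; apply: ler_wpM2r; [exact: ltW|exact: G1Cb].
have t1 : 0 < tau <= 1 by rewrite t0 (le_trans t2 h12).
have Rb l' : (l' <= k)%N -> nr N (-3) (residual N tau (Y l') (O l') (Y l'.+1)) <= C7 * tau `^ (9 / 4) * B ^+ 4.
  move=> lk; have lM : (l' < M)%N by exact: leq_ltn_trans lk kM.
  have [Q0 Q3] := QU l' lM.
  apply: (hC7 N tau (Y l') (O l') (Y l'.+1) _ B t1 (st l' lM) Q0 (hC2 N (O l')) B1).
  - apply: (le_trans Q3); rewrite /B; apply: ler_pM; [by pos|by pos| |].
      exact: C2Cb.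
    by rewrite /W ler_peMl// (le_trans ler01 U3).
  - by apply: Yb; exact: leqW.
  - by apply: Yb.
  - exact: le_trans (YF l' lk) WB.
have tp : 0 < tau `^ (1 / 4) by rewrite powR_gt0.
have rho : nr N (-1) (rr k.+1) <= G2 * tau `^ (1 / 4) * B ^+ 4.
  (* Division by tau reduces tau^(9/4) to tau^(5/4); the k + 1 <= T / tau steps of Gronwall then
     leave tau^(1/4). *)
  set De := 2 / tau * (C7 * tau `^ (9 / 4) * B ^+ 4).
  have t9 : 0 < tau `^ (9 / 4) by rewrite powR_gt0.
  have De0 : 0 <= De by rewrite /De; pos.
  have e1 : 1 <= expR (2 * tau) by rewrite -[leLHS]expR0 ler_expR mulr_ge0// ltW.
  have := @discrete_gronwall k.+1 (fun l => nr N (-1) (rr l)) (expR (2 * tau)) De e1 De0.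
  move=> g; have {g}g : nr N (-1) (rr k.+1) <= k.+1%:R * expR (2 * tau) ^+ k.+1 * De.
    apply: g; first by rewrite nr_null// => i; rewrite /rr Y0 Z0 subrr.
    move=> l' lk; have lM := leq_trans lk kM.
    have t12 : 0 < tau <= 1 / 2 by rewrite t0.
    apply: (le_trans (comparison_step (Y l') (Y l'.+1) t12 (stZ l' lM))).
    apply: ler_wpM2l; first exact: expR_ge0.
    rewrite lerD2l /De; apply: ler_wpM2l; first by rewrite divr_ge0// ltW.
    by apply: Rb; rewrite -ltnS.
  apply: (le_trans g).
  have tk : tau * k.+1%:R <= T by apply: le_trans tM; rewrite ler_pM2l// ler_nat.
  have e2 : expR (2 * tau) ^+ k.+1 <= expR (2 * T).
    rewrite -expRM_natl ler_expR mulrCA; apply: ler_wpM2l => //.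
    by rewrite mulrC.
  rewrite /De (_ : 2 / tau * _ = tau * (2 * C7 * tau `^ (1 / 4) * B ^+ 4)); last first.
    have -> : tau `^ (9 / 4) = tau ^+ 2 * tau `^ (1 / 4).
      rewrite -powR_mulrn ?(ltW t0)// -powRD; last by rewrite (gt_eqF t0) implybT.
      by congr (_ `^ _); field.
    by move: (tau `^ (1 / 4)) (B ^+ 4) => a b; field; rewrite gt_eqF.
  move: tp e1 e2; move: (tau `^ (1 / 4)) (expR (2 * tau) ^+ _) => a e tp _ e2.
  rewrite [leLHS](_ : _ = (tau * k.+1%:R) * e * (2 * C7 * a * B ^+ 4)); last by ring.
  rewrite [leRHS](_ : _ = (T * expR (2 * T)) * (2 * C7 * a * B ^+ 4)); last by rewrite /G2; ring.
  apply: ler_wpM2r; first by pos.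
  have tk0 : 0 <= tau * k.+1%:R by rewrite mulr_ge0// ltW.
  apply: (le_via (tau * k.+1%:R * expR (2 * T))); first exact: ler_wpM2l.
  by apply: ler_wpM2r => //; exact: expR_ge0.
(* With z = 1/(8 B) the H^(3/2) part is at most (4 B)/(8 B) = 1/2, and the H^-1 part is at most half
   of G3 tau^(1/4) B^8, by the choice G3 = 2 * 8^4 * G2. *)
have z0 : 0 < (8 * B)^-1 by pos.
apply: (le_trans (interp_three_halves N (rr k.+1) z0)).
have n32 : nr N (3 / 2) (rr k.+1) <= 4 * B.
  apply: (le_via (2 * nr N (3 / 2) (Y k.+1) + 2 * nr N (3 / 2) (Z k.+1))).
    rewrite /nr !mulr_sumr -big_split; apply: ler_sum => i _ /=.
    rewrite [leRHS](_ : _ = la i `^ (3 / 2) * (2 * Y k.+1 i ^+ 2 + 2 * Z k.+1 i ^+ 2)); last by ring.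
    apply: ler_wpM2l; first exact: powR_ge0.
    exact: sq.
  exact: (add4 _ _ _ (Yb _ (leqnn k.+1)) (Zb _ kM)).
have q1 : (8 * B)^-1 * nr N (3 / 2) (rr k.+1) <= 1 / 2.
  apply: (le_via ((8 * B)^-1 * (4 * B))); first by apply: ler_wpM2l => //; exact: ltW.
  by rewrite le_eqVlt; apply/orP; left; apply/eqP; field; rewrite gt_eqF.
have q2 : (8 * B)^-1 ^- 4 * nr N (-1) (rr k.+1) <= 1 / 2.
  rewrite exprVn invrK; apply: (le_via ((8 * B) ^+ 4 * (G2 * tau `^ (1 / 4) * B ^+ 4))).
    by apply: ler_wpM2l => //; pos.
  move: hsmall; rewrite /G3; move: (tau `^ (1 / 4)) => a hs1.
  rewrite (_ : _ * _ = (2 * 8 ^+ 4 * G2 * a * B ^+ 8) / 2); last by field.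
  by rewrite ler_pM2r ?invr_gt0.
exact: le_trans (lerD q1 q2) h11.
Qed.
End theorem.
End spectral_estimates.

(** * The L^2 norm of representatives *)

Section square_integrable.
Implicit Types (f u v w : V -> R) (x : V) (N : nat).

Lemma Lnorm2_sqrt v : L2 D v -> 'N[m]_2%:E[EFin \o v]%E = (Num.sqrt (\int[m]_x (v x ^+ 2)))%:E.
Proof.
move=> hv; rewrite unlock /=.
rewrite (_ : (fun x => _) = (fun x => (v x ^+ 2)%:E)); last first.
  by apply/funext => x; rewrite /= -[2]/(2%:R) powR_mulrn// real_normK ?num_real.
rewrite (Ig_fin (L2_sqr hv)) poweR_EFin powR12_sqrt//.
by apply: RI_ge0 => x; exact: sqr_ge0.
Qed.

Lemma norm2E v : L2 D v -> norm2 D v = Num.sqrt (\int[m]_x (v x ^+ 2)).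
Proof. by move=> hv; rewrite /norm2 Lnorm2_sqrt. Qed.

Lemma L2B f w : L2 D f -> L2 D w -> L2 D (fun x => f x - w x).
Proof.
move=> hf hw; have := L2D hf (L2Z (-1) hw); congr (L2 D _).
by apply/funext => x; rewrite mulN1r.
Qed.

Lemma inner_le u v : L2 D u -> L2 D v -> `|inner D u v| <= norm2 D u * norm2 D v.
Proof.
move=> hu hv; rewrite !norm2E// -sqrtrM; last by apply: RI_ge0 => x; exact: sqr_ge0.
rewrite -sqrtr_sqr; apply: ler_wsqrtr.
exact: (RI_CS (L2_measurable hu) (L2_measurable hv) (L2_sqr hu) (L2_sqr hv)).
Qed.

Lemma norm2_ge0 v : 0 <= norm2 D v.
Proof. by apply: fine_ge0; exact: Lnorm_ge0. Qed.

Lemma norm2_eq0 v : L2 D v -> norm2 D v = 0 -> eq_ae D v (fun=> 0).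
Proof.
move=> hv h0; have mv := L2_measurable hv.
have h : ('N[m]_2%:E[EFin \o v] = 0)%E by rewrite Lnorm2_sqrt// -norm2E// h0.
have := Lnorm_eq0_eq0 _ _ h; move=> /(_ _ _)h1.
have : (EFin \o v) = \0%E %[ae m] by apply: h1 => //; exact/mEFinP.
by apply: filterS => x /(_ I) /= [].
Qed.

Lemma L2_ae f u : mfun f -> eq_ae D f u -> L2 D u -> L2 D f.
Proof.
move=> mf fu hu; apply: L2P => //.
have mf2 : mfun (fun x => f x ^+ 2) by exact: measurable_funX.
apply: IgP => //; have mu2 := Ig_meas (L2_sqr hu).
rewrite (ae_eq_integral (fun x => `|u x ^+ 2|%:E)%E)//.
- exact: Ig_lty (L2_sqr hu).
- by apply/mEFinP; exact: measurableT_comp.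
- by apply/mEFinP; exact: measurableT_comp.
- by apply: filterS fu => x -> _.
Qed.
End square_integrable.

Section eigenbasis.
Variables (e : nat -> V -> R) (lam : nat -> R).
Hypothesis he : neumann_eigenbasis D e lam.
Local Notation la := (fun i => lam i.+1).
Implicit Types (f u v : V -> R) (x : V) (N : nat).

(** * Eigenfunction expansions, Bessel and Parseval *)

Section expansions.
Let psum (c : nat -> R) n : V -> R := \sum_(j < n) c j \*: e j.

Lemma psumE c n x : psum c n x = \sum_(j < n) c j * e j x.
Proof. by rewrite /psum fct_sumE; apply: eq_bigr => j _. Qed.

Lemma psum_L2 c n : L2 D (psum c n).
Proof.
rewrite (_ : psum c n = fun x => \sum_(j < n) c j * e j x); last by apply/funext => x; rewrite psumE.
elim: n => [|n ih].
  rewrite (_ : (fun x => _) = cst 0); first exact: L2_cst.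
  by apply/funext => x; rewrite big_ord0.
rewrite (_ : (fun x => _) = (fun x => \sum_(j < n) c j * e j x + c n * e n x)); last first.
  by apply/funext => x; rewrite big_ord_recr.
by apply: L2D => //; apply: L2Z; exact: eig_L2 he n.
Qed.

Lemma inner_psum c n j : inner D (psum c n) (e j) = if (j < n)%N then c j else 0.
Proof.
have ii i : Ig m (fun x => c i * (e i x * e j x)) by apply: IgZ; apply: L2_IgM; exact: eig_L2 he _.
rewrite /inner (RI_ext _ (g := fun x => \sum_(i < n) c i * (e i x * e j x))); last first.
  by move=> x; rewrite psumE mulr_suml; apply: eq_bigr => i _; rewrite mulrA.
rewrite RI_sum//.
rewrite (eq_bigr (fun i : 'I_n => c i * (i == j :> nat)%:R)); last first.
  move=> i _; rewrite RI_Z; last by apply: L2_IgM; exact: eig_L2 he _.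
  by congr (_ * _); exact: eig_orthonormal he i j.
case: ifPn => [jn|]; last first.
  rewrite -leqNgt => nj; rewrite big1// => i _.
  by rewrite (_ : (i == j :> nat) = false) ?mulr0//; apply/negbTE; rewrite neq_ltn (leq_trans (ltn_ord i) nj).
rewrite (bigD1 (Ordinal jn))//= eqxx mulr1 big1 ?addr0// => i ij.
by rewrite (_ : (i == j :> nat) = false) ?mulr0//; apply/negbTE; move: ij; rewrite -val_eqE.
Qed.

Lemma small_limit (a : nat -> R) (b : R) : a n @[n --> \oo] --> 0 -> 0 <= b -> (\forall n \near \oo, b <= a n) -> b = 0.
Proof.
move=> a0 b0 h; apply/eqP; rewrite eq_le b0 andbT; apply/ler_addgt0Pr => ep ep0; rewrite add0r.
have : \forall n \near \oo, a n < ep by apply: (cvgr_lt 0).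
move=> h2; have [n [hn1 hn2]] := filter_ex (filterI h h2); lra.
Qed.

Lemma norm2_e j : norm2 D (e j) = 1.
Proof.
rewrite norm2E; last exact: eig_L2 he j.
have := eig_orthonormal he j j; rewrite eqxx /inner => E.
by rewrite (_ : \int[m]_x _ = 1) ?sqrtr1// -[RHS]E; apply: RI_ext => x; rewrite expr2.
Qed.

Lemma expansion_coef c u j : is_expansion D e c u -> inner D u (e j) = c j.
Proof.
move=> [hu cu]; apply/eqP; rewrite -subr_eq0 -normr_eq0; apply/eqP.
apply: (small_limit cu) => //; near=> n.
have jn : (j < n)%N by near: n; exact: nbhs_infty_gt.
have hs := psum_L2 c n; have hj := eig_L2 he j.
have : `|inner D (fun x => psum c n x - u x) (e j)| <= norm2 D (psum c n - u) * norm2 D (e j).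
  by apply: inner_le => //; exact: L2B.
rewrite norm2_e mulr1; congr (_ <= _); rewrite distrC; congr (`|_|).
rewrite /inner (RI_ext _ (g := fun x => psum c n x * e j x - u x * e j x)); last by move=> x; rewrite mulrBl.
rewrite RI_B; [|exact: L2_IgM|exact: L2_IgM].
by have := inner_psum c n j; rewrite jn /inner => ->.
Unshelve. all: by end_near. Qed.

(** [expansion] selects some representative of the sum; when only finitely many coefficients are
    nonzero, it can differ from the finite sum on a null set only. *)
Lemma expansion_finite c n : (forall j, (n <= j)%N -> c j = 0) ->
  L2 D (expansion D e c) /\ eq_ae D (expansion D e c) (fun x => \sum_(j < n) c j * e j x).
Proof.
move=> c0; have sE k : (n <= k)%N -> psum c k = psum c n.
  move=> nk; apply/funext => x; rewrite !psumE -!(big_mkord xpredT (fun j => c j * e j x)).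
  rewrite (big_cat_nat (n := n))//= (_ : \sum_(n <= i < k) c i * e i x = 0) ?addr0//.
  by rewrite big_nat_cond big1// => j; rewrite andbT => /andP[nj _]; rewrite c0// mul0r.
have ex : is_expansion D e c (psum c n).
  split; first exact: psum_L2.
  have z : norm2 D (cst 0) = 0.
    rewrite norm2E; last exact: L2_cst.
    by rewrite (RI_ext _ (g := fun=> 0)) ?RI_0 ?sqrtr0// => x; rewrite expr0n.
  apply: cvg_near_cst; near=> k.
  have nk : (n <= k)%N by near: k; exact: nbhs_infty_ge.
  rewrite -/(psum c k) sE//; rewrite [X in norm2 D X](_ : _ = cst 0) ?z//.
  by apply/funext => x; rewrite /= subrr.
have [hu cu] : is_expansion D e c (expansion D e c) by exact: (xgetI _ ex).
split=> //; set u := expansion D e c in hu cu *.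
have : norm2 D (psum c n - u) = 0.
  apply: (small_limit cu); first exact: norm2_ge0.
  near=> k; rewrite -/(psum c k) sE//.
  by near: k; exact: nbhs_infty_ge.
move=> /norm2_eq0 h; have {}h := h (L2B (psum_L2 c n) hu).
apply: filterS h => x /eqP; rewrite /= subr_eq0 => /eqP <-.
by rewrite psumE.
Unshelve. all: by end_near. Qed.

Lemma psum_distance u n : L2 D u -> \int[m]_x ((psum (fun j => inner D u (e j)) n x - u x) ^+ 2) =
  \int[m]_x (u x ^+ 2) - \sum_(j < n) inner D u (e j) ^+ 2.
Proof.
move=> hu; set c := fun j => inner D u (e j).
have hs := psum_L2 c n.
have us v : L2 D v -> \int[m]_x (v x * psum c n x) = \sum_(j < n) c j * inner D v (e j).
  move=> hv; have ii i : Ig m (fun x => c i * (v x * e i x)) by apply: IgZ; apply: L2_IgM => //; exact: eig_L2 he _.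
  rewrite (RI_ext _ (g := fun x => \sum_(i < n) c i * (v x * e i x))); last first.
    by move=> x; rewrite psumE mulr_sumr; apply: eq_bigr => i _; rewrite mulrCA.
  rewrite RI_sum//; apply: eq_bigr => i _; rewrite RI_Z//.
  by apply: L2_IgM => //; exact: eig_L2 he _.
have ss : \int[m]_x (psum c n x ^+ 2) = \sum_(j < n) c j ^+ 2.
  rewrite (RI_ext _ (g := fun x => psum c n x * psum c n x)); last by move=> x; rewrite expr2.
  by rewrite us//; apply: eq_bigr => i _; rewrite inner_psum ltn_ord expr2.
have us' : \int[m]_x (u x * psum c n x) = \sum_(j < n) c j ^+ 2.
  by rewrite us//; apply: eq_bigr => i _; rewrite expr2.
rewrite (RI_ext _ (g := fun x => psum c n x ^+ 2 - 2 * (u x * psum c n x) + u x ^+ 2)); last by move=> x; ring.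
rewrite RI_D; [|apply: IgB; [exact: L2_sqr|apply: IgZ; exact: L2_IgM]|exact: L2_sqr].
rewrite RI_B; [|exact: L2_sqr|apply: IgZ; exact: L2_IgM].
rewrite RI_Z; last exact: L2_IgM.
by rewrite us' ss; ring.
Qed.

Lemma Bessel_partial u n : L2 D u -> \sum_(j < n) inner D u (e j) ^+ 2 <= \int[m]_x (u x ^+ 2).
Proof.
by move=> hu; rewrite -subr_ge0 -psum_distance//; apply: RI_ge0 => x; exact: sqr_ge0.
Qed.

Lemma Parseval u : L2 D u ->
  \sum_(j < n) inner D u (e j) ^+ 2 @[n --> \oo] --> \int[m]_x (u x ^+ 2).
Proof.
move=> hu; set c := fun j => inner D u (e j).
set a := fun n => norm2 D (psum c n - u); have ha : a n @[n --> \oo] --> 0 by exact: eig_complete he _ hu.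
have E : (fun n => \sum_(j < n) inner D u (e j) ^+ 2) = (fun n => \int[m]_x (u x ^+ 2) - a n * a n).
  apply/funext => n; have hs := psum_L2 c n.
  rewrite -expr2 /a norm2E; last exact: (L2B hs hu).
  rewrite sqr_sqrtr; last by apply: RI_ge0 => x; exact: sqr_ge0.
  have -> : \int[m]_x ((psum c n - u) x ^+ 2) = \int[m]_x ((psum c n x - u x) ^+ 2) by apply: RI_ext.
  by rewrite psum_distance//; ring.
rewrite E -[X in _ --> X]subr0; apply: cvgB; first exact: cvg_cst.
by rewrite -[X in _ --> X](mulr0 (0 : R)); exact: (cvgM ha ha).
Qed.
End expansions.

(** * The scheme in coefficients *)

Section representation.
Variables (eb : nat -> V -> R) (gb : nat -> 'I_d -> V -> R).
Hypothesis hs : spectral_system eb gb la.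
Hypothesis heb : forall i, eq_ae D (e i.+1) (eb i).
Local Notation S := (S eb).
Local Notation Fc := (Fc eb).
Local Notation p6 := (p6 eb).

(** Functions of the scheme are determined up to null sets only. [rep] records the N coefficients,
    index i standing for e_(i+1), and is stable under each operation of the scheme. *)
Definition rep N f (c : nat -> R) := L2 D f /\ eq_ae D f (S N c).

Let mS N c : mfun (S N c) := S_meas hs N c.

Let all_eb : {ae m, forall x, forall i, e i.+1 x = eb i x}.
Proof. exact: ae_foralln heb. Qed.

Lemma rep_inner N f c (i : nat) : rep N f c -> inner D f (e i.+1) = if (i < N)%N then c i else 0.
Proof.
move=> [hf fS]; have hS := S_L2 hs N c.
have hei := eig_L2 he i.+1; have hebi := eb_L2 hs i.
transitivity (\int[m]_x (S N c x * eb i x)).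
  apply: RI_ae; [exact: measurable_funM (L2_measurable hf) (L2_measurable hei)|
    exact: measurable_funM (mS N c) (L2_measurable hebi)|].
  by apply: filterS2 fS (heb i) => x -> ->.
case: ifPn => iN; first exact: (cf_S hs c iN).
rewrite (S_inner_f hs)// big1// => j _; rewrite /cf (ss_orthonormal hs).
rewrite (_ : (i == j :> nat) = false) ?mulr0//; apply/negbTE.
by rewrite neq_ltn orbC (leq_trans (ltn_ord j))// leqNgt.
Qed.

Lemma rep_inner0 N f c : rep N f c -> inner D f (e 0%N) = 0.
Proof.
move=> [hf fS]; have hS := S_L2 hs N c.
have he0 := eig_L2 he 0.
transitivity (\int[m]_x (S N c x * cst (vol D `^ (- 2^-1)) x)).
  apply: RI_ae; [exact: measurable_funM (L2_measurable hf) (L2_measurable he0)|exact: measurable_funM|].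
  by apply: filterS2 fS (eig_e0 he) => x -> ->.
rewrite (S_inner_f hs); last exact: L2_cst.
rewrite big1// => i _; rewrite /cf RI_Z ?(ss_mean hs) ?mulr0//.
exact: L2_Ig (eb_L2 hs i).
Qed.

Lemma rep_expansion N (k : nat -> R) : k 0%N = 0 -> (forall j, (N <= j)%N -> k j.+1 = 0) ->
  rep N (expansion D e k) (fun i => k i.+1).
Proof.
move=> k0 kN; have [|h1 h2] := @expansion_finite k N.+1.
  by move=> [|j]; rewrite ?ltnS => h; [rewrite k0|exact: kN].
split=> //; apply: filterS2 h2 all_eb => x -> h; rewrite big_ord_recl k0 mul0r add0r.
by apply: eq_bigr => i _; rewrite /= h.
Qed.

Lemma rep_ext N f c c' : (forall i, (i < N)%N -> c i = c' i) -> rep N f c -> rep N f c'.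
Proof.
move=> h [h1 h2]; split=> //; apply: filterS h2 => x ->.
by apply: eq_bigr => i _; rewrite h.
Qed.

Lemma rep_semigroup N f c (t : R) : rep N f c ->
  rep N (semigroup D e lam t f) (fun i => expR (- t * lam i.+1 ^+ 2) * c i).
Proof.
move=> hf; apply: (rep_ext (c := fun i => expR (- t * lam i.+1 ^+ 2) * inner D f (e i.+1))).
  by move=> i iN; rewrite (rep_inner _ hf) iN.
apply: (@rep_expansion N (fun j => expR (- t * lam j ^+ 2) * inner D f (e j))).
- by rewrite (rep_inner0 hf) mulr0.
- by move=> j Nj; rewrite (rep_inner _ hf) ltnNge Nj mulr0.
Qed.

Lemma rep_A_inv N f c : rep N f c -> rep N (A_pow D e lam (- 1) f) (fun i => (lam i.+1)^-1 * c i).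
Proof.
move=> hf; apply: (rep_ext (c := fun i => A_pow_coef D e lam (-1) f i.+1)).
  move=> i iN; rewrite /= (rep_inner _ hf) iN powR_inv1//.
  exact: ltW (ss_pos hs i).
apply: (@rep_expansion N (A_pow_coef D e lam (-1) f)) => // j Nj.
by rewrite /= (rep_inner _ hf) ltnNge Nj mulr0.
Qed.

Lemma rep_sum N (c : nat -> R) : rep N (\sum_(1 <= i < N.+1) c i \*: e i) (fun i => c i.+1).
Proof.
have E : (\sum_(1 <= i < N.+1) c i \*: e i) = fun x => \sum_(i < N) c i.+1 * e i.+1 x.
  apply/funext => x; rewrite fct_sumE big_add1 /= big_mkord.
  by apply: eq_bigr.
rewrite E; split; last by apply: filterS all_eb => x h; apply: eq_bigr => i _; rewrite h.
elim: {E} N => [|n ih].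
  rewrite (_ : (fun x => _) = cst 0); first exact: L2_cst.
  by apply/funext => x; rewrite big_ord0.
rewrite (_ : (fun x => _) = (fun x => \sum_(j < n) c j.+1 * e j.+1 x + c n.+1 * e n.+1 x)); last first.
  by apply/funext => x; rewrite big_ord_recr.
by apply: L2D => //; apply: L2Z; exact: eig_L2 he n.+1.
Qed.

Lemma rep_B N f c u k : rep N f c -> rep N u k -> rep N (f - u) (fun i => c i - k i).
Proof.
move=> [hf fS] [hu uS]; split; first exact: L2B hf hu.
by apply: filterS2 fS uS => x h1 h2; rewrite S_B -h1 -h2.
Qed.

Lemma rep_D N f c u k : rep N f c -> rep N u k -> rep N (f + u) (fun i => c i + k i).
Proof.
move=> [hf fS] [hu uS]; split; first exact: L2D hf hu.
by apply: filterS2 fS uS => x h1 h2; rewrite S_D -h1 -h2.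
Qed.

Lemma rep_Z N f c (a : R) : rep N f c -> rep N (a \*: f) (fun i => a * c i).
Proof.
move=> [hf fS]; split; first exact: (L2Z a hf).
apply: filterS fS => x h; rewrite [LHS](_ : _ = a * f x)// h mulr_sumr.
by apply: eq_bigr => i _; rewrite mulrA.
Qed.

Lemma rep_nonlinearity N f c : rep N f c -> L2 D (nonlinearity f) /\
  forall i, inner D (nonlinearity f) (e i.+1) = Fc N c i.
Proof.
move=> [hf fS]; have mf := L2_measurable hf.
have mn : mfun (nonlinearity f) by apply: measurable_funB => //; exact: measurable_funX.
have fn : eq_ae D (nonlinearity f) (nonlinearity (S N c)) by apply: filterS fS => x h; rewrite /nonlinearity h.
have hn : L2 D (nonlinearity (S N c)) by apply: (bmf_L2); apply: bmf_F; exact: bmf_S hs N c.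
split; first exact: L2_ae mn fn hn.
move=> i; have hei := eig_L2 he i.+1; have hebi := eb_L2 hs i.
apply: RI_ae; [exact: measurable_funM mn (L2_measurable hei)|
  exact: measurable_funM (L2_measurable hn) (L2_measurable hebi)|].
by apply: filterS2 fn (heb i) => x -> ->.
Qed.

Lemma rep_norm2 N f c : rep N f c -> norm2 D f = Num.sqrt (\sum_(i < N) c i ^+ 2).
Proof.
move=> [hf fS]; rewrite norm2E//; congr Num.sqrt.
rewrite -(nr0E la) -(S_sqr hs); apply: RI_ae.
- exact: measurable_funX (L2_measurable hf).
- exact: measurable_funX.
- by apply: filterS fS => x ->.
Qed.

Lemma rep_Lnorm6 N f c : rep N f c -> ('N[m]_6%:E[EFin \o f] = ((p6 N c) `^ 6^-1)%:E)%E.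
Proof.
move=> [hf fS]; rewrite unlock /=.
have mf := L2_measurable hf.
rewrite (_ : (fun x => _) = (fun x => (f x ^+ 6)%:E)); last first.
  apply/funext => x; rewrite /= -[6]/(6%:R) powR_mulrn//.
  by rewrite -[f x ^+ 6]ger0_norm ?normrX// (exprM _ 2 3) exprn_ge0// sqr_ge0.
rewrite (ae_eq_integral (fun x => (S N c x ^+ 6)%:E))//.
- rewrite Ig_fin; last by apply: bmf_Ig; apply: bmf_X; exact: bmf_S hs N c.
  by rewrite poweR_EFin.
- by apply/mEFinP; exact: measurable_funX.
- by apply/mEFinP; exact: measurable_funX.
- by apply: filterS fS => x -> _.
Qed.

Lemma rep_galerkin N v : L2 D v -> rep N (galerkin D e N v) (fun i => inner D v (e i.+1)).
Proof. by move=> _; exact: rep_sum. Qed.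

Section scheme_coefficients.
Context {dO : measure_display} {Omega : measurableType dO}.
Variables (W : R -> (V -> R) -> Omega -> R) (X0 : Omega -> V -> R) (T : R) (M N : nat).
Local Notation tau := (T / M%:R).

Definition zeta (k i : nat) (w : Omega) : R :=
  W (k.+1%:R * tau) (e i.+1) w - W (k%:R * tau) (e i.+1) w.

Fixpoint ocoef (k i : nat) (w : Omega) : R :=
  if k is k'.+1 then decay la tau i * (ocoef k' i w + zeta k' i w) else inner D (X0 w) (e i.+1).

Fixpoint ycoef (w : Omega) (k : nat) : nat -> R :=
  if k is k'.+1 then let c := fun j => ycoef w k' j + ocoef k' j w in
    fun i => decay la tau i * ycoef w k' i -
      (1 + tau * Fnorm eb N c)^-1 * ((1 - decay la tau i) / la i) * Fc N c i
  else fun=> 0.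

Lemma ycoef_path (w : Omega) n : scheme_path eb la N tau n (fun k i => ocoef k i w) (ycoef w).
Proof. by split. Qed.

(** The splitting is exact by linearity of the semigroup: [ocoef] collects initial value and noise,
    [ycoef] the tamed forcing evaluated at the sum of both. *)
Lemma rep_scheme (w : Omega) (k : nat) : L2 D (X0 w) ->
  rep N (scheme D e lam W X0 T M N k w) (fun i => ycoef w k i + ocoef k i w).
Proof.
move=> h0; elim: k => [|k ih] /=.
  by apply: (rep_ext _ (rep_galerkin N h0)) => i _; rewrite add0r.
set X := scheme _ _ _ _ _ _ _ _ _ _ in ih *.
set c := fun i => ycoef w k i + ocoef k i w in ih.
have [hn hF] := rep_nonlinearity ih.
have rPF : rep N (galerkin D e N (nonlinearity X)) (Fc N c).
  by apply: (rep_ext _ (rep_galerkin N hn)) => i _; rewrite hF.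
have rno : rep N (noise_increment e W T M N k w) (fun i => zeta k i w).
  exact: (rep_sum N (fun i => W (k.+1%:R * tau) (e i) w - W (k%:R * tau) (e i) w)).
have nE : norm2 D (galerkin D e N (nonlinearity X)) = Fnorm eb N c by rewrite (rep_norm2 rPF).
have sg f c' := @rep_semigroup N f c' tau.
have := rep_D (rep_B (sg _ _ ih) (rep_Z (1 + tau * Fnorm eb N c)^-1 (rep_A_inv (rep_B rPF (sg _ _ rPF))))) (sg _ _ rno).
rewrite nE; apply: rep_ext => i _; rewrite /decay /c mulNr; ring.
Qed.
End scheme_coefficients.
End representation.

(** * The trace condition on the covariance *)

Section trace.
Local Notation nr := (nr la).

Let lp i : 0 < lam i.+1 := lam_gt0 he i.

Lemma eig_Hdot i : Hdot D (e i.+1).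
Proof. by split; [exact: eig_L2 he _|exact: eig_mean he i]. Qed.

Lemma Hdot_inner0 u : Hdot D u -> inner D u (e 0%N) = 0.
Proof.
move=> [hu u0]; have he0 := eig_L2 he 0.
transitivity (\int[m]_x (vol D `^ (- 2^-1) * u x)).
  apply: RI_ae; [exact: measurable_funM (L2_measurable hu) (L2_measurable he0)|
    by apply: measurable_funM => //; exact: L2_measurable hu|].
  by apply: filterS (eig_e0 he) => x ->; rewrite mulrC.
by rewrite RI_Z ?u0 ?mulr0//; exact: L2_Ig.
Qed.

(** Bessel for A^(al/2) v; outside the domain of this operator the right side is +oo. *)
Lemma Hdot_norm_ge (al : R) v N : L2 D v ->
  ((nr N al (fun i => inner D v (e i.+1)))%:E <= Hdot_norm D e lam al v ^+ 2)%E.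
Proof.
move=> hv; rewrite /Hdot_norm; case: asboolP => [[u hu]|_]; last by rewrite expe2 mulyy leey.
have [hA cA] : is_expansion D e (A_pow_coef D e lam (al / 2) v) (A_pow D e lam (al / 2) v).
  exact: (xgetI _ hu).
rewrite (Lnorm2_sqrt hA) -EFin_expe lee_fin sqr_sqrtr; last by apply: RI_ge0 => x; exact: sqr_ge0.
apply: le_trans (Bessel_partial N.+1 hA); rewrite big_ord_recl /= ler_wpDl ?sqr_ge0//.
apply: ler_sum => i _; rewrite (expansion_coef _ (conj hA cA)) /= exprMn.
have <- : (lam i.+1 `^ (al / 2)) ^+ 2 = lam i.+1 `^ al by [rewrite -powR_mulrn ?powR_ge0// -powRrM divfK].
by [].
Qed.

Variables (Q Qhalf : (V -> R) -> V -> R).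
Hypotheses (hQ : covariance_operator D Q) (hQh : sqrt_operator D Qhalf Q).

Definition qv i : R := inner D (Q (e i.+1)) (e i.+1).

Lemma qv_ge0 i : 0 <= qv i. Proof. exact: cov_ge0 hQ _ (eig_Hdot i). Qed.

Lemma qvE i : qv i = \int[m]_x (Qhalf (e i.+1) x ^+ 2).
Proof.
have [hS hSS] := hQh; have hi := eig_Hdot i.
have h1 := op_Hdot (cov_op hS) hi; have h2 := op_Hdot (cov_op hS) h1.
have h3 := op_Hdot (cov_op hQ) hi.
transitivity (inner D (Qhalf (Qhalf (e i.+1))) (e i.+1)).
  apply: RI_ae; [exact: measurable_funM (L2_measurable h3.1) (L2_measurable hi.1)|
    exact: measurable_funM (L2_measurable h2.1) (L2_measurable hi.1)|].
  by apply: filterS (hSS _ hi) => x ->.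
rewrite (cov_sym hS h1 hi); apply: RI_ext => x; by rewrite expr2.
Qed.

(** The Hilbert-Schmidt norm sums |A^((ga-2)/2) Q^(1/2) e_k|^2 over k, whereas the noise needs the
    sum of la_i^(ga-2) |Q^(1/2) e_i|^2. Symmetry of Q^(1/2) exchanges the two on finite sections;
    Parseval then completes the inner sum. *)
Lemma trace_bound (ga : R) : (HS_norm D e lam (ga - 2) Qhalf < +oo)%E ->
  exists2 H : R, 0 <= H & forall N, \sum_(i < N) lam i.+1 `^ (ga - 2) * qv i <= H.
Proof.
have [hS hSS] := hQh.
rewrite /HS_norm; set s := (\sum_(1 <= k <oo) _)%E => hs.
have u0 k : (0 <= (Hdot_norm D e lam (ga - 2) (Qhalf (e k))) ^+ 2)%E.
  rewrite expe2; have : (0 <= Hdot_norm D e lam (ga - 2) (Qhalf (e k)))%E.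
    by rewrite /Hdot_norm; case: asboolP => // _; exact: Lnorm_ge0.
  by move=> h; exact: mule_ge0.
have s0 : (0 <= s)%E by apply: nneseries_ge0 => k _ _; exact: u0.
have [r rE] : exists r : R, s = r%:E.
  move: s0 hs; case: s => [r|//|//]; first by exists r.
  by rewrite poweRyr// invr_eq0.
have r0 : 0 <= r by move: s0; rewrite rE lee_fin.
exists r => // N.
have hi j : L2 D (Qhalf (e j.+1)) by have [] := op_Hdot (cov_op hS) (eig_Hdot j).
have part K : \sum_(j < N) lam j.+1 `^ (ga - 2) * \sum_(k < K) inner D (Qhalf (e j.+1)) (e k.+1) ^+ 2 <= r.
  rewrite -lee_fin -rE; apply: le_trans (nneseries_lim_ge K.+1 _); last by move=> k _ _; exact: u0.
  rewrite big_add1 /= big_mkord.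
  apply: (le_via (\sum_(k < K) (nr N (ga - 2) (fun i => inner D (Qhalf (e k.+1)) (e i.+1)))%:E)%E); last first.
    by apply: lee_sum => k _; exact: Hdot_norm_ge.
  rewrite sumEFin lee_fin /nr; under eq_bigr do rewrite mulr_sumr.
  rewrite exchange_big /=; apply: ler_sum => k _; apply: ler_sum => j _.
  rewrite (cov_sym hS (eig_Hdot j) (eig_Hdot k)) /inner.
  rewrite (RI_ext _ (g := fun x => Qhalf (e k.+1) x * e j.+1 x))//.
  by move=> x; rewrite mulrC.
have conv j : \sum_(k < K) inner D (Qhalf (e j.+1)) (e k.+1) ^+ 2 @[K --> \oo] --> qv j.
  have := Parseval (hi j); rewrite -qvE -(cvg_shiftS) /=.
  rewrite (_ : (fun n => \sum_(i < n.+1) _) = fun K => \sum_(k < K) inner D (Qhalf (e j.+1)) (e k.+1) ^+ 2)//.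
  apply/funext => n; rewrite big_ord_recl /= Hdot_inner0 ?expr0n ?add0r//.
  exact: (op_Hdot (cov_op hS) (eig_Hdot j)).
have lim : \sum_(j < N) lam j.+1 `^ (ga - 2) * \sum_(k < K) inner D (Qhalf (e j.+1)) (e k.+1) ^+ 2 @[K --> \oo] -->
    \sum_(j < N) lam j.+1 `^ (ga - 2) * qv j.
  apply: cvg_big => [|j _]; first by exact: add_continuous.
  by apply: cvgM; [exact: cvg_cst|exact: conv].
by apply: (cvgr_to_le lim); near=> K; exact: part.
Unshelve. all: by end_near. Qed.
End trace.

(** * Moments of the discrete stochastic convolution *)

Section wiener.
Variables (Q Qhalf : (V -> R) -> V -> R).
Hypotheses (hQ : covariance_operator D Q) (hQh : sqrt_operator D Qhalf Q).
Context {dO : measure_display} {Omega : measurableType dO} (P : probability Omega R).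
Variables (Ft : R -> set (set Omega)) (hFt : filtration Ft).
Variables (W : R -> (V -> R) -> Omega -> R) (hW : Q_wiener D P Ft Q W).

Section noise_moments.
Local Notation nr := (nr la).

Let lp i : 0 < lam i.+1 := lam_gt0 he i.

Definition adapted (G : set (set Omega)) (X : Omega -> R) := forall B, measurable B -> G (X @^-1` B).

(** Adaptedness to [G] is measurability on the type whose sigma-algebra is generated by [G]; as [G]
    is a sigma-algebra, nothing is added by generating. *)
Lemma adapted_comb (G : set (set Omega)) (X Y : Omega -> R) (a b c : R) : sigma_algebra setT G ->
  adapted G X -> adapted G Y -> adapted G (fun w => a * X w + b * Y w + c).
Proof.
move=> sG hX hY.
have mE (Z : Omega -> R) : adapted G Z -> mfun (Z : g_sigma_algebraType G -> R).
  by move=> h _ B mB; rewrite setTI; apply: sub_sigma_algebra; exact: h.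
have : mfun (fun w : g_sigma_algebraType G => a * (X : g_sigma_algebraType G -> R) w + b * (Y : g_sigma_algebraType G -> R) w + c).
  apply: measurable_funD => //; apply: measurable_funD; apply: measurable_funM => //; exact: mE.
move=> h B mB; have := h measurableT B mB; rewrite setTI.
by rewrite /measurable /= sigma_algebra_id.
Qed.

Lemma adapted_mono (G H : set (set Omega)) X : G `<=` H -> adapted G X -> adapted H X.
Proof. by move=> GH hX B mB; exact: GH (hX B mB). Qed.

Lemma adapted_measurable (t : R) X : 0 <= t -> adapted (Ft t) X -> mfun X.
Proof. by move=> t0 hX _ B mB; rewrite setTI; exact: (filt_measurable hFt t0) (hX B mB). Qed.

Variables (T : R) (T0 : 0 < T) (M : nat) (M0 : (0 < M)%N).
Local Notation tau := (T / M%:R).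
Local Notation zeta := (zeta W T M).

Let t0 : 0 < tau. Proof. by rewrite divr_gt0// ltr0n. Qed.
Let tk (k : nat) : 0 <= k%:R * tau. Proof. by rewrite mulr_ge0// ltW. Qed.
Let tS (k : nat) : k%:R * tau <= k.+1%:R * tau. Proof. by rewrite ler_pM2r// ler_nat. Qed.

Fixpoint zcoef (k i : nat) (w : Omega) : R :=
  if k is k'.+1 then decay la tau i * (zcoef k' i w + zeta k' i w) else 0.

Lemma ocoef_split X0 (k i : nat) (w : Omega) : ocoef W X0 T M k i w =
  decay la tau i ^+ k * inner D (X0 w) (e i.+1) + zcoef k i w.
Proof.
elim: k => [|k ih] /=; first by rewrite mul1r addr0.
by rewrite ih exprS; ring.
Qed.

Lemma zeta_adapted k i : adapted (Ft (k.+1%:R * tau)) (zeta k i).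
Proof.
have h1 : adapted (Ft (k.+1%:R * tau)) (W (k.+1%:R * tau) (e i.+1)).
  by move=> B mB; apply: (wiener_adapted hW) => //; exact: eig_Hdot i.
have h2 : adapted (Ft (k.+1%:R * tau)) (W (k%:R * tau) (e i.+1)).
  apply: (adapted_mono (filt_mono hFt (tk k) (tS k))).
  by move=> B mB; apply: (wiener_adapted hW) => //; exact: eig_Hdot i.
have := adapted_comb 1 (-1) 0 (filt_sigma hFt (tk k.+1)) h1 h2.
by congr adapted; apply/funext => w; rewrite /zeta; ring.
Qed.

Lemma zcoef_adapted k i : adapted (Ft (k%:R * tau)) (zcoef k i).
Proof.
elim: k => [|k ih] /=.
  move=> B mB; have [h0 hC _] := filt_sigma hFt (tk 0).
  have [B0|B0] := pselect (B 0).
    rewrite (_ : _ @^-1` B = setT `\` set0); first exact: hC.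
    by rewrite setD0; apply/seteqP; split.
  by rewrite (_ : _ @^-1` B = set0)//; apply/seteqP; split.
have h1 := adapted_mono (filt_mono hFt (tk k) (tS k)) ih.
have := adapted_comb (decay la tau i) (decay la tau i) 0 (filt_sigma hFt (tk k.+1)) h1 (@zeta_adapted k i).
by congr adapted; apply/funext => w; ring.
Qed.

Lemma zcoef_measurable k i : mfun (zcoef k i).
Proof. exact: adapted_measurable (tk k) (@zcoef_adapted k i). Qed.

Lemma subgaussian_mono (X : Omega -> R) (v v' : R) : v <= v' -> subgaussian P X v -> subgaussian P X v'.
Proof.
move=> vv h s; apply: (le_trans (h s)); rewrite lee_fin ler_expR ler_pM2r// ler_wpM2l//.
exact: sqr_ge0.
Qed.

(** q / (2 la^2) is the stationary variance of the corresponding Ornstein-Uhlenbeck process. The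
    recursion preserves it because exp(-2 x)(1 + 2 x) <= 1 with x = tau la^2, so the bound is
    uniform in time and step size. *)
Lemma zcoef_subgaussian k i : subgaussian P (zcoef k i) (qv Q i / (2 * lam i.+1 ^+ 2)).
Proof.
have li := lp i; have q0 := qv_ge0 hQ i.
elim: k => [|k ih].
  move=> s /=; under eq_integral do rewrite mulr0 expR0.
  rewrite integral_cst// mul1e; apply: (le_trans (probability_le1 _ _)) => //.
  by rewrite lee_fin -expR0 ler_expR; apply: divr_ge0 => //; apply: mulr_ge0; [exact: sqr_ge0|apply: divr_ge0 => //; pos].
have mz : mfun (zeta k i) by exact: adapted_measurable (tk k.+1) (@zeta_adapted k i).
have hz : subgaussian P (zeta k i) (tau * qv Q i).
  apply: gaussian_subgaussian => //; first by pos.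
  have := wiener_gaussian hW (tk k) (tS k) (eig_Hdot i).
  have E (t q : R) : (k.+1%:R * t - k%:R * t) * q = t * q by rewrite -natr1; ring.
  by rewrite E.
have ind : independent_of P (zeta k i) (Ft (k%:R * tau)).
  exact: (wiener_independent hW (tk k) (tS k) (eig_Hdot i)).
have := subgaussian_step (decay la tau i) (@zcoef_measurable k i) mz (@zcoef_adapted k i) ind ih hz.
apply: subgaussian_mono; set q := qv Q i in q0 *.
set x := tau * lam i.+1 ^+ 2; have x0 : 0 < x by rewrite /x; pos.
have -> : q / (2 * lam i.+1 ^+ 2) + tau * q = (1 + 2 * x) * (q / (2 * lam i.+1 ^+ 2)).
  by rewrite /x; move: (T / M%:R) => t; field; rewrite gt_eqF.
rewrite mulrA; apply: ler_piMl; first by apply: divr_ge0 => //; pos.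
rewrite /decay -/x -expRM_natl; apply: (le_via (expR (2%:R * - x) * expR (2 * x))).
  by apply: ler_wpM2l; [exact: expR_ge0|exact: expR_ge1Dx].
by rewrite -expRD -expR0 ler_expR; lra.
Qed.
End noise_moments.

Section moments.
Local Notation nr := (nr la).
Variables (T : R) (T0 : 0 < T) (ga : R) (H : R) (H0 : 0 <= H).
Hypothesis htr : forall N, \sum_(i < N) lam i.+1 `^ (ga - 2) * qv Q i <= H.

Let lp i : 0 < lam i.+1 := lam_gt0 he i.

Lemma measurable_nr N (X : nat -> Omega -> R) : (forall i, mfun (X i)) ->
  mfun (fun w => nr N ga (fun i => X i w)).
Proof.
move=> hX; rewrite /nr; apply: measurable_sum => i.
by apply: measurable_funM => //; exact: measurable_funX.
Qed.

Lemma half_sum N : \sum_(i < N) (2^-1 : R) ^+ i.+1 <= 1.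
Proof.
have -> : \sum_(i < N) (2^-1 : R) ^+ i.+1 = 1 - 2^-1 ^+ N.
  elim: N => [|N ih]; first by rewrite big_ord0 expr0 subrr.
  by rewrite big_ord_recr /= ih exprS; field.
by rewrite gerBl exprn_ge0.
Qed.

(** Power mean with the weights la^ga v_i, whose sum is bounded by the trace condition because la^ga
    q / (2 la^2) = la^(ga-2) q / 2. Moments of the norm reduce to scalar subgaussian moments,
    uniformly in [N]. *)
Lemma noise_moment N M k n : (0 < M)%N ->
  (\int[P]_w (nr N ga (fun i => zcoef T M k i w) ^+ n.+1)%:E <=
   ((H / 2 + 1) ^+ n.+1 * moment_const n.+1)%:E)%E.
Proof.
move=> M0; set z := fun i w => zcoef T M k i w.
have mz i : mfun (z i) := zcoef_measurable T0 M0 k i.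
(* The summand with 2^-1 ^+ i.+1 only keeps the variance bound positive. *)
pose v i := qv Q i / (2 * lam i.+1 ^+ 2) + lam i.+1 `^ (- ga) * 2^-1 ^+ i.+1.
have q0 i : 0 <= qv Q i := qv_ge0 hQ i.
have v0 i : 0 < v i.
  have li := lp i; apply: ltr_wpDl; first by apply: divr_ge0 => //; pos.
  by apply: mulr_gt0; [rewrite powR_gt0|rewrite exprn_gt0].
have hz i : subgaussian P (z i) (v i).
  apply: (subgaussian_mono _ (zcoef_subgaussian T0 M0 k i)).
  by rewrite /v lerDl; apply: mulr_ge0; [exact: powR_ge0|exact: exprn_ge0].
pose wt i := lam i.+1 `^ ga * v i.
have w0 i : 0 <= wt i by apply: mulr_ge0; [exact: powR_ge0|exact: ltW].
have wsum : \sum_(i < N) wt i <= H / 2 + 1.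
  rewrite (eq_bigr (fun i : 'I_N => (lam i.+1 `^ (ga - 2) * qv Q i) / 2 + 2^-1 ^+ i.+1)); last first.
    move=> i _; have li := lp i; rewrite /wt /v mulrDr; congr (_ + _).
      rewrite powRD; last by rewrite (gt_eqF li) implybT.
      by rewrite powRN -[2]/(2%:R) powR_mulrn ?(ltW li)//; field; rewrite gt_eqF.
    by rewrite mulrA -powRD ?subrr ?powRr0 ?mul1r// (gt_eqF li) implybT.
  rewrite big_split /=; apply: lerD; last exact: half_sum.
  have h := htr N; rewrite ler_pdivlMr// mulr_suml; apply: le_trans h.
  by apply: ler_sum => i _; rewrite divfK.
set S := \sum_(i < N) wt i in wsum; have S0 : 0 <= S by apply: sumr_ge0.
have pt w : nr N ga (fun i => z i w) ^+ n.+1 <= \sum_(i < N) (S ^+ n * wt i / v i ^+ n.+1) * z i w ^+ (2 * n.+1).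
  have -> : nr N ga (fun i => z i w) = \sum_(i < N) wt i * (z i w ^+ 2 / v i).
    by apply: eq_bigr => i _; rewrite /wt; field; rewrite gt_eqF.
  apply: (le_trans (@power_mean _ N wt (fun i => z i w ^+ 2 / v i) n w0 _)).
    by move=> i; apply: divr_ge0; [exact: sqr_ge0|exact: ltW].
  rewrite mulr_sumr; apply: ler_sum => i _.
  rewrite -/S expr_div_n -exprM; move: (S ^+ n) (z i w ^+ _) => s q.
  by rewrite [leLHS](_ : _ = s * wt i / v i ^+ n.+1 * q)//; field; rewrite expf_neq0// gt_eqF.
have c0 i : 0 <= S ^+ n * wt i / v i ^+ n.+1 by have := v0 i => vi; have := w0 i => wi; pos.
have z0 i w : 0 <= z i w ^+ (2 * n.+1) by rewrite exprM exprn_ge0// sqr_ge0.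
apply: (le_via (\int[P]_w (\sum_(i < N) ((S ^+ n * wt i / v i ^+ n.+1)%:E * (z i w ^+ (2 * n.+1))%:E)))%E).
  apply: le_integral0 => w; first by rewrite lee_fin exprn_ge0// nr_ge0.
  by under eq_bigr do rewrite -EFinM; rewrite sumEFin lee_fin.
have mzE i : mfun (fun w => (z i w ^+ (2 * n.+1))%:E).
  by apply/mEFinP; exact: measurable_funX.
rewrite ge0_integral_sum//; last 2 first.
- by move=> i; apply: measurable_funeM.
- by move=> i w _; rewrite -EFinM lee_fin mulr_ge0.
apply: (le_via (\sum_(i < N) (S ^+ n * wt i * moment_const n.+1)%:E)%E).
  apply: lee_sum => i _; rewrite ge0_integralZl_EFin//; last by move=> w _; rewrite lee_fin.
  apply: (le_trans (lee_wpmul2l _ (subgaussian_moment n.+1 (mz i) (v0 i) (hz i)))); first by rewrite lee_fin.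
  rewrite -EFinM lee_fin le_eqVlt; apply/orP; left; apply/eqP; have vi := v0 i.
  by move: (moment_const _) => K; field; rewrite expf_neq0// gt_eqF.
rewrite sumEFin lee_fin -mulr_suml -mulr_sumr -/S -exprSr.
apply: ler_wpM2r; first exact: moment_const_ge0.
by rewrite lerXn2r ?nnegrE//; apply: addr_ge0 => //; apply: divr_ge0.
Qed.

Section initial.
Variables (X0 : Omega -> V -> R) (hX0 : Hdot_measurable D (Ft 0) X0).

Let h0 w : Hdot D (X0 w) := hX0.1 w.

(** Pairing with e_(i+1) is continuous, so its superlevel sets are open in the sense of [Hdot_open],
    and open rays generate the Borel sets. *)
Lemma initial_measurable i : mfun (fun w => inner D (X0 w) (e i.+1)).
Proof.
have hei := eig_L2 he i.+1.
apply: (measurability _ (RGenOInfty.measurableE R)) => //= _ [_ [a ->] <-].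
rewrite setTI preimage_itvoy; apply: (filt_measurable hFt (lexx 0)).
apply: (hX0.2 [set v | a < inner D v (e i.+1)] _) => u hu /= au.
exists (inner D u (e i.+1) - a); first by rewrite subr_gt0.
move=> v hv hvu.
have h : `|inner D (fun x => v x - u x) (e i.+1)| <= norm2 D (v - u) * norm2 D (e i.+1).
  by apply: inner_le => //; exact: (L2B hv.1 hu.1).
have E : inner D (fun x => v x - u x) (e i.+1) = inner D v (e i.+1) - inner D u (e i.+1).
  rewrite /inner -RI_B; [|exact: (L2_IgM hv.1 hei)|exact: (L2_IgM hu.1 hei)].
  by apply: RI_ext => x; rewrite mulrBl.
move: h; rewrite E (norm2_e) mulr1 ler_norml => /andP[h _] /=; lra.
Qed.

Lemma initial_moment N n :
  (\int[P]_w (nr N ga (fun i => inner D (X0 w) (e i.+1)) ^+ n)%:E <=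
   \int[P]_w (Hdot_norm D e lam ga (X0 w)) ^+ (2 * n))%E.
Proof.
apply: le_integral0 => w; first by rewrite lee_fin exprn_ge0// nr_ge0.
have h := Hdot_norm_ge ga N (h0 w).1.
have n0 := nr_ge0 la N ga (fun i => inner D (X0 w) (e i.+1)).
elim: n => [|n ih]; first by rewrite muln0 expr0.
rewrite exprS EFinM mulnS !expeS muleA -expe2; apply: lee_pmul => //; rewrite lee_fin//.
exact: exprn_ge0.
Qed.

(** The semigroup contracts the initial part, so the squared norm of O is at most twice that of the
    initial value plus twice that of the noise part. *)
Lemma convolution_moment n : (\int[P]_w (Hdot_norm D e lam ga (X0 w)) ^+ (2 * n.+1) < +oo)%E ->
  exists2 K : R, 0 <= K & forall N M k, (0 < M)%N ->
  (\int[P]_w ((1 + nr N ga (fun i => ocoef W X0 T M k i w)) ^+ n.+1)%:E <= K%:E)%E.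
Proof.
move=> hfin; set m := n.+1.
have [K0 [K00 hK0]] : exists K0 : R, 0 <= K0 /\ (\int[P]_w (Hdot_norm D e lam ga (X0 w)) ^+ (2 * m) = K0%:E)%E.
  have p0 : (0 <= \int[P]_w (Hdot_norm D e lam ga (X0 w)) ^+ (2 * m))%E.
    apply: integral_ge0 => w _; apply: expe_ge0.
    by rewrite /Hdot_norm; case: asboolP => // _; exact: Lnorm_ge0.
  move: p0 hfin; rewrite -/m; case: (\int[P]_w _)%E => [r|//|//].
  by rewrite lee_fin => r0 _; exists r.
set Kz := (H / 2 + 1) ^+ m * moment_const m.
have Kz0 : 0 <= Kz.
  apply: mulr_ge0; last exact: moment_const_ge0.
  by apply: exprn_ge0; apply: addr_ge0 => //; apply: divr_ge0.
exists (2 ^+ m * (1 + (4 ^+ m * K0 + 4 ^+ m * Kz))).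
  by apply: mulr_ge0; [exact: exprn_ge0|pos].
move=> N M k M0.
set x0 := fun i w => inner D (X0 w) (e i.+1); set z := fun i w => zcoef T M k i w.
set A := fun w => nr N ga (fun i => x0 i w); set Z := fun w => nr N ga (fun i => z i w).
have A0 w : 0 <= A w by exact: nr_ge0.
have Z0 w : 0 <= Z w by exact: nr_ge0.
have mA : mfun A by apply: measurable_nr => i; exact: initial_measurable.
have mZ : mfun Z by apply: measurable_nr => i; exact: (zcoef_measurable T0 M0 k i).
have pt w : (1 + nr N ga (fun i => ocoef W X0 T M k i w)) ^+ m <=
   2 ^+ m * (1 + (4 ^+ m * A w ^+ m + 4 ^+ m * Z w ^+ m)).
  have h1 : nr N ga (fun i => ocoef W X0 T M k i w) <= 2 * A w + 2 * Z w.
    rewrite /A /Z /nr !mulr_sumr -big_split; apply: ler_sum => i _ /=.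
    rewrite [leRHS](_ : _ = lam i.+1 `^ ga * (2 * x0 i w ^+ 2 + 2 * z i w ^+ 2)); last by ring.
    apply: ler_wpM2l; first exact: powR_ge0.
    rewrite ocoef_split -/(x0 i w) -/(z i w).
    have d1 : (decay la (T / M%:R) i ^+ k * x0 i w) ^+ 2 <= x0 i w ^+ 2.
      rewrite exprMn ler_piMl ?sqr_ge0// -exprM; apply: exprn_ile1; first exact: expR_ge0.
      rewrite /decay -expR0 ler_expR oppr_le0; apply: mulr_ge0; last exact: sqr_ge0.
      by apply: divr_ge0 => //; exact: ltW.
    have := sqr_ge0 (decay la (T / M%:R) i ^+ k * x0 i w - z i w); move: d1; lra.
  have n1 := nr_ge0 la N ga (fun i => ocoef W X0 T M k i w).
  have a0 := A0 w; have z0 := Z0 w.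
  apply: (le_via ((1 + (2 * A w + 2 * Z w)) ^+ m)).
    by rewrite lerXn2r ?nnegrE//; [lra|lra|rewrite lerD2l].
  have a20 : 0 <= 2 * A w by lra.
  have z20 : 0 <= 2 * Z w by lra.
  apply: (le_trans (exprD_le m ler01 (addr_ge0 a20 z20))); rewrite expr1n.
  apply: ler_wpM2l; first exact: exprn_ge0.
  rewrite lerD2l; apply: (le_trans (exprD_le m a20 z20)).
  by rewrite !exprMn [4](_ : _ = 2 * 2 :> R) ?exprMn; [lra|ring].
apply: (le_via (\int[P]_w ((2 ^+ m)%:E * (1%:E + ((4 ^+ m)%:E * (A w ^+ m)%:E + (4 ^+ m)%:E * (Z w ^+ m)%:E))))%E).
  apply: le_integral0 => w; last first.
    apply: (le_via (2 ^+ m * (1 + (4 ^+ m * A w ^+ m + 4 ^+ m * Z w ^+ m)))%:E).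
      by rewrite lee_fin.
    by rewrite EFinM EFinD EFinD !EFinM.
  by rewrite lee_fin exprn_ge0// addr_ge0// nr_ge0.
have mAm : mfun (fun w => (A w ^+ m)%:E) by apply/mEFinP; exact: measurable_funX.
have mZm : mfun (fun w => (Z w ^+ m)%:E) by apply/mEFinP; exact: measurable_funX.
have Am0 w : (0 <= (A w ^+ m)%:E)%E by rewrite lee_fin exprn_ge0.
have Zm0 w : (0 <= (Z w ^+ m)%:E)%E by rewrite lee_fin exprn_ge0.
have t0 : (0 <= (4 ^+ m : R)%:E)%E by rewrite lee_fin exprn_ge0.
have mAe : mfun (fun w => (4 ^+ m)%:E * (A w ^+ m)%:E)%E by exact: measurable_funeM.
have mZe : mfun (fun w => (4 ^+ m)%:E * (Z w ^+ m)%:E)%E by exact: measurable_funeM.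
rewrite ge0_integralZl_EFin ?exprn_ge0//; last 2 first.
- by move=> w _; apply: adde_ge0 => //; apply: adde_ge0; exact: mule_ge0.
- by apply: emeasurable_funD => //; exact: emeasurable_funD.
rewrite EFinM; apply: lee_wpmul2l; first by rewrite lee_fin exprn_ge0.
rewrite ge0_integralD//; last 2 first.
- by move=> w _; apply: adde_ge0; exact: mule_ge0.
- exact: emeasurable_funD.
rewrite ge0_integralD//; last 2 first.
- by move=> w _; exact: mule_ge0.
- by move=> w _; exact: mule_ge0.
rewrite !ge0_integralZl_EFin ?exprn_ge0//.
rewrite EFinD; apply: leeD; first by rewrite integral_cst// mul1e; exact: probability_le1.
rewrite EFinD; apply: leeD; rewrite EFinM; apply: lee_wpmul2l => //.
- by rewrite -hK0; exact: initial_moment.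
- exact: noise_moment.
Qed.
End initial.
End moments.
End wiener.

(** * From the pathwise bound to expectations *)

Section pointwise_moment.
Local Notation nr := (nr la).
Variables (T : R) (T0 : 0 < T) (ga : R) (hga : d%:R / 2 < ga).
Context {dO : measure_display} {Omega : measurableType dO}.
Variable W : R -> (V -> R) -> Omega -> R.

Lemma root_power_le (g p : R) n : 0 <= g -> 0 <= p -> p < n%:R -> (g `^ 6^-1) `^ p <= (1 + g) ^+ n.
Proof.
move=> g0 p0 pn; rewrite -powRrM -powR_mulrn; last by lra.
apply: (le_via ((1 + g) `^ (6^-1 * p))).
  by apply: ge0_ler_powR; rewrite ?nnegrE; lra.
by rewrite ler_powR; lra.
Qed.

(** A power of [Aux] is turned by [power_mean] into a time average of powers at single times, so
    moments of O at each fixed time suffice and no supremum over time stands inside the expectation.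
    Constant and exponent are fixed before [X0], as the order of the initial moment must be. *)
Lemma scheme_Lnorm6_le (p : R) : 0 <= p -> exists (C : R) (n : nat), 0 <= C /\ forall X0 M N k w, (0 < M)%N -> (k <= M)%N ->
  L2 D (X0 w) ->
  ('N[m]_6%:E[EFin \o scheme D e lam W X0 T M N k w] `^ p <=
   (C * (\sum_(j < M) T / M%:R * (1 + nr N ga (fun i => ocoef W X0 T M j i w)) ^+ n.+1 +
     (1 + nr N ga (fun i => ocoef W X0 T M k i w)) ^+ n.+1))%:E)%E.
Proof.
move=> p0; have [eb [gb [hs heb]]] := exists_spectral_system he.
have [C2 C20 hC2] := F2 hs hga.
have [C [r [q [C0 hC]]]] := scheme_p6 hs hga T0.
(* n exceeds [p]; A^(r n) leads to the exponent q (s + 1) at single times, and the supremum of O to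
   3 n. [m0] dominates both. *)
pose n := (Num.truncn p).+1; pose s := (r * n)%N; pose m0 := (q * s.+1 + 3 * n)%N.
have v0 := vol_gt0.
pose C' := 1 + 32 * C + 32 * vol D * C2 ^+ 3.
have C'1 : 0 <= C' by rewrite /C'; pos.
pose K := C' ^+ n * 2 ^+ n * (2 ^+ s.+1 * (1 + T ^+ s) + 1).
exists K, m0; split; first by rewrite /K; pos.
move=> X0 M N k w M0 kM hX.
set O := fun j i => ocoef W X0 T M j i w; set Y := ycoef eb W X0 T M N w.
have tau0 : 0 < T / M%:R by rewrite divr_gt0// ltr0n.
set tau := T / M%:R in tau0 *.
pose U j := 1 + nr N ga (O j).
have U1 j : 1 <= U j by rewrite /U lerDl nr_ge0.
have Ux j a b : (a <= b)%N -> U j ^+ a <= U j ^+ b by move=> ab; rewrite ler_weXn2l.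
rewrite (rep_Lnorm6 hs (rep_scheme hs heb W T M N k hX)) poweR_EFin lee_fin.
set g := p6 eb N _; have g0 : 0 <= g := p6_ge0 eb N _.
set A := Aux la N ga tau M q O.
have A1 : 1 <= A by apply: Aux_ge1; exact: ltW.
have gle : g <= 32 * (C * A ^+ r + vol D * (C2 * U k) ^+ 3).
  have h1 := hC N tau M O Y k tau0 _ (ycoef_path eb W X0 T M N w M) kM.
  have h2 : {ae m, forall x, S eb N (O k) x ^+ 2 <= C2 * U k}.
    apply: filterS (hC2 N (O k)) => x /le_trans; apply; rewrite ler_pM2l// /U; lra.
  have u0 : 0 <= C2 * U k := mulr_ge0 (ltW C20) (le_trans ler01 (U1 k)).
  apply: (le_trans (p6_add hs (Y k) u0 h2)); rewrite ler_pM2l// lerD2r; apply: h1.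
  by rewrite /tau divfK// pnatr_eq0 -lt0n.
have Ar1 : 1 <= A ^+ r by exact: exprn_ege1.
have gle2 : 1 + g <= C' * (A ^+ r + U k ^+ 3).
  have u3 : 0 <= U k ^+ 3 by rewrite exprn_ge0// (le_trans _ (U1 k)).
  apply: (le_via (1 + (32 * (C * A ^+ r + vol D * (C2 * U k) ^+ 3)))); first by rewrite lerD2l.
  rewrite exprMn /C'; move: (A ^+ r) (U k ^+ 3) Ar1 u3 => a u a1 u0.
  have h1 : 0 <= 32 * C * u by pos.
  have a0 : 0 <= a by lra.
  have h2 : 0 <= 32 * vol D * C2 ^+ 3 * a by pos.
  rewrite [leRHS](_ : _ = a + u + 32 * C * a + 32 * C * u + 32 * vol D * C2 ^+ 3 * a + 32 * vol D * C2 ^+ 3 * u); last by ring.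
  rewrite [leLHS](_ : _ = 1 + 32 * C * a + 32 * vol D * C2 ^+ 3 * u); last by ring.
  lra.
have tsum : \sum_(j < M) tau = T.
  by rewrite sumr_const card_ord -[LHS]mulr_natr /tau divfK// pnatr_eq0 -lt0n.
have hA : A ^+ s.+1 <= 2 ^+ s.+1 * (1 + T ^+ s * \sum_(j < M) tau * U j ^+ (q * s.+1)).
  have U0 j : 0 <= U j ^+ q by rewrite exprn_ge0// (le_trans _ (U1 j)).
  have x0 : 0 <= \sum_(j < M) tau * U j ^+ q by apply: sumr_ge0 => j _; rewrite mulr_ge0// ltW.
  apply: (le_trans (exprD_le s.+1 ler01 x0)); rewrite expr1n.
  apply: ler_wpM2l; first exact: exprn_ge0.
  rewrite lerD2l; apply: (le_trans (@power_mean _ M (fun=> tau) (fun j => U j ^+ q) s _ U0)); first by move=> _; exact: ltW.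
  rewrite tsum; under eq_bigr do rewrite -exprM; exact: lexx.
have Um j : 1 <= U j ^+ m0.+1 by rewrite exprn_ege1.
set Sm := \sum_(j < M) tau * U j ^+ m0.+1.
have Sm0 : 0 <= Sm by apply: sumr_ge0 => j _; rewrite mulr_ge0// ?ltW// (lt_le_trans _ (Um j)).
have hS : \sum_(j < M) tau * U j ^+ (q * s.+1) <= Sm.
  by apply: ler_sum => j _; rewrite ler_pM2l//; apply: Ux; rewrite /m0 -addnS leq_addr.
apply: (le_via ((1 + g) ^+ n)).
  exact: (root_power_le g0 p0 (truncnS_gt p)).
apply: (le_via ((C' * (A ^+ r + U k ^+ 3)) ^+ n)); first by rewrite lerXn2r ?nnegrE//; lra.
have u3 : 0 <= U k ^+ 3 by rewrite exprn_ge0// (le_trans _ (U1 k)).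
rewrite exprMn /K -!(mulrA (C' ^+ n)); apply: ler_wpM2l; first exact: exprn_ge0.
apply: (le_trans (exprD_le n (le_trans ler01 Ar1) u3)).
rewrite -(mulrA (2 ^+ n)); apply: ler_wpM2l; first exact: exprn_ge0.
rewrite -!exprM; have hU : U k ^+ (3 * n) <= U k ^+ m0.+1 by apply: Ux; apply: leqW; exact: leq_addl.
have hA2 : A ^+ (r * n) <= 2 ^+ s.+1 * (1 + T ^+ s * Sm).
  apply: (le_via (A ^+ s.+1)); first by rewrite ler_weXn2l.
  apply: (le_trans hA); apply: ler_wpM2l; first exact: exprn_ge0.
  by rewrite lerD2l; apply: ler_wpM2l => //; rewrite exprn_ge0// ltW.
apply: (le_trans (lerD hA2 hU)).
have t0 : 0 <= T ^+ s by rewrite exprn_ge0// ltW.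
have w0 : 0 < 2 ^+ s.+1 :> R by rewrite exprn_gt0.
move: (Um k); rewrite -/(U k) -/(U _) -/Sm.
clear hS hA hA2 hU; move: (U k ^+ m0.+1) (T ^+ s) (2 ^+ s.+1) t0 w0 Sm Sm0 => u t b t0 w0 S' S0 u1.
rewrite mulrDl mul1r; apply: lerD; last by rewrite lerDr.
rewrite -mulrA ler_pM2l//; have := mulr_ge0 t0 (le_trans ler01 u1); nra.
Qed.
End pointwise_moment.
End eigenbasis.
End domain_analysis.

Theorem theorem12 (R : realType) (d : nat) (d_range : (1 <= d <= 3)%N)
  (T : R) (T_gt0 : 0 < T) (gamma : R) (gamma_gt : d%:R / 2 < gamma)
  (gamma_le : gamma <= 4) (D : convex_lipschitz_domain R d)
  (e : nat -> 'rV[R]_d -> R) (lam : nat -> R)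
  (e_basis : neumann_eigenbasis D e lam)
  (dO : measure_display) (Omega : measurableType dO) (P : probability Omega R)
  (Ft : R -> set (set Omega)) (Ft_filtration : filtration Ft)
  (Q Qhalf : ('rV[R]_d -> R) -> 'rV[R]_d -> R)
  (Q_cov : covariance_operator D Q) (Qhalf_sqrt : sqrt_operator D Qhalf Q)
  (Q_HS : (HS_norm D e lam (gamma - 2) Qhalf < +oo)%E)
  (W : R -> ('rV[R]_d -> R) -> Omega -> R) (W_wiener : Q_wiener D P Ft Q W)
  (p : R) (p_ge1 : 1 <= p) :
  exists p0 : nat, forall X0 : Omega -> 'rV[R]_d -> R,
    Hdot_measurable D (Ft 0) X0 ->
    (\int[P]_w (Hdot_norm D e lam gamma (X0 w)) ^+ p0 < +oo)%E ->
    (ereal_sup [set y | exists M N i : nat,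
       [/\ (0 < M)%N, (0 < N)%N, (i <= M)%N &
        y = \int[P]_w
              'N[leb D]_6%:E[EFin \o scheme D e lam W X0 T M N i w] `^ p]]
     < +oo)%E.
Proof.
have [H H0 htr] := trace_bound e_basis Q_cov Qhalf_sqrt Q_HS.
have [C [n [C0 hC]]] := scheme_Lnorm6_le d_range e_basis T_gt0 gamma_gt W (le_trans ler01 p_ge1).
(* The estimates involve [nr], a squared norm, to the power n + 1: hence 2 (n + 1) moments of
   |X_0|_gamma. *)
exists (2 * n.+1)%N => X0 hX0 hfin.
have [K K0 hK] := convolution_moment e_basis Q_cov Ft_filtration W_wiener T_gt0 H0 htr hX0 hfin.
(* M summands of weight T / M and expectation at most K give T K; the last K is the term at time
   i. *)
apply: (@le_lt_trans _ _ (C * (T * K + K))%:E); last exact: ltry.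
apply: ge_ereal_sup => _ [M [N [i [M0 N0 iM ->]]]].
pose U j w := (1 + nr (fun i => lam i.+1) N gamma (fun l => ocoef D e lam W X0 T M j l w)) ^+ n.+1.
have tau0 : 0 <= T / M%:R by apply: divr_ge0 => //; exact: ltW.
have U0 j w : 0 <= U j w by rewrite exprn_ge0// addr_ge0// nr_ge0.
have mU j : mfun (U j).
  apply: measurable_funX; apply: measurable_funD => //; apply: measurable_nr => l.
  rewrite (_ : ocoef D e lam W X0 T M j l = (fun w => decay (fun i => lam i.+1) (T / M%:R) l ^+ j * inner D (X0 w) (e l.+1) +
      zcoef e lam W T M j l w)); last by apply/funext => w; exact: ocoef_split.
  apply: measurable_funD; last exact: (zcoef_measurable e_basis Ft_filtration W_wiener T_gt0 M0 j l).
  by apply: measurable_funM => //; exact: (initial_measurable e_basis Ft_filtration hX0).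
have mUE j : mfun (fun w => (U j w)%:E) by exact/mEFinP.
have U0E j w : (0 <= (U j w)%:E)%E by rewrite lee_fin.
apply: (le_via (\int[P]_w (C%:E * (\sum_(j < M) (T / M%:R)%:E * (U j w)%:E + (U i w)%:E)))%E).
  apply: le_integral0 => w; first exact: poweR_ge0.
  apply: le_trans (hC X0 M N i w M0 iM (hX0.1 w).1) _.
  by rewrite EFinM EFinD -sumEFin.
have mS j : mfun (fun w => ((T / M%:R)%:E * (U j w)%:E)%E) by exact: measurable_funeM.
have S0 j w : (0 <= (T / M%:R)%:E * (U j w)%:E)%E by rewrite mule_ge0.
have mSum : mfun (fun w => (\sum_(j < M) (T / M%:R)%:E * (U j w)%:E)%E).
  by apply: emeasurable_sum => j; exact: mS.
rewrite ge0_integralZl_EFin//; last 2 first.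
- by move=> w _; apply: adde_ge0 => //; apply: sume_ge0.
- exact: emeasurable_funD.
rewrite (EFinM C); apply: lee_wpmul2l; first by rewrite lee_fin.
rewrite ge0_integralD//; last by move=> w _; apply: sume_ge0.
rewrite (EFinD (T * K)); apply: leeD; last exact: hK.
rewrite ge0_integral_sum//.
apply: (le_via (\sum_(j < M) (T / M%:R * K)%:E)%E).
  apply: lee_sum => j _; rewrite ge0_integralZl_EFin// (EFinM (T / M%:R)); apply: lee_wpmul2l; first by rewrite lee_fin.
  exact: hK.
rewrite sumEFin lee_fin sumr_const card_ord -[leLHS]mulr_natr mulrAC divfK// pnatr_eq0 -lt0n//.
Qed.
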